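(* Let $\lambda_1,\ldots,\lambda_n\in\mathcal{W}P^+$ and put $\pi_\Lambda=\pi_{\lambda_1}\otimes\cdots\otimes\pi_{\lambda_n}$. Suppose $\pi_\Lambda$ is a dominant path, i.e. $\pi_\Lambda(t)\in\sum_{\eta\in P^+}\mathbb{R}_{\ge0}\eta$ for all $t\in[0,1]$, and set $\lambda=\lambda_1+\cdots+\lambda_n$ (which lies in $P^+$). Then the assignment $F\pi_\lambda\mapsto F\pi_\Lambda$ ($F\in\mathcal{F}$) is a well-defined isomorphism of crystals $\mathbb{B}(\lambda)\xrightarrow{\ \cong\ }\mathcal{F}\pi_\Lambda$, where $\mathcal{F}\pi_\Lambda$ denotes the set of nonzero paths $F\pi_\Lambda$, $F\in\mathcal{F}$.
   Context: Borcherds–Cartan datum: $I$ is a countable set and $A=(a_{ij})_{i,j\in I}$ satisfies: $a_{ii}=2$ or $a_{ii}\in\mathbb{Z}_{\le0}$; $a_{ij}\in\mathbb{Z}_{\le 0}$ for $i\ne j$; $a_{ij}=0\iff a_{ji}=0$ for $i\neq j$. $I^{re}=\{i:a_{ii}=2\}$, $I^{im}=I\setminus I^{re}$. Fix $(A,\{\alpha_i\},\{\alpha_i^\vee\},P,P^\vee)$ with $P^\vee$ a free $\mathbb{Z}$-module, $P=\mathrm{Hom}_{\mathbb Z}(P^\vee,\mathbb Z)$, $\mathfrak h=P^\vee\otimes\mathbb C$, $\alpha_i^\vee\in P^\vee$, $\alpha_i\in P$, $\alpha_i^\vee(\alpha_j)=a_{ij}$, both families linearly independent. $P^+=\{\lambda\in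 P:\alpha_i^\vee(\lambda)\ge 0\ \forall i\}$. $\Delta^+$ = positive roots of the generalized Kac–Moody algebra. $r_i(\mu)=\mu-\alpha_i^\vee(\mu)\alpha_i$ on $\mathfrak h^*$; $\mathcal W_{re}$ = group generated by $r_i$, $i\in I^{re}$; $\Delta^+_{re}=\mathcal W_{re}\{\alpha_i\}_{i\in I^{re}}\cap\Delta^+$, $\Delta_{im}=\mathcal W_{re}\{\alpha_i\}_{i\in I^{im}}$; for $\beta=w\alpha_i$ ($w\in\mathcal W_{re}$) in $\Delta^+_{re}\sqcup\Delta_{im}$, $\beta^\vee=w\alpha_i^\vee$ and $r_\beta=wr_iw^{-1}$ (well defined). The monoid $\mathcal W$ is generated by $r_i$ ($i\in I$) with relations $r_i^2=1$ ($i\in I^{re}$); $(r_ir_j)^m=(r_jr_i)^m=1$ for $i\ne j\in I^{re}$ when the order $m$ of $r_ir_j$ in $GL(\mathfrak h^* )$ lies in $\{2,3,4,6\}$; $r_ir_j=r_jr_i$ if $i\in I^{im}$, $j\ne i$, $a_{ij}=0$; it acts on $\mathfrak h^*$ via $r_i$. $\mathcal WP^+=\{w\lambda: w\in\mathcal W,\lambda\in P^+\}$. For $\lambda\in P^+$, $\mathcal W\lambda$ is ordered by: $\mu\ge\nu$ iff there are $\mu=\lambda_0,\ldots,\lambda_k=\nu$ in $\mathcal W\lambda$ and $\beta_s\in\Delta^+_{re}\sqcup\Delta_{im}$ with $\lambda_{s-1}=r_{\beta_s}\lambda_s$, $\beta_s^\vee(\lambda_s)>0$; $\mu\xleftarrow{\beta}\nu$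 means $\mu=r_\beta\nu$, $\beta^\vee(\nu)>0$ and $\mu$ covers $\nu$. For rational $a\in(0,1]$, an $a$-chain for $(\mu,\nu)$ is $\mu=\nu_0\xleftarrow{\beta_1}\nu_1\cdots\xleftarrow{\beta_k}\nu_k=\nu$ with $a\beta_s^\vee(\nu_s)\in\mathbb Z_{>0}$ if $\beta_s$ real and $=1$ if $\beta_s\in\Delta_{im}$. Paths: $\mathbb P$ = piecewise-linear continuous $\pi:[0,1]\to\mathfrak h_{\mathbb R}^*$ ($\mathfrak h_{\mathbb R}$ a real form containing the $\alpha_i^\vee$), $\pi(0)=0$, $\pi(1)\in P$, not identified up to reparametrization; $\mathbf 0$ an extra element. $H_i^\pi(t)=\alpha_i^\vee(\pi(t))$, $m_i^\pi=\min\{H_i^\pi(t):H_i^\pi(t)\in\mathbb Z\}$. Root operators (fixing $\mathbf 0$): $f_+^i=\max\{t:H_i^\pi(t)=m_i^\pi\}$; if $f_+^i=1$, $f_i\pi=\mathbf 0$; else $f_-^i=\min\{t\ge f_+^i:H_i^\pi(t)=m_i^\pi+1\}$ and $f_i\pi(t)=\pi(t)$ on $[0,f_+^i]$, $\pi(t)-(H_i^\pi(t)-m_i^\pi)\alpha_i$ on $[f_+^i,f_-^i]$, $\pi(t)-\alpha_i$ on $[f_-^i,1]$. For $i\in I^{re}$: $e_+^i=\min\{t:H_i^\pi(t)=m_i^\pi\}$; if $e_+^i=0$, $e_i\pi=\mathbf0$; else $e_-^i=\max\{t\le e_+^i:H_i^\pi(t)=m_i^\pi+1\}$ and $e_i\pi(t)=\pi(t)$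 on $[0,e_-^i]$, $\pi(t)-(H_i^\pi(t)-m_i^\pi-1)\alpha_i$ on $[e_-^i,e_+^i]$, $\pi(t)+\alpha_i$ on $[e_+^i,1]$. For $i\in I^{im}$: $e_-^i=f_+^i$; $e_i\pi=\mathbf0$ if $e_-^i=1$ or $H_i^\pi<m_i^\pi+1-a_{ii}$ on $[e_-^i,1]$; else $e_+^i=\min\{t\ge e_-^i:H_i^\pi(t)=m_i^\pi+1-a_{ii}\}$, $e_i\pi=\mathbf 0$ if $H_i^\pi(s)\le m_i^\pi-a_{ii}$ for some $s\ge e_+^i$, and otherwise $e_i\pi(t)=\pi(t)$ on $[0,e_-^i]$, $\pi(t)+\frac{1}{1-a_{ii}}(H_i^\pi(t)-m_i^\pi)\alpha_i$ on $[e_-^i,e_+^i]$, $\pi(t)+\alpha_i$ on $[e_+^i,1]$. $\mathcal F$ = monoid generated by the $f_i$. $\pi_\mu(t)=t\mu$. Concatenation: $(\pi_1\otimes\cdots\otimes\pi_n)(t)=\sum_{l<m}\pi_l(1)+\pi_m(nt-m+1)$ for $t\in[\frac{m-1}n,\frac mn]$. GLS paths of shape $\lambda\in P^+$: $\pi=(\lambda_1,\ldots,\lambda_k;a_0,\ldots,a_k)$, $\lambda_1>\cdots>\lambda_k$ in $\mathcal W\lambda$, rationals $0=a_0<\cdots<a_k=1$, with an $a_s$-chain for $(\lambda_s,\lambda_{s+1})$ ($1\le s<k$) and a $1$-chain for $(\lambda_k,\lambda)$; as a path, $\pi(t)=\sum_{l<s}(a_l-a_{l-1})\lambda_l+(t-a_{s-1})\lambda_s$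 on $[a_{s-1},a_s]$. $\mathbb B(\lambda)$ = set of these; $\mathbb B(\lambda)=\{F\pi_\lambda:F\in\mathcal F\}\setminus\{\mathbf0\}$. Crystal structure on a set $B\subset\mathbb P$ stable (up to $\mathbf 0$) under all $f_i$ and $e_i$, $i\in I^{re}$: $\mathrm{wt}(\pi)=\pi(1)$; for $i\in I^{re}$, $\varepsilon_i=-m_i^\pi$, $\varphi_i=H_i^\pi(1)-m_i^\pi$; for $i\in I^{im}$, $\varepsilon_i=0$, $\varphi_i=\alpha_i^\vee(\pi(1))$; Kashiwara operators are the root operators $f_i$ and $e_i$ ($i\in I^{re}$), while for $i\in I^{im}$, $e_i\pi$ is the root-operator image if it lies in $B$ and $\mathbf0$ otherwise. This applies to $B=\mathbb B(\lambda)$ and $B=\mathcal F\pi_\Lambda$. An isomorphism of crystals is a bijection preserving $\mathrm{wt},\varepsilon_i,\varphi_i$ and commuting with all $e_i,f_i$. *)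

(* Defs.v *)
From HB Require Import structures.
From mathcomp Require Import all_boot all_order all_algebra.
From mathcomp Require Import boolp classical_sets reals.
From Stdlib Require List.
Set Implicit Arguments. Unset Strict Implicit. Unset Printing Implicit Defensive.
Import Order.TTheory GRing.Theory Num.Theory.
Local Open Scope ring_scope.
Local Open Scope classical_set_scope.

Section LSPaths.
(* R : the reals; I : index set of the Borcherds-Cartan datum (countable);
   J : a basis of the free Z-module P^vee.
   coroot i : J -> int   the coordinates of alpha_i^vee in P^vee (finite support supp i);
   root i   : J -> int   alpha_i in P = Hom(P^vee, Z) = Z^J.
   h_R = P^vee (x) R, so h_R^* = R^J.  *)
Variables (R : realType) (I : countType) (J : choiceType).
Variables (coroot : I -> J -> int) (supp : I -> seq J) (root : I -> J -> int).

Definition pairZ (i : I) (mu : J -> int) : int :=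
  \sum_(k <- supp i) coroot i k * mu k.

Definition cartan (i j : I) : int := pairZ i (root j).

Definition BC_datum : Prop :=
  [/\ (forall i k, k \notin supp i -> coroot i k = 0),
      (forall i, cartan i i = 2 \/ cartan i i <= 0),
      (forall i j, i != j -> cartan i j <= 0) &
      (forall i j, i != j -> (cartan i j == 0) = (cartan j i == 0))] /\
  [/\
      (forall (s : seq I) (c : I -> int), uniq s ->
          (forall k, \sum_(i <- s) c i * coroot i k = 0) ->
          forall i, i \in s -> c i = 0) &
      (forall (s : seq I) (c : I -> int), uniq s ->
          (forall k, \sum_(i <- s) c i * root i k = 0) ->
          forall i, i \in s -> c i = 0)].

Definition is_real_index (i : I) : bool := cartan i i == 2.

Definition dominant_weight (mu : J -> int) : Prop := forall i, 0 <= pairZ i mu.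

Definition refl (i : I) (mu : J -> int) : J -> int :=
  fun k => mu k - pairZ i mu * root i k.

(* W P^+ : the W-monoid acts through the r_i, so W mu = words in the r_i *)
Definition in_WPplus (mu : J -> int) : Prop :=
  exists (w : seq I) (nu : J -> int), dominant_weight nu /\ mu = foldr refl nu w.

Definition V := J -> R.
Definition emb (mu : J -> int) : V := fun k => (mu k)%:~R.
Definition vadd (u v : V) : V := fun k => u k + v k.
Definition vscale (c : R) (u : V) : V := fun k => c * u k.
Definition alphaR (i : I) : V := emb (root i).
Definition pairR (i : I) (v : V) : R := \sum_(k <- supp i) (coroot i k)%:~R * v k.

(* Paths are maps [0,1] -> h_R^*; we represent them as maps R -> h_R^*
   evaluated through the clamp to [0,1] (so equality of paths = equality on [0,1]). *)
Definition Path := R -> V.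
Definition clamp (t : R) : R := Num.max 0 (Num.min t 1).

Definition pi_mu (mu : V) : Path := fun t => vscale (clamp t) mu.

Definition concat (ps : seq Path) : Path := fun t0 =>
  let n := size ps in
  let t := clamp t0 in
  let l := minn n.-1 (Num.truncn (n%:R * t)) in
  let p0 : Path := fun _ _ => 0 in
  fun k => \sum_(q < l) (nth p0 ps q) 1 k + (nth p0 ps l) (n%:R * t - l%:R) k.

Definition Hf (i : I) (p : Path) (t : R) : R := pairR i (p t).

Definition mmin (i : I) (p : Path) : R :=
  inf [set x | exists t, [/\ 0 <= t <= 1, Hf i p t = x & exists z : int, x = z%:~R]].

Definition fplus (i : I) (p : Path) : R :=
  sup [set t | 0 <= t <= 1 /\ Hf i p t = mmin i p].

(* root operator f_i (None stands for the extra element 0) *)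
Definition f_root (i : I) (p : Path) : option Path :=
  let m := mmin i p in
  let fp := fplus i p in
  if fp == 1 then None else
  let fm := inf [set t | fp <= t <= 1 /\ Hf i p t = m + 1] in
  Some (fun t0 => let t := clamp t0 in
    if t <= fp then p t
    else if t <= fm then vadd (p t) (vscale (- (Hf i p t - m)) (alphaR i))
    else vadd (p t) (vscale (-1) (alphaR i))).

Definition e_root (i : I) (p : Path) : option Path :=
  let m := mmin i p in
  if is_real_index i then
    let ep := inf [set t | 0 <= t <= 1 /\ Hf i p t = m] in
    if ep == 0 then None else
    let em := sup [set t | 0 <= t <= ep /\ Hf i p t = m + 1] in
    Some (fun t0 => let t := clamp t0 in
      if t <= em then p t
      else if t <= ep then vadd (p t) (vscale (- (Hf i p t - m - 1)) (alphaR i))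
      else vadd (p t) (alphaR i))
  else
    let a : R := (cartan i i)%:~R in
    let em := fplus i p in
    if em == 1 then None else
    if `[< forall t, em <= t <= 1 -> Hf i p t < m + 1 - a >] then None else
    let ep := inf [set t | em <= t <= 1 /\ Hf i p t = m + 1 - a] in
    if `[< exists s, ep <= s <= 1 /\ Hf i p s <= m - a >] then None else
    Some (fun t0 => let t := clamp t0 in
      if t <= em then p t
      else if t <= ep then vadd (p t) (vscale ((1 - a)^-1 * (Hf i p t - m)) (alphaR i))
      else vadd (p t) (alphaR i)).

(* elements of the monoid F generated by the f_i, as words; F pi *)
Definition Fapply (F : seq I) (p : Path) : option Path :=
  foldr (fun i o => obind (f_root i) o) (Some p) F.

Definition Forbit (p : Path) : set Path := [set q | exists F, Fapply F p = Some q].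

Definition wt (p : Path) : V := p 1.
Definition eps (i : I) (p : Path) : R := if is_real_index i then - mmin i p else 0.
Definition phi (i : I) (p : Path) : R :=
  if is_real_index i then Hf i p 1 - mmin i p else pairR i (p 1).
Definition kas_f (i : I) (B : set Path) (p : Path) : option Path := f_root i p.
Definition kas_e (i : I) (B : set Path) (p : Path) : option Path :=
  if is_real_index i then e_root i p else
  match e_root i p with
  | Some q => if `[< B q >] then Some q else None
  | None => None
  end.

Definition crystal_iso (B1 B2 : set Path) (Phi : Path -> Path) : Prop :=
  [/\ (forall b, B1 b -> B2 (Phi b)),
      (forall b b', B1 b -> B1 b' -> Phi b = Phi b' -> b = b'),
      (forall c, B2 c -> exists2 b, B1 b & Phi b = c) &
      (forall b, B1 b -> wt (Phi b) = wt b /\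
         forall i, [/\ eps i (Phi b) = eps i b, phi i (Phi b) = phi i b,
                       kas_e i B2 (Phi b) = omap Phi (kas_e i B1 b) &
                       kas_f i B2 (Phi b) = omap Phi (kas_f i B1 b)])].

Definition dominant_path (p : Path) : Prop :=
  forall t, 0 <= t <= 1 ->
    exists s : seq (R * (J -> int)),
      (forall x, List.In x s -> 0 <= x.1 /\ dominant_weight x.2) /\
      p t = (fun k => \sum_(x <- s) x.1 * (x.2 k)%:~R).

End LSPaths.

(* Main.v *)
(* Every application of the root operator of an imaginary index [i] behaves like
   that of a new real index: replacing [i] by infinitely many letters [(i, q)]
   turns the paths into paths for a generalized Cartan matrix with all diagonal
   entries 2, whose extra coordinates record how far each application has
   progressed in time.  There, Bruhat covers show that the orbit of a path with
   regular dominant directions consists of Lakshmibai-Seshadri type paths, on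
   which the integral minima are integers and [e_i f_i = 1].  The integers are
   constant when [pi_u (x) pi_v] is deformed with [u + v] fixed, so the operators
   only see [u + v].  With the tensor product rule, induction on a word [G] shows
   that a dominant product of extremal straight paths [G pi_nu] behaves like the
   straight path with the same end.  An equality of two original paths lifts to
   the larger coordinates up to renaming imaginary letters, because the progress
   of one such letter is a ramp, and a sum of ramps determines the ramps. *)
Require Import Defs.
From HB Require Import structures.
From mathcomp Require Import all_boot all_order all_algebra.
From mathcomp Require Import boolp classical_sets functions reals.
From mathcomp Require Import zify ring lra.
From Stdlib Require List.
Set Implicit Arguments. Unset Strict Implicit. Unset Printing Implicit Defensive.
Import Order.TTheory GRing.Theory Num.Theory.
Local Open Scope ring_scope.

(** For imaginary [i] the map [r_i] is not an involution, so lengths, covers and reflected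
    directions have no direct analogue. But one application of [f_i] only subtracts [H_i - m] times
    the root, which is a reflection for a letter pairing to 2 with itself, and later applications
    feel it only through [H_i], that is, through [a_ii]. Hence each copy serves once, and distinct
    copies pair by [a_ii]. The price is that the original roots do not separate the copies, so
    coincidences of paths need a separate lifting argument. A second obstacle: directions determine
    Weyl group elements only for regular weights, while the given weights may be singular or
    non-dominant. Singular weights are limits of regular ones, which is harmless because the
    operators are Lipschitz in the path and the data they consult are integers; a single weight is
    made regular by appending [rho], which no admissible word touches. Non-dominant weights occur
    only as images of dominant ones under words. No map of orbits is built before the end: paths are
    compared by which words act, with which minima, and which words coincide. *)

Definition gcm (K : choiceType) (a : K -> K -> int) :=
  [/\ forall k, a k k = 2, forall j k, j != k -> a j k <= 0 &
      forall j k, j != k -> (a j k == 0) = (a k j == 0)].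

(** * Weyl group and Bruhat covers *)

Section Reflections.
Variables (R : realType) (K : choiceType) (a : K -> K -> int).
Hypothesis ga : gcm a.

Lemma a2 k : a k k = 2. Proof. by case: ga. Qed.
Lemma aneg j k : j != k -> a j k <= 0. Proof. by case: ga => _ h _; apply: h. Qed.
Lemma asym j k : j != k -> (a j k == 0) = (a k j == 0).
Proof. by case: ga => _ _ h; apply: h. Qed.

Local Notation vec := ((K + K)%type -> R).

Definition sc (c : R) (v : vec) : vec := fun x => c * v x.
(* A vector is given by its pairings [inl j] with the simple coroots and by
   formal coordinates [inr k] counting the [k]-th simple root. *)
Definition al (k : K) : vec := fun x => match x with
  inl j => (a j k)%:~R | inr j => (j == k)%:R end.
Definition om (k : K) : vec := fun x => match x with
  inl j => (j == k)%:R | inr j => 0 end.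
Definition rs (i : K) (v : vec) : vec := v - sc (v (inl i)) (al i).
Fixpoint act (w : seq K) (v : vec) : vec := if w is i :: w' then rs i (act w' v) else v.

Lemma vecDE (u v : vec) x : (u + v) x = u x + v x. Proof. by []. Qed.
Lemma vecNE (v : vec) x : (- v) x = - v x. Proof. by []. Qed.
Lemma vec0E x : (0 : vec) x = 0. Proof. by []. Qed.
Lemma scE c (v : vec) x : sc c v x = c * v x. Proof. by []. Qed.

Definition vecE := (vecDE, vecNE, scE, vec0E).

Lemma rsE i v x : rs i v x = v x - v (inl i) * al i x.
Proof. by []. Qed.

Lemma rsK i v : rs i (rs i v) = v.
Proof. apply/funext => x; rewrite !rsE /= a2; ring. Qed.

Lemma rsD i u v : rs i (u + v) = rs i u + rs i v.
Proof. apply/funext => x; rewrite !(rsE, vecE); ring. Qed.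

Lemma rs_sc i c v : rs i (sc c v) = sc c (rs i v).
Proof. apply/funext => x; rewrite !(rsE, vecE); ring. Qed.

Lemma act_cat u w v : act (u ++ w) v = act u (act w v).
Proof. by elim: u => //= i u ->. Qed.

Lemma actD w u v : act w (u + v) = act w u + act w v.
Proof. by elim: w => //= i w ->; rewrite rsD. Qed.

Lemma act_sc w c v : act w (sc c v) = sc c (act w v).
Proof. by elim: w => //= i w ->; rewrite rs_sc. Qed.

Lemma scN1 v : sc (-1) v = - v.
Proof. by apply/funext => x; rewrite !vecE mulN1r. Qed.

Lemma actN w v : act w (- v) = - act w v.
Proof. by rewrite -scN1 act_sc scN1. Qed.

Lemma actB w u v : act w (u - v) = act w u - act w v.
Proof. by rewrite actD actN. Qed.

Lemma act_revK w v : act (rev w) (act w v) = v.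
Proof. by elim: w v => //= i w IH v; rewrite rev_cons -cats1 act_cat /= rsK IH. Qed.

Lemma act_rev w v : act w (act (rev w) v) = v.
Proof. by rewrite -{1}(revK w) act_revK. Qed.

Definition isint (v : vec) := forall k, v (inl k) \is a Num.int.

Lemma isint_al i : isint (al i).
Proof. by move=> k; rewrite /= intr_int. Qed.

Lemma isint_om i : isint (om i).
Proof. by move=> k /=; case: eqP. Qed.

Lemma isintB u v : isint u -> isint v -> isint (u - v).
Proof. by move=> hu hv k; rewrite !vecE rpredB. Qed.

Lemma isintD u v : isint u -> isint v -> isint (u + v).
Proof. by move=> hu hv k; rewrite !vecE rpredD. Qed.

Lemma isint_sc c v : c \is a Num.int -> isint v -> isint (sc c v).
Proof. by move=> hu hv k; rewrite !vecE rpredM. Qed.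

Lemma isint_rs i v : isint v -> isint (rs i v).
Proof. by move=> hv; apply: isintB => //; apply: isint_sc => //; exact: isint_al. Qed.

Lemma isint_act w v : isint v -> isint (act w v).
Proof. by move=> hv; elim: w => //= i w; exact: isint_rs. Qed.

Definition eqw (u w : seq K) := forall v, act u v = act w v.

Lemma eqw_refl u : eqw u u. Proof. by []. Qed.
Lemma eqw_sym u w : eqw u w -> eqw w u. Proof. by move=> h v; rewrite h. Qed.
Lemma eqw_trans u w z : eqw u w -> eqw w z -> eqw u z.
Proof. by move=> h h' v; rewrite h h'. Qed.
Lemma eqw_cat u u' w w' : eqw u u' -> eqw w w' -> eqw (u ++ w) (u' ++ w').
Proof. by move=> h h' v; rewrite !act_cat h' h. Qed.
Lemma eqw_cons i u w : eqw u w -> eqw (i :: u) (i :: w).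
Proof. by move=> h v; rewrite /= h. Qed.
Lemma eqw_cons2 i w : eqw (i :: i :: w) w.
Proof. by move=> v; rewrite /= rsK. Qed.
Lemma eqw_rev u w : eqw u w -> eqw (rev u) (rev w).
Proof. by move=> h v; rewrite -{1}(act_rev w v) -h act_revK. Qed.

Lemma len_subproof w : exists n, `[< exists2 u, size u = n & eqw u w >].
Proof. by exists (size w); apply/asboolP; exists w. Qed.
(** Coxeter length, read off from the action on [vec] instead of from a presentation of the
    group. *)
Definition len w : nat := ex_minn (len_subproof w).

Lemma len_le w u : eqw u w -> (len w <= size u)%N.
Proof.
move=> h; rewrite /len; case: ex_minnP => m _; apply.
by apply/asboolP; exists u.
Qed.

Lemma lenP w : exists2 u, size u = len w & eqw u w.
Proof. by rewrite /len; case: ex_minnP => m /asboolP. Qed.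

Lemma len_eqw u w : eqw u w -> len u = len w.
Proof.
move=> h; apply/eqP; rewrite eqn_leq; apply/andP; split.
  by have [x <- hx] := lenP w; apply: len_le; apply: eqw_trans hx (eqw_sym h).
by have [x <- hx] := lenP u; apply: len_le; apply: eqw_trans hx h.
Qed.

Lemma len_cons i w : (len (i :: w) <= (len w).+1)%N.
Proof. by have [x <- hx] := lenP w; apply: (@len_le _ (i :: x)); apply: eqw_cons. Qed.

Lemma len_cons' i w : (len w <= (len (i :: w)).+1)%N.
Proof. by rewrite -(len_eqw (eqw_cons2 i w)); exact: len_cons. Qed.

Lemma len0 w : len w = 0%N -> eqw w [::].
Proof. by move=> h; have [x] := lenP w; rewrite h => /size0nil -> /eqw_sym. Qed.

(* Vanishing coordinates are invisible to the letters involved, so the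
   functional [v |-> act w v (inl j)] is a finite combination of coordinates. *)
Lemma act_id w v : (forall k, k \in w -> v (inl k) = 0) -> act w v = v.
Proof.
elim: w => //= i w IH h; rewrite IH; last by move=> k kw; apply: h; rewrite inE kw orbT.
by apply/funext => x; rewrite rsE h ?mul0r ?subr0 // mem_head.
Qed.

Lemma sumvE (s : seq K) (F : K -> vec) x :
  (\sum_(k <- s) F k) x = \sum_(k <- s) F k x.
Proof. by elim: s => [|k s IH]; rewrite ?big_nil // !big_cons vecDE IH. Qed.

Lemma act_sum w (s : seq K) (F : K -> vec) :
  act w (\sum_(k <- s) F k) = \sum_(k <- s) act w (F k).
Proof.
elim: s => [|k s IH]; last by rewrite !big_cons actD IH.
rewrite !big_nil; have := act_sc w 0 0.
have -> : sc 0 0 = 0 :> vec by apply/funext => x; rewrite !vecE mul0r.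
by move=> ->; apply/funext => x; rewrite !vecE mul0r.
Qed.

Lemma act_coord w j v :
  act w v (inl j) = \sum_(k <- undup (j :: w)) v (inl k) * act w (om k) (inl j).
Proof.
set s := undup _; set v0 := v - \sum_(k <- s) sc (v (inl k)) (om k).
have us : uniq s by rewrite undup_uniq.
have v00 k : k \in s -> v0 (inl k) = 0.
  move=> ks; rewrite /v0 !vecE sumvE (bigD1_seq k) //= scE /= eqxx mulr1.
  rewrite big1_seq ?addr0 ?subrr //= => l /andP[lk _].
  by rewrite scE /= eq_sym (negbTE lk) mulr0.
have h0 : act w v0 (inl j) = 0.
  rewrite act_id ?v00 // ?mem_undup ?mem_head // => k kw.
  by rewrite v00 // mem_undup inE kw orbT.
move: h0; rewrite /v0 actB act_sum !vecE sumvE => /eqP; rewrite subr_eq0 => /eqP ->.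
by apply: eq_bigr => k _; rewrite act_sc vecE.
Qed.

(** The numbers [act w (om k) (inl j)] are the coefficients of the coroot w^{-1} alpha_j^vee in the
    simple coroots; [pos] and [neg] give its sign. *)
Definition pos j w := forall k, 0 <= act w (om k) (inl j).
Definition neg j w := forall k, act w (om k) (inl j) <= 0.
Definition dom (v : vec) := forall k, 0 <= v (inl k).
Definition reg (v : vec) := forall k, 0 < v (inl k).

Lemma reg_dom v : reg v -> dom v. Proof. by move=> h k; apply: ltW. Qed.
Lemma dom_om k : dom (om k). Proof. by move=> j /=; rewrite ler0n. Qed.

Lemma pos_ge0 j w v : pos j w -> dom v -> 0 <= act w v (inl j).
Proof. by move=> p d; rewrite act_coord; apply: sumr_ge0 => k _; apply: mulr_ge0. Qed.

Lemma om_neq0 j w : exists k, act w (om k) (inl j) != 0.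
Proof.
apply: contrapT => h.
have h0 k : act w (om k) (inl j) = 0 by apply/eqP; apply/negPn/negP => h'; apply: h; exists k.
have := act_coord w j (act (rev w) (om j)).
rewrite act_rev /= eqxx big1 => [/eqP|k _]; first by rewrite oner_eq0.
by rewrite h0 mulr0.
Qed.

Lemma act_coord0 w j k : k \notin j :: w -> act w (om k) (inl j) = 0.
Proof.
rewrite inE negb_or => /andP[kj kw].
rewrite act_id => [|l lw] /=; first by rewrite eq_sym (negbTE kj).
by case: eqP lw kw => // -> ->.
Qed.

Lemma pos_gt0 j w v : pos j w -> reg v -> 0 < act w v (inl j).
Proof.
move=> p d; have [k hk] := om_neq0 j w.
have ks : k \in undup (j :: w).
  by rewrite mem_undup; apply: contraNT hk => /act_coord0 ->.
rewrite act_coord (bigD1_seq k) ?undup_uniq //=.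
apply: ltr_pwDl; first by rewrite mulr_gt0 // lt_neqAle eq_sym hk p.
by apply: sumr_ge0 => l _; apply: mulr_ge0 => //; apply: ltW.
Qed.

Lemma neg_lt0 j w v : neg j w -> reg v -> act w v (inl j) < 0.
Proof.
move=> p d; have [k hk] := om_neq0 j w.
have ks : k \in undup (j :: w).
  by rewrite mem_undup; apply: contraNT hk => /act_coord0 ->.
rewrite act_coord (bigD1_seq k) ?undup_uniq //=.
apply: ltr_nwDl; first by rewrite pmulr_rlt0 // lt_neqAle hk p.
by apply: sumr_le0 => l _; apply: mulr_ge0_le0 => //; apply: ltW.
Qed.

Lemma pos_neg j w : pos j w -> neg j w -> False.
Proof.
move=> p n; have [k] := om_neq0 j w; rewrite eq_le p n; by [].
Qed.

Lemma pos_eqw j u w : eqw u w -> pos j u -> pos j w.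
Proof. by move=> h p k; rewrite -h. Qed.
Lemma neg_eqw j u w : eqw u w -> neg j u -> neg j w.
Proof. by move=> h p k; rewrite -h. Qed.

Lemma pos_cons j w : pos j w -> neg j (j :: w).
Proof. by move=> p k; rewrite /= rsE /= a2; have := p k; lra. Qed.
Lemma neg_cons j w : neg j w -> pos j (j :: w).
Proof. by move=> p k; rewrite /= rsE /= a2; have := p k; lra. Qed.

(** * Rank two subgroups *)

Section Dihedral.
Variables (s t : K).
Hypothesis st : s != t.
Let n1 : int := - a s t.
Let n2 : int := - a t s.

Lemma n1_ge0 : 0 <= n1. Proof. by rewrite oppr_ge0 aneg. Qed.
Lemma n2_ge0 : 0 <= n2. Proof. by rewrite oppr_ge0 aneg // eq_sym. Qed.
Lemma n12 : (n1 == 0) = (n2 == 0). Proof. by rewrite !oppr_eq0 asym. Qed.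

Lemma rs_st v : rs s v (inl t) = v (inl t) + n2%:~R * v (inl s).
Proof. by rewrite rsE /= /n2 rmorphN /=; ring. Qed.
Lemma rs_ts v : rs t v (inl s) = v (inl s) + n1%:~R * v (inl t).
Proof. by rewrite rsE /= /n1 rmorphN /=; ring. Qed.
Lemma rs_ii i v : rs i v (inl i) = - v (inl i).
Proof. by rewrite rsE /= a2; ring. Qed.

Fixpoint alt (b : bool) (n : nat) : seq K :=
  if n is n'.+1 then (if b then t else s) :: alt (~~ b) n' else [::].

Lemma size_alt b n : size (alt b n) = n.
Proof. by elim: n b => //= n IH b; rewrite IH. Qed.

Definition ST v (q : nat) := (act (alt true q) v (inl s), act (alt false q) v (inl t)).

Lemma STS v q : ST v q.+2 =
  (n1%:~R * (ST v q.+1).2 - (ST v q).1, n2%:~R * (ST v q.+1).1 - (ST v q).2).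
Proof.
rewrite /ST.
have e1 : act (alt true q.+2) v = rs t (act (alt false q.+1) v) by [].
have e2 : act (alt false q.+2) v = rs s (act (alt true q.+1) v) by [].
have e3 : act (alt false q.+1) v (inl s) = - act (alt true q) v (inl s) by rewrite /= rs_ii.
have e4 : act (alt true q.+1) v (inl t) = - act (alt false q) v (inl t) by rewrite /= rs_ii.
rewrite e1 e2 rs_ts rs_st e3 e4.
by congr (_, _); cbn [fst snd]; ring.
Qed.

Lemma ST0 v : ST v 0 = (v (inl s), v (inl t)). Proof. by []. Qed.
Lemma ST1 v : ST v 1 = (v (inl s) + n1%:~R * v (inl t), v (inl t) + n2%:~R * v (inl s)).
Proof. by rewrite /ST /= rs_ts rs_st. Qed.

(** The order of the product of the two reflections; [None] stands for infinite order. *)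
Definition braid_len : option nat :=
  if n1 * n2 == 0 then Some 2 else if n1 * n2 == 1 then Some 3 else
  if n1 * n2 == 2 then Some 4 else if n1 * n2 == 3 then Some 6 else None.

(** The recursion does not oscillate here: the last two inequalities bound each value below by half
    of the first term in the recursion, and reproduce themselves when the product is at least 4. *)
Lemma ST_inf v q : 4 <= n1 * n2 -> 0 <= v (inl s) -> 0 <= v (inl t) ->
  [/\ 0 <= (ST v q).1, 0 <= (ST v q).2,
     n1%:~R * (ST v q).2 <= 2 * (ST v q.+1).1 &
     n2%:~R * (ST v q).1 <= 2 * (ST v q.+1).2].
Proof.
move=> h4 hs ht.
have hn : 4 <= n1%:~R * n2%:~R :> R by rewrite -rmorphM /= (ler_int _ 4).
have p1 : 0 <= n1%:~R :> R by rewrite ler0z n1_ge0.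
have p2 : 0 <= n2%:~R :> R by rewrite ler0z n2_ge0.
elim: q => [|q [i1 i2 i3 i4]].
  by rewrite ST1 ST0 /=; split => //; have := mulr_ge0 p1 ht; have := mulr_ge0 p2 hs; nra.
have j1 : 0 <= (ST v q.+1).1 by have := mulr_ge0 p1 i2; lra.
have j2 : 0 <= (ST v q.+1).2 by have := mulr_ge0 p2 i1; lra.
rewrite STS; cbn [fst snd]; split => //.
  have h : 4 * (ST v q).1 <= 2 * (n1%:~R * (ST v q.+1).2).
    apply: (@le_trans _ _ (n1%:~R * n2%:~R * (ST v q).1)); first exact: ler_wpM2r.
    by rewrite -mulrA [leRHS]mulrCA; apply: ler_wpM2l.
  by lra.
have h : 4 * (ST v q).2 <= 2 * (n2%:~R * (ST v q.+1).1).
  apply: (@le_trans _ _ (n1%:~R * n2%:~R * (ST v q).2)); first exact: ler_wpM2r.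
  by rewrite (mulrC n1%:~R) -mulrA [leRHS]mulrCA; apply: ler_wpM2l.
by lra.
Qed.

Lemma n12_cases : 4 <= n1 * n2 \/
  (n1, n2) \in [:: (0, 0); (1, 1); (1, 2); (2, 1); (1, 3); (3, 1)].
Proof.
have := n1_ge0; have := n2_ge0; have := n12.
case: n1 => // m1; case: n2 => // m2.
case: m1 => [|[|[|[|m1]]]]; case: m2 => [|[|[|[|m2]]]] //= _ _ _; try (by right); left; lia.
Qed.

(* [stp] tracks the coefficients of [al s] and [al t] in [v - act w v]. *)
Definition stp (c d : R) (i : K) (xy : R * R) : R * R :=
  if i == s then (c - xy.1 + n1%:~R * xy.2, xy.2)
  else (xy.1, d - xy.2 + n2%:~R * xy.1).

Lemma act_alt b n v (c := v (inl s)) (d := v (inl t)) :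
  let xy := foldr (stp c d) (0, 0) (alt b n) in
  act (alt b n) v = v - sc xy.1 (al s) - sc xy.2 (al t).
Proof.
elim: n b => [|n IH] b /=.
  by apply/funext => x; rewrite !vecE; ring.
rewrite IH; set xy := foldr _ _ _; apply/funext => x.
have e1 : (a s t)%:~R = - n1%:~R :> R by rewrite /n1 rmorphN opprK.
have e2 : (a t s)%:~R = - n2%:~R :> R by rewrite /n2 rmorphN opprK.
move: xy => xy; case: b; rewrite /stp.
  by rewrite eq_sym (negbTE st) rsE !vecE; cbn [fst snd al]; rewrite a2 e2 -/c -/d; ring.
by rewrite eqxx rsE !vecE; cbn [fst snd al]; rewrite a2 e1 -/c -/d; ring.
Qed.

(** The coefficients of [stp] as integral linear forms in the two pairings. The braid relation
    becomes an equality of closed terms, decided by computation for each of the six finite pairs of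
    entries. *)
Definition stpZ (m1 m2 : int) (b : bool) (z : (int * int) * (int * int)) :=
  let: ((x1, x2), (y1, y2)) := z in
  if b then ((x1, x2), (- y1 + m2 * x1, 1 - y2 + m2 * x2))
  else ((1 - x1 + m1 * y1, - x2 + m1 * y2), (y1, y2)).

Fixpoint altZ (m1 m2 : int) (b : bool) (n : nat) :=
  if n is n'.+1 then stpZ m1 m2 b (altZ m1 m2 (~~ b) n') else ((0, 0), (0, 0)).

Lemma foldr_stp c d b n : foldr (stp c d) (0, 0) (alt b n) =
  let: ((x1, x2), (y1, y2)) := altZ n1 n2 b n in
  (x1%:~R * c + x2%:~R * d, y1%:~R * c + y2%:~R * d).
Proof.
elim: n b => [|n IH] b /=; first by congr (_, _); rewrite mulr0z; ring.
rewrite IH; case: (altZ _ _ _ _) => [[x1 x2] [y1 y2]].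
case: b; rewrite /stp /=; last first.
  by rewrite eqxx; congr (_, _); rewrite ?rmorphD ?rmorphB ?rmorphM ?rmorphN /= ?mulr1z; ring.
rewrite eq_sym (negbTE st).
by congr (_, _); rewrite ?rmorphD ?rmorphB ?rmorphM ?rmorphN /= ?mulr1z; ring.
Qed.

Lemma braid m : braid_len = Some m -> eqw (alt true m) (alt false m).
Proof.
move=> hm v; rewrite !act_alt !foldr_stp.
suff -> : altZ n1 n2 true m = altZ n1 n2 false m by [].
move: hm; rewrite /braid_len; have [h4|hc] := n12_cases.
  by do 4! (case: eqP => [h|_]; first by rewrite h in h4).
move: hc; rewrite !inE; move: n1 n2 => m1 m2.
by case/or4P => [/eqP[-> ->]|/eqP[-> ->]|/eqP[-> ->]|/or3P[] /eqP[-> ->]] /= [<-].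
Qed.

Lemma ST_fin v m q : braid_len = Some m -> (q < m)%N ->
  0 <= v (inl s) -> 0 <= v (inl t) -> 0 <= (ST v q).1.
Proof.
move=> hm hq hs ht; move: hm; rewrite /braid_len; have [h4|hc] := n12_cases.
  by do 4! (case: eqP => [h|_]; first by rewrite h in h4).
suff: m = match braid_len with Some m => m | None => 0%N end ->
   0 <= (ST v q).1 by move=> h hb; apply: h; rewrite /braid_len hb.
move: hc; rewrite !inE /braid_len => hc hm.
have hq' : (q < 6)%N.
  by apply: leq_trans hq _; rewrite hm; do 4! case: ifP => // _.
move: hq' hq.
case: q => [|[|[|[|[|[|q]]]]]] // _; rewrite ?STS ?ST1 ?ST0 /=;
move: hm hc; move: n1 n2 => m1 m2 ->;
case/or4P => [/eqP[-> ->]|/eqP[-> ->]|/eqP[-> ->]|/or3P[] /eqP[-> ->]] //= _;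
rewrite ?mulr1z ?mulr0z; try lra.
Qed.

(** A word of minimal size alternates. Its first letter is [t], since a leading [s] would cancel,
    and it is shorter than the braid length, since otherwise the braid relation would produce a
    leading [s]. What remains is [ST_fin] or [ST_inf]. *)
Lemma dihedral_pos d : all (mem [:: s; t]) d ->
  (forall d', eqw d' d -> (size d <= size d')%N) ->
  (forall d', eqw d' (s :: d) -> (size d <= size d')%N) ->
  forall v, 0 <= v (inl s) -> 0 <= v (inl t) -> 0 <= act d v (inl s).
Proof.
move=> hd hmin hs v vs vt.
have dalt : exists b, d = alt b (size d).
  elim: d hd hmin {hs} => [|i d IH] /=; first by exists true.
  move=> /andP[hi hd] hmin.
  have [|b hb] := IH hd.
    move=> d' h; have := hmin (i :: d'); rewrite /= ltnS; apply; exact: eqw_cons.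
  move: hb hd hmin {IH}; case: d => [|j d] hb hd hmin.
    exists (i == t); rewrite /=; move: hi; rewrite !inE.
    by case/orP => /eqP -> ; rewrite ?(negbTE st) ?eqxx.
  exists (~~ b).
  change (i :: j :: d = (if ~~ b then t else s) :: alt (~~ ~~ b) (size (j :: d))).
  rewrite negbK -hb.
  have ij : i != j.
    apply/eqP => ij; have := hmin d; rewrite ij => /(_ (eqw_sym (eqw_cons2 _ _))) /=.
    by rewrite ltnNge leqnSn.
  have hj : j = if b then t else s by case: hb.
  congr (_ :: _); move: ij hi; rewrite hj !inE.
  case: (b) => /= h /orP[] /eqP hi; rewrite hi //; by rewrite hi eqxx in h.
case: dalt => b hb.
case: b hb => hb; last first.
  case: (d) hb hs => [//|i d'] /= [-> _] hs.
  by have := hs d' (eqw_sym (eqw_cons2 _ _)); rewrite ltnn.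
rewrite hb -[act _ _ _]/(ST v (size d)).1.
have [h4|hc] := n12_cases; first by have [] := ST_inf (size d) h4 vs vt.
have [m hm] : exists m, braid_len = Some m.
  rewrite /braid_len; move: hc; rewrite !inE; move: n1 n2 => m1 m2.
  by case/or4P => [/eqP[-> ->]|/eqP[-> ->]|/eqP[-> ->]|/or3P[] /eqP[-> ->]] /=; eexists.
apply: (ST_fin hm) => //; rewrite ltnNge; apply/negP => hle.
have alt_cat b' p q : alt b' (p + q) = alt b' p ++ alt (if odd p then ~~ b' else b') q.
  elim: p b' => //= p IH b'; rewrite IH; congr (_ :: (_ ++ alt _ _)).
  by case: (odd p); case: b'.
have m0 : (0 < m)%N.
  by move: hm; rewrite /braid_len; do 4! (case: ifP => [_ [<-] //|_]).
move: hb; rewrite -(subnKC hle) alt_cat; set r := alt _ (_ - _) => hb.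
case: (m) m0 hm hb hle (braid hm) => // m' _ hm hb hle hbr.
have := hs (behead (alt false m'.+1) ++ r).
rewrite hb /= !size_cat !size_alt ltnn => H.
suff: false by [].
apply: H; apply: eqw_sym.
apply: (@eqw_trans _ (s :: alt false m'.+1 ++ r)).
  by apply: eqw_cons; apply: (@eqw_cat (alt true m'.+1)).
exact: eqw_cons2.
Qed.

End Dihedral.

(** Let [t] be the first letter of a shortest word. Among the length-additive factorisations of [w]
    as [d ++ v] with [d] a word in [s] and [t], one with [v] shortest is chosen; by induction [v] is
    positive at [s] and [t], and the rank two case takes care of [d]. *)
Lemma len_pos s w : (len w <= len (s :: w))%N -> pos s w.
Proof.
elim: {w}(len w) {-2}w (leqnn (len w)) s => [|n IH] w hn s hs.
  have w0 : len w = 0%N by apply/eqP; rewrite -leqn0.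
  by apply: pos_eqw (eqw_sym (len0 w0)) _ => k /=; rewrite ler0n.
have [hw|hw] := leqP (len w) n; first exact: IH.
have lw : len w = n.+1 by apply/eqP; rewrite eqn_leq hn.
have [u su eu] := lenP w.
case: u su eu => [|t u]; rewrite lw // => -[su] eu.
have lu : len u = n.
  apply/eqP; rewrite eqn_leq -{1}su len_le //=.
  by rewrite -ltnS -lw -(len_eqw eu) len_cons.
have st : s != t.
  apply/eqP => e; move: hs; rewrite lw -(len_eqw (eqw_cons s eu)) e.
  by rewrite (len_eqw (eqw_cons2 t u)) lu ltnn.
pose P k := `[< exists d v, [/\ all (mem [:: s; t]) d, eqw (d ++ v) w,
    (size d + len v = len w)%N & len v = k] >].
have exP : exists k, P k.
  exists n; apply/asboolP; exists [:: t], u; split => //=; first by rewrite !inE eqxx orbT.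
  by rewrite lu lw.
case: (ex_minnP exP) => k /asboolP[d [v [hd ev sz lv]]] kmin.
have kn : (k <= n)%N.
  apply: kmin; apply/asboolP; exists [:: t], u; split => //=; first by rewrite !inE eqxx orbT.
  by rewrite lu lw.
have step i : i \in [:: s; t] -> (len v <= len (i :: v))%N.
  move=> hi; rewrite leqNgt; apply/negP => hlt.
  have hl : (len (i :: v)).+1 = len v by apply/eqP; rewrite eqn_leq hlt len_cons'.
  have: (k <= len (i :: v))%N.
    apply: kmin; apply/asboolP; exists (rcons d i), (i :: v); split => //.
    - by rewrite all_rcons hd andbT.
    - apply: eqw_trans ev; rewrite -cats1 -catA /=.
      by apply: eqw_cat => //; exact: eqw_cons2.
    - by rewrite size_rcons addSnnS hl.
  by rewrite leqNgt -lv hlt.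
have ps : pos s v by apply: IH; rewrite ?lv // -lv step // mem_head.
have pt : pos t v by apply: IH; rewrite ?lv // -lv step // !inE eqxx orbT.
have dmin d' (x : seq K) : eqw d' x -> (len (x ++ v) <= size d' + len v)%N.
  move=> h; have [v' <- ev'] := lenP v; rewrite -size_cat; apply: len_le.
  by apply: eqw_cat => //; exact: eqw_sym.
apply: (pos_eqw ev) => l; rewrite act_cat; apply: (dihedral_pos st hd) => //.
  by move=> d' /dmin; rewrite (len_eqw ev) -sz leq_add2r.
move=> d' /dmin; rewrite [(_ :: _) ++ _]/= (len_eqw (eqw_cons s ev)) => h.
by rewrite -(leq_add2r (len v)) sz (leq_trans hs).
Qed.

Lemma len_neg s w : (len (s :: w) < len w)%N -> neg s w.
Proof.
move=> h; apply: neg_eqw (eqw_cons2 s w) _; apply: pos_cons; apply: len_pos.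
by rewrite (len_eqw (eqw_cons2 s w)) ltnW.
Qed.

Lemma pos_or_neg s w : pos s w \/ neg s w.
Proof.
by have [/len_pos|/len_neg] := leqP (len w) (len (s :: w)); [left|right].
Qed.

Lemma pos_len s w : pos s w -> len (s :: w) = (len w).+1.
Proof.
move=> p; apply/eqP; rewrite eqn_leq len_cons ltnNge; apply/negP => h.
have : neg s w.
  apply: neg_eqw (eqw_cons2 s w) _; apply: pos_cons; apply: len_pos.
  by rewrite (len_eqw (eqw_cons2 s w)).
exact: pos_neg p.
Qed.

Lemma neg_len s w : neg s w -> len w = (len (s :: w)).+1.
Proof.
move=> /neg_cons /pos_len; rewrite (len_eqw (eqw_cons2 s w)) => ->; by [].
Qed.

Lemma all_pos w : (forall k, pos k w) -> eqw w [::].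
Proof.
move=> h; have [u su eu] := lenP w; case: u su eu => [|s u] su eu; first exact: eqw_sym.
have: neg s w.
  apply: (neg_eqw eu); apply: pos_cons; apply: len_pos.
  by rewrite (len_eqw eu) -su /= (leq_trans (len_le (eqw_refl u))).
by move/(pos_neg (h s)).
Qed.

(** * Reflections z^{-1} r_i z, strong exchange and covers *)

Definition rw (z : seq K) (i : K) : seq K := rev z ++ i :: z.

Lemma rwE z i v : act (rw z i) v = v - sc (act z v (inl i)) (act (rev z) (al i)).
Proof. by rewrite act_cat /= /rs actB act_revK act_sc. Qed.

Lemma rw_cons z i p : eqw (rw (z ++ [:: p]) i) (p :: rw z i ++ [:: p]).
Proof. by move=> v; rewrite /rw rev_cat /= -catA. Qed.

(** The reflection [p] changes the sign of no positive coroot but its own: the coefficients of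
    z^{-1} alpha_i^vee away from [p] are both nonnegative and nonpositive, and the one at [p] is an
    invertible nonnegative integer. *)
Lemma flip_functional i z p : pos i z -> neg i (z ++ [:: p]) ->
  forall v, act z v (inl i) = v (inl p).
Proof.
move=> pz nz.
have c0 k : k != p -> act z (om k) (inl i) = 0.
  move=> kp; apply/eqP; rewrite eq_le pz andbT.
  have := nz k; rewrite act_cat /=.
  suff -> : rs p (om k) = om k by [].
  by apply/funext => x; rewrite rsE /= eq_sym (negbTE kp) mul0r subr0.
set c := act z (om p) (inl i).
have hv v : act z v (inl i) = v (inl p) * c.
  rewrite act_coord; have [ps|ps] := boolP (p \in undup (i :: z)); last first.
    have -> : c = 0 by apply: act_coord0; rewrite -mem_undup.
    rewrite mulr0; apply: big1_seq => k /andP[_ ks].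
    by rewrite c0 ?mulr0 //; apply: contraNneq ps => <-.
  rewrite (bigD1_seq p) ?undup_uniq //= big1 ?addr0 // => k kp.
  by rewrite c0 ?mulr0.
suff c1 : c = 1 by move=> v; rewrite hv c1 mulr1.
have := hv (act (rev z) (om i)); rewrite act_rev /= eqxx => h1.
have /intrP[m hm] : act (rev z) (om i) (inl p) \is a Num.int.
  by apply: isint_act; exact: isint_om.
have /intrP[n hn] : c \is a Num.int by apply: isint_act; exact: isint_om.
have c_ge0 : 0 <= c := pz p.
rewrite hm hn in h1; move: c_ge0; rewrite hn ler0z => n0.
have {}h1 : m * n = 1 by apply/eqP; rewrite -(eqr_int R) rmorphM /= -h1.
have n1 : 1 <= n by rewrite -gtz0_ge1 lt_neqAle n0 andbT; apply/eqP => e; rewrite -e mulr0 in h1.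
have m1 : 1 <= m by rewrite -gtz0_ge1 -(pmulr_lgt0 _ (lt_le_trans ltr01 n1)) h1.
by have -> : n = 1 by nia.
Qed.

(** The coroots agree by the previous lemma, but the roots must be compared too. The product of the
    two reflections fixes [om k] for every [k] other than [p], so it is negative at no letter and
    therefore trivial. *)
Lemma flip_rw i z p : pos i z -> neg i (z ++ [:: p]) -> eqw (rw z i) [:: p].
Proof.
move=> pz nz; have hf := flip_functional pz nz.
set g := act (rev z) (al i).
have gp : g (inl p) = 2 by rewrite -hf /g act_rev /= a2.
have yE v : act (rw z i ++ [:: p]) v = v - sc (v (inl p)) (al p) + sc (v (inl p)) g.
  rewrite act_cat rwE -/g hf /= rs_ii; apply/funext => x.
  by rewrite !(rsE, vecE); ring.
suff /all_pos h : forall k, pos k (rw z i ++ [:: p]).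
  by move=> v; have := h (rs p v); rewrite act_cat /= rsK.
move=> k; have [->|kp] := eqVneq k p.
  by move=> l; rewrite yE !vecE /= a2 gp subrK ler0n.
have [//|/(_ k)] := pos_or_neg k (rw z i ++ [:: p]).
by rewrite yE !vecE /= eqxx eq_sym (negbTE kp) /= !mul0r subr0 addr0 ler10.
Qed.

(** The positive root changes sign at some letter of [u]; there the reflection is simple by
    [flip_rw] and deletes that letter. *)
Lemma strong_exchange u z i : pos i z -> neg i (z ++ rev u) ->
  exists2 u', (size u' < size u)%N & eqw (u ++ rw z i) u'.
Proof.
elim/last_ind: u z => [|u p IH] z pz; first by rewrite cats0 => /(pos_neg pz).
rewrite rev_rcons -cat1s catA => nz.
have [pp|np] := pos_or_neg i (z ++ [:: p]); last first.
  exists u; first by rewrite size_rcons.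
  rewrite -cats1 -catA /=; apply: (@eqw_trans _ (u ++ [:: p; p])).
    by apply: eqw_cat => //; apply: eqw_cons; exact: flip_rw.
  by rewrite -[X in eqw _ X]cats0; apply: eqw_cat => //; exact: eqw_cons2.
have [u' su' eu'] := IH _ pp nz.
exists (rcons u' p); first by rewrite !size_rcons ltnS.
rewrite -!cats1 -catA /=.
apply: (@eqw_trans _ ((u ++ rw (z ++ [:: p]) i) ++ [:: p])); last exact: eqw_cat.
move=> v; rewrite -catA 2!(act_cat u) (act_cat (rw (z ++ [:: p]) i)) rw_cons.
by rewrite /= (act_cat (rw z i)) /= rsK.
Qed.

Lemma len_reflection_neg u z i : pos i z -> neg i (z ++ rev u) ->
  (len (u ++ rw z i) < len u)%N.
Proof.
move=> pz nz; have [x sx ex] := lenP u.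
have := @strong_exchange x z i pz; case.
  apply: neg_eqw nz; apply: eqw_cat => //; exact: eqw_rev.
move=> x' hs hx; rewrite -sx (len_eqw (eqw_cat (eqw_sym ex) (eqw_refl (rw z i)))) //.
by apply: leq_ltn_trans hs; apply: len_le.
Qed.

Lemma act_rw_neg z i v : act z (act (rw z i) v) (inl i) = - act z v (inl i).
Proof. by rewrite act_cat act_rev /= rs_ii. Qed.

Lemma rwK z i : eqw (rw z i ++ rw z i) [::].
Proof. by move=> v; rewrite !act_cat /= act_rev rsK act_revK. Qed.

Lemma rev_rw z i : rev (rw z i) = rw z i.
Proof. by rewrite /rw rev_cat rev_cons revK -cats1 -catA. Qed.

Lemma len_reflection_pos u z i : pos i z -> pos i (z ++ rev u) ->
  (len u < len (u ++ rw z i))%N.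
Proof.
move=> pz pu.
have e : eqw ((u ++ rw z i) ++ rw z i) u.
  rewrite -catA -[X in eqw _ X]cats0; apply: eqw_cat => //; exact: rwK.
rewrite -{1}(len_eqw e); apply: len_reflection_neg => // k.
rewrite rev_cat rev_rw (act_cat z) (act_cat (rw z i)) act_rw_neg oppr_le0.
by have := pu k; rewrite act_cat.
Qed.

(* [cov p u v]: [u] covers [v] in Bruhat order by the reflection of a real root
   taking an integral value at [p]. *)
Definition cov (p : vec) (u v : seq K) := exists z i,
  [/\ pos i z, eqw u (v ++ rw z i), len u = (len v).+1 & act z p (inl i) \is a Num.int].

Lemma cov_eqw p u u' v v' : eqw u u' -> eqw v v' -> cov p u v -> cov p u' v'.
Proof.
move=> hu hv [z [i [pz e l h]]]; exists z, i; split => //.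
  by apply: eqw_trans (eqw_sym hu) _; apply: eqw_trans e _; apply: eqw_cat.
by rewrite -(len_eqw hu) -(len_eqw hv).
Qed.

(** The lengths force the image under [v] of the root of the cover to be positive, and negative
    after applying [j]. So it is the simple root of [j], and integrality of the cover turns into
    integrality at [j]. *)
Lemma cov_flip p u v j : cov p u v -> neg j u -> pos j v ->
  eqw u (j :: v) /\ act v p (inl j) \is a Num.int.
Proof.
move=> [z [i [pz e l h]]] nu pv.
have pz' : pos i (z ++ rev v).
  have [//|nz] := pos_or_neg i (z ++ rev v).
  by have := len_reflection_neg pz nz; rewrite -(len_eqw e) l ltnNge leqnSn.
have nz' : neg i ((z ++ rev v) ++ [:: j]).
  have [pz''|//] := pos_or_neg i ((z ++ rev v) ++ [:: j]).
  have := @len_reflection_pos (j :: v) z i pz; rewrite rev_cons -cats1 catA => /(_ pz'').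
  have -> : len ((j :: v) ++ rw z i) = len (j :: u).
    by apply: len_eqw => x; rewrite /= -e.
  have := pos_len pv; have := neg_len nu; rewrite l => -[<-] -> ; by rewrite ltnNge leqnSn.
split.
  apply: eqw_trans e _ => x.
  rewrite -[RHS]/(act [:: j] (act v x)) -(flip_rw pz' nz') !(act_cat, rwE) act_revK.
  by rewrite actB act_sc rev_cat revK act_cat.
have := flip_functional pz' nz' (act v p); rewrite act_cat act_revK => <-; exact: h.
Qed.

Lemma cov_cons p u v i : cov p u v ->
  (pos i u /\ pos i v) \/ (neg i u /\ neg i v) -> cov p (i :: u) (i :: v).
Proof.
move=> [z [k [pz e l h]]] hs; exists z, k; split => //; first exact: eqw_cons.
case: hs => -[hu hv]; first by rewrite !pos_len // l.
by move: l; rewrite (neg_len hu) (neg_len hv) => -[].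
Qed.

Lemma cov_simple p v i : pos i v -> act v p (inl i) \is a Num.int -> cov p (i :: v) v.
Proof.
move=> pv h; exists v, i; split => //; last by rewrite pos_len.
by move=> x; rewrite /rw !act_cat act_rev.
Qed.

(** The two images differ by an integral multiple of a root. *)
Lemma cov_congr p u v : cov p u v -> isint (act u p - act v p).
Proof.
move=> [z [i [pz e l h]]]; rewrite e act_cat rwE actB act_sc.
have -> (x y : vec) : x - y - x = - y by apply/funext => k; rewrite !vecE; ring.
rewrite -scN1; apply: isint_sc; first by rewrite rpredN1.
apply: isint_sc => //; do 2! apply: isint_act; exact: isint_al.
Qed.

Lemma cov_translate p q u v : isint q -> cov p u v -> cov (p - q) u v.
Proof.
move=> hq [z [i [pz e l h]]]; exists z, i; split => //.
by rewrite actB !vecE rpredB //; exact: isint_act.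
Qed.

Lemma pos_notin i w : i \notin w -> pos i w.
Proof.
move=> iw; have [//|/(_ i)] := pos_or_neg i w; rewrite act_id /= ?eqxx ?ler10 //.
by move=> k kw /=; case: eqP kw iw => // -> ->.
Qed.

(* For a letter [i] foreign to both words, the reflection [u v^-1] is along a
   positive root without [i]-component, hence pairing nonpositively with [i]. *)
Lemma cov_fresh p u v i nu : i \notin u -> i \notin v -> dom nu -> cov p u v ->
  act v nu (inl i) <= act u nu (inl i).
Proof.
move=> iu iv dn [z [k [pz e l h]]].
have pz' : pos k (z ++ rev v).
  have [//|nz] := pos_or_neg k (z ++ rev v).
  by have := len_reflection_neg pz nz; rewrite -(len_eqw e) l ltnNge leqnSn.
set b := act v (act (rev z) (al k)).
have yE x : act (u ++ rev v) x = x - sc (act (z ++ rev v) x (inl k)) b.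
  by rewrite (act_cat u) e (act_cat v) rwE actB act_rev act_sc -/b (act_cat z).
have iy : i \notin u ++ rev v by rewrite mem_cat mem_rev negb_or iu.
have bi : b (inl i) <= 0.
  have b2 : act (z ++ rev v) b (inl k) = 2.
    by rewrite act_cat act_revK act_rev /= a2.
  have om0 : act (z ++ rev v) (om i) (inl k) = 0.
    have : act (u ++ rev v) (om i) = om i.
      by apply: act_id => j jy /=; case: eqP jy iy => // -> ->.
    move/(congr1 (fun x => act (z ++ rev v) x (inl k))); rewrite yE actB act_sc !vecE b2.
    lra.
  have [j hj] := om_neq0 k (z ++ rev v).
  have cj : 0 < act (z ++ rev v) (om j) (inl k) by rewrite lt_neqAle eq_sym hj pz'.
  have ji : i != j by apply: contraNneq hj => <-; rewrite om0.
  have := pos_notin iy j; rewrite yE !vecE /= (negbTE ji) /= sub0r oppr_ge0.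
  by rewrite (pmulr_rle0 _ cj).
have -> : act u nu = act (u ++ rev v) (act v nu) by rewrite act_cat act_revK.
rewrite yE !vecE act_cat act_revK lerBrDr gerDl.
by apply: mulr_ge0_le0 => //; exact: pos_ge0.
Qed.

Definition reduced w := len w = size w.

Lemma reduced_exists w : exists2 u, reduced u & eqw u w.
Proof. by have [u su eu] := lenP w; exists u; rewrite // /reduced su; exact: len_eqw. Qed.

Lemma reduced_cons i u : reduced (i :: u) -> reduced u /\ pos i u.
Proof.
rewrite /reduced => h; have h1 := len_cons i u; have h2 := len_le (eqw_refl u).
have e : len u = size u.
  by apply/eqP; rewrite eqn_leq h2 /= -ltnS -[X in (X <= _)%N]/(size (i :: u)) -h.
by split => //; apply: len_pos; rewrite h e /=.
Qed.

Lemma reduced_tr u nu k : reduced u -> dom nu -> act u nu (inr k) <= nu (inr k).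
Proof.
move=> ru dn; elim: u ru => [//|i u IH] /reduced_cons[ru pu] /=.
rewrite rsE /=; apply: le_trans (IH ru); rewrite gerBl.
by apply: mulr_ge0; rewrite ?ler0n //; exact: pos_ge0.
Qed.

Lemma tr_act w nu k : dom nu -> act w nu (inr k) <= nu (inr k).
Proof. by have [u ru eu] := reduced_exists w; rewrite -eu => ?; exact: reduced_tr. Qed.

Lemma tr_act_eq w nu : reg nu -> (forall k, act w nu (inr k) = nu (inr k)) -> eqw w [::].
Proof.
move=> rn h; have [u ru eu] := reduced_exists w; apply: eqw_trans (eqw_sym eu) _.
case: u ru eu => // i u /reduced_cons[ru pu] eu; have := h i; rewrite -eu /= rsE /= eqxx mulr1.
have := reduced_tr i ru (reg_dom rn); have := pos_gt0 pu rn; lra.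
Qed.

End Reflections.

(** * Future infima *)

Section RealFunctions.
Local Open Scope classical_set_scope.
Variable R : realType.
Implicit Types (g : R -> R) (s t c e L : R).

Lemma last_time (P : R -> Prop) t0 L : t0 <= L -> P t0 ->
  exists t', [/\ t0 <= t' <= L, forall s, t' < s <= L -> ~ P s &
    forall e, 0 < e -> exists2 s, t' - e < s & [/\ t0 <= s, s <= t' & P s]].
Proof.
move=> h0 p0; set E := [set s | t0 <= s <= L /\ P s].
have hE : has_sup E.
  by split; [exists t0; split; rewrite ?lexx|exists L => s [/andP[]]].
have tE : t0 <= sup E by apply: ub_le_sup; [case: hE|split; rewrite ?lexx].
exists (sup E); split.
- by rewrite tE /=; apply: ge_sup; [case: hE|move=> s [/andP[]]].
- move=> s /andP[hs sL] ps; move: (hs); rewrite ltNge => /negP; apply.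
  apply: ub_le_sup; [by case: hE|split => //].
  by rewrite sL (le_trans tE (ltW hs)).
- move=> e e0; have [s Es hs] := sup_adherent e0 hE.
  by exists s => //; case: (Es) => /andP[h1 h2] ps; split => //; apply: ub_le_sup; [case: hE|].
Qed.

Definition lipschitz L C g := forall s t, 0 <= s <= L -> 0 <= t <= L ->
  `|g s - g t| <= C * `|s - t|.

Definition finf L g t := inf [set x | exists2 s, t <= s <= L & g s = x].

Section FutureInfimum.
Variables (L C : R) (g : R -> R).
Hypothesis lg : lipschitz L C g.

Lemma lip_ge0 : 0 < L -> 0 <= C.
Proof.
move=> L0; have h : `|g 0 - g L| <= C * `|0 - L| by apply: lg; lra.
have := le_trans (normr_ge0 _) h.
by rewrite pmulr_lge0 // normr_gt0 sub0r oppr_eq0 gt_eqF.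
Qed.

Lemma has_inf_future t : 0 <= t <= L ->
  has_inf [set x | exists2 s, t <= s <= L & g s = x].
Proof.
move=> /andP[t0 tL]; split; first by exists (g t), t; rewrite ?lexx.
exists (g t - `|C| * `|L|) => _ [s /andP[ts sL] <-].
have hs : 0 <= s <= L by rewrite (le_trans t0 ts).
have: `|g s - g t| <= C * `|s - t| by apply: lg; lra.
rewrite [`|s - t|]ger0_norm ?subr_ge0 // => h.
have h2 : C * (s - t) <= `|C| * `|L|.
  apply: (@le_trans _ _ (`|C| * (s - t))); first by rewrite ler_wpM2r ?subr_ge0 ?ler_norm.
  by apply: ler_wpM2l => //; have := ler_norm L; lra.
by have := ler_norm (g t - g s); rewrite distrC; lra.
Qed.

Lemma finf_le t s : 0 <= t -> t <= s <= L -> finf L g t <= g s.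
Proof.
move=> t0 hs; have [|_ hl] := @has_inf_future t; first by lra.
by apply: (ge_inf hl); exists s.
Qed.

Lemma le_finf t c : 0 <= t <= L -> (forall s, t <= s <= L -> c <= g s) -> c <= finf L g t.
Proof.
move=> ht h; apply: lb_le_inf; first by have [] := has_inf_future ht.
by move=> _ [s /h hs <-].
Qed.

Lemma finf_lt t c : 0 <= t <= L -> finf L g t < c -> exists2 s, t <= s <= L & g s < c.
Proof.
move=> ht h; have := inf_adherent (_ : 0 < c - finf L g t) (has_inf_future ht).
rewrite subr_gt0 h => /(_ isT)[_ [s hs <-]]; rewrite -/(finf L g t) addrC subrK => ?.
by exists s.
Qed.

Lemma finf_mono s t : 0 <= s -> s <= t -> t <= L -> finf L g s <= finf L g t.
Proof.
move=> s0 st tL; apply: le_finf => [|r /andP[tr rL]]; first by rewrite (le_trans s0 st).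
by apply: finf_le => //; rewrite (le_trans st tr).
Qed.

Lemma finf_end : 0 <= L -> finf L g L = g L.
Proof.
move=> L0; apply/eqP; rewrite eq_le finf_le ?lexx //=.
apply: le_finf => [|s /andP[h1 h2]]; first by rewrite L0 lexx.
by have -> : s = L by apply/eqP; rewrite eq_le h1 h2.
Qed.

Lemma finf_split s t c : 0 <= s -> s <= t -> t <= L ->
  (forall r, s <= r <= t -> c <= g r) -> c <= finf L g t -> c <= finf L g s.
Proof.
move=> s0 st tL h hc; apply: le_finf => [|r /andP[sr rL]]; first by rewrite s0 (le_trans st).
have [rt|tr] := leP r t; first by apply: h; rewrite sr.
by apply: le_trans hc _; apply: finf_le; rewrite ?(le_trans s0 st) ?(ltW tr).
Qed.

Lemma lip_finf : 0 < L -> lipschitz L C (finf L g).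
Proof.
move=> L0; have C0 := lip_ge0 L0.
suff h s t : 0 <= s -> s <= t -> t <= L -> finf L g t - C * (t - s) <= finf L g s.
  move=> s t /andP[s0 sL] /andP[t0 tL].
  wlog st : s t s0 sL t0 tL / s <= t.
    by move=> w; have [|/ltW] := leP s t => hs; [|rewrite distrC [`|s - t|]distrC]; apply: w.
  have h1 := h _ _ s0 st tL; have h2 := finf_mono s0 st tL.
  by rewrite [`|finf L g s - _|]distrC [`|s - t|]distrC !ger0_norm ?subr_ge0 //; lra.
move=> s0 st tL.
have ht : 0 <= t <= L by rewrite (le_trans s0 st).
apply: (finf_split s0 st tL).
  move=> r /andP[sr rt]; have h1 : finf L g t <= g t by apply: finf_le; lra.
  have hr : 0 <= r <= L by rewrite (le_trans s0 sr) (le_trans rt tL).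
  have := lg ht hr; rewrite [`|t - r|]ger0_norm ?subr_ge0 // => h2.
  have := ler_norm (g t - g r) => h3.
  have : C * (t - r) <= C * (t - s) by rewrite ler_wpM2l // lerB.
  lra.
by rewrite gerBl mulr_ge0 // subr_ge0.
Qed.

(** The witness is the last time at which the future infimum keeps its value. The height attains the
    infimum there, since otherwise the infimum would not change for a while longer. *)
Lemma last_min t0 : 0 < L -> 0 <= t0 <= L ->
  exists2 t', t0 <= t' <= L & [/\ finf L g t' = finf L g t0, g t' = finf L g t0 &
    forall s, t' < s <= L -> finf L g t0 < finf L g s].
Proof.
move=> L0 /andP[t00 t0L]; have C0 := lip_ge0 L0; set c := finf L g t0.
have [t' [/andP[h1 h2] h3 h4]] := @last_time (fun s => finf L g s = c) t0 L t0L erefl.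
have ht' : 0 <= t' <= L by rewrite (le_trans t00 h1).
have Ft' : finf L g t' = c.
  apply/eqP; rewrite eq_le [X in _ && X]finf_mono ?andbT //.
  rewrite leNgt; apply/negP => hlt.
  set e := (finf L g t' - c) / (C + 1).
  have C1 : 0 < C + 1 by lra.
  have e0 : 0 < e by rewrite divr_gt0 // subr_gt0.
  have [s hs [s1 s2 fs]] := h4 _ e0.
  have hs' : 0 <= s <= L by rewrite (le_trans t00 s1) (le_trans s2 h2).
  have := lip_finf L0 ht' hs'; rewrite fs !ger0_norm ?subr_ge0 ?(ltW hlt) //.
  have : (C + 1) * (t' - s) < finf L g t' - c.
    by rewrite mulrC -ltr_pdivlMr // -/e; lra.
  rewrite mulrDl mul1r; lra.
have hgt s : t' < s <= L -> c < finf L g s.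
  move=> /andP[ts sL]; rewrite lt_neqAle eq_sym; apply/andP; split.
    by apply/eqP; apply: h3; rewrite ts.
  by apply: finf_mono => //; rewrite (le_trans h1 (ltW ts)).
exists t'; first by rewrite h1.
split => //; apply/eqP; rewrite eq_le; apply/andP; split; last first.
  by rewrite -Ft'; apply: finf_le; rewrite ?lexx //; case/andP: ht'.
have [tL|Lt] := ltP t' L; last first.
  have e : t' = L by lra.
  by rewrite -Ft' e (finf_end (ltW L0)).
rewrite leNgt; apply/negP => hlt.
(* Within time [e] a function with Lipschitz constant [C] cannot fall from [g t'] to the midpoint of
   [c] and [g t']. *)
set e := (g t' - c) / (2 * (C + 1)).
have C1 : 0 < C + 1 by lra.
have e0 : 0 < e by rewrite divr_gt0 ?subr_gt0 // mulr_gt0.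
set s := Num.min L (t' + e).
have ts : t' < s <= L by rewrite lt_min tL ltrDl e0 ge_min lexx.
have hd : c < Num.min (finf L g s) ((g t' + c) / 2).
  by rewrite lt_min hgt //= ; lra.
rewrite -[X in X < _]Ft' in hd; have [r /andP[r1 r2]] := finf_lt ht' hd.
rewrite lt_min => /andP[g1 g2].
have rs : r < s.
  rewrite ltNge; apply/negP => sr.
  have := @finf_le s r; rewrite sr r2 => /(_ _ isT) => h; have {}h : finf L g s <= g r.
    by apply: h; case/andP: ht' ts => ? ? /andP[? _]; lra.
  by move: g1; rewrite ltNge h.
have hr : 0 <= r <= L by case/andP: ht' => ? ?; rewrite r2 andbT; lra.
have := lg ht' hr; rewrite [`|t' - r|]distrC [`|r - t'|]ger0_norm ?subr_ge0 // => h5.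
have h6 := ler_norm (g t' - g r).
have : s <= t' + e by rewrite ge_min lexx orbT.
move=> h7; have h8 : C * (r - t') <= C * e by apply: ler_wpM2l => //; lra.
have h9 : (C + 1) * e = (g t' - c) / 2.
  rewrite /e; field; lra.
move: h9; rewrite mulrDl mul1r; lra.
Qed.

End FutureInfimum.
Definition rlin L g t k := exists2 e, 0 < e /\ t + e <= L &
  forall s, t <= s <= t + e -> g s = g t + (s - t) * k.
Definition llin g t k := exists2 e, 0 < e /\ 0 <= t - e &
  forall s, t - e <= s <= t -> g s = g t + (s - t) * k.

(* Piecewise linear without flat pieces, with integral strict local minima. *)
Definition tame L g := [/\ exists C, lipschitz L C g, g 0 = 0, g L \is a Num.int,
  (exists2 k, k != 0 & rlin L g 0 k) /\ (exists2 k, k != 0 & llin g L k) &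
  forall t, 0 < t < L -> exists k k', [/\ k != 0, k' != 0, llin g t k, rlin L g t k' &
    k < 0 -> 0 < k' -> g t \is a Num.int]].

Section Tame.
Variables (L : R) (g : R -> R).
Hypotheses (L0 : 0 < L) (tg : tame L g).
Notation F := (finf L g).

Lemma tame_lip : exists C, lipschitz L C g. Proof. by case: tg. Qed.

Lemma tame_rlin t : 0 <= t < L -> exists2 k, k != 0 & rlin L g t k.
Proof.
case: tg => _ _ _ [hs _] hm /andP[t0 tL].
move: t0; rewrite le_eqVlt => /orP[/eqP <- //|t0].
by have [|_ [k [_ h _ hr _]]] := hm t; [rewrite t0 tL|exists k].
Qed.

Lemma tame_llin t : 0 < t <= L -> exists2 k, k != 0 & llin g t k.
Proof.
case: tg => _ _ _ [_ hs] hm /andP[t0].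
rewrite le_eqVlt => /orP[/eqP -> //|tL].
by have [|k [_ [h _ hr _ _]]] := hm t; [rewrite t0 tL|exists k].
Qed.

(** At the last time where the value is attained the height rises afterwards. That time is an end
    point, or a strict local minimum with integral height, or [t0] itself. *)
Lemma tame_val t0 : 0 <= t0 <= L -> F t0 \is a Num.int \/
  [/\ g t0 = F t0, 0 < t0, t0 < L & forall s, t0 < s <= L -> F t0 < F s].
Proof.
move=> ht0; have [C lg] := tame_lip.
have [t' /andP[h1 h2] [h3 h4 h5]] := last_min lg L0 ht0; set c := F t0 in h3 h4 h5 *.
have [tL|Lt] := ltP t' L; last first.
  by left; have -> : c = g L; [rewrite -h4; congr g; lra|case: tg].
have t0' : 0 <= t' by lra.
move: t0'; rewrite le_eqVlt => /orP[/eqP e|t0'].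
  by left; rewrite -h4 -e; case: tg => _ ->.
have [|k [k' [k0 k'0 hl hr hz]]] := (let: And5 _ _ _ _ h := tg in h) t'; first by lra.
have k'p : 0 < k'.
  case: hr => e [e0 eL] /(_ (t' + e)) hg.
  have := h5 (t' + e); have : F (t' + e) <= g (t' + e) by apply: (finf_le lg); lra.
  rewrite hg ?h4; last by lra.
  move=> h6 h7; have {}h7 : c < F (t' + e) by apply: h7; lra.
  have : 0 < e * k' by lra.
  by rewrite pmulr_rgt0.
move: h1; rewrite le_eqVlt => /orP[/eqP e|t0t'].
  by right; rewrite e in ht0 *; split => //; lra.
left; rewrite -h4; apply: hz => //.
case: hl => e [e0 eL] hg; set e' := Num.min e (t' - t0).
have e'0 : 0 < e' by rewrite lt_min e0 subr_gt0.
have e'e : e' <= e by rewrite ge_min lexx.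
have e't : e' <= t' - t0 by rewrite ge_min lexx orbT.
have hs := hg (t' - e'); have {}hs : g (t' - e') = g t' + (t' - e' - t') * k by apply: hs; lra.
have h6 : F t0 <= g (t' - e') by apply: (finf_le lg); lra.
rewrite lt_neqAle k0 /= -(pmulr_rle0 _ e'0).
have : t' - e' - t' = - e' by ring.
move=> e1; rewrite hs e1 h4 -/c in h6; lra.
Qed.

Lemma tame_int : F 0 \is a Num.int.
Proof. by have [|//|[_ h _ _]] := @tame_val 0; [rewrite lexx ltW|rewrite ltxx in h]. Qed.

(** Either the last minimum after [t] lies later and the infimum is constant until then, or it is at
    [t] and the rising height carries the infimum along. *)
Lemma tame_right t : 0 <= t < L ->
  [/\ exists2 e, 0 < e /\ t + e <= L & forall s, t <= s <= t + e -> F s = F t &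
      F t \is a Num.int] \/
  exists k, [/\ 0 < k, F t = g t, rlin L g t k & exists2 e, 0 < e /\ t + e <= L &
     forall s, t <= s <= t + e -> F s = g s].
Proof.
move=> ht; have [C lg] := tame_lip; have [k k0 [e [e0 eL] hg]] := tame_rlin ht.
have ht' : 0 <= t <= L by lra.
have [t' /andP[h1 h2] [h3 h4 h5]] := last_min lg L0 ht'.
move: h1; rewrite le_eqVlt => /orP[/eqP et|tt']; last first.
  left; split.
    exists (t' - t); first by lra.
    move=> s hs; apply/eqP; rewrite eq_le; apply/andP; split.
      by rewrite -h3; apply: (finf_mono lg); lra.
    by apply: (finf_mono lg); lra.
  have [//|[_ _ _ /(_ t')]] := tame_val ht'; rewrite h3 tt' h2 ltxx => /(_ isT); by [].
right; rewrite -{t'}et in h3 h4 h5 h2; exists k.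
have fe : F t < F (t + e) by apply: h5; lra.
have kp : 0 < k.
  have hge : g (t + e) = g t + (t + e - t) * k by apply: hg; lra.
  have h6 : F (t + e) <= g (t + e) by apply: (finf_le lg); lra.
  have e1 : t + e - t = e by ring.
  have : 0 < e * k by rewrite e1 in hge; lra.
  by rewrite pmulr_rgt0.
split => //; first by exists e.
set d := Num.min e ((F (t + e) - F t) / k).
have d0 : 0 < d by rewrite lt_min e0 divr_gt0 // subr_gt0.
have de : d <= e by rewrite ge_min lexx.
have dk : d * k <= F (t + e) - F t by rewrite -ler_pdivlMr // ge_min lexx orbT.
exists d; first by lra.
move=> s hs; apply/eqP; rewrite eq_le; apply/andP; split.
  by apply: (finf_le lg); lra.
have hgs : g s = g t + (s - t) * k by apply: hg; lra.
have hsd : (s - t) * k <= d * k by apply: ler_wpM2r; lra.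
apply: (finf_split lg (t := t + e)); try lra.
move=> r hr; rewrite hgs (hg r); last by lra.
by rewrite lerD2l; apply: ler_wpM2r; lra.
Qed.

(** The extra clause in the stationary case decides later on which side of the letter the left
    direction lies. *)
Lemma tame_left t : 0 < t <= L ->
  (exists2 e, 0 < e /\ 0 <= t - e & forall s, t - e <= s <= t -> F s = F t) /\
    (forall k, llin g t k -> k < 0 \/ F t < g t) \/
  exists k, [/\ 0 < k, F t = g t, llin g t k & exists2 e, 0 < e /\ 0 <= t - e &
     forall s, t - e <= s <= t -> F s = g s].
Proof.
move=> ht; have [C lg] := tame_lip; have [k k0 [e [e0 eL] hg]] := tame_llin ht.
have uniq k' : llin g t k' -> k' = k.
  move=> [e' [e'0 e'L] hg']; set d := Num.min e e'.
  have d0 : 0 < d by rewrite lt_min e0.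
  have [de de'] : d <= e /\ d <= e' by rewrite !ge_min !lexx orbT.
  have h1 : g (t - d) = g t + (t - d - t) * k by apply: hg; lra.
  have h2 : g (t - d) = g t + (t - d - t) * k' by apply: hg'; lra.
  have h3 : t - d - t = - d by ring.
  have : d * k' = d * k by rewrite h3 in h1 h2; lra.
  by move/(mulfI (lt0r_neq0 d0)).
have Fg : F t <= g t by apply: (finf_le lg); lra.
have [kn|kp] := ltP k 0.
  left; split; last by move=> k' /uniq ->; left.
  exists e => // s hs; apply/eqP; rewrite eq_le; apply/andP; split.
    by apply: (finf_mono lg); lra.
  apply: (finf_split lg (t := t)); try lra.
  move=> r hr; rewrite (hg r); last by lra.
  by apply: (le_trans Fg); rewrite lerDl; apply: mulr_le0; lra.
have {k0} kp : 0 < k by rewrite lt_neqAle eq_sym k0.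
have [Fl|gF] := ltP (F t) (g t).
  left; split; last by move=> k' _; right.
  set d := Num.min e ((g t - F t) / k).
  have d0 : 0 < d by rewrite lt_min e0 divr_gt0 // subr_gt0.
  have de : d <= e by rewrite ge_min lexx.
  have dk : d * k <= g t - F t by rewrite -ler_pdivlMr // ge_min lexx orbT.
  exists d; first by lra.
  move=> s hs; apply/eqP; rewrite eq_le; apply/andP; split.
    by apply: (finf_mono lg); lra.
  apply: (finf_split lg (t := t)); try lra.
  move=> r hr; rewrite (hg r); last by lra.
  have : - d * k <= (r - t) * k by apply: ler_wpM2r; lra.
  lra.
have eF : F t = g t by lra.
right; exists k; split => //; first by exists e.
exists e => // s hs; apply/eqP; rewrite eq_le; apply/andP; split.
  by apply: (finf_le lg); lra.
have hgs : g s = g t + (s - t) * k by apply: hg; lra.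
apply: (finf_split lg (t := t)); try lra.
  move=> r hr; rewrite hgs (hg r); last by lra.
  by rewrite lerD2l; apply: ler_wpM2r; lra.
by rewrite eF hgs gerDl; apply: mulr_le0_ge0; lra.
Qed.

End Tame.

(* Between the minimum [m] and [m + 1] the future infimum is the height itself, so
   that the closed form below agrees with the definition of the root operators. *)
Definition qprop L g := forall t, 0 <= t <= L -> finf L g t < g t ->
  finf L g t <= finf L g 0 \/ finf L g 0 + 1 <= finf L g t.

Lemma int_lt_le (x y : R) : x \is a Num.int -> y \is a Num.int -> x < y -> x + 1 <= y.
Proof.
move=> /intrP[m ->] /intrP[n ->]; rewrite ltr_int => h.
by rewrite -[1]/(1%:~R) -rmorphD ler_int /= addrC lez1D.
Qed.

Lemma tame_qprop L g : 0 < L -> tame L g -> qprop L g.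
Proof.
move=> L0 tg t ht hlt; have [C lg] := tame_lip tg.
have [hle|hgt] := leP (finf L g t) (finf L g 0); [by left|right].
apply: int_lt_le => //; first exact: tame_int.
have [//|[h _ _ _]] := tame_val L0 tg ht.
by rewrite h ltxx in hlt.
Qed.

End RealFunctions.

(** * Paths of Lakshmibai-Seshadri type and their closure under the operators *)

Section LSPaths.
Variables (R : realType) (K : choiceType) (a : K -> K -> int).
Hypothesis ga : gcm a.
Local Notation vec := ((K + K)%type -> R).
Local Notation act := (act a).
Local Notation al := (al R a).
Local Notation pos := (pos R a).
Local Notation neg := (neg R a).
Local Notation eqw := (eqw R a).
Implicit Types (b eta : R -> vec) (u v w x : seq K) (nu : vec) (L t s : R) (A : pred K).

Definition rgerm L b t nu := exists2 e, 0 < e /\ t + e <= L &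
  forall s, t <= s <= t + e -> b s = b t + sc (s - t) nu.
Definition lgerm b t nu := exists2 e, 0 < e /\ 0 <= t - e &
  forall s, t - e <= s <= t -> b s = b t + sc (s - t) nu.

Definition Ht b (i : K) : R -> R := fun t => b t (inl i).

Lemma rgerm_rlin L b t nu i : rgerm L b t nu -> rlin L (Ht b i) t (nu (inl i)).
Proof. by move=> [e he h]; exists e => // s hs; rewrite /Ht h // !vecE. Qed.
Lemma lgerm_llin b t nu i : lgerm b t nu -> llin (Ht b i) t (nu (inl i)).
Proof. by move=> [e he h]; exists e => // s hs; rewrite /Ht h // !vecE. Qed.

(* The orientation [o] is [true] for paths with dominant directions and [false]
   for time-reversed ones. *)
Definition regO (o : bool) nu := forall k, 0 < if o then nu (inl k) else - nu (inl k).
(** For a regular direction the sign of the slope at [i] depends on the Weyl group element alone;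
    time reversal exchanges the two signs. *)
Definition rise (o : bool) i w := if o then pos i w else neg i w.

Lemma rise_or o i w : rise o i w \/ rise (~~ o) i w.
Proof. by case: o; have [] := pos_or_neg R ga i w; [left|right|right|left]. Qed.

Lemma rise_gt o i w nu : regO o nu -> rise o i w -> 0 < act w nu (inl i).
Proof.
case: o => /= hr h; first exact: (pos_gt0 ga).
by have := neg_lt0 ga h (v := - nu) hr; rewrite actN !vecE oppr_lt0.
Qed.

Lemma rise_lt o i w nu : regO o nu -> rise (~~ o) i w -> act w nu (inl i) < 0.
Proof.
case: o => /= hr h; first exact: (neg_lt0 ga).
by have := pos_gt0 ga h (v := - nu) hr; rewrite actN !vecE oppr_gt0.
Qed.

Lemma rise_neq0 o i w nu : regO o nu -> act w nu (inl i) != 0.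
Proof.
move=> hr; have [/(rise_gt hr)|/(rise_lt hr)] := rise_or o i w; first by move/lt0r_neq0.
by move/ltr0_neq0.
Qed.

Lemma gt_rise o i w nu : regO o nu -> 0 < act w nu (inl i) -> rise o i w.
Proof.
by move=> hr h; have [//|/(rise_lt hr)] := rise_or o i w; rewrite ltNge (ltW h).
Qed.

Lemma lt_rise o i w nu : regO o nu -> act w nu (inl i) < 0 -> rise (~~ o) i w.
Proof.
by move=> hr h; have [/(rise_gt hr)|//] := rise_or o i w; rewrite ltNge (ltW h).
Qed.

Lemma rise_excl o i w : rise o i w -> rise (~~ o) i w -> False.
Proof. by case: o => /= h h'; [apply: (pos_neg ga h)|apply: (pos_neg ga h')]. Qed.

Lemma rise_eqw o i u v : eqw u v -> rise o i u -> rise o i v.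
Proof. by case: o; [exact: pos_eqw|exact: neg_eqw]. Qed.

(** A path read backwards traverses the Bruhat order in the opposite sense. *)
Definition stepo (o : bool) (p : vec) u v := if o then cov a p u v else cov a p v u.

Lemma stepo_eqw o p u u' v v' : eqw u u' -> eqw v v' -> stepo o p u v -> stepo o p u' v'.
Proof. by case: o => h h'; [exact: cov_eqw|apply: cov_eqw]. Qed.

Lemma stepo_flip o p u v i : stepo o p u v -> rise (~~ o) i u -> rise o i v ->
  eqw u (i :: v) /\ act v p (inl i) \is a Num.int.
Proof.
case: o => /= hc hu hv; first exact: (cov_flip ga hc).
have [e h] := cov_flip ga hc hv hu; split.
  by move=> x; rewrite -(eqw_cons2 ga i u) /= e.
by rewrite e /= rs_ii // rpredN.
Qed.

Lemma stepo_cons o p u v i : stepo o p u v ->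
  rise o i u /\ rise o i v \/ rise (~~ o) i u /\ rise (~~ o) i v ->
  stepo o p (i :: u) (i :: v).
Proof.
case: o => /= hc h; apply: (cov_cons ga hc) => //.
by case: h => -[h1 h2]; [right|left].
Qed.

Lemma stepo_simple o p v i : rise o i v -> act v p (inl i) \is a Num.int ->
  stepo o p (i :: v) v.
Proof.
case: o => /= hr hz; first exact: (cov_simple ga).
have e1 : eqw (i :: i :: v) v := eqw_cons2 ga i v.
have e2 : eqw (i :: v) (i :: v) by [].
apply: (cov_eqw e1 e2).
by apply: (cov_simple ga); [exact: (neg_cons ga)|rewrite /= rs_ii // rpredN].
Qed.

Lemma isintN (q : vec) : isint q -> isint (- q).
Proof. by move=> h k; rewrite !vecE rpredN. Qed.

Lemma stepo_congr o p u v : stepo o p u v -> isint (act u p - act v p).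
Proof.
case: o => /= [/(cov_congr ga) //|/(cov_congr ga)/isintN].
by rewrite opprB.
Qed.

Inductive chain (o : bool) (p : vec) (A : pred K) : seq K -> seq K -> Prop :=
| chain_nil u v : eqw u v -> chain o p A u v
| chain_cons u x v : stepo o p u x -> all A x -> chain o p A x v -> chain o p A u v.

Lemma chain_eqw_l o p A u u' v : eqw u u' -> chain o p A u v -> chain o p A u' v.
Proof.
move=> h hc; case: hc h => {u v} [u v e|u x v st hx hc] h.
  by apply: chain_nil; apply: eqw_trans (eqw_sym h) e.
have e : eqw x x by [].
by apply: (chain_cons _ hx hc); apply: (stepo_eqw h e).
Qed.

Lemma chain_congr o p A u v : chain o p A u v -> isint (act u p - act v p).
Proof.
elim=> {u v} [u v h k|u x v /stepo_congr h _ _ h']; first by rewrite h !vecE subrr rpred0.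
by have := isintD h h'; rewrite addrA subrK.
Qed.

Lemma isint_congr (p q : vec) k : isint (p - q) ->
  (p (inl k) \is a Num.int) = (q (inl k) \is a Num.int).
Proof.
move=> /(_ k); rewrite !vecE => h; apply/idP/idP => h'.
  by have := rpredB h' h; rewrite opprB addrC subrK.
by have := rpredD h h'; rewrite subrK.
Qed.

Lemma chain_reflect o p A i u v : A i -> chain o p A u v -> all A u -> rise o i v ->
  (rise o i u -> chain o p A (i :: u) (i :: v)) /\
  (rise (~~ o) i u -> act v p (inl i) \is a Num.int /\ chain o p A u (i :: v)).
Proof.
move=> Ai hc; elim: hc => {u v} [u v e|u x v st hx hc IH] hu hv.
  split=> [_|]; first by apply: chain_nil; apply: eqw_cons.
  by move/(rise_eqw e) => /(rise_excl hv).
have [IH1 IH2] := IH hx hv.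
have hix : all A (i :: x) by rewrite /= Ai.
split=> hs; have [rx|fx] := rise_or o i x.
- by apply: (chain_cons _ hix (IH1 rx)); apply: stepo_cons st _; left.
- have [iv cv] := IH2 fx; apply: (chain_cons (x := u)) => //; last exact: (chain_cons st).
  apply: stepo_simple => //; rewrite (isint_congr i (stepo_congr st)).
  by rewrite (isint_congr i (chain_congr hc)).
- have [e ix] := stepo_flip st hs rx; split.
    by rewrite -(isint_congr i (chain_congr hc)).
  by apply: (chain_eqw_l (eqw_sym e)); exact: IH1.
- by have [iv cv] := IH2 fx; split => //; exact: (chain_cons st).
Qed.

Lemma chain_rcons o p A u v x : chain o p A u v -> stepo o p v x -> all A x ->
  chain o p A u x.
Proof.
move=> hc st hx; elim: hc st => {u v} [u v e|u y v st' hy hc IH] st.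
  apply: (@chain_cons _ _ _ _ x) => //; last by apply: chain_nil.
  have e' : eqw x x by [].
  exact: (stepo_eqw (eqw_sym e) e').
by apply: (chain_cons st' hy); exact: IH.
Qed.

Lemma stepo_rev o p q u v : isint q -> stepo o p u v -> stepo (~~ o) (p - q) v u.
Proof. by move=> hq; case: o => /=; exact: (cov_translate). Qed.

Lemma chain_rev o p q A u v : isint q -> chain o p A u v -> all A u ->
  chain (~~ o) (p - q) A v u.
Proof.
move=> hq hc; elim: hc => {u v} [u v e|u x v st hx hc IH] hu.
  by apply: chain_nil; apply: eqw_sym.
by apply: (chain_rcons (IH hx)) => //; exact: stepo_rev.
Qed.

(* [b] is bent away from the base path [eta] by Weyl group elements: at each time
   the two one-sided elements are joined by a chain of covers that is integral at
   [eta t], as for the [a]-chains of Lakshmibai-Seshadri paths. *)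
Record LS (o : bool) (A : pred K) L eta b : Prop := MkLS {
  ls_eta0 : eta 0 = 0;
  ls_etaL : isint (eta L);
  ls_0 : b 0 = 0;
  ls_L : isint (b L);
  ls_lip : forall x : (K + K)%type, exists C, lipschitz L C (fun t => b t x);
  ls_lipe : forall x : (K + K)%type, exists C, lipschitz L C (fun t => eta t x);
  ls_start : exists nu w, [/\ regO o nu, all A w, rgerm L eta 0 nu & rgerm L b 0 (act w nu)];
  ls_finish : exists nu w, [/\ regO o nu, all A w, lgerm eta L nu & lgerm b L (act w nu)];
  ls_mid : forall t, 0 < t < L -> exists nu u nu' v,
    [/\ regO o nu /\ all A u, regO o nu' /\ all A v,
        lgerm eta t nu /\ lgerm b t (act u nu), rgerm L eta t nu' /\ rgerm L b t (act v nu') &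
        chain o (eta t) A u v /\ isint (b t - act v (eta t))] }.

(** At a strict local minimum the direction passes from falling to rising, so the chain crosses [i],
    which makes the base and hence the height integral at [i]. *)
Lemma LS_tame o A L eta b i : LS o A L eta b -> tame L (Ht b i).
Proof.
move=> ls; split.
- exact: ls_lip ls (inl i).
- by rewrite /Ht (ls_0 ls).
- exact: ls_L ls i.
- split.
    have [nu [w [rn _ _ h]]] := ls_start ls.
    by exists (act w nu (inl i)); [exact: rise_neq0 rn|exact: rgerm_rlin].
  have [nu [w [rn _ _ h]]] := ls_finish ls.
  by exists (act w nu (inl i)); [exact: rise_neq0 rn|exact: lgerm_llin].
- move=> t /(ls_mid ls)[nu [u [nu' [v [[rn hu] [rn' hv] [_ hl] [_ hr] [hc hi]]]]]].
  exists (act u nu (inl i)), (act v nu' (inl i)); split.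
  + exact: rise_neq0 rn. + exact: rise_neq0 rn'.
  + exact: lgerm_llin. + exact: rgerm_rlin.
  move=> /(lt_rise rn) fu /(gt_rise rn') rv; rewrite -/(Ht b i t) /Ht (isint_congr i hi).
  (* The letter [i] may lie outside [A], so the alphabet of the chain is enlarged first. *)
  have hall w : all predT w by exact/allP.
  have hc' : chain o (eta t) predT u v.
    elim: hc => [x y e|x y z st _ _ h]; first exact: chain_nil.
    exact: (chain_cons st (hall y) h).
  have [_ h] := chain_reflect (isT : predT i) hc' (hall u) rv.
  by have [] := h fu.
Qed.

(* The root operator f_i in closed form; [eop] is its conjugate under time reversal. *)
Definition Xt L (g : R -> R) t := Num.min 1 (finf L g t - finf L g 0).
Definition fop L i b : R -> vec := fun t => b t - sc (Xt L (Ht b i) t) (al i).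
Definition revp L b : R -> vec := fun t => b (L - t) - b L.
Definition eop L i b := revp L (fop L i (revp L b)).

Lemma Xt_lip L (g : R -> R) : 0 < L -> (exists C, lipschitz L C g) ->
  exists C, lipschitz L C (Xt L g).
Proof.
move=> L0 [C lg]; exists C => s t hs ht.
apply: le_trans (lip_finf lg L0 hs ht).
rewrite /Xt; have := ler_norm (finf L g s - finf L g t); have := ler_norm (finf L g t - finf L g s).
rewrite distrC; set d := `|_|; move=> h1 h2; rewrite ler_norml.
by have [h3|h3] := leP 1 (finf L g s - finf L g 0); have [h4|h4] := leP 1 (finf L g t - finf L g 0); lra.
Qed.

Section XtFacts.
Variables (L : R) (g : R -> R).
Hypotheses (L0 : 0 < L) (tg : tame L g).
Notation F := (finf L g).
Notation m := (finf L g 0).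

(** Integrality in the stationary case keeps the path congruent to the image of its base when a
    multiple of the root is subtracted. *)
Lemma Xt_right t : 0 <= t < L ->
  Xt L g t \is a Num.int /\ (exists2 e, 0 < e /\ t + e <= L &
      forall s, t <= s <= t + e -> Xt L g s = Xt L g t) \/
  exists k, [/\ 0 < k, Xt L g t = g t - m, rlin L g t k & exists2 e, 0 < e /\ t + e <= L &
     forall s, t <= s <= t + e -> Xt L g s = g s - m].
Proof.
move=> ht; have mi := tame_int L0 tg; have [C lg] := tame_lip tg.
have [[[e he hF] Fi]|[k [k0 Fg hr [e [e0 eL] hF]]]] := tame_right L0 tg ht.
  left; split; last by exists e => // s hs; rewrite /Xt hF.
  by rewrite /Xt; have [h|h] := leP 1 (F t - m); rewrite ?rpred1 ?rpredB.
have [h|h] := leP (m + 1) (F t).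
  left; split; first by rewrite /Xt min_l ?rpred1 //; lra.
  exists e => // s hs; rewrite /Xt !min_l //; try lra.
  have : F t <= F s by apply: (finf_mono lg); lra.
  lra.
right; exists k; split => //.
  by rewrite /Xt min_r Fg //; lra.
case: hr => e' [e'0 e'L] hg.
set d := Num.min (Num.min e e') ((m + 1 - F t) / k).
have d0 : 0 < d by rewrite !lt_min e0 e'0 divr_gt0 // subr_gt0.
have [[de de'] dk] : (d <= e /\ d <= e') /\ d * k <= m + 1 - F t.
  by rewrite -ler_pdivlMr // !ge_min !lexx ?orbT.
exists d; first by lra.
move=> s hs; rewrite /Xt hF; last by lra.
rewrite min_r // hg; last by lra.
have : (s - t) * k <= d * k by apply: ler_wpM2r; lra.
lra.
Qed.

Lemma Xt_left t : 0 < t <= L ->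
  (exists2 e, 0 < e /\ 0 <= t - e & forall s, t - e <= s <= t -> Xt L g s = Xt L g t) /\
    (Xt L g t = g t - m -> forall k, llin g t k -> k < 0) \/
  exists k, [/\ 0 < k, Xt L g t = g t - m, llin g t k & exists2 e, 0 < e /\ 0 <= t - e &
     forall s, t - e <= s <= t -> Xt L g s = g s - m].
Proof.
move=> ht; have [C lg] := tame_lip tg.
have Fg : F t <= g t by apply: (finf_le lg); lra.
have [[[e he hF] hk]|[k [k0 Fg' hl [e [e0 eL] hF]]]] := tame_left tg ht.
  left; split; first by exists e => // s hs; rewrite /Xt hF.
  move=> hX k /hk[//|hlt]; move: hX; rewrite /Xt.
  by have [h|h] := leP 1 (F t - m); lra.
have [h|h] := leP (g t) (m + 1).
  right; exists k; split => //; first by rewrite /Xt min_r Fg' //; lra.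
  exists e; first by [].
  move=> s hs; rewrite /Xt hF // min_r //.
  have h1 : F s <= F t by apply: (finf_mono lg); lra.
  by rewrite hF // in h1; lra.
left; split; last by rewrite /Xt min_l; lra.
case: hl => e' [e'0 e'L] hg.
set d := Num.min (Num.min e e') ((g t - (m + 1)) / k).
have d0 : 0 < d by rewrite !lt_min e0 e'0 divr_gt0 // subr_gt0.
have [[de de'] dk] : (d <= e /\ d <= e') /\ d * k <= g t - (m + 1).
  by rewrite -ler_pdivlMr // !ge_min !lexx ?orbT.
exists d; first by lra.
move=> s hs; rewrite /Xt hF; last by lra.
rewrite Fg' min_l ?min_l //; try lra.
rewrite hg; last by lra.
have : - d * k <= (s - t) * k by apply: ler_wpM2r; lra.
lra.
Qed.

Lemma Xt0 : Xt L g 0 = 0.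
Proof. by rewrite /Xt subrr min_r. Qed.

Lemma XtL_int : Xt L g L \is a Num.int.
Proof.
have [C lg] := tame_lip tg; rewrite /Xt (finf_end lg (ltW L0)).
have mi := tame_int L0 tg; have gi : g L \is a Num.int by case: tg.
by have [h|h] := leP 1 (g L - m); rewrite ?rpred1 ?rpredB.
Qed.

End XtFacts.

Lemma rgerm_const L b t nu (X : R -> R) i :
  rgerm L b t nu -> (exists2 e, 0 < e /\ t + e <= L & forall s, t <= s <= t + e -> X s = X t) ->
  rgerm L (fun s => b s - sc (X s) (al i)) t nu.
Proof.
move=> [e [e0 eL] hb] [e' [e'0 e'L] hX]; set d := Num.min e e'.
have d0 : 0 < d by rewrite lt_min e0.
have [de de'] : d <= e /\ d <= e' by rewrite !ge_min !lexx orbT.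
exists d; first by lra.
move=> s hs; apply/funext => x; rewrite hb ?hX; try lra.
rewrite !vecE; ring.
Qed.

Lemma lgerm_const b t nu (X : R -> R) i :
  lgerm b t nu -> (exists2 e, 0 < e /\ 0 <= t - e & forall s, t - e <= s <= t -> X s = X t) ->
  lgerm (fun s => b s - sc (X s) (al i)) t nu.
Proof.
move=> [e [e0 eL] hb] [e' [e'0 e'L] hX]; set d := Num.min e e'.
have d0 : 0 < d by rewrite lt_min e0.
have [de de'] : d <= e /\ d <= e' by rewrite !ge_min !lexx orbT.
exists d; first by lra.
move=> s hs; apply/funext => x; rewrite hb ?hX; try lra.
rewrite !vecE; ring.
Qed.

Lemma rgerm_refl L b t nu (X : R -> R) m i : rgerm L b t nu ->
  (exists2 e, 0 < e /\ t + e <= L & forall s, t <= s <= t + e -> X s = Ht b i s - m) ->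
  rgerm L (fun s => b s - sc (X s) (al i)) t (rs a i nu).
Proof.
move=> [e [e0 eL] hb] [e' [e'0 e'L] hX]; set d := Num.min e e'.
have d0 : 0 < d by rewrite lt_min e0.
have [de de'] : d <= e /\ d <= e' by rewrite !ge_min !lexx orbT.
exists d; first by lra.
move=> s hs; apply/funext => x; rewrite (hX s) ?(hX t) /Ht; try lra.
rewrite hb; last by lra.
rewrite !vecE rsE; ring.
Qed.

Lemma lgerm_refl b t nu (X : R -> R) m i : lgerm b t nu ->
  (exists2 e, 0 < e /\ 0 <= t - e & forall s, t - e <= s <= t -> X s = Ht b i s - m) ->
  lgerm (fun s => b s - sc (X s) (al i)) t (rs a i nu).
Proof.
move=> [e [e0 eL] hb] [e' [e'0 e'L] hX]; set d := Num.min e e'.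
have d0 : 0 < d by rewrite lt_min e0.
have [de de'] : d <= e /\ d <= e' by rewrite !ge_min !lexx orbT.
exists d; first by lra.
move=> s hs; apply/funext => x; rewrite (hX s) ?(hX t) /Ht; try lra.
rewrite hb; last by lra.
rewrite !vecE rsE; ring.
Qed.

Lemma rlin_uniq L g t k k' : rlin L g t k -> rlin L g t k' -> k = k'.
Proof.
move=> [e [e0 eL] hg] [e' [e'0 e'L] hg']; set d := Num.min e e'.
have d0 : 0 < d by rewrite lt_min e0.
have [de de'] : d <= e /\ d <= e' by rewrite !ge_min !lexx orbT.
have h1 : g (t + d) = g t + (t + d - t) * k by apply: hg; lra.
have h2 : g (t + d) = g t + (t + d - t) * k' by apply: hg'; lra.
have h3 : t + d - t = d by ring.
have : d * k = d * k' by rewrite h3 in h1 h2; lra.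
by move/(mulfI (lt0r_neq0 d0)).
Qed.

Lemma llin_uniq g t k k' : llin g t k -> llin g t k' -> k = k'.
Proof.
move=> [e [e0 eL] hg] [e' [e'0 e'L] hg']; set d := Num.min e e'.
have d0 : 0 < d by rewrite lt_min e0.
have [de de'] : d <= e /\ d <= e' by rewrite !ge_min !lexx orbT.
have h1 : g (t - d) = g t + (t - d - t) * k by apply: hg; lra.
have h2 : g (t - d) = g t + (t - d - t) * k' by apply: hg'; lra.
have h3 : t - d - t = - d by ring.
have : d * k = d * k' by rewrite h3 in h1 h2; lra.
by move/(mulfI (lt0r_neq0 d0)).
Qed.

Lemma fop_lip L i b (x : (K + K)%type) : 0 < L -> (exists C, lipschitz L C (Ht b i)) ->
  (exists C, lipschitz L C (fun t => b t x)) ->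
  exists C, lipschitz L C (fun t => fop L i b t x).
Proof.
move=> L0 /(Xt_lip L0)[C' lC'] [C lC].
exists (C + C' * `|al i x|) => s t hs ht.
rewrite /fop !vecE; set c := al i x.
have -> (y z z' y' : R) : y - z * c - (y' - z' * c) = (y - y') - (z - z') * c by ring.
apply: le_trans (ler_normB _ _) _; rewrite normrM mulrDl lerD ?lC //.
by rewrite mulrAC ler_wpM2r // lC'.
Qed.

Lemma revp_lip L b (x : (K + K)%type) : (exists C, lipschitz L C (fun t => b t x)) ->
  exists C, lipschitz L C (fun t => revp L b t x).
Proof.
move=> [C lC]; exists C => s t hs ht; rewrite /revp !vecE.
have -> (y z y' : R) : y - z - (y' - z) = y - y' by ring.
have := lC (L - s) (L - t); have -> : L - s - (L - t) = t - s by ring.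
by rewrite [`|t - s|]distrC; apply; lra.
Qed.

(** On each side of a time the direction is kept or reflected. If both are kept, the chain stays; if
    only the left one is reflected, a simple step is put in front; if the right one is reflected,
    the two halves of [chain_reflect] cover a left direction that is reflected or kept. *)
Lemma LS_fop o (A : pred K) L eta b i : 0 < L -> A i -> LS o A L eta b ->
  LS o A L eta (fop L i b).
Proof.
move=> L0 Ai ls; have tg := LS_tame i ls.
split; try by case: ls.
- by apply/funext => x; rewrite /fop !vecE (Xt0) (ls_0 ls) mul0r subr0.
- apply: isintB; first exact: ls_L ls.
  by apply: isint_sc; [exact: XtL_int|exact: isint_al].
- by move=> x; apply: fop_lip => //; [exact: ls_lip ls (inl i)|exact: ls_lip ls x].
- have [nu [w [rn hw he hb]]] := ls_start ls.
  have h0 : (0 : R) <= 0 < L by apply/andP; split.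
  have [[_ hX]|[k [k0 _ hr [e he' hX]]]] := Xt_right L0 tg h0.
    by exists nu, w; split => //; exact: rgerm_const.
  exists nu, (i :: w); split => //=; first by rewrite Ai.
  by apply: (rgerm_refl (m := finf L (Ht b i) 0) hb); exists e.
- have [nu [w [rn hw he hb]]] := ls_finish ls.
  have h0 : 0 < L <= L by apply/andP; split.
  have [[hX _]|[k [k0 _ hr [e he' hX]]]] := Xt_left tg h0.
    by exists nu, w; split => //; exact: lgerm_const.
  exists nu, (i :: w); split => //=; first by rewrite Ai.
  by apply: (lgerm_refl (m := finf L (Ht b i) 0) hb); exists e.
move=> t ht; have [nu [u [nu' [v [[rn hu] [rn' hv] [hel hl] [her hr] [hc hi]]]]]] := ls_mid ls ht.
have htl : 0 < t <= L by lra.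
have htr : 0 <= t < L by lra.
have hlin := lgerm_llin i hl; have hrin := rgerm_rlin i hr.
have mi := tame_int L0 tg.
have iu : (act u (eta t) (inl i) \is a Num.int) = (b t (inl i) \is a Num.int).
  by rewrite (isint_congr i hi) (isint_congr i (chain_congr hc)).
have hAu : all A (i :: u) by rewrite /= Ai.
have hAv : all A (i :: v) by rewrite /= Ai.
have [[Xi hX]|[k [k0 XE hr' [e he hX]]]] := Xt_right L0 tg htr.
  have hi' : isint (fop L i b t - act v (eta t)).
    rewrite /fop addrAC; apply: isintB => //.
    by apply: isint_sc => //; exact: isint_al.
  have [[hX' _]|[k' [k'0 XE' hl' [e' he' hX']]]] := Xt_left tg htl.
    exists nu, u, nu', v; split => //; split => //.
      exact: lgerm_const. exact: rgerm_const.
  have ru : rise o i u by apply: (gt_rise rn); rewrite (llin_uniq hlin hl').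
  exists nu, (i :: u), nu', v; split => //; split => //.
  - by apply: (lgerm_refl (m := finf L (Ht b i) 0) hl); exists e'.
  - exact: rgerm_const.
  - apply: (chain_cons (x := u)) => //; apply: stepo_simple => //.
    rewrite iu; have : Xt L (Ht b i) t + finf L (Ht b i) 0 \is a Num.int by rewrite rpredD.
    by rewrite XE' subrK.
have rv : rise o i v by apply: (gt_rise rn'); rewrite (rlin_uniq hrin hr').
have [c1 c2] := chain_reflect Ai hc hu rv.
have hi' : isint (fop L i b t - act (i :: v) (eta t)).
  have -> : fop L i b t - act (i :: v) (eta t) = (b t - act v (eta t)) -
     sc ((b t - act v (eta t)) (inl i) - finf L (Ht b i) 0) (al i).
    by apply/funext => x; rewrite /fop /= !vecE rsE XE /Ht; ring.
  apply: isintB => //; apply: isint_sc; last exact: isint_al.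
  by rewrite rpredB.
have hrg : rgerm L (fop L i b) t (act (i :: v) nu') by apply: (rgerm_refl (m := finf L (Ht b i) 0) hr); exists e.
have [[hX' hk]|[k' [k'0 XE' hl' [e' he' hX']]]] := Xt_left tg htl.
  exists nu, u, nu', (i :: v); split => //; split => //.
    exact: lgerm_const.
  by have [] := c2 (lt_rise rn (hk XE _ hlin)).
exists nu, (i :: u), nu', (i :: v); split => //; split => //.
  by apply: (lgerm_refl (m := finf L (Ht b i) 0) hl); exists e'.
by apply: c1; apply: (gt_rise rn); rewrite (llin_uniq hlin hl').
Qed.

Lemma revpK L b : b 0 = 0 -> revp L (revp L b) = b.
Proof.
move=> b0; apply/funext => t; apply/funext => x.
by rewrite /revp !vecE subrr b0 vec0E subKr; ring.
Qed.

Lemma rgerm_revp L b t nu : lgerm b t nu -> rgerm L (revp L b) (L - t) (- nu).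
Proof.
move=> [e [e0 et] h]; exists e; first by lra.
move=> s hs; apply/funext => x; rewrite /revp (h (L - s)); last by lra.
by rewrite subKr !vecE; ring.
Qed.

Lemma lgerm_revp L b t nu : rgerm L b t nu -> lgerm (revp L b) (L - t) (- nu).
Proof.
move=> [e [e0 et] h]; exists e; first by lra.
move=> s hs; apply/funext => x; rewrite /revp (h (L - s)); last by lra.
by rewrite subKr !vecE; ring.
Qed.

Lemma regO_revp o nu : regO o nu -> regO (~~ o) (- nu).
Proof. by case: o => h k; have := h k; rewrite /= !vecE ?opprK. Qed.

(** Reversal subtracts the end of the base; this end is integral, so the covers in the reversed
    chains remain integral. *)
Lemma LS_revp o A L eta b : 0 < L -> LS o A L eta b -> LS (~~ o) A L (revp L eta) (revp L b).
Proof.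
move=> L0 ls; split.
- by rewrite /revp subr0 subrr.
- by rewrite /revp subrr (ls_eta0 ls) sub0r; apply: isintN; exact: ls_etaL ls.
- by rewrite /revp subr0 subrr.
- by rewrite /revp subrr (ls_0 ls) sub0r; apply: isintN; exact: ls_L ls.
- by move=> x; apply: revp_lip; exact: ls_lip ls x.
- by move=> x; apply: revp_lip; exact: ls_lipe ls x.
- have [nu [w [rn hw he hb]]] := ls_finish ls.
  exists (- nu), w; split => //; first exact: regO_revp.
    by rewrite -(subrr L); exact: rgerm_revp.
  by rewrite actN -(subrr L); exact: rgerm_revp.
- have [nu [w [rn hw he hb]]] := ls_start ls.
  exists (- nu), w; split => //; first exact: regO_revp.
    by rewrite -[X in lgerm _ X]subr0; exact: lgerm_revp.
  by rewrite actN -[X in lgerm _ X]subr0; exact: lgerm_revp.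
move=> t ht; have ht' : 0 < L - t < L by lra.
have [nu [u [nu' [v [[rn hu] [rn' hv] [hel hl] [her hr] [hc hi]]]]]] := ls_mid ls ht'.
have e : L - (L - t) = t by ring.
exists (- nu'), v, (- nu), u; split; try by split => //; exact: regO_revp.
- by rewrite actN -e; split; exact: lgerm_revp.
- by rewrite actN -e; split; exact: rgerm_revp.
split; first exact: chain_rev (ls_etaL ls) hc hu.
have hcg := chain_congr hc.
have -> : revp L b t - act u (revp L eta t) = (b (L - t) - act v (eta (L - t))) -
    (act u (eta (L - t)) - act v (eta (L - t))) - b L + act u (eta L).
  by rewrite /revp actB; apply/funext => x; rewrite !vecE; ring.
apply: isintD; last by apply: isint_act; exact: ls_etaL ls.
by apply: isintB; [exact: isintB|exact: ls_L ls].
Qed.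

Lemma LS_eop o (A : pred K) L eta b i : 0 < L -> A i -> LS o A L eta b ->
  LS o A L eta (eop L i b).
Proof.
move=> L0 Ai ls; have := LS_revp L0 (LS_fop L0 Ai (LS_revp L0 ls)).
by rewrite negbK revpK ?(ls_eta0 ls).
Qed.

End LSPaths.

(** * Limits and intermediate values of Lipschitz functions *)

Section Lip.
Local Open Scope classical_set_scope.
Variable R : realType.
Implicit Types (g : R -> R) (s t c e L v : R).

Lemma lip_lim_le L C g t v : lipschitz L C g -> 0 <= t <= L ->
  (forall e, 0 < e -> exists s, [/\ 0 <= s <= L, `|s - t| < e & g s <= v]) -> g t <= v.
Proof.
move=> lg ht h; rewrite leNgt; apply/negP => hv.
have C1 : 0 < `|C| + 1 by rewrite ltr_wpDl.
have [|s [hs h1 h2]] := h ((g t - v) / (`|C| + 1)); first by rewrite divr_gt0 // subr_gt0.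
have h3 := lg _ _ ht hs; rewrite ltr_pdivlMr // in h1.
have h4 : C * `|t - s| <= (`|C| + 1) * `|t - s|.
  by apply: ler_wpM2r => //; have := ler_norm C; lra.
have := ler_norm (g t - g s); rewrite distrC mulrC in h1; lra.
Qed.

Lemma lip_opp L C g : lipschitz L C g -> lipschitz L C (fun t => - g t).
Proof. by move=> lg s t hs ht; rewrite -opprD normrN; exact: lg. Qed.

Lemma lip_lim_ge L C g t v : lipschitz L C g -> 0 <= t <= L ->
  (forall e, 0 < e -> exists s, [/\ 0 <= s <= L, `|s - t| < e & v <= g s]) -> v <= g t.
Proof.
move=> /lip_opp lg ht h; rewrite -lerN2; apply: (lip_lim_le lg ht) => e /h[s [h1 h2 h3]].
by exists s; rewrite lerN2.
Qed.

Lemma lip_ivt L C g u w v : lipschitz L C g -> 0 <= u -> u <= w -> w <= L ->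
  g u <= v -> v <= g w -> exists s, [/\ u <= s <= w, g s = v & forall r, s < r <= w -> v < g r].
Proof.
move=> lg u0 uw wL gu gw.
have [s [/andP[h1 h2] h3 h4]] := last_time (P := fun r => g r <= v) uw gu.
have hs : 0 <= s <= L by lra.
have gs : g s <= v.
  apply: (lip_lim_le lg hs) => e /h4[r hr [r1 r2 r3]]; exists r; split => //; first by lra.
  by rewrite distrC ger0_norm; lra.
have h5 r : s < r <= w -> v < g r by move=> /h3/negP; rewrite -ltNge.
exists s; split => //; first by lra.
apply/eqP; rewrite eq_le gs /=.
have [sw|ws] := ltP s w; last by have -> : s = w by lra.
apply: (lip_lim_ge lg hs) => e e0.
have h0 : 0 < Num.min (e / 2) (w - s) by rewrite lt_min subr_gt0 sw andbT; lra.
have [he hw] : Num.min (e / 2) (w - s) <= e / 2 /\ Num.min (e / 2) (w - s) <= w - s.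
  by rewrite !ge_min !lexx orbT.
exists (s + Num.min (e / 2) (w - s)); split; first by lra.
  by rewrite addrAC subrr add0r gtr0_norm //; lra.
by apply/ltW/h5; lra.
Qed.

Lemma lip_antimono L C g : lipschitz L C g ->
  (forall t, 0 <= t < L -> exists2 k, k <= 0 & rlin L g t k) ->
  forall s t, 0 <= s -> s <= t -> t <= L -> g t <= g s.
Proof.
move=> lg hk s t s0 st tL.
have [r [/andP[h1 h2] h3 h4]] := last_time (P := fun r => g r <= g s) st (lexx _).
have hr : 0 <= r <= L by lra.
have gr : g r <= g s.
  apply: (lip_lim_le lg hr) => e /h4[q hq [q1 q2 q3]]; exists q; split => //; first by lra.
  by rewrite distrC ger0_norm; lra.
have [rt|tr] := ltP r t; last by have <- : r = t by lra.
have [|k k0 [e [e0 eL] hg]] := hk r; first by lra.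
have d0 : 0 < Num.min e (t - r) by rewrite lt_min e0 subr_gt0.
have [de dt] : Num.min e (t - r) <= e /\ Num.min e (t - r) <= t - r.
  by rewrite !ge_min !lexx orbT.
have [] := h3 (r + Num.min e (t - r)); first by lra.
rewrite hg; last by lra.
rewrite addrAC subrr add0r; apply: le_trans gr; rewrite gerDl.
by apply: mulr_ge0_le0 => //; exact: ltW.
Qed.

Lemma finf_eqon L g g' t : (forall s, t <= s <= L -> g s = g' s) -> finf L g t = finf L g' t.
Proof.
move=> h; rewrite /finf; congr inf; apply/seteqP.
by split=> x [s hs <-]; exists s => //; rewrite h.
Qed.

End Lip.

(** * Inverse operators, words, and paths over a regular dominant base *)

Section Operators.
Local Open Scope classical_set_scope.
Variables (R : realType) (K : choiceType) (a : K -> K -> int).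
Hypothesis ga : gcm a.
Local Notation vec := ((K + K)%type -> R).
Local Notation act := (act a).
Local Notation al := (al R a).
Local Notation fop := (fop a).
Local Notation eop := (eop a).
Implicit Types (b c eta : R -> vec) (u v w x : seq K) (L t s : R) (A : pred K) (i j : K).

Definition eqon L b c := forall t, 0 <= t <= L -> b t = c t.
Definition mn L b i := finf L (Ht b i) 0.
(** The closed forms [fop] and [eop] are total; that the operator does not give the extra element 0
    is kept as a separate predicate, [vf] for [f_i] and [ve] for [e_i]. *)
Definition vf L i b := mn L b i + 1 <= b L (inl i).
Definition ve L i b := mn L b i + 1 <= 0.
Definition lipp L b := forall x : (K + K)%type, exists C, lipschitz L C (fun t => b t x).

Lemma eqon_sym L b c : eqon L b c -> eqon L c b.
Proof. by move=> h t ht; rewrite h. Qed.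
Lemma eqon_trans L b c d : eqon L b c -> eqon L c d -> eqon L b d.
Proof. by move=> h h' t ht; rewrite h // h'. Qed.

Lemma Xt_eqon L b c i t : eqon L b c -> 0 <= t <= L -> Xt L (Ht b i) t = Xt L (Ht c i) t.
Proof.
move=> h ht; rewrite /Xt (@finf_eqon _ L _ (Ht c i) t) ?(@finf_eqon _ L _ (Ht c i) 0) // => s hs;
 by rewrite /Ht h //; lra.
Qed.

Lemma fop_eqon L b c i : eqon L b c -> eqon L (fop L i b) (fop L i c).
Proof. by move=> h t ht; rewrite /fop (Xt_eqon i h ht) h. Qed.

Lemma mn_eqon L b c i : eqon L b c -> mn L b i = mn L c i.
Proof. by move=> h; apply: finf_eqon => s hs; rewrite /Ht h. Qed.

Lemma revp_eqon L b c : eqon L b c -> eqon L (revp L b) (revp L c).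
Proof. by move=> h t ht; rewrite /revp !h //; lra. Qed.

Lemma eop_eqon L b c i : eqon L b c -> eqon L (eop L i b) (eop L i c).
Proof. by move=> h; apply/revp_eqon/fop_eqon/revp_eqon. Qed.

Lemma vf_eqon L i b c : 0 < L -> eqon L b c -> vf L i b -> vf L i c.
Proof. by move=> L0 h; rewrite /vf (mn_eqon i h) h // lexx ltW. Qed.

Lemma lipp_fop L i b : 0 < L -> lipp L b -> lipp L (fop L i b).
Proof. by move=> L0 lb x; apply: fop_lip => //; exact: (lb (inl i)). Qed.

Lemma lipp_revp L b : lipp L b -> lipp L (revp L b).
Proof. by move=> lb x; apply: revp_lip; exact: lb. Qed.

Lemma lipp_eop L i b : 0 < L -> lipp L b -> lipp L (eop L i b).
Proof. by move=> L0 lb; apply/lipp_revp/lipp_fop/lipp_revp. Qed.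

Lemma XtE0 L g : Xt L g 0 = 0 :> R.
Proof. by rewrite /Xt subrr min_r. Qed.

Lemma fop0 L i b : fop L i b 0 = b 0.
Proof. by apply/funext => x; rewrite /fop !vecE XtE0 mul0r subr0. Qed.

Lemma Xt_end L b i : 0 < L -> lipp L b ->
  Xt L (Ht b i) L = Num.min 1 (b L (inl i) - mn L b i).
Proof.
by move=> L0 lb; have [C lC] := lb (inl i); rewrite /Xt (finf_end lC) // ltW.
Qed.

Lemma revp0 L b : revp L b 0 = 0.
Proof. by rewrite /revp subr0 subrr. Qed.

Lemma eop0 L i b : eop L i b 0 = 0.
Proof. exact: revp0. Qed.

Lemma mn_le L b i t : lipp L b -> 0 <= t <= L -> mn L b i <= b t (inl i).
Proof. by move=> lb ht; have [C lC] := lb (inl i); exact: (finf_le lC). Qed.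

Lemma mn_le0 L b i : 0 < L -> lipp L b -> b 0 = 0 -> mn L b i <= 0.
Proof. by move=> L0 lb b0; rewrite -[leRHS](vec0E R (inl i)) -b0 mn_le // lexx ltW. Qed.

Lemma mn_revp L b i : 0 < L -> lipp L b -> mn L (revp L b) i = mn L b i - b L (inl i).
Proof.
move=> L0 lb; have lr := lipp_revp lb; have [C lC] := lb (inl i); have [C' lC'] := lr (inl i).
have h0 : (0 : R) <= 0 <= L by rewrite lexx ltW.
apply/eqP; rewrite eq_le; apply/andP; split.
  rewrite lerBrDr; apply: (le_finf lC h0) => s hs; rewrite -lerBrDr.
  have -> : Ht b i s - b L (inl i) = revp L b (L - s) (inl i) by rewrite /revp !vecE subKr.
  by apply: mn_le => //; lra.
apply: (le_finf lC' h0) => s hs; rewrite /Ht /revp !vecE lerD2r.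
by apply: mn_le => //; lra.
Qed.

Lemma vf_revp L i b : 0 < L -> lipp L b -> b 0 = 0 -> vf L i (revp L b) <-> ve L i b.
Proof.
move=> L0 lb b0; rewrite /vf /ve mn_revp // /revp subrr b0 !vecE.
by split; lra.
Qed.

Section EF.
Variables (L : R) (b : R -> vec) (i : K).
Hypotheses (L0 : 0 < L) (lb : lipp L b) (b0 : b 0 = 0) (qb : qprop L (Ht b i)) (vb : vf L i b).
Local Notation g := (Ht b i).
Local Notation F := (finf L g).
Local Notation m := (finf L g 0).
Local Notation X := (Xt L g).
Local Notation c := (fop L i b).

Lemma XL1 : X L = 1.
Proof. by rewrite Xt_end // min_l //; move: vb; rewrite /vf /mn; lra. Qed.

Lemma X_mono s t : 0 <= s -> s <= t -> t <= L -> X s <= X t.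
Proof.
move=> s0 st tL; have [C lC] := lb (inl i); have h := finf_mono lC s0 st tL.
rewrite /Xt; have [h1|h1] := leP 1 (F s - m); have [h2|h2] := leP 1 (F t - m); lra.
Qed.

Lemma X_ge0 t : 0 <= t <= L -> 0 <= X t.
Proof. by move=> ht; rewrite -(XtE0 L g); apply: X_mono; lra. Qed.

Lemma X_le1 t : X t <= 1.
Proof. by rewrite /Xt ge_min lexx. Qed.

Lemma Hc t : Ht c i t = g t - 2 * X t.
Proof. by rewrite /Ht /fop !vecE /= a2 // mulrC. Qed.

Lemma Hc_ge t : 0 <= t <= L -> m - X t <= Ht c i t.
Proof.
move=> ht; have [C lC] := lb (inl i); rewrite Hc /Xt.
have Fg : F t <= g t by apply: (finf_le lC); lra.
have Fm : m <= F t by apply: (finf_mono lC); lra.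
by have [h1|h1] := leP 1 (F t - m); lra.
Qed.

(** While the letter is in progress [qprop] identifies the old height with [m + X t], whose
    reflection is [m - X t]. *)
Lemma Hc_eq t : 0 <= t <= L -> 0 < X t -> X t < 1 -> Ht c i t = m - X t.
Proof.
move=> ht; have [C lC] := lb (inl i); rewrite Hc /Xt.
have [h1|h1] := leP 1 (F t - m); first by lra.
move=> h2 _; have Fg : F t <= g t by apply: (finf_le lC); lra.
have [Fl|gF] := ltP (F t) (g t); last by lra.
by case: (qb ht Fl); lra.
Qed.

Lemma Hc_low t (v : R) : 0 <= t <= L -> 0 < X t -> m - X t < v -> exists2 s, 0 <= s <= t & Ht c i s < v.
Proof.
move=> ht X0 hv; have [X1|X1] := ltP (X t) 1.
  by exists t; rewrite ?Hc_eq //; lra.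
have {}X1 : X t = 1 by have := X_le1 t; lra.
have [C lC] := Xt_lip L0 (lb (inl i)).
set d := Num.min (1 / 2) ((v - (m - 1)) / 2).
have d0 : 0 < d by rewrite lt_min; apply/andP; split; lra.
have [d1 d2] : d <= 1 / 2 /\ d <= (v - (m - 1)) / 2 by rewrite !ge_min !lexx orbT.
have [s [hs Xs _]] : exists s, [/\ 0 <= s <= t, X s = 1 - d & forall r, s < r <= t -> 1 - d < X r].
  by apply: (lip_ivt lC); rewrite ?XtE0; lra.
exists s; first by lra.
rewrite Hc_eq; lra.
Qed.

(** The future of the reversed path is the past of [c], over which the infimum of the height is
    [m - X], as [X] increases. *)
Lemma Xt_revp t : 0 <= t <= L -> Xt L (Ht (revp L c) i) t = 1 - X (L - t).
Proof.
move=> ht; have lc : lipp L (revp L c) by apply/lipp_revp/lipp_fop.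
have [C lC] := lc (inl i).
have HE s : Ht (revp L c) i s = Ht c i (L - s) - Ht c i L by rewrite /Ht /revp !vecE.
have lo r : 0 <= r <= L -> m - X (L - r) - Ht c i L <= finf L (Ht (revp L c) i) r.
  move=> hr; apply: (le_finf lC hr) => s hs; rewrite -/(Ht (revp L c) i s) HE lerD2r.
  apply: le_trans (Hc_ge _); last by lra.
  by rewrite lerD2l lerN2; apply: X_mono; lra.
have up r : 0 <= r <= L -> 0 < X (L - r) ->
    finf L (Ht (revp L c) i) r = m - X (L - r) - Ht c i L.
  move=> hr X0; apply/eqP; rewrite eq_le lo // andbT leNgt; apply/negP => hlt.
  have [||s hs hv] := @Hc_low (L - r) (finf L (Ht (revp L c) i) r + Ht c i L) _ X0; try lra.
  have : finf L (Ht (revp L c) i) r <= Ht (revp L c) i (L - s) by apply: (finf_le lC); lra.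
  by rewrite HE subKr; lra.
have h0 : finf L (Ht (revp L c) i) 0 = m - 1 - Ht c i L.
  by rewrite up ?subr0 ?XL1 // ?lexx ?ltW.
have hLt : 0 <= L - t <= L by lra.
have h1 := X_ge0 hLt; have h2 := X_le1 (L - t); have hlo := lo _ ht.
rewrite [LHS]/Xt h0; move: h1; rewrite le_eqVlt => /orP[/eqP X0|X0].
  by rewrite -X0 subr0 min_l //; rewrite -X0 in hlo; lra.
by rewrite up // min_r; lra.
Qed.

Lemma eop_fop : eqon L (eop L i c) b.
Proof.
move=> t ht; apply/funext => x; rewrite /eop {1}/revp /fop !vecE -/(fop L i b).
rewrite !Xt_revp; try lra.
rewrite subrr XtE0 subKr /revp !vecE subrr subKr fop0 b0 /fop !vecE; ring.
Qed.

Lemma mn_fop : mn L c i = m - 1.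
Proof.
have lc := lipp_fop i L0 lb; have [C lC] := lc (inl i).
have hL : 0 <= L <= L by rewrite lexx ltW.
have h0 : (0 : R) <= 0 <= L by rewrite lexx ltW.
apply/eqP; rewrite eq_le; apply/andP; split; last first.
  apply: (le_finf lC h0) => s hs; rewrite -/(Ht c i s).
  by have h1 := Hc_ge hs; have h2 := X_le1 s; lra.
rewrite leNgt; apply/negP => hlt.
have X1 := XL1; have [||s hs hv] := @Hc_low L (mn L c i) hL; rewrite ?X1; try lra.
by have := mn_le i lc hs; rewrite -/(Ht c i s); lra.
Qed.

Lemma fop_end : c L = b L - al i.
Proof. by apply/funext => x; rewrite /fop !vecE XL1 mul1r. Qed.

End EF.

(** The reversed path is again of this type, hence satisfies [qprop], and [eop_fop] for it is the
    other composition. *)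
Lemma fop_eop o A L eta b i : 0 < L -> LS a o A L eta b -> ve L i b ->
  [/\ eqon L (fop L i (eop L i b)) b, vf L i (eop L i b) & eop L i b L = b L + al i].
Proof.
move=> L0 ls vb; have lb : lipp L b := ls_lip ls; have b0 := ls_0 ls.
have lr := LS_revp ga L0 ls.
have qr : qprop L (Ht (revp L b) i) by apply: tame_qprop => //; exact: (LS_tame ga i lr).
have vr : vf L i (revp L b) by apply/vf_revp.
have lrb := lipp_revp lb.
have h := eop_fop L0 lrb (revp0 L b) qr vr.
have lfr := lipp_fop i L0 lrb.
have eL : eop L i b L = b L + al i.
  rewrite /eop {1}/revp subrr fop0 revp0 (fop_end L0 lrb vr) /revp subrr b0.
  by apply/funext => x; rewrite !vecE; ring.
split => //.
  have := revp_eqon h; rewrite revpK // /eop revpK ?fop0 //; exact: eop0.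
rewrite /vf eL mn_revp // (mn_fop L0 lrb qr vr) (fop_end L0 lrb vr) -/(mn _ _ _).
rewrite mn_revp // /revp subrr b0 !vecE /= a2 //.
have := mn_le i lb (_ : 0 <= L <= L); rewrite lexx ltW // => /(_ isT).
lra.
Qed.

Fixpoint Fop L (F : seq K) b := if F is i :: F' then fop L i (Fop L F' b) else b.
Fixpoint vld L (F : seq K) b : Prop :=
  if F is i :: F' then vld L F' b /\ vf L i (Fop L F' b) else True.

Lemma Fop_eqon L F b c : eqon L b c -> eqon L (Fop L F b) (Fop L F c).
Proof. by move=> h; elim: F => //= i F; exact: fop_eqon. Qed.

Lemma vld_eqon L F b c : 0 < L -> eqon L b c -> vld L F b -> vld L F c.
Proof.
move=> L0 h; elim: F => //= i F IH [/IH ? ?]; split => //.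
by apply: vf_eqon (Fop_eqon F h) _.
Qed.

Lemma lipp_Fop L F b : 0 < L -> lipp L b -> lipp L (Fop L F b).
Proof. by move=> L0 lb; elim: F => //= i F; exact: lipp_fop. Qed.

Lemma Fop0 L F b : Fop L F b 0 = b 0.
Proof. by elim: F => //= i F IH; rewrite fop0. Qed.

Lemma LS_Fop o A L eta b F : 0 < L -> all A F -> LS a o A L eta b -> LS a o A L eta (Fop L F b).
Proof. by move=> L0; elim: F => //= i F IH /andP[Ai /IH h] /h; exact: LS_fop. Qed.

Lemma Fop_end L F b (x : (K + K)%type) : 0 < L -> lipp L b -> vld L F b ->
  Fop L F b L x = b L x - \sum_(k <- F) al k x.
Proof.
move=> L0 lb; elim: F => [|i F IH] /=; first by rewrite big_nil subr0.
move=> [/IH h v]; rewrite (fop_end L0 (lipp_Fop F L0 lb) v) !vecE h big_cons; ring.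
Qed.

Lemma sum_al_inr F k : \sum_(j <- F) al j (inr k) = (count_mem k F)%:R.
Proof.
elim: F => [|j F IH]; first by rewrite big_nil.
by rewrite big_cons IH /= natrD eq_sym.
Qed.

Section Regular.
Variables (L : R) (eta : R -> vec) (A : pred K).
Hypothesis L0 : 0 < L.
Local Notation LS := (LS a true A L eta).

(** Directions are Weyl translates of dominant base directions, and translates only lose root
    coordinates. *)
Lemma LS_tr_mono b k : LS b -> forall s t, 0 <= s -> s <= t -> t <= L ->
  b t (inr k) - eta t (inr k) <= b s (inr k) - eta s (inr k).
Proof.
move=> ls; have [C lC] := ls_lip ls (inr k); have [C' lC'] := ls_lipe ls (inr k).
apply: (@lip_antimono _ L (C + C') (fun t => b t (inr k) - eta t (inr k))).
  move=> s t hs ht; have -> (x y z w : R) : x - y - (z - w) = (x - z) - (y - w) by ring.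
  by apply: le_trans (ler_normB _ _) _; rewrite mulrDl lerD ?lC ?lC'.
have gap t nu w : reg nu -> rgerm L eta t nu -> rgerm L b t (act w nu) ->
    exists2 k0, k0 <= 0 & rlin L (fun s => b s (inr k) - eta s (inr k)) t k0.
  move=> rn [e [e0 eL] he] [e' [e'0 e'L] hb].
  exists (act w nu (inr k) - nu (inr k)).
    by rewrite subr_le0; apply: (tr_act ga); exact: reg_dom.
  exists (Num.min e e'); first by rewrite lt_min e0 e'0; split => //; rewrite -lerBrDl ge_min lerBrDl eL.
  have [de de'] : Num.min e e' <= e /\ Num.min e e' <= e' by rewrite !ge_min !lexx orbT.
  move=> s hs; rewrite (he s) ?(hb s); try lra.
  rewrite !vecE; ring.
move=> t /andP[t0 tL]; move: t0; rewrite le_eqVlt => /orP[/eqP <-|t0].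
  by have [nu [w [rn _ he hb]]] := ls_start ls; exact: gap rn he hb.
have [|nu [u [nu' [v [_ [rn' _] _ [her hr] _]]]]] := ls_mid ls (t := t); first by lra.
exact: gap rn' her hr.
Qed.

Lemma lgerm_uniq b t nu nu' : lgerm b t nu -> lgerm b t nu' -> nu = nu'.
Proof.
move=> h h'; apply/funext => x; apply: (@llin_uniq _ (fun s => b s x) t).
  by case: h => e he hh; exists e => // s hs; rewrite hh // !vecE.
by case: h' => e he hh; exists e => // s hs; rewrite hh // !vecE.
Qed.

Lemma chain_from_id (p : vec) u v : chain a true p A u v -> eqw R a u [::] -> eqw R a v [::].
Proof.
move=> hc; elim: hc => {u v} [u v e h|u x v [z [i [_ _ l _]]] _ _ _ h].
  exact: eqw_trans (eqw_sym e) h.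
move: l; rewrite (len_eqw h).
have e0 : eqw R a [::] [::] by [].
by have := len_le e0; rewrite /= leqn0 => /eqP ->.
Qed.

(* Along a dominant regular base the chain can only go down, so a path starting
   in the direction of the base never leaves it. *)
Lemma LS_trivial b : LS b ->
  (exists nu w, [/\ eqw R a w [::], rgerm L eta 0 nu & rgerm L b 0 (act w nu)]) -> eqon L b eta.
Proof.
move=> ls [nu0 [w0 [e0 he0 hb0]]].
pose P t := forall s, 0 <= s <= t -> b s = eta s.
have step t nu w : 0 <= t < L -> P t -> eqw R a w [::] -> rgerm L eta t nu ->
    rgerm L b t (act w nu) -> exists2 e, 0 < e & t + e <= L /\ P (t + e).
  move=> ht Pt ew [e [ep eL] he] [e' [e'p e'L] hb].
  have d0 : 0 < Num.min e e' by rewrite lt_min ep.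
  have [de de'] : Num.min e e' <= e /\ Num.min e e' <= e' by rewrite !ge_min !lexx orbT.
  exists (Num.min e e') => //; split; first by lra.
  move=> s hs; have [st|ts] := leP s t; first by apply: Pt; lra.
  rewrite (he s) ?(hb s); [|lra|lra].
  by rewrite ew Pt //; lra.
have P0 : P 0.
  move=> s hs; have -> : s = 0 by lra.
  by rewrite (ls_0 ls) (ls_eta0 ls).
have [t [/andP[t0 tL] h3 h4]] := last_time (ltW L0) P0.
have ht : 0 <= t <= L by lra.
have Plt s : 0 <= s < t -> b s = eta s.
  move=> hs; have [|r hr [r0 rt Pr]] := h4 (t - s); first by lra.
  by apply: Pr; lra.
have Pt : P t.
  move=> s hs; have [st|ts] := ltP s t; first by apply: Plt; lra.
  have -> : s = t by lra.
  move: t0; rewrite le_eqVlt => /orP[/eqP <-|t0]; first by rewrite (ls_0 ls) (ls_eta0 ls).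
  have hlim (y : R -> R) (D : R) : lipschitz L D y ->
     (forall r, 0 <= r < t -> y r <= 0) -> y t <= 0.
    move=> ly hy; apply: (lip_lim_le ly ht) => e ep.
    exists (t - Num.min (e / 2) t).
    have d0 : 0 < Num.min (e / 2) t by rewrite lt_min t0 andbT; lra.
    have [de dt] : Num.min (e / 2) t <= e / 2 /\ Num.min (e / 2) t <= t.
      by rewrite !ge_min !lexx orbT.
    split; first by lra.
      by rewrite addrAC subrr add0r normrN gtr0_norm //; lra.
    by apply: hy; lra.
  apply/funext => x; have [C lC] := ls_lip ls x; have [C' lC'] := ls_lipe ls x.
  have l1 : lipschitz L (C + C') (fun t => (b t - eta t) x).
    move=> p q hp hq; rewrite !vecE.
    have -> (x0 y z w : R) : x0 - y - (z - w) = (x0 - z) - (y - w) by ring.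
    by apply: le_trans (ler_normB _ _) _; rewrite mulrDl lerD ?lC ?lC'.
  have h1 : (b t - eta t) x <= 0.
    by apply: (hlim _ _ l1) => r hr; rewrite Plt // !vecE subrr.
  have h2 : - (b t - eta t) x <= 0.
    by apply: (hlim _ _ (lip_opp l1)) => r hr; rewrite Plt // !vecE subrr oppr0.
  rewrite !vecE in h1 h2; lra.
have [tL'|Lt] := ltP t L; last by move=> s hs; apply: Pt; lra.
have [e ep [eL Pe]] : exists2 e, 0 < e & t + e <= L /\ P (t + e).
  move: t0; rewrite le_eqVlt => /orP[/eqP e|t0].
    by rewrite -e in tL' *; apply: (@step 0 nu0 w0) => //; rewrite lexx.
  have [|nu [u [nu' [v [[rn _] [rn' _] [hel hl] [her hr] [hc _]]]]]] := ls_mid ls (t := t).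
    by lra.
  have bl : lgerm b t nu.
    case: hel => e he hh; exists e => // s hs; rewrite (Pt s); last by lra.
    rewrite (Pt t); [exact: hh|lra].
  (* To the left of [t] the path coincides with its base, so its element fixes a regular
     direction. *)
  have eu : eqw R a u [::].
    by apply: (tr_act_eq ga rn) => k; rewrite (lgerm_uniq hl bl).
  by apply: (step _ _ _ _ Pt (chain_from_id hc eu) her hr); lra.
by have := h3 (t + e); case=> //; lra.
Qed.

(** The root coordinates relative to the base decrease from 0 to 0, so the initial element loses
    nothing and fixes its regular direction. *)
Lemma LS_tr0 b : LS b -> (forall k, b L (inr k) = eta L (inr k)) -> eqon L b eta.
Proof.
move=> ls h; apply: (LS_trivial ls); have [nu [w [rn _ he hb]]] := ls_start ls.
exists nu, w; split => //; apply: (tr_act_eq ga rn) => k.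
have h1 := tr_act ga w k (reg_dom rn).
case: (he) => e [e0 eL] he'; case: (hb) => e' [e'0 e'L] hb'.
have d0 : 0 < Num.min e e' by rewrite lt_min e0.
have [de de'] : Num.min e e' <= e /\ Num.min e e' <= e' by rewrite !ge_min !lexx orbT.
set d := Num.min e e' in d0 de de'.
have := LS_tr_mono k ls (_ : 0 <= d) (_ : d <= L) (lexx L); rewrite h subrr => h2.
have {}h2 : 0 <= b d (inr k) - eta d (inr k) by apply: h2; lra.
rewrite (he' d) ?(hb' d) in h2; try lra.
rewrite (ls_0 ls) (ls_eta0 ls) !vecE !add0r subr0 -mulrBr pmulr_rge0 // in h2.
lra.
Qed.

(** If no [e_j] applies, all minima are 0, the initial direction is dominant and the initial element
    trivial. *)
Lemma LS_dominant b : LS b -> (forall j, ~ ve L j b) -> eqon L b eta.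
Proof.
move=> ls h; apply: (LS_trivial ls); have [nu [w [rn _ he hb]]] := ls_start ls.
exists nu, w; split => //; apply: (all_pos ga) => k.
have lb : lipp L b := ls_lip ls.
have m0 : mn L b k = 0.
  have h1 := mn_le0 k L0 lb (ls_0 ls); have := h k; rewrite /ve => /negP; rewrite -ltNge => h2.
  have mi : mn L b k \is a Num.int by apply: tame_int => //; exact: (LS_tame ga k ls).
  apply/eqP; rewrite eq_le h1 leNgt; apply/negP => h3.
  by have := int_lt_le mi (rpred0 _) h3; lra.
apply: (@gt_rise _ _ _ ga true k w nu) => //.
rewrite lt_neqAle eq_sym (rise_neq0 ga k w rn) /=.
case: hb => e [e0 eL] hb; have := mn_le k lb (_ : 0 <= 0 + e <= L); rewrite m0 hb; last by lra.
rewrite (ls_0 ls) !vecE !add0r subr0 => hh; rewrite -(pmulr_rge0 _ e0); apply: hh.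
by lra.
Qed.

(** The letter [i] occurs in [F] because the raised path still cannot exceed the base in root
    coordinates. *)
Lemma LS_eop_count b F i : (forall i, A i) -> LS b -> ve L i b ->
  (forall k, b L (inr k) = eta L (inr k) - (count_mem k F)%:R) ->
  perm_eq (i :: rem i F) F /\
  (forall k, eop L i b L (inr k) = eta L (inr k) - (count_mem k (rem i F))%:R).
Proof.
move=> hA ls vi hb; have [h1 h2 h3] := fop_eop L0 ls vi.
have lc := LS_eop ga L0 (hA i) ls.
have cnt k : eop L i b L (inr k) = eta L (inr k) - (count_mem k F)%:R + (k == i)%:R.
  by rewrite h3 !vecE hb.
have iF : i \in F.
  have := LS_tr_mono i lc (lexx 0) (ltW L0) (lexx L).
  rewrite (ls_0 lc) (ls_eta0 lc) cnt eqxx !vecE => h4.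
  rewrite -has_pred1 has_count lt0n; apply/eqP => e0.
  by move: h4; rewrite e0 !subr0 addrAC subrr add0r ler10.
have pF : perm_eq (i :: rem i F) F by rewrite perm_sym perm_to_rem.
split=> // k; rewrite cnt; move/permP: pF => /(_ (pred1 k)) <- /=.
by rewrite natrD eq_sym; ring.
Qed.

(** Induction on the number of simple roots between the path and its base: unless it is the base
    some [e_i] applies and removes one of them. *)
Lemma LS_raise b F : (forall i, A i) -> LS b ->
  (forall k, b L (inr k) = eta L (inr k) - (count_mem k F)%:R) ->
  exists F', [/\ perm_eq F' F, vld L F' eta & eqon L b (Fop L F' eta)].
Proof.
move=> hA; have [n sF] : exists n, size F = n by exists (size F).
elim: n F sF b => [|n IH] F sF b ls hb.
  have F0 := size0nil sF; rewrite {F sF}F0 in hb *.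
  exists [::]; split => //.
  by apply: LS_tr0 => // k; rewrite hb subr0.
have [hd|/existsNP[i /contrapT vi]] := pselect (forall j, ~ ve L j b).
  have e := LS_dominant ls hd; case: F sF hb => // k F _ hb.
  have := hb k; rewrite e; last by rewrite lexx ltW.
  move/eqP; rewrite -subr_eq0 opprB addrC subrK /= eqxx.
  by rewrite pnatr_eq0.
have [h1 h2 h3] := fop_eop L0 ls vi.
have lc := LS_eop ga L0 (hA i) ls.
have [pF cnt] := LS_eop_count hA ls vi hb.
have [|F' [p1 p2 p3]] := IH (rem i F) _ _ lc cnt.
  by move/perm_size: pF; rewrite sF => -[].
exists (i :: F'); split.
- by apply: perm_trans pF; rewrite perm_cons.
- by split => //; exact: vf_eqon p3 h2.
- by apply: eqon_trans (eqon_sym h1) _; exact: fop_eqon.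
Qed.

Lemma LS_lower b F i : (forall i, A i) -> LS b -> ve L i b ->
  (forall k, b L (inr k) = eta L (inr k) - (count_mem k F)%:R) ->
  exists F', [/\ perm_eq (i :: F') F, vld L (i :: F') eta & eqon L b (Fop L (i :: F') eta)].
Proof.
move=> hA ls vi hb; have [h1 h2 h3] := fop_eop L0 ls vi.
have lc := LS_eop ga L0 (hA i) ls.
have [pF cnt] := LS_eop_count hA ls vi hb.
have [F' [p1 p2 p3]] := LS_raise hA lc cnt; exists F'; split.
- by apply: perm_trans pF; rewrite perm_cons.
- by split => //; exact: vf_eqon p3 h2.
- by apply: eqon_trans (eqon_sym h1) _; exact: fop_eqon.
Qed.

End Regular.
End Operators.

(** * Deformation of two straight paths with constant sum *)

Lemma lip_int_const (R : realType) (C : R) (h : R -> R) : lipschitz 1 C h ->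
  (forall s, 0 < s <= 1 -> h s \is a Num.int) -> forall s, 0 <= s <= 1 -> h s = h 1.
Proof.
move=> lh hi.
have key (k : R -> R) s : lipschitz 1 C k -> (forall s, 0 < s <= 1 -> k s \is a Num.int) ->
    0 < s <= 1 -> k 1 <= k s.
  move=> lk ki hs; rewrite leNgt; apply/negP => hlt.
  have i1 : k 1 \is a Num.int by apply: ki; lra.
  have h1 := int_lt_le (ki _ hs) i1 hlt.
  have [r [hr kr _]] : exists r, [/\ s <= r <= 1, k r = k s + 1 / 2 &
      forall q, r < q <= 1 -> k s + 1 / 2 < k q] by apply: (lip_ivt lk); lra.
  have ir : k r \is a Num.int by apply: ki; lra.
  have : k s < k r by lra.
  by move/(int_lt_le (ki _ hs) ir); lra.
have pos s : 0 < s <= 1 -> h s = h 1.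
  move=> hs; apply/eqP; rewrite eq_le; apply/andP; split; last exact: key.
  rewrite -lerN2; apply: (key (fun s => - h s)) => //; first exact: lip_opp.
  by move=> r hr; rewrite rpredN hi.
move=> s hs; have [s0|s0] := ltP 0 s; first by apply: pos; lra.
have near e : 0 < e -> exists r, [/\ 0 <= r <= 1, `|r - s| < e & h r = h 1].
  move=> e0; exists (Num.min (e / 2) 1).
  have d0 : 0 < Num.min (e / 2) 1 by rewrite lt_min ltr01 andbT; lra.
  have [d1 d2] : Num.min (e / 2) 1 <= e / 2 /\ Num.min (e / 2) 1 <= 1.
    by rewrite !ge_min !lexx orbT.
  split; first by lra.
    have -> : s = 0 by lra.
    by rewrite subr0 gtr0_norm //; lra.
  by apply: pos; lra.
apply/eqP; rewrite eq_le; apply/andP; split.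
  by apply: (lip_lim_le lh hs) => e /near[r [h1 h2 h3]]; exists r; split => //; rewrite h3.
by apply: (lip_lim_ge lh hs) => e /near[r [h1 h2 h3]]; exists r; split => //; rewrite h3.
Qed.

Section Deformation.
Variables (R : realType) (K : choiceType) (a : K -> K -> int).
Hypothesis ga : gcm a.
Local Notation vec := ((K + K)%type -> R).
Local Notation act := (act a).
Local Notation al := (al R a).
Local Notation fop := (fop a).
Local Notation eop := (eop a).
Local Notation Fop := (Fop a).
Local Notation vld := (vld a).
Implicit Types (b c eta : R -> vec) (w : seq K) (L t s d : R) (A : pred K) (i j k : K).
Implicit Types (S : seq (K + K)%type) (u v : vec).

Definition mop L (m : bool * K) b := if m.1 then fop L m.2 b else eop L m.2 b.
Definition Mop L (M : seq (bool * K)) b := foldr (mop L) b M.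

Lemma LS_Mop o A L eta b M : 0 < L -> all A (map snd M) -> LS a o A L eta b ->
  LS a o A L eta (Mop L M b).
Proof.
move=> L0; elim: M => //= -[[] i] M IH /andP[Ai /IH h] /h ls.
  exact: LS_fop.
exact: LS_eop.
Qed.

Lemma lipp_Mop L b M : 0 < L -> lipp L b -> lipp L (Mop L M b).
Proof.
move=> L0 lb; elim: M => //= -[c i] M IH.
by rewrite /mop /=; case: c; [exact: lipp_fop|exact: lipp_eop].
Qed.

Lemma Mop_eqon L M b c : eqon L b c -> eqon L (Mop L M b) (Mop L M c).
Proof.
move=> h; elim: M => //= -[d i] M IH.
by rewrite /mop /=; case: d; [exact: fop_eqon|exact: eop_eqon].
Qed.

Lemma Mop_cat L M N b : Mop L (M ++ N) b = Mop L M (Mop L N b).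
Proof. by rewrite /Mop foldr_cat. Qed.

Lemma Mop_fop L F b : Mop L (map (pair true) F) b = Fop L F b.
Proof. by elim: F => //= i F ->. Qed.

Lemma Mop0 L M b : b 0 = 0 -> Mop L M b 0 = 0.
Proof.
move=> b0; elim: M => //= -[c i] M IH; rewrite /mop /=.
by case: c; rewrite ?fop0 ?eop0.
Qed.

Lemma mop_end L m b : 0 < L -> lipp L b -> b 0 = 0 ->
  mop L m b L = b L - sc (if m.1 then Num.min 1 (b L (inl m.2) - mn L b m.2)
                          else - Num.min 1 (- mn L b m.2)) (al m.2).
Proof.
move=> L0 lb b0; case: m => -[] i; rewrite /mop /=.
  by rewrite /fop Xt_end.
rewrite /eop {1}/revp subrr fop0 revp0 /fop Xt_end //; last exact: lipp_revp.
rewrite mn_revp // /revp subrr b0.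
have -> : (0 - b L) (inl i) - (mn L b i - b L (inl i)) = - mn L b i by rewrite !vecE; ring.
by apply/funext => x; rewrite !vecE; ring.
Qed.

Definition close S L d b c := forall x, x \in S -> forall t, 0 <= t <= L ->
  `|b t x - c t x| <= d.

Lemma close_finf S L d b c i t : lipp L b -> lipp L c -> close S L d b c -> inl i \in S ->
  0 <= t <= L -> `|finf L (Ht b i) t - finf L (Ht c i) t| <= d.
Proof.
move=> lb lc h hi ht; have [C lC] := lb (inl i); have [C' lC'] := lc (inl i).
have h1 s : 0 <= s <= L -> b s (inl i) - c s (inl i) <= d /\ c s (inl i) - b s (inl i) <= d.
  by move=> hs; have := h _ hi s hs; rewrite ler_norml => /andP[h1 h2]; split; lra.
rewrite ler_norml; apply/andP; split.
  suff : finf L (Ht c i) t - d <= finf L (Ht b i) t by lra.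
  apply: (le_finf lC) => // s hs; rewrite /Ht.
  have hs' : 0 <= s <= L by lra.
  have h2 : finf L (Ht c i) t <= Ht c i s by exact: (finf_le lC' (proj1 (andP ht))).
  by have := h1 s hs'; rewrite /Ht in h2 *; lra.
suff : finf L (Ht b i) t - d <= finf L (Ht c i) t by lra.
apply: (le_finf lC') => // s hs; rewrite /Ht.
have hs' : 0 <= s <= L by lra.
have h2 : finf L (Ht b i) t <= Ht b i s by exact: (finf_le lC (proj1 (andP ht))).
by have := h1 s hs'; rewrite /Ht in h2 *; lra.
Qed.

(** The constant depends on neither the paths nor the distance [d], so that it can be used uniformly
    in the deformation parameter. The set [S] must contain [inl i], the coordinate that the operator
    reads. *)
Lemma close_fop S i : inl i \in S -> exists2 D, 0 <= D & forall L d b c, 0 < L -> lipp L b ->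
  lipp L c -> 0 <= d -> close S L d b c -> close S L (D * d) (fop L i b) (fop L i c).
Proof.
move=> hi; exists (1 + 2 * \sum_(x <- S) `|al i x|).
  by apply: addr_ge0 => //; apply: mulr_ge0 => //; apply: sumr_ge0.
move=> L d b c L0 lb lc d0 h x hx t ht; rewrite /fop !vecE.
set X := Xt _ _ _; set X' := Xt _ _ _; set e := al i x.
have hX : `|X - X'| <= 2 * d.
  have h1 := close_finf lb lc h hi ht.
  have h2 := close_finf lb lc h hi (_ : 0 <= 0 <= L).
  have {}h2 := h2 (introT andP (conj (lexx 0) (ltW L0))).
  move: h1 h2; rewrite /X /X' /Xt; move: (finf _ _ t) (finf _ _ t) (finf _ _ 0) (finf _ _ 0).
  move=> F F' m m'; rewrite !ler_norml => /andP[h1 h2] /andP[h3 h4].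
  by have [h5|h5] := leP 1 (F - m); have [h6|h6] := leP 1 (F' - m'); apply/andP; split; lra.
have he : `|e| <= \sum_(y <- S) `|al i y|.
  by rewrite (big_rem x hx) /= lerDl; apply: sumr_ge0.
have -> : b t x - X * e - (c t x - X' * e) = (b t x - c t x) - (X - X') * e by ring.
apply: le_trans (ler_normB _ _) _; rewrite [leRHS]mulrDl mul1r; apply: lerD; first exact: h.
rewrite normrM -mulrA [_ * d]mulrC mulrA.
by apply: ler_pM.
Qed.

Lemma close_revp S L d b c : 0 < L -> 0 <= d -> close S L d b c ->
  close S L (2 * d) (revp L b) (revp L c).
Proof.
move=> L0 d0 h x hx t ht; rewrite /revp !vecE.
have -> (p q r z : R) : p - q - (r - z) = (p - r) - (q - z) by ring.
apply: le_trans (ler_normB _ _) _; rewrite mulr_natl mulr2n; apply: lerD; apply: h => //; lra.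
Qed.

Lemma close_mop S m : inl m.2 \in S -> exists2 D, 0 <= D & forall L d b c, 0 < L -> lipp L b ->
  lipp L c -> 0 <= d -> close S L d b c -> close S L (D * d) (mop L m b) (mop L m c).
Proof.
case: m => -[] i /= hi; have [D D0 h] := close_fop hi; first by exists D.
exists (2 * (D * 2)); first by do 2! apply: mulr_ge0 => //.
move=> L d b c L0 lb lc d0 hc; rewrite /mop /= /eop.
have d2 : 0 <= 2 * d by apply: mulr_ge0.
have := close_revp L0 _ (h L (2 * d) _ _ L0 (lipp_revp lb) (lipp_revp lc) d2 (close_revp L0 d0 hc)).
rewrite -!mulrA; apply; apply: mulr_ge0 => //.
Qed.

Lemma close_Mop S M : {subset [seq inl m.2 | m <- M] <= S} ->
  exists2 D, 0 <= D & forall L d b c, 0 < L -> lipp L b ->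
  lipp L c -> 0 <= d -> close S L d b c -> close S L (D * d) (Mop L M b) (Mop L M c).
Proof.
elim: M => [|m M IH] hS; first by exists 1 => // L d b c; rewrite mul1r.
have [|D D0 h] := IH; first by move=> x hx; apply: hS; rewrite inE hx orbT.
have [|D' D'0 h'] := @close_mop S m; first by apply: hS; rewrite mem_head.
exists (D' * D); first exact: mulr_ge0.
move=> L d b c L0 lb lc d0 hc; rewrite -mulrA /=.
by apply: h' => //; [exact: lipp_Mop|exact: lipp_Mop|exact: mulr_ge0|exact: h].
Qed.

Definition line2 u v : R -> vec := fun t => if t <= 1 then sc t u else u + sc (t - 1) v.

Lemma line2_0 u v : line2 u v 0 = 0.
Proof. by rewrite /line2 ler01; apply/funext => x; rewrite !vecE mul0r. Qed.

Lemma line2_2 u v : line2 u v 2 = u + v.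
Proof.
have h : (2 : R) <= 1 = false by apply/negbTE; rewrite -ltNge; lra.
rewrite /line2 h.
by apply/funext => x; rewrite !vecE; ring.
Qed.

Lemma line2_r u v t : 0 <= t < 2 -> rgerm 2 (line2 u v) t (if t < 1 then u else v).
Proof.
move=> ht; have [t1|t1] := ltP t 1.
  exists (1 - t); first by lra.
  move=> s hs; rewrite /line2; have -> : s <= 1 by lra.
  by rewrite (ltW t1); apply/funext => x; rewrite !vecE; ring.
exists (2 - t); first by lra.
move=> s hs; rewrite /line2; have [s1|s1] := leP s 1.
  have -> : s = 1 by lra.
  have -> : t = 1 by lra.
  by rewrite lexx; apply/funext => x; rewrite !vecE; ring.
have [t1'|t1'] := leP t 1; last by apply/funext => x; rewrite !vecE; ring.
have -> : t = 1 by lra.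
by apply/funext => x; rewrite !vecE; ring.
Qed.

Lemma line2_l u v t : 0 < t <= 2 -> lgerm (line2 u v) t (if t <= 1 then u else v).
Proof.
move=> ht; have [t1|t1] := leP t 1.
  exists t; first by lra.
  move=> s hs; rewrite /line2; have -> : s <= 1 by lra.
  by rewrite t1; apply/funext => x; rewrite !vecE; ring.
exists (t - 1); first by lra.
move=> s hs; rewrite /line2 [t <= 1]leNgt t1 /=; have [s1|s1] := leP s 1; last first.
  by apply/funext => x; rewrite !vecE; ring.
have -> : s = 1 by lra.
by apply/funext => x; rewrite !vecE; ring.
Qed.

Lemma line2_lip u v : lipp 2 (line2 u v).
Proof.
move=> x; exists (`|u x| + `|v x|) => s t hs ht.
wlog st : s t hs ht / s <= t.
  by move=> h; have [|/ltW] := leP s t => st; [|rewrite distrC [`|s - t|]distrC]; apply: h.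
rewrite distrC [`|s - t|]distrC [`|t - s|]ger0_norm ?subr_ge0 //.
have u0 := normr_ge0 (u x); have v0 := normr_ge0 (v x).
have n1 := ler_norm (u x); have n2 := ler_norm (- u x); rewrite normrN in n2.
have n3 := ler_norm (v x); have n4 := ler_norm (- v x); rewrite normrN in n4.
rewrite /line2 ler_norml; have [s1|s1] := leP s 1; have [t1|t1] := leP t 1; rewrite !vecE.
- have p1 : - `|u x| * (t - s) <= u x * (t - s) by apply: ler_wpM2r; lra.
  have p2 : u x * (t - s) <= `|u x| * (t - s) by apply: ler_wpM2r; lra.
  have p3 : 0 <= `|v x| * (t - s) by apply: mulr_ge0 => //; lra.
  by apply/andP; split; lra.
- have p1 : - `|u x| * (1 - s) <= u x * (1 - s) by apply: ler_wpM2r; lra.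
  have p2 : u x * (1 - s) <= `|u x| * (1 - s) by apply: ler_wpM2r; lra.
  have p4 : - `|v x| * (t - 1) <= v x * (t - 1) by apply: ler_wpM2r; lra.
  have p5 : v x * (t - 1) <= `|v x| * (t - 1) by apply: ler_wpM2r; lra.
  have p3 : 0 <= `|v x| * (1 - s) by apply: mulr_ge0 => //; lra.
  have p6 : 0 <= `|u x| * (t - 1) by apply: mulr_ge0 => //; lra.
  by apply/andP; split; lra.
- by exfalso; lra.
have p1 : - `|v x| * (t - s) <= v x * (t - s) by apply: ler_wpM2r; lra.
have p2 : v x * (t - s) <= `|v x| * (t - s) by apply: ler_wpM2r; lra.
have p3 : 0 <= `|u x| * (t - s) by apply: mulr_ge0 => //; lra.
by apply/andP; split; lra.
Qed.

(** The path is its own base and the chain at the break point is trivial, so only the sum has to be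
    integral; this leaves room to deform [u] and [v] continuously. *)
Lemma LS_line2 A u v : reg u -> reg v -> isint (u + v) ->
  LS a true A 2 (line2 u v) (line2 u v).
Proof.
move=> ru rv iuv; have lip := line2_lip u v.
split => //; try exact: line2_0; try by rewrite line2_2.
- exists u, [::]; split => //; have := @line2_r u v 0; rewrite ltr01 lexx => h; apply: h; lra.
- have h := @line2_l u v 2; have h2 : (2 : R) <= 1 = false by apply/negbTE; rewrite -ltNge; lra.
  by exists v, [::]; rewrite h2 in h; split => //; apply: h; lra.
move=> t ht; have hl := @line2_l u v t; have hr := @line2_r u v t.
exists (if t <= 1 then u else v), [::], (if t < 1 then u else v), [::]; split.
- by split => //; case: ifP.
- by split => //; case: ifP.
- by split; apply: hl; lra.
- by split; apply: hr; lra.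
split; first exact: chain_nil.
by move=> k; rewrite !vecE subrr rpred0.
Qed.

(* Directions are regular for [s > 0] even if [u] and [v] are not, and [s = 1]
   depends only on [u + v]. *)
Definition fam u v s := line2 (u + sc s (sc (1 / 2) (u + v) - u)) (v + sc s (sc (1 / 2) (u + v) - v)).

Lemma fam0 u v : fam u v 0 = line2 u v.
Proof.
have e (p q : vec) : p + sc 0 q = p by apply/funext => x; rewrite !vecE; ring.
by rewrite /fam !e.
Qed.

Lemma fam1 u v : fam u v 1 = line2 (sc (1 / 2) (u + v)) (sc (1 / 2) (u + v)).
Proof. by rewrite /fam; congr line2; apply/funext => x; rewrite !vecE; ring. Qed.

Lemma fam_sum u v s :
  (u + sc s (sc (1 / 2) (u + v) - u)) + (v + sc s (sc (1 / 2) (u + v) - v)) = u + v.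
Proof. by apply/funext => x; rewrite !vecE; field. Qed.

Lemma fam_2 u v s : fam u v s 2 = u + v.
Proof. by rewrite /fam line2_2 fam_sum. Qed.

Lemma close_fam S u v : exists2 D, 0 <= D & forall s s',
  close S 2 (D * `|s - s'|) (fam u v s) (fam u v s').
Proof.
set p := sc (1 / 2) (u + v) - u; set q := sc (1 / 2) (u + v) - v.
exists (\sum_(x <- S) (`|p x| + `|q x|)); first by apply: sumr_ge0 => x _; apply: addr_ge0.
move=> s s' x hx t ht.
have hD : `|p x| + `|q x| <= \sum_(y <- S) (`|p y| + `|q y|).
  by rewrite (big_rem x hx) /= lerDl; apply: sumr_ge0 => y _; apply: addr_ge0.
apply: (@le_trans _ _ ((`|p x| + `|q x|) * `|s - s'|)); last exact: ler_wpM2r.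
rewrite /fam -/p -/q /line2; have [t1|t1] := leP t 1; rewrite !vecE.
  have -> : t * (u x + s * p x) - t * (u x + s' * p x) = t * p x * (s - s') by ring.
  rewrite normrM; apply: ler_wpM2r => //; rewrite normrM ger0_norm; last by lra.
  by have := normr_ge0 (p x); have := normr_ge0 (q x); nra.
have -> : u x + s * p x + (t - 1) * (v x + s * q x) - (u x + s' * p x + (t - 1) * (v x + s' * q x))
   = (p x + (t - 1) * q x) * (s - s') by ring.
rewrite normrM; apply: ler_wpM2r => //; apply: le_trans (ler_normD _ _) _.
rewrite normrM [`|t - 1|]ger0_norm; last by lra.
by have := normr_ge0 (q x); nra.
Qed.

Section Family.
Variables u v : vec.
Hypotheses (du : dom u) (dv : dom v) (ruv : reg (u + v)) (iuv : isint (u + v)).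
Local Notation eta s := (fam u v s).

Lemma two_gt0 : (0 : R) < 2. Proof. by []. Qed.
Local Hint Resolve two_gt0 : core.

Lemma LS_fam A s : 0 < s <= 1 -> LS a true A 2 (eta s) (eta s).
Proof.
move=> hs; apply: LS_line2; last by rewrite fam_sum.
  move=> k; have := ruv k; have := du k; have := dv k; rewrite !vecE; nra.
move=> k; have := ruv k; have := du k; have := dv k; rewrite !vecE; nra.
Qed.

Lemma lipp_fam s : lipp 2 (eta s).
Proof. exact: line2_lip. Qed.
Local Hint Resolve lipp_fam : core.

Lemma fam_00 s : eta s 0 = 0.
Proof. exact: line2_0. Qed.

Lemma fam_close M x : exists2 D, 0 <= D & forall s s' t, 0 <= t <= 2 ->
  `|Mop 2 M (eta s) t x - Mop 2 M (eta s') t x| <= D * `|s - s'|.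
Proof.
set S := x :: [seq inl m.2 | m <- M].
have [|D D0 hD] := @close_Mop S M; first by move=> y hy; rewrite inE hy orbT.
have [D' D'0 hD'] := close_fam S u v.
exists (D * D'); first exact: mulr_ge0.
move=> s s' t ht; rewrite -mulrA; apply: hD => //; last by rewrite mem_head.
by rewrite mulr_ge0.
Qed.

Lemma fam_close_finf M j : exists2 D, 0 <= D & forall s s' t, 0 <= t <= 2 ->
  `|finf 2 (Ht (Mop 2 M (eta s)) j) t - finf 2 (Ht (Mop 2 M (eta s')) j) t| <= D * `|s - s'|.
Proof.
have [D D0 hD] := fam_close M (inl j); exists D => // s s' t ht.
apply: (close_finf (S := [:: inl j])) => //; try exact: lipp_Mop; last by rewrite mem_head.
by move=> x; rewrite inE => /eqP -> r hr; exact: hD.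
Qed.

(** Integral for positive parameters and Lipschitz in the parameter, the minimum is constant down to
    [s = 0], where directions may be singular. *)
Lemma fam_mn M j s : 0 <= s <= 1 -> mn 2 (Mop 2 M (eta s)) j = mn 2 (Mop 2 M (eta 1)) j.
Proof.
have [D D0 hD] := fam_close_finf M j.
apply: (@lip_int_const _ D (fun s => mn 2 (Mop 2 M (eta s)) j)) => [p q hp hq|p hp].
  by apply: hD; rewrite lexx ltW.
have ls : LS a true predT 2 (eta p) (Mop 2 M (eta p)).
  by apply: LS_Mop => //; [exact/allP|exact: LS_fam].
by apply: tame_int => //; exact: (LS_tame ga j ls).
Qed.

Lemma fam_end M s : 0 <= s <= 1 -> Mop 2 M (eta s) 2 = Mop 2 M (eta 1) 2.
Proof.
move=> hs; elim: M => [|m M IH] /=; first by rewrite !fam_2.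
rewrite !mop_end //; try exact: lipp_Mop; try by apply: Mop0; exact: fam_00.
by rewrite IH fam_mn.
Qed.

Lemma fam_vf M i s : 0 <= s <= 1 -> vf 2 i (Mop 2 M (eta s)) <-> vf 2 i (Mop 2 M (eta 1)).
Proof. by move=> hs; rewrite /vf fam_mn // fam_end. Qed.

Lemma fam_ve M i s : 0 <= s <= 1 -> ve 2 i (Mop 2 M (eta s)) <-> ve 2 i (Mop 2 M (eta 1)).
Proof. by move=> hs; rewrite /ve fam_mn. Qed.

Lemma fam_vld F s : 0 <= s <= 1 -> vld 2 F (eta s) <-> vld 2 F (eta 1).
Proof.
move=> hs; elim: F => [//|i F IH] /=.
by rewrite IH -!Mop_fop fam_vf.
Qed.

Lemma fam_near s : 0 <= s <= 1 -> forall e, 0 < e -> exists2 r, 0 < r <= 1 & `|s - r| < e.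
Proof.
move=> hs e e0; have [s0|s0] := ltP 0 s; first by exists s; [lra|rewrite subrr normr0].
have d0 : 0 < Num.min (e / 2) 1 by rewrite lt_min ltr01 andbT; lra.
have [d1 d2] : Num.min (e / 2) 1 <= e / 2 /\ Num.min (e / 2) 1 <= 1.
  by rewrite !ge_min !lexx orbT.
exists (Num.min (e / 2) 1); first by lra.
have -> : s = 0 by lra.
by rewrite sub0r normrN gtr0_norm //; lra.
Qed.

Lemma fam_approx (D e s : R) : 0 <= D -> 0 <= s <= 1 -> 0 < e ->
  exists2 r, 0 < r <= 1 & D * `|s - r| < e.
Proof.
move=> D0 hs e0; have [|r hr h] := fam_near hs (e := e / (D + 1)).
  by apply: divr_gt0 => //; lra.
exists r => //; rewrite ltr_pdivlMr in h; last by lra.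
by have := normr_ge0 (s - r); nra.
Qed.

(** A failure would consist of strict inequalities and persist at nearby positive parameters, where
    the path is tame; [e] is the margin in these inequalities. *)
Lemma fam_qprop F i s : 0 <= s <= 1 -> qprop 2 (Ht (Fop 2 F (eta s)) i).
Proof.
move=> hs t ht; rewrite -Mop_fop; set M := map _ _ => hlt.
have [//|h1] := leP (finf 2 (Ht (Mop 2 M (eta s)) i) t) (finf 2 (Ht (Mop 2 M (eta s)) i) 0).
  by left.
right; rewrite leNgt; apply/negP => h2.
have [D D0 hD] := fam_close M (inl i); have [D' D'0 hD'] := fam_close_finf M i.
move: hlt h1 h2; set f := finf 2 _ t; set m := finf 2 _ 0; set g := Ht _ _ _ => hlt h1 h2.
set e := Num.min ((g - f) / 2) (Num.min (f - m) (m + 1 - f)).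
have e0 : 0 < e by rewrite !lt_min; apply/and3P; split; lra.
have [e1 e2 e3] : [/\ e <= (g - f) / 2, e <= f - m & e <= m + 1 - f].
  by rewrite !ge_min !lexx !orbT.
have [r hr h] := fam_approx (addr_ge0 D0 D'0) hs e0.
have hd1 : `|g - Mop 2 M (eta r) t (inl i)| < e.
  apply: le_lt_trans (hD s r t ht) _; apply: le_lt_trans h; apply: ler_wpM2r => //; lra.
have hd2 : `|f - finf 2 (Ht (Mop 2 M (eta r)) i) t| < e.
  apply: le_lt_trans (hD' s r t ht) _; apply: le_lt_trans h; apply: ler_wpM2r => //; lra.
have ls : LS a true predT 2 (eta r) (Mop 2 M (eta r)).
  by apply: LS_Mop => //; [exact/allP|exact: LS_fam].
have q := tame_qprop two_gt0 (LS_tame ga i ls) ht.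
have em : m = finf 2 (Ht (Mop 2 M (eta r)) i) 0.
  by rewrite /m -!/(mn _ _ _) fam_mn // [RHS]fam_mn //; lra.
move: q; rewrite -em /Ht; move: hd1 hd2; rewrite !ltr_norml.
move: (Mop _ _ _ t (inl i)) (finf _ _ t) => g' f' /andP[a1 a2] /andP[a3 a4] q.
by case: q; lra.
Qed.

Definition unF F := [seq (false, i) | i <- rev F].

Lemma unF_rcons i F : unF (i :: F) = rcons (unF F) (false, i).
Proof. by rewrite /unF rev_cons map_rcons. Qed.

Lemma unF_Fop F s : 0 <= s <= 1 -> vld 2 F (eta s) ->
  eqon 2 (Mop 2 (unF F) (Fop 2 F (eta s))) (eta s).
Proof.
move=> hs; elim: F => [//|i F IH] /= [vF vi]; rewrite unF_rcons -cats1 Mop_cat /=.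
apply: (eqon_trans _ (IH vF)); apply: Mop_eqon; rewrite /mop /=.
apply: (eop_fop ga) => //; first exact: lipp_Fop.
  by rewrite Fop0 fam_00.
exact: fam_qprop.
Qed.

(* Undo the word [F] by the inverse operators; zero total displacement along a
   regular base forces the base itself. *)
Lemma fam_eq_transfer F G s s' : 0 <= s <= 1 -> 0 < s' <= 1 ->
  vld 2 F (eta 1) -> vld 2 G (eta 1) ->
  eqon 2 (Fop 2 F (eta s)) (Fop 2 G (eta s)) -> eqon 2 (Fop 2 F (eta s')) (Fop 2 G (eta s')).
Proof.
move=> hs hs' vF vG e; have hs1 : 0 <= s' <= 1 by lra.
have vFs : vld 2 F (eta s) by apply/fam_vld.
have vFs' : vld 2 F (eta s') by apply/fam_vld.
pose N := map (pair true) G.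
have lsG : LS a true predT 2 (eta s') (Fop 2 G (eta s')).
  by apply: LS_Fop => //; [exact/allP|exact: LS_fam].
have endG : Mop 2 (unF F) (Fop 2 G (eta s')) 2 = eta s' 2.
  have E r : Mop 2 (unF F) (Fop 2 G (eta r)) = Mop 2 (unF F ++ map (pair true) G) (eta r).
    by rewrite Mop_cat Mop_fop.
  rewrite E (fam_end _ hs1) -(fam_end _ hs) -E.
  rewrite -(Mop_eqon (unF F) e) ?lexx ?ltW // (unF_Fop hs vFs) ?lexx ?ltW //.
  by rewrite !fam_2.
have lsE : LS a true predT 2 (eta s') (Mop 2 (unF F) (Fop 2 G (eta s'))).
  by apply: LS_Mop => //; exact/allP.
have h1 : eqon 2 (Mop 2 (unF F) (Fop 2 G (eta s'))) (eta s').
  by apply: (LS_tr0 ga two_gt0 lsE) => k; rewrite endG.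
suff h2 : eqon 2 (Fop 2 F (Mop 2 (unF F) (Fop 2 G (eta s')))) (Fop 2 G (eta s')).
  by apply: eqon_trans (Fop_eqon a F (eqon_sym h1)) h2.
(* At [s] the partly undone path is [F2] applied to the base, so the next [e_i] is nonzero there.
   Non-vanishing carries over to [s'], where [f_i e_i] is therefore the identity. *)
have ind F1 F2 : F = F1 ++ F2 ->
  eqon 2 (Fop 2 F1 (Mop 2 (unF F1) (Fop 2 G (eta s')))) (Fop 2 G (eta s')) /\
  eqon 2 (Mop 2 (unF F1) (Fop 2 G (eta s))) (Fop 2 F2 (eta s)).
  elim/last_ind: F1 F2 => [|F1 i IH] F2 eF.
    by split => //; move: eF => /= <-; exact: eqon_sym.
  rewrite -cats1 -catA /= in eF; have [IH1 IH2] := IH _ eF.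
  have vF2 : vld 2 (i :: F2) (eta s).
    by move: vFs; rewrite eF; elim: (F1) => //= j F1' h [/h].
  have eu : unF (rcons F1 i) = (false, i) :: unF F1 by rewrite /unF rev_rcons.
  have lF2 : lipp 2 (Fop 2 F2 (eta s)) by exact: lipp_Fop.
  have z2 : Fop 2 F2 (eta s) 0 = 0 by rewrite Fop0 fam_00.
  have q2 : qprop 2 (Ht (Fop 2 F2 (eta s)) i) by exact: fam_qprop.
  case: vF2 => vF2 vi2.
  have vei : ve 2 i (Fop 2 (i :: F2) (eta s)).
    rewrite /ve /= (mn_fop ga two_gt0 lF2 q2 vi2) subrK.
    by apply: mn_le0.
  have vei' : ve 2 i (Mop 2 (unF F1) (Fop 2 G (eta s'))).
    have E r : Mop 2 (unF F1) (Fop 2 G (eta r)) = Mop 2 (unF F1 ++ map (pair true) G) (eta r).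
      by rewrite Mop_cat Mop_fop.
    rewrite E; apply: (fam_ve _ _ hs1).2; apply: (fam_ve _ _ hs).1.
    by rewrite -E /ve (mn_eqon i IH2); exact: vei.
  have lsE2 : LS a true predT 2 (eta s') (Mop 2 (unF F1) (Fop 2 G (eta s'))).
    by apply: LS_Mop => //; exact/allP.
  have [g1 g2 g3] := fop_eop ga two_gt0 lsE2 vei'.
  rewrite eu /=; split.
    rewrite -cats1; apply: eqon_trans IH1.
    have -> b : Fop 2 (F1 ++ [:: i]) b = Fop 2 F1 (fop 2 i b).
      by elim: (F1) => //= j F1' ->.
    by apply: Fop_eqon.
  apply: (eqon_trans (eop_eqon a i IH2)); exact: (eop_fop ga).
by have [] := ind F [::] (esym (cats0 F)).
Qed.

(** The transfer reaches only positive parameters; an equality at [s = 0] is recovered from those by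
    continuity. *)
Lemma fam_eq F G s : 0 <= s <= 1 -> vld 2 F (eta 1) -> vld 2 G (eta 1) ->
  eqon 2 (Fop 2 F (eta s)) (Fop 2 G (eta s)) <-> eqon 2 (Fop 2 F (eta 1)) (Fop 2 G (eta 1)).
Proof.
move=> hs vF vG; have h1 : 0 < (1 : R) <= (1 : R) by lra.
have h1' : 0 <= (1 : R) <= (1 : R) by lra.
split; first exact: fam_eq_transfer.
move=> e t ht; apply/funext => x; apply/eqP; rewrite -subr_eq0 -normr_eq0 eq_le normr_ge0 andbT.
rewrite leNgt; apply/negP; set z := `|_| => z0.
have [D D0 hD] := fam_close (map (pair true) F) x.
have [D' D'0 hD'] := fam_close (map (pair true) G) x.
have [r hr h] := fam_approx (addr_ge0 D0 D'0) hs z0.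
have er := fam_eq_transfer h1' hr vF vG e ht.
have := hD s r t ht; have := hD' s r t ht; rewrite !Mop_fop er => a1 a2.
have : z <= D * `|s - r| + D' * `|s - r|.
  rewrite /z.
  have sub3 (p q y : R) : p - q = (p - y) - (q - y) by ring.
  rewrite (sub3 _ _ (Fop 2 G (eta r) t x)).
  by apply: le_trans (ler_normB _ _) _; apply: lerD; [exact: a2|exact: a1].
rewrite -mulrDl => a3; lra.
Qed.

(** At [s = 1] the base is regular and [LS_lower] applies; validity and the resulting equality of
    words do not depend on the parameter. *)
Lemma fam_lower G i s : 0 <= s <= 1 -> vld 2 G (eta s) -> ve 2 i (Fop 2 G (eta s)) ->
  exists G', [/\ perm_eq (i :: G') G, vld 2 (i :: G') (eta s) &
    eqon 2 (Fop 2 G (eta s)) (Fop 2 (i :: G') (eta s))].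
Proof.
move=> hs vG vi; have h1 : 0 < (1 : R) <= (1 : R) by lra.
have vG1 : vld 2 G (eta 1) by apply/(fam_vld _ hs).
have ls : LS a true predT 2 (eta 1) (Fop 2 G (eta 1)).
  by apply: LS_Fop => //; [exact/allP|exact: LS_fam].
have [||G' [p1 p2 p3]] := LS_lower ga two_gt0 (fun _ => isT) ls (i := i) (F := G).
- by have := fam_ve (map (pair true) G) i hs; rewrite !Mop_fop => -[h _]; exact: h.
- by move=> k; rewrite Fop_end // sum_al_inr.
exists G'; split => //; first by apply/fam_vld.
by apply/fam_eq.
Qed.

End Family.
End Deformation.

(** * Progress of a letter foreign to the word *)

Section Fresh.
Variables (R : realType) (K : choiceType) (a : K -> K -> int).
Hypothesis ga : gcm a.
Local Notation vec := ((K + K)%type -> R).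
Local Notation act := (act a).
Local Notation Fop := (Fop a).
Implicit Types (b c eta : R -> vec) (w : seq K) (L t s d : R) (i j k : K).
Implicit Types (u v : vec).

Section FreshLetter.
Variables (A : pred K) (L : R) (b eta : R -> vec) (i : K) (u : vec).
Hypotheses (Ai : ~~ A i) (L1 : L > 1) (ls : LS a true A L eta b).
Hypotheses (lin : forall t, t <= 1 -> eta t = sc t u).

Lemma fresh_notin w : all A w -> i \notin w.
Proof. by move=> /allP h; apply/negP => /h; rewrite (negbTE Ai). Qed.

(** No direction involves [i], so the slope at [i] is always positive and the height is its own
    future infimum. *)
Lemma fresh_finf t : 0 <= t <= L -> finf L (Ht b i) t = Ht b i t.
Proof.
move=> ht; have L0 : 0 < L := lt_trans ltr01 L1.
have [C lC] := ls_lip ls (inl i).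
have [t' h1 [h2 h3 h4]] := last_min lC L0 ht.
suff <- : t' = t by rewrite h2 -h3.
apply/eqP; rewrite eq_le; apply/andP; split; last by lra.
rewrite leNgt; apply/negP => tt'.
have [nu [w [rn hw [e [e0 he] hl]]]] : exists nu w, [/\ regO true nu, all A w & lgerm b t' (act w nu)].
  have [tL|tL] := ltP t' L; last first.
    have [nu [w [h5 h6 _ h7]]] := ls_finish ls.
    have -> : t' = L by lra.
    by exists nu, w.
  have [|nu [w [nu' [w' [[h5 h6] _ [_ h7] _ _]]]]] := ls_mid ls (t := t'); first by lra.
  by exists nu, w.
have pw : rise R a true i w by exact: (pos_notin R ga (fresh_notin hw)).
have p := rise_gt ga rn pw.
pose d := Num.min e (t' - t).
have d0 : 0 < d by rewrite lt_min; apply/andP; split; lra.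
have [d1 d2] : d <= e /\ d <= t' - t by rewrite !ge_min !lexx orbT.
have := hl (t' - d); rewrite -/d => h5.
have {}h5 : b (t' - d) = b t' + sc (t' - d - t') (act w nu) by apply: h5; lra.
have h6 : finf L (Ht b i) t <= Ht b i (t' - d) by apply: (finf_le lC); lra.
by move: h6; rewrite /Ht h5 -[finf _ _ _]h3 !vecE; nra.
Qed.

Lemma fresh_mono s t : 0 <= s -> s <= t -> t <= L -> Ht b i s <= Ht b i t.
Proof.
move=> s0 st tL; have [C lC] := ls_lip ls (inl i).
by rewrite -[leLHS]fresh_finf ?(finf_le lC) //; lra.
Qed.

(* The slope on the letter [i] can only drop, at a time [t] by an element of
   [Z / t], so that the height is at least [1] from then on. *)
Lemma fresh_linear : exists sg, forall t, 0 <= t <= 1 -> Ht b i t = t * sg \/ 1 <= Ht b i t.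
Proof.
have [nu [w [rn hw ge [e [e0 he] gb]]]] := ls_start ls.
set sg := act w nu (inl i); exists sg.
pose P t := forall s, 0 <= s <= t -> Ht b i s = s * sg.
have H0 : Ht b i 0 = 0 by rewrite /Ht (ls_0 ls).
have P0 : P 0.
  move=> s hs; have -> : s = 0 by lra.
  by rewrite H0 mul0r.
have [t' [h1 h2 h3]] := last_time ler01 P0.
have Plt s : 0 <= s < t' -> Ht b i s = s * sg.
  move=> hs; have [|s1 hs1 [_ _ Ps1]] := h3 (t' - s); first by lra.
  by apply: Ps1; lra.
have Pe : 0 < Num.min e 1 by rewrite lt_min ltr01 andbT.
have [e1 e2] : Num.min e 1 <= e /\ Num.min e 1 <= 1 by rewrite !ge_min !lexx orbT.
have t'0 : 0 < t'.
  rewrite ltNge; apply/negP => t'0; have := h2 (Num.min e 1); apply; first by lra.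
  move=> s hs; rewrite /Ht gb ?vecE; last by lra.
  by rewrite (ls_0 ls) vecE subr0 -/sg; ring.
have [h4|h4] := ltP t' 1; last first.
  move=> t ht; have [tt|tt] := ltP t t'; first by left; apply: Plt; lra.
  have -> : t = 1 by lra.
  left; have [C lC] := ls_lip ls (inl i).
  have [|g1 [w1 [g2 [w2 [_ _ [_ [d [d0 hd] gl]] _ _]]]]] := ls_mid ls (t := 1); first by rewrite ltr01.
  pose r := Num.min d 1.
  have r0 : 0 < r by rewrite lt_min ltr01 andbT.
  have [r1 r2] : r <= d /\ r <= 1 by rewrite !ge_min !lexx orbT.
  have a1 : b (1 - r) (inl i) = (1 - r) * sg by apply: Plt; lra.
  have a2 : b (1 - r / 2) (inl i) = (1 - r / 2) * sg by apply: Plt; lra.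
  rewrite gl in a1; last by lra.
  rewrite gl in a2; last by lra.
  have r' : r != 0 by lra.
  move: a1 a2; rewrite /Ht !vecE; move: (b 1 _) (act _ _ _) => y z a1 a2.
  have a3 : z = sg by apply: (mulfI r'); lra.
  by rewrite a3 in a1; lra.
have [|g1 [w1 [g2 [w2 [[rg1 hw1] [rg2 hw2] [gel gbl] [ger gbr] [hc hi]]]]]] := ls_mid ls (t := t').
  by rewrite t'0 (lt_trans h4 L1).
have hg1 : g1 = u.
  have [d [d0 hd] gl] := gel.
  have := gl (t' - d); have q1 := lin (ltW h4); have q2 : eta (t' - d) = sc (t' - d) u by apply: lin; lra.
  rewrite q1 q2.
  have hdd : t' - d <= t' - d <= t' by lra.
  move=> /(_ hdd) h; apply/funext => x; have := congr1 (fun f => f x) h; rewrite !vecE => h5.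
  have d' : d != 0 by lra.
  by apply: (mulfI d'); lra.
have hg2 : g2 = u.
  have [d [d0 hd] gl] := ger.
  pose r := Num.min d (1 - t').
  have r0 : 0 < r by rewrite lt_min; apply/andP; split; lra.
  have [r1 r2] : r <= d /\ r <= 1 - t' by rewrite !ge_min !lexx orbT.
  have := gl (t' + r); have q1 := lin (ltW h4); have q2 : eta (t' + r) = sc (t' + r) u by apply: lin; lra.
  rewrite q1 q2.
  have hdd : t' <= t' + r <= t' + d by lra.
  move=> /(_ hdd) h; apply/funext => x; have := congr1 (fun f => f x) h; rewrite !vecE => h5.
  have d' : r != 0 by lra.
  by apply: (mulfI d'); lra.
rewrite hg1 hg2 in gbl gbr rg1 rg2.
have [Ht' l1] : Ht b i t' = t' * sg /\ act w1 u (inl i) = sg.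
  have [d [d0 hd] gl] := gbl.
  pose r := Num.min d t'.
  have r0 : 0 < r by rewrite lt_min; apply/andP; split; lra.
  have [r1 r2] : r <= d /\ r <= t' by rewrite !ge_min !lexx orbT.
  have a1 : b (t' - r) (inl i) = (t' - r) * sg by apply: Plt; lra.
  have a2 : b (t' - r / 2) (inl i) = (t' - r / 2) * sg by apply: Plt; lra.
  rewrite gl in a1; last by lra.
  rewrite gl in a2; last by lra.
  have r' : r != 0 by lra.
  move: a1 a2; rewrite /Ht !vecE; move: (b t' _) (act _ _ _) => y z a1 a2.
  have a3 : z = sg by apply: (mulfI r'); lra.
  by split => //; rewrite a3 in a1; lra.
have Pt' : P t'.
  move=> s hs; have [st|st] := ltP s t'; first by apply: Plt; lra.
  by have -> : s = t' by lra.
pose r := act w2 u (inl i).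
have pw : rise R a true i w2 by exact: (pos_notin R ga (fresh_notin hw2)).
have r0 : 0 < r := rise_gt ga rg2 pw.
have drop : r <= sg.
  rewrite -l1 /r; elim: hc hw1 hw2 => {gbl gbr hi l1 r r0} [p q h|p x q st hx hc IH] hp hq.
    by rewrite h.
  apply: le_trans (IH hx hq) _.
  exact: (cov_fresh ga (fresh_notin hp) (fresh_notin hx) (reg_dom rg1) st).
have dint : t' * (sg - r) \is a Num.int.
  have := chain_congr ga hc i; rewrite lin; last by lra.
  by rewrite !act_sc !vecE l1 -/r mulrBr.
have [rs|rs] := eqVneq r sg.
  exfalso; have [d [d0 hd] gr] := gbr.
  pose q := Num.min d (1 - t').
  have q0 : 0 < q by rewrite lt_min; apply/andP; split; lra.
  have [q1 q2] : q <= d /\ q <= 1 - t' by rewrite !ge_min !lexx orbT.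
  apply: (h2 (t' + q)); first by lra.
  move=> s hs; have [st|st] := leP s t'; first by apply: Pt'; lra.
  rewrite /Ht gr; last by lra.
  by rewrite !vecE -/r rs; move: Ht'; rewrite /Ht => ->; ring.
have big : 1 <= t' * (sg - r).
  have h5 : (0 : R) \is a Num.int by rewrite rpred0.
  have := int_lt_le h5 dint; rewrite add0r; apply.
  by apply: mulr_gt0 => //; rewrite subr_gt0 lt_neqAle rs.
move=> t ht; have [tt|tt] := leP t t'; first by left; apply: Pt'; lra.
have [t10 t11] := andP ht; have L2 : t <= L := le_trans t11 (ltW L1).
right; apply: (@le_trans _ _ (Ht b i t')); last by apply: fresh_mono => //; lra.
by rewrite Ht'; nra.
Qed.

(** Proportionality to time is stated without the slope, which depends on the deformation parameter,
    so that it survives the limit in [line2_fresh_X]. *)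
Lemma fresh_X t t' : 0 <= t' -> t' <= t -> t <= 1 -> Xt L (Ht b i) t < 1 ->
  t * Xt L (Ht b i) t' = t' * Xt L (Ht b i) t.
Proof.
move=> t'0 tt t1; have [sg hs] := fresh_linear.
have H0 : Ht b i 0 = 0 by rewrite /Ht (ls_0 ls).
have tL : t <= L := le_trans t1 (ltW L1).
rewrite /Xt !fresh_finf ?H0 ?subr0; try by lra.

have m := fresh_mono t'0 tt; rewrite ltNge le_min lexx /= -ltNge => h.
have {}m : Ht b i t' <= Ht b i t by apply: m; lra.
rewrite !min_r; try by lra.
have [|->|] := hs t; [by lra| |by lra].
have [|->|] := hs t'; [by lra| |by lra].
ring.
Qed.

End FreshLetter.

Lemma line2_fresh_X u v F i t t' : dom u -> dom v -> reg (u + v) -> isint (u + v) -> i \notin F ->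
  0 <= t' -> t' <= t -> t <= 1 ->
  Xt 2 (Ht (Fop 2 F (line2 u v)) i) t < 1 ->
  t * Xt 2 (Ht (Fop 2 F (line2 u v)) i) t' = t' * Xt 2 (Ht (Fop 2 F (line2 u v)) i) t.
Proof.
move=> du dv ruv iuv iF t'0 tt t1.
have L0 : (0 : R) < 2 by [].
have [D D0 hD] := fam_close_finf a u v (map (pair true) F) i.
pose X s := Xt 2 (Ht (Fop 2 F (fam u v s)) i).
have cX s r : 0 <= r <= 1 -> `|X 0 r - X s r| <= 2 * D * `|s|.
  move=> hr; have := hD 0 s r; have := hD 0 s 0; rewrite !Mop_fop sub0r normrN.
  have h0 : 0 <= (0 : R) <= 2 by lra.
  have h1 : 0 <= (r : R) <= 2 by lra.
  move=> /(_ h0) + /(_ h1); rewrite /X /Xt.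
  move: (finf _ _ 0) (finf _ _ r) (finf _ _ 0) (finf _ _ r) => m f m' f'.
  rewrite !ler_norml => /andP[p1 p2] /andP[p3 p4].
  by have [h5|h5] := leP 1 (f - m); have [h6|h6] := leP 1 (f' - m'); apply/andP; split; lra.
rewrite -fam0 -/(X 0 _) => hX1; rewrite -/(X 0 _).
have lX s : 0 < s <= 1 -> X s t < 1 -> t * X s t' = t' * X s t.
  move=> hs; have ls : LS a true (mem F) 2 (fam u v s) (Fop 2 F (fam u v s)).
    by apply: LS_Fop => //; last exact: LS_fam; apply/allP.
  apply: (fresh_X (A := mem F) _ _ ls) => //; first by lra.
  by move=> r hr; rewrite /fam /line2 hr.
apply/eqP; rewrite -subr_eq0 -normr_eq0 eq_le normr_ge0 andbT leNgt; apply/negP.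
set z := `|_| => z0.
have D2 : 0 <= 2 * D + 2 * D by lra.
have z1 : 0 < Num.min z (1 - X 0 t) by rewrite lt_min z0 subr_gt0.
have h01 : 0 <= (0 : R) <= 1 by rewrite lexx ler01.
have [r hr h] := fam_approx D2 h01 z1.
have [e1 e2] : Num.min z (1 - X 0 t) <= z /\ Num.min z (1 - X 0 t) <= 1 - X 0 t.
  by rewrite !ge_min !lexx orbT.
rewrite sub0r normrN in h; have nr := normr_ge0 r.
have c1 : `|X 0 t - X r t| <= 2 * D * `|r| by apply: cX; lra.
have c2 : `|X 0 t' - X r t'| <= 2 * D * `|r| by apply: cX; lra.
have : X r t < 1 by move: c1; rewrite ler_norml => /andP[]; nra.
move/(lX _ hr) => e.
have : z <= 2 * D * `|r| + 2 * D * `|r|.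
  rewrite /z.
  have -> : t * X 0 t' - t' * X 0 t = t * (X 0 t' - X r t') - t' * (X 0 t - X r t).
    by rewrite !mulrBr e; ring.
  apply: le_trans (ler_normB _ _) _; rewrite !normrM ger0_norm ?[`|t'|]ger0_norm //; last by lra.
  by have := normr_ge0 (X 0 t - X r t); have := normr_ge0 (X 0 t' - X r t'); nra.
by lra.
Qed.

End Fresh.

(** * Tensor products *)

Section TensorRule.
Variables (R : realType) (K : choiceType) (a : K -> K -> int).
Hypothesis ga : gcm a.
Local Notation vec := ((K + K)%type -> R).
Local Notation al := (al R a).
Local Notation fop := (fop a).
Local Notation Fop := (Fop a).
Local Notation vld := (vld a).
Implicit Types (b c d : R -> vec) (F G : seq K) (T U t s : R) (A : pred K) (i j k : K).
Implicit Types (u v : vec).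

(** Time is not rescaled: lengths add, and concatenation is associative. The unit interval is
    restored only when comparing with the original paths. *)
Definition cat T b c : R -> vec := fun t => if t <= T then b t else b T + c (t - T).

Lemma cat_l T b c t : t <= T -> cat T b c t = b t.
Proof. by rewrite /cat => ->. Qed.

Lemma cat_r T b c t : c 0 = 0 -> T <= t -> cat T b c t = b T + c (t - T).
Proof.
rewrite /cat => c0 h; case: ifP => h' //.
have -> : t = T by apply/eqP; rewrite eq_le h' h.
by rewrite subrr c0 addr0.
Qed.

Lemma cat_assoc T U b c d : 0 < U -> c 0 = 0 -> cat (T + U) (cat T b c) d = cat T b (cat U c d).
Proof.
move=> U0 c0; apply/funext => t; rewrite /cat; have [h1|h1] := leP t (T + U).
  have -> : t - T <= U by lra.
  by [].
have -> : t - T <= U = false by apply/negbTE; rewrite -ltNge; lra.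
have -> : t <= T = false by apply/negbTE; rewrite -ltNge; lra.
have -> : T + U <= T = false by apply/negbTE; rewrite -ltNge; lra.
have -> : t - (T + U) = t - T - U by ring.
have -> : T + U - T = U by ring.
by rewrite addrA.
Qed.

Lemma cat_eqon T U b b' c c' : 0 <= T -> eqon T b b' -> eqon U c c' -> eqon (T + U) (cat T b c) (cat T b' c').
Proof.
move=> T0 hb hc t ht; rewrite /cat; case: leP => h; first by apply: hb; lra.
by rewrite hb ?hc //; lra.
Qed.

Lemma cat_inj T U b b' c c' : 0 <= T -> 0 <= U -> c 0 = 0 -> c' 0 = 0 ->
  eqon (T + U) (cat T b c) (cat T b' c') -> eqon T b b' /\ eqon U c c'.
Proof.
move=> T0 U0 c0 c0' h.
have h1 : eqon T b b' by move=> t ht; have := h t; rewrite !cat_l; [apply; lra|lra|lra].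
split => // t ht; have q : T <= T + t by lra.
have := h (T + t); rewrite (cat_r _ c0 q) (cat_r _ c0' q).
have e : T + t - T = t by ring.
rewrite e h1; last by rewrite lexx T0.
by move=> e2; apply: (addrI (b' T)); apply: e2; lra.
Qed.

Section Two.
Variables (T U : R) (b c : R -> vec).
Hypotheses (T0 : 0 < T) (U0 : 0 < U) (lb : lipp T b) (lc : lipp U c) (c0 : c 0 = 0).
Local Notation bc := (cat T b c).

Lemma lipp_cat : lipp (T + U) bc.
Proof.
have T0' := T0; have U0' := U0.
move=> x; have [C lC] := lb x; have [D lD] := lc x.
have C0 := lip_ge0 lC T0; have D0 := lip_ge0 lD U0.
exists (C + D) => s t hs ht.
wlog st : s t hs ht / s <= t.
  by move=> h; have [|/ltW] := leP s t => st; [|rewrite distrC [`|s - t|]distrC]; apply: h.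
rewrite distrC [`|s - t|]distrC [`|t - s|]ger0_norm ?subr_ge0 //.
have [tT|tT] := leP t T.
  have sT : s <= T := le_trans st tT.
  rewrite !cat_l //; apply: le_trans (lC t s _ _) _; try by lra.
  by rewrite ger0_norm; nra.
have [sT|sT] := leP s T; last first.
  rewrite (cat_r _ c0 (ltW sT)) (cat_r _ c0 (ltW tT)) !vecE opprD addrACA subrr add0r.
  apply: le_trans (lD (t - T) (s - T) _ _) _; try by lra.
  by rewrite ger0_norm; nra.
rewrite (cat_l _ _ sT) (cat_r _ c0 (ltW tT)) !vecE.
have h1 : `|b T x - b s x| <= C * (T - s).
  by rewrite -[X in _ <= _ * X]ger0_norm; [apply: lC; lra|lra].
have h2 : `|c (t - T) x - c 0 x| <= D * (t - T).
  have e : `|t - T - 0| = t - T by rewrite subr0 ger0_norm; lra.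
  by rewrite -[X in _ <= _ * X]e; apply: lD; lra.
rewrite c0 !vecE subr0 in h2.
have -> : b T x + c (t - T) x - b s x = (b T x - b s x) + c (t - T) x by ring.
apply: le_trans (ler_normD _ _) _; apply: le_trans (lerD h1 h2) _.
have h3 : 0 <= D * (T - s) by apply: mulr_ge0 => //; lra.
have h4 : 0 <= C * (t - T) by apply: mulr_ge0 => //; lra.
by lra.
Qed.

Lemma cat_finf_r i t : T <= t -> t <= T + U ->
  finf (T + U) (Ht bc i) t = b T (inl i) + finf U (Ht c i) (t - T).
Proof.
have T0' := T0; have U0' := U0.
move=> h1 h2; have [C lC] := lipp_cat (inl i); have [D lD] := lc (inl i).
apply/eqP; rewrite eq_le; apply/andP; split.
  rewrite -lerBlDl; apply: (le_finf lD) => [|s hs]; first by lra.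
  rewrite lerBlDl; have : finf (T + U) (Ht bc i) t <= Ht bc i (T + s) by apply: (finf_le lC); lra.
  rewrite /Ht cat_r //; last by lra.
  by have -> : T + s - T = s by ring.
apply: (le_finf lC) => [|s hs]; first by lra.
rewrite /Ht cat_r //; last by lra.
by rewrite !vecE lerD2l; apply: (finf_le lD); lra.
Qed.

Lemma cat_finf_l i t : 0 <= t -> t <= T ->
  finf (T + U) (Ht bc i) t = Num.min (finf T (Ht b i) t) (b T (inl i) + mn U c i).
Proof.
have T0' := T0; have U0' := U0.
move=> h1 h2; have [C lC] := lipp_cat (inl i); have [D lD] := lb (inl i).
have hr := @cat_finf_r i T (lexx _); rewrite subrr -/(mn _ _ _) in hr.
have {}hr : finf (T + U) (Ht bc i) T = b T (inl i) + mn U c i by apply: hr; lra.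
apply/eqP; rewrite eq_le le_min -andbA; apply/and3P; split.
- apply: (le_finf lD) => [|s hs]; first by lra.
  by have : finf (T + U) (Ht bc i) t <= Ht bc i s; [apply: (finf_le lC); lra|rewrite /Ht cat_l //; lra].
- by rewrite -hr; apply: (finf_mono lC); lra.
apply: (finf_split lC (t := T)) => //; [lra| |by rewrite hr ge_min lexx orbT].
move=> r hr'; rewrite /Ht cat_l; last by lra.
by rewrite ge_min; apply/orP; left; apply: (finf_le lD); lra.
Qed.

Lemma mn_cat i : mn (T + U) bc i = Num.min (mn T b i) (b T (inl i) + mn U c i).
Proof. by rewrite /mn cat_finf_l // ltW. Qed.

Lemma cat_end : bc (T + U) = b T + c U.
Proof. by rewrite cat_r //; [have -> : T + U - T = U by ring|rewrite lerDl ltW]. Qed.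

(** For integral data the hypothesis reads phi_i of [b] greater than epsilon_i of [c]: the minimum
    is attained for the last time inside [b], with a full unit to climb before [b] ends. *)
Lemma fop_cat_l i : mn T b i + 1 <= b T (inl i) + mn U c i ->
  eqon (T + U) (fop (T + U) i bc) (cat T (fop T i b) c).
Proof.
have T0' := T0; have U0' := U0.
move=> h t ht; have hm := mn_cat i; rewrite min_l in hm; last by lra.
have [tT|tT] := leP t T.
  rewrite cat_l // /fop cat_l //; congr (_ - sc _ _).
  rewrite /Xt cat_finf_l ?(proj1 (andP ht)) // -/(mn _ _ _) hm -/(mn T b i).
  have [h1|h1] := leP (finf T (Ht b i) t) (b T (inl i) + mn U c i) => //.
  by rewrite !min_l //; lra.
have tT' := ltW tT.
have X1 : Xt T (Ht b i) T = 1.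
  have := mn_le0 i U0 lc c0; rewrite Xt_end // => h'; rewrite min_l //; lra.
have X2 : Xt (T + U) (Ht bc i) t = 1.
  have [C lC] := lc (inl i).
  rewrite /Xt cat_finf_r //; last by lra.
  rewrite -/(mn _ bc i) hm min_l //.
  have : mn U c i <= finf U (Ht c i) (t - T) by apply: (finf_mono lC); lra.
  by lra.
by rewrite cat_r // {1}/fop X2 /fop X1 cat_r // addrAC.
Qed.

Lemma fop_cat_r i : b 0 = 0 -> b T (inl i) + mn U c i <= mn T b i ->
  eqon (T + U) (fop (T + U) i bc) (cat T b (fop U i c)).
Proof.
have T0' := T0; have U0' := U0.
move=> b0 h t ht; have hm := mn_cat i; rewrite min_r in hm; last by lra.
have [C lC] := lb (inl i).
have [tT|tT] := leP t T.
  rewrite cat_l // /fop cat_l //.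
  suff -> : Xt (T + U) (Ht bc i) t = 0 by apply/funext => x; rewrite !vecE mul0r subr0.
  rewrite /Xt cat_finf_l ?(proj1 (andP ht)) // -/(mn _ _ _) hm.
  have : mn T b i <= finf T (Ht b i) t by apply: (finf_mono lC); lra.
  by move=> h1; rewrite [X in X - _]min_r; [rewrite subrr min_r|lra].
have tT' := ltW tT.
rewrite cat_r //; last by rewrite fop0.
rewrite /fop cat_r // /Xt cat_finf_r //; last by lra.
rewrite -/(mn _ bc i) hm -/(mn U c i) addrA.
by have -> (p q r : R) : p + q - (p + r) = q - r by ring.
Qed.

Lemma qprop_cat i : b 0 = 0 -> qprop T (Ht b i) -> qprop U (Ht c i) -> mn T b i \is a Num.int ->
  mn U c i \is a Num.int -> b T (inl i) \is a Num.int -> qprop (T + U) (Ht bc i).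
Proof.
have T0' := T0; have U0' := U0.
move=> b0 qb qc mb mc eb t ht; rewrite -/(mn _ bc i) mn_cat.
have hi : b T (inl i) + mn U c i \is a Num.int by rewrite rpredD.
have im x : x \is a Num.int -> x <= Num.min (mn T b i) (b T (inl i) + mn U c i) \/
    Num.min (mn T b i) (b T (inl i) + mn U c i) + 1 <= x.
  move=> ix; have [|h] := leP x (Num.min (mn T b i) (b T (inl i) + mn U c i)); first by left.
  by right; apply: int_lt_le => //; case: leP.
have [tT|tT] := leP t T.
  rewrite cat_finf_l ?(proj1 (andP ht)) //; case: (leP (finf T (Ht b i) t)) => h1 h2; last exact: im.
  rewrite /Ht cat_l // in h2; have ht' : 0 <= t <= T by lra.
  have [h3|h3] := qb _ ht' h2.
    have -> : finf T (Ht b i) t = mn T b i.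
      apply/eqP; rewrite eq_le h3 /=; have [C lC] := lb (inl i).
      by apply: (finf_mono lC); lra.
    exact: im.
  right; apply: le_trans h3; rewrite lerD2r ge_min lexx //.
have tT' := ltW tT; have tU : t <= T + U by lra.
rewrite cat_finf_r // /Ht cat_r // !vecE ltrD2l => h1.
have ht' : 0 <= t - T <= U by lra.
have [h3|h3] := qc _ ht' h1.
  have e : finf U (Ht c i) (t - T) = mn U c i.
    apply/eqP; rewrite eq_le h3 /=; have [C lC] := lc (inl i).
    by apply: (finf_mono lC); lra.
  by rewrite -/(Ht c i) e; exact: im.
right; rewrite -/(Ht c i); apply: (@le_trans _ _ (b T (inl i) + mn U c i + 1)).
  by rewrite lerD2r ge_min lexx orbT.
by rewrite -addrA lerD2l.
Qed.

End Two.
End TensorRule.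

(** * Similarity of paths under words *)

Section Similarity.
Variables (R : realType) (K : choiceType) (a : K -> K -> int).
Hypothesis ga : gcm a.
Local Notation vec := ((K + K)%type -> R).
Local Notation al := (al R a).
Local Notation fop := (fop a).
Local Notation Fop := (Fop a).
Local Notation vld := (vld a).
Implicit Types (b c d : R -> vec) (F G W : seq K) (T U t s : R) (A : pred K) (i j k : K).
Implicit Types (u v : vec).

Lemma Fop_cat T F G b : Fop T (F ++ G) b = Fop T F (Fop T G b).
Proof. by elim: F => //= i F ->. Qed.

Lemma vld_cat T F G b : vld T (F ++ G) b <-> vld T G b /\ vld T F (Fop T G b).
Proof.
elim: F => [|i F IH] /=; first by split => [|[]].
by rewrite IH Fop_cat; split => [[[]]|[? []]].
Qed.

Lemma lipp_eqon T b c : eqon T b c -> lipp T b -> lipp T c.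
Proof. by move=> h lb x; have [C lC] := lb x; exists C => s t hs ht; rewrite -!h //; exact: lC. Qed.

Lemma qprop_eqon T b c i : eqon T b c -> 0 <= T -> qprop T (Ht b i) -> qprop T (Ht c i).
Proof.
move=> h T0 q t ht.
have e s : 0 <= s <= T -> finf T (Ht c i) s = finf T (Ht b i) s.
  by move=> hs; apply: finf_eqon => // r hr; rewrite /Ht h //; lra.
by rewrite !e ?lexx // /Ht -(h _ ht); exact: q.
Qed.

(** The integrality makes the two cases of the tensor product rule exhaustive and [qprop] gives
    [e_i f_i = 1]; [nice] asks for this on all valid images, since words act step by step. *)
Definition ok T b := [/\ lipp T b, b 0 = 0, forall i, mn T b i \is a Num.int,
  forall i, b T (inl i) \is a Num.int & forall i, qprop T (Ht b i)].

Lemma ok_eqon T b c : 0 < T -> eqon T b c -> ok T b -> ok T c.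
Proof.
move=> T0 h [h1 h2 h3 h4 h5]; split.
- exact: lipp_eqon h1.
- by rewrite -h // lexx ltW.
- by move=> i; rewrite -(mn_eqon i h).
- by move=> i; rewrite -h // lexx ltW.
- by move=> i; apply: (qprop_eqon h (ltW T0)).
Qed.

Definition nice T b := 0 < T /\ forall F, vld T F b -> ok T (Fop T F b).

Lemma nice_ok T b : nice T b -> ok T b.
Proof. by case=> _ h; exact: (h [::]). Qed.

Lemma nice_lipp T b : nice T b -> lipp T b.
Proof. by case/nice_ok. Qed.

Lemma nice_0 T b : nice T b -> b 0 = 0.
Proof. by case/nice_ok. Qed.

Lemma nice_Fop T b W : nice T b -> vld T W b -> nice T (Fop T W b).
Proof.
move=> [T0 h] vW; split => // F vF; rewrite -Fop_cat; apply: h.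
by apply/vld_cat.
Qed.

Lemma nice_eqon T b c : eqon T b c -> nice T b -> nice T c.
Proof.
move=> h [T0 hn]; split => // F vF; apply: (ok_eqon T0 (Fop_eqon a F h)).
by apply: hn; apply: vld_eqon vF => //; exact: eqon_sym.
Qed.

Lemma tensor_or T U b c i : ok T b -> ok U c ->
  mn T b i + 1 <= b T (inl i) + mn U c i \/ b T (inl i) + mn U c i <= mn T b i.
Proof.
move=> [_ _ hb hbe _] [_ _ hc _ _]; have [h|h] := leP (b T (inl i) + mn U c i) (mn T b i); first by right.
by left; apply: int_lt_le => //; rewrite rpredD.
Qed.

Lemma ok_cat T U b c : 0 < T -> 0 < U -> ok T b -> ok U c -> ok (T + U) (cat T b c).
Proof.
move=> T0 U0 [h1 h2 h3 h4 h5] [g1 g2 g3 g4 g5]; split.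
- exact: lipp_cat.
- by rewrite cat_l // ltW.
- by move=> i; rewrite mn_cat //; case: leP => _ //; rewrite rpredD.
- by move=> i; rewrite cat_end // vecDE rpredD.
- by move=> i; apply: qprop_cat.
Qed.

(** Words in [A] cannot tell the two paths apart. Equivalence of validity is not part of the
    definition, since ends and minima decide it ([sim_vld]); the alphabet is restricted because
    heights of original paths are matched only on active letters. *)
Definition sim A T b S c := [/\ forall j, A j -> b T (inl j) = c S (inl j),
  forall F j, all A F -> A j -> vld T F b -> vld S F c -> mn T (Fop T F b) j = mn S (Fop S F c) j &
  forall F G, all A F -> all A G -> vld T F b -> vld T G b -> vld S F c -> vld S G c ->
    (eqon T (Fop T F b) (Fop T G b) <-> eqon S (Fop S F c) (Fop S G c))].

Lemma sim_refl A T b : sim A T b T b.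
Proof. by []. Qed.

Lemma sim_sym A T b S c : sim A T b S c -> sim A S c T b.
Proof.
move=> [h1 h2 h3]; split => [j /h1 //|F j hF hj vc vb|F G hF hG vc vc' vb vb'].
  by rewrite h2.
by rewrite h3.
Qed.

Lemma sim_sub A A' T b S c : {subset A <= A'} -> sim A' T b S c -> sim A T b S c.
Proof.
move=> h [h1 h2 h3]; split => [j /h /h1 //|F j hF hj|F G hF hG].
  by apply: h2; [exact: sub_all hF|exact: h].
by apply: h3; [exact: sub_all hF|exact: sub_all hG].
Qed.

Lemma sim_eqon A T b b' S c : 0 < T -> eqon T b b' -> sim A T b S c -> sim A T b' S c.
Proof.
move=> T0 h [h1 h2 h3]; have h' := eqon_sym h.
split => [j /h1 <-|F j hF hj vF vF'|F G hF hG vF vG vF' vG'].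
- by rewrite h // lexx ltW.
- have vb := vld_eqon T0 h' vF.
  by rewrite -(h2 F j hF hj vb vF'); apply: mn_eqon; exact: Fop_eqon.
have vb := vld_eqon T0 h' vF; have vb' := vld_eqon T0 h' vG.
rewrite -(h3 F G hF hG vb vb' vF' vG'); split => e.
  by apply: eqon_trans (Fop_eqon a F h) _; apply: eqon_trans e _; exact: Fop_eqon.
by apply: eqon_trans (Fop_eqon a F h') _; apply: eqon_trans e _; exact: Fop_eqon.
Qed.

Lemma sim_vld A T b S c F : sim A T b S c -> 0 < T -> 0 < S -> lipp T b -> lipp S c -> all A F ->
  vld T F b -> vld S F c.
Proof.
move=> [h1 h2 h3] T0 S0 lb lc; elim: F => //= i F IH /andP[Ai hF] [vF vi].
have vF' := IH hF vF; split => //; move: vi.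
by rewrite /vf h2 // !Fop_end // h1.
Qed.

Lemma sim_trans A T b S c U d : 0 < T -> 0 < S -> lipp T b -> lipp S c ->
  sim A T b S c -> sim A S c U d -> sim A T b U d.
Proof.
move=> T0 S0 lb lc h h'.
have v := sim_vld h T0 S0 lb lc; case: h h' => h1 h2 h3 [g1 g2 g3].
split => [j hj|F j hF hj vF vF'|F G hF hG vF vG vF' vG']; first by rewrite h1 // g1.
  by rewrite h2 ?g2 //; exact: v.
by rewrite h3 ?g3 //; exact: v.
Qed.

Lemma sim_Fop A T b S c W : 0 < T -> 0 < S -> lipp T b -> lipp S c ->
  sim A T b S c -> all A W -> vld T W b -> sim A T (Fop T W b) S (Fop S W c).
Proof.
move=> T0 S0 lb lc h hW vW; have vW' := sim_vld h T0 S0 lb lc hW vW.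
case: h => h1 h2 h3; split => [j hj|F j hF hj vF vF'|F G hF hG vF vG vF' vG'].
- by rewrite !Fop_end // h1.
- by rewrite -!Fop_cat h2 // ?all_cat ?hF //; apply/vld_cat.
by rewrite -!Fop_cat h3 // ?all_cat ?hF ?hG //; apply/vld_cat.
Qed.

Section Tensor2.
Variables (A : pred K) (T U T' U' : R) (b c b' c' : R -> vec).
Hypotheses (sb : sim A T b T' b') (sc : sim A U c U' c').
Hypotheses (nb : nice T b) (nc : nice U c) (nb' : nice T' b') (nc' : nice U' c').

(** The tensor product rule consults minima and ends only, which agree, so both products distribute
    a word over their factors in the same way. *)
Lemma Fop_tensor2 F : all A F -> vld (T + U) F (cat T b c) -> exists F1 F2,
  [/\ perm_eq F (F1 ++ F2) /\ vld (T' + U') F (cat T' b' c'), vld T F1 b /\ vld U F2 c,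
     vld T' F1 b' /\ vld U' F2 c',
     eqon (T + U) (Fop (T + U) F (cat T b c)) (cat T (Fop T F1 b) (Fop U F2 c)) &
     eqon (T' + U') (Fop (T' + U') F (cat T' b' c')) (cat T' (Fop T' F1 b') (Fop U' F2 c'))].
Proof.
have [T0 U0 T0' U0'] : [/\ 0 < T, 0 < U, 0 < T' & 0 < U'].
  by split; [case: nb|case: nc|case: nb'|case: nc'].
elim: F => [|i F IH] /=; first by exists [::], [::].
move=> /andP[Ai hF] [/(IH hF) [F1 [F2 [[pF vF'] [v1 v2] [v1' v2'] e e']]] vi].
have [hF1 hF2] : all A F1 /\ all A F2.
  by move: hF; rewrite (perm_all A pF) all_cat => /andP.
have o1 := nb.2 _ v1; have o2 := nc.2 _ v2; have o1' := nb'.2 _ v1'; have o2' := nc'.2 _ v2'.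
have [l1 z1 _ _ _] := o1; have [l2 z2 _ _ _] := o2.
have [l1' z1' _ _ _] := o1'; have [l2' z2' _ _ _] := o2'.
have m1 : mn T (Fop T F1 b) i = mn T' (Fop T' F1 b') i by case: sb => _ h _; exact: h.
have m2 : mn U (Fop U F2 c) i = mn U' (Fop U' F2 c') i by case: sc => _ h _; exact: h.
have e1 : Fop T F1 b T (inl i) = Fop T' F1 b' T' (inl i).
  by have q1 := nice_lipp nb; have q2 := nice_lipp nb'; rewrite !Fop_end //; case: sb => ->.
have e2 : Fop U F2 c U (inl i) = Fop U' F2 c' U' (inl i).
  by have q1 := nice_lipp nc; have q2 := nice_lipp nc'; rewrite !Fop_end //; case: sc => ->.
have TU0 : 0 < T + U by rewrite addr_gt0.
have TU0' : 0 < T' + U' by rewrite addr_gt0.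
have vi' : vf (T' + U') i (Fop (T' + U') F (cat T' b' c')).
  apply: (vf_eqon TU0' (eqon_sym e')); move: (vf_eqon TU0 e vi).
  by rewrite /vf !mn_cat // !cat_end // !vecDE m1 m2 e1 e2.
have [h|h] := tensor_or i o1 o2.
  exists (i :: F1), F2; split => //.
  - by rewrite /= perm_cons.
  - split => //; split => //; rewrite /vf; apply: le_trans h _.
    by have := mn_le0 i U0 l2 z2; lra.
  - split => //; split => //; rewrite /vf -m1 -e1; apply: le_trans h _.
    by have := mn_le0 i U0 l2 z2; lra.
  - apply: eqon_trans (fop_eqon a i e) _; exact: fop_cat_l.
  by apply: eqon_trans (fop_eqon a i e') _; apply: fop_cat_l => //; rewrite -m1 -m2 -e1.
exists F1, (i :: F2); split => //.
- by rewrite perm_sym -cat1s perm_catCA /= perm_cons perm_sym.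
- split => //; split => //; move: (vf_eqon TU0 e vi).
  by rewrite /vf mn_cat // cat_end // vecDE min_r //; lra.
- split => //; split => //; move: (vf_eqon TU0 e vi).
  by rewrite /vf -m2 -e2 mn_cat // cat_end // vecDE min_r //; lra.
- apply: eqon_trans (fop_eqon a i e) _; exact: fop_cat_r.
by apply: eqon_trans (fop_eqon a i e') _; apply: fop_cat_r => //; rewrite -m1 -m2 -e1.
Qed.

Lemma sim_cat : sim A (T + U) (cat T b c) (T' + U') (cat T' b' c').
Proof.
have [T0 U0 T0' U0'] : [/\ 0 < T, 0 < U, 0 < T' & 0 < U'].
  by split; [case: nb|case: nc|case: nb'|case: nc'].
have [c0 c0'] : c 0 = 0 /\ c' 0 = 0 by split; [exact: nice_0 nc|exact: nice_0 nc'].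
split => [j hj|F j hF hj vF vF'|F G hF hG vF vG vF' vG'].
- rewrite !cat_end // !vecDE; by case: sb => -> // _ _; case: sc => ->.
- have [F1 [F2 [[pF _] [v1 v2] [v1' v2'] e e']]] := Fop_tensor2 hF vF.
  have [hF1 hF2] : all A F1 /\ all A F2.
    by move: hF; rewrite (perm_all A pF) all_cat => /andP.
  have [l1 z1 _ _ _] := nb.2 _ v1; have [l2 z2 _ _ _] := nc.2 _ v2.
  have [l1' z1' _ _ _] := nb'.2 _ v1'; have [l2' z2' _ _ _] := nc'.2 _ v2'.
  rewrite (mn_eqon j e) (mn_eqon j e') !mn_cat //.
  congr (Num.min _ (_ + _)); first by case: sb => _ h _; exact: h.
    by have q1 := nice_lipp nb; have q2 := nice_lipp nb'; rewrite !Fop_end //; case: sb => ->.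
  by case: sc => _ h _; exact: h.
have [F1 [F2 [[pF _] [v1 v2] [v1' v2'] e e']]] := Fop_tensor2 hF vF.
have [G1 [G2 [[pG _] [w1 w2] [w1' w2'] f f']]] := Fop_tensor2 hG vG.
have [hF1 hF2] : all A F1 /\ all A F2.
  by move: hF; rewrite (perm_all A pF) all_cat => /andP.
have [hG1 hG2] : all A G1 /\ all A G2.
  by move: hG; rewrite (perm_all A pG) all_cat => /andP.
have s1 : eqon T (Fop T F1 b) (Fop T G1 b) <-> eqon T' (Fop T' F1 b') (Fop T' G1 b').
  by case: sb => _ _ h; exact: h.
have s2 : eqon U (Fop U F2 c) (Fop U G2 c) <-> eqon U' (Fop U' F2 c') (Fop U' G2 c').
  by case: sc => _ _ h; exact: h.
split => h.
  have h' := eqon_trans (eqon_trans (eqon_sym e) h) f.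
  have [|||| /s1 q1 /s2 q2] := cat_inj _ _ _ _ h'; rewrite ?Fop0 ?ltW //.
  by apply: (eqon_trans e'); apply: eqon_trans (eqon_sym f'); apply: cat_eqon; rewrite ?ltW.
have h' := eqon_trans (eqon_trans (eqon_sym e') h) f'.
have [|||| /s1 q1 /s2 q2] := cat_inj _ _ _ _ h'; rewrite ?Fop0 ?ltW //.
by apply: (eqon_trans e); apply: eqon_trans (eqon_sym f); apply: cat_eqon; rewrite ?ltW.
Qed.

End Tensor2.

Lemma Fop_tensor T U b c F : nice T b -> nice U c -> vld (T + U) F (cat T b c) -> exists F1 F2,
  [/\ perm_eq F (F1 ++ F2), vld T F1 b, vld U F2 c &
     eqon (T + U) (Fop (T + U) F (cat T b c)) (cat T (Fop T F1 b) (Fop U F2 c))].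
Proof.
move=> nb nc vF.
have [F1 [F2 [[pF _] [v1 v2] _ e _]]] :=
  Fop_tensor2 (sim_refl predT T b) (sim_refl predT U c) nb nc nb nc (all_predT F) vF.
by exists F1, F2.
Qed.

Lemma nice_cat T U b c : nice T b -> nice U c -> nice (T + U) (cat T b c).
Proof.
move=> nb nc; have [T0 _] := nb; have [U0 _] := nc.
split => [|F vF]; first exact: addr_gt0.
have [F1 [F2 [_ v1 v2 e]]] := Fop_tensor nb nc vF.
apply: (ok_eqon (addr_gt0 T0 U0) (eqon_sym e)).
by apply: ok_cat => //; [exact: nb.2|exact: nc.2].
Qed.

Definition st v : R -> vec := fun t => sc t v.

Lemma st0 v : st v 0 = 0.
Proof. by apply/funext => x; rewrite /st !vecE mul0r. Qed.

Lemma st1 v : st v 1 = v.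
Proof. by apply/funext => x; rewrite /st !vecE mul1r. Qed.

Lemma st_lipp T v : lipp T (st v).
Proof.
by move=> x; exists `|v x| => s t hs ht; rewrite /st !vecE -mulrBl normrM mulrC.
Qed.

Lemma mn_st v i : dom v -> mn 1 (st v) i = 0.
Proof.
move=> dv; have [C lC] := @st_lipp 1 v (inl i).
have h01 : 0 <= (0 : R) <= 1 by rewrite lexx ler01.
apply/eqP; rewrite eq_le; apply/andP; split.
  by apply: mn_le0; rewrite ?st0 //; exact: st_lipp.
apply: (le_finf lC h01) => s hs; rewrite /Ht /st !vecE; apply: mulr_ge0 => //.
by case/andP: hs.
Qed.

Lemma line2E u v : line2 u v = cat 1 (st u) (st v).
Proof. by apply/funext => t; rewrite /line2 /cat st1. Qed.

Section Absorb.
Variables (T : R) (p : R -> vec) (v : vec).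
Hypotheses (T0 : 0 < T) (lp : lipp T p) (p0 : p 0 = 0) (dv : dom v).

(** A dominant straight path has epsilon_i equal to 0, so every letter that is valid on the left
    factor acts there. *)
Lemma absorb F : vld T F p -> vld (T + 1) F (cat T p (st v)) /\
  eqon (T + 1) (Fop (T + 1) F (cat T p (st v))) (cat T (Fop T F p) (st v)).
Proof.
have T1 : 0 < T + 1 by apply: addr_gt0.
elim: F => [//|i F IH] /= [/IH [v1 e] vi].
have l : lipp T (Fop T F p) by exact: lipp_Fop.
have h : mn T (Fop T F p) i + 1 <= Fop T F p T (inl i) + mn 1 (st v) i.
  by rewrite mn_st // addr0.
split; last first.
  apply: eqon_trans (fop_eqon a i e) _; apply: fop_cat_l => //; first exact: st_lipp.
  exact: st0.
split => //; apply: (vf_eqon T1 (eqon_sym e)).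
rewrite /vf mn_cat ?cat_end ?st0 //; try exact: st_lipp.
rewrite mn_st // addr0 st1 vecDE min_l; first by move: vi; rewrite /vf; have := dv i; lra.
by apply: mn_le => //; rewrite lexx ltW.
Qed.

Lemma absorb_mn F j : vld T F p -> mn (T + 1) (Fop (T + 1) F (cat T p (st v))) j = mn T (Fop T F p) j.
Proof.
move=> vF; have [_ e] := absorb vF; have l : lipp T (Fop T F p) by exact: lipp_Fop.
rewrite (mn_eqon j e) mn_cat ?st0 //; last exact: st_lipp.
rewrite mn_st // addr0 min_l //; apply: mn_le => //; by rewrite lexx ltW.
Qed.

Lemma absorb_eq F G : vld T F p -> vld T G p ->
  eqon (T + 1) (Fop (T + 1) F (cat T p (st v))) (Fop (T + 1) G (cat T p (st v))) <->
  eqon T (Fop T F p) (Fop T G p).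
Proof.
move=> vF vG; have [_ e] := absorb vF; have [_ f] := absorb vG; split => h.
  have h' := eqon_trans (eqon_trans (eqon_sym e) h) f.
  by have [||||] := cat_inj _ _ _ _ h'; rewrite ?st0 ?ltW.
apply: (eqon_trans e); apply: eqon_trans (eqon_sym f).
by apply: cat_eqon; rewrite ?ltW.
Qed.

End Absorb.

Definition rho : vec := fun x => if x is inl _ then 1 else 0.

(** Appending [rho] makes the total weight regular, so the results on [fam] apply at parameter 0;
    [absorb] then removes the appended path. *)
Lemma nice_st v : dom v -> isint v -> nice 1 (st v).
Proof.
move=> dv iv; have L0 : (0 : R) < 1 := ltr01.
have drho : dom rho by move=> k; exact: ler01.
have rv : reg (v + rho) by move=> k; rewrite vecDE ltr_wpDl.
have iv' : isint (v + rho) by apply: isintD => // k; exact: rpred1.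
have h01 : 0 <= (0 : R) <= 1 by rewrite lexx ler01.
split => // F vF; have lF : lipp 1 (Fop 1 F (st v)) by apply: lipp_Fop => //; exact: st_lipp.
have z : st v 0 = 0 by exact: st0.
have [v1 e] := absorb L0 (@st_lipp 1 v) drho vF.
have m i := absorb_mn L0 (@st_lipp 1 v) drho i vF.
have e2 : (1 : R) + 1 = 2 by [].
rewrite -line2E e2 -fam0 in v1 e m.
have vs : vld 2 F (fam v rho 1) by apply/(fam_vld ga dv drho rv iv' F h01).
split => //; first by rewrite Fop0.
- by move=> i; rewrite -m -Mop_fop fam_mn //; apply: tame_int => //;
    apply: (LS_tame ga i (A := predT) (o := true) (eta := fam v rho 1));
    apply: LS_Mop => //; [exact/allP|apply: LS_fam => //; lra].
- move=> i; rewrite Fop_end //; last exact: st_lipp.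
  rewrite st1 rpredB // rpred_sum // => k _; exact: isint_al.
move=> i t ht; have q := fam_qprop ga dv drho rv iv' (F := F) (i := i) h01.
have ht2 : 0 <= t <= 2 by lra.
have := qprop_eqon e _ q ht2; rewrite ltW // => /(_ isT).
have lr := @st_lipp 1 rho.
have ht0 : 0 <= t by case/andP: ht.
have ht1 : t <= 1 by case/andP: ht.
rewrite -e2 !cat_finf_l ?st0 ?ler01 //.
rewrite mn_st // addr0 /Ht cat_l // -/(mn _ _ _).
have [C lC] := lF (inl i).
have f1 : finf 1 (Ht (Fop 1 F (st v)) i) t <= Fop 1 F (st v) 1 (inl i).
  by apply: (finf_le lC); rewrite ?ht1 ?lexx.
have f2 : finf 1 (Ht (Fop 1 F (st v)) i) 0 <= Fop 1 F (st v) 1 (inl i).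
  by apply: (finf_le lC); rewrite ?ler01 ?lexx.
by rewrite !min_l.
Qed.

(** Both products are similar to the member of their family at parameter 1, and the two families
    share it. *)
Lemma sim_line2 u v u' v' : dom u -> dom v -> dom u' -> dom v' -> u + v = u' + v' ->
  reg (u + v) -> isint (u + v) -> sim predT 2 (line2 u v) 2 (line2 u' v').
Proof.
move=> du dv du' dv' e r i.
suff h p q : dom p -> dom q -> p + q = u + v -> sim predT 2 (fam p q 1) 2 (line2 p q).
  have h1 := h _ _ du dv erefl; have h2 := h _ _ du' dv' (esym e).
  have e1 : fam u v 1 = fam u' v' 1 by rewrite !fam1 e.
  rewrite -e1 in h2; apply: (sim_trans _ _ _ _ (sim_sym h1) h2) => //; exact: lipp_fam || exact: line2_lip.
move=> dp dq epq; have h01 : 0 <= (0 : R) <= 1 by rewrite lexx ler01.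
rewrite -epq in r i; rewrite -fam0; split => [j _|F j _ _ _ _|F G _ _ vF vG _ _].
- by rewrite !fam_2.
- by rewrite -!Mop_fop [RHS]fam_mn.
by rewrite -(fam_eq ga dp dq r i h01 vF vG).
Qed.

(** The intermediate path has weights [u + v] and 0; its second factor is absorbed. *)
Lemma sim_st2 u v : dom u -> dom v -> reg (u + v) -> isint (u + v) ->
  sim predT (1 + 1) (cat 1 (st u) (st v)) 1 (st (u + v)).
Proof.
move=> du dv r i.
have d0 : dom (0 : vec) by move=> k.
have L0 : (0 : R) < 1 := ltr01.
have h : sim predT 2 (line2 u v) 2 (line2 (u + v) 0).
  by apply: sim_line2 => //; [exact: reg_dom|rewrite addr0].
have h' : sim predT (1 + 1) (line2 (u + v) 0) 1 (st (u + v)).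
  rewrite line2E; have l := @st_lipp 1 (u + v).
  split => [j _|F j _ _ _ vF|F G _ _ _ _ vF vG].
  - by rewrite cat_end ?st0 // !st1 addr0.
  - exact: absorb_mn.
  exact: absorb_eq.
rewrite -line2E; apply: (sim_trans _ _ _ _ h h') => //; exact: line2_lip.
Qed.

End Similarity.

(** * Words of bounded length on highly dominant paths *)

Section Stable.
Variables (R : realType) (K : choiceType) (a : K -> K -> int).
Hypothesis ga : gcm a.
Local Notation vec := ((K + K)%type -> R).
Local Notation al := (al R a).
Local Notation om := (@om R K).
Local Notation rho := (@rho R K).
Local Notation fop := (fop a).
Local Notation Fop := (Fop a).
Local Notation vld := (vld a).
Local Notation sim := (sim a).
Local Notation nice := (nice a).
Implicit Types (b c p q : R -> vec) (F G W : seq K) (T U S t s : R) (A : pred K) (i j k : K).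
Implicit Types (u v mu nu ka : vec) (d m n : nat).

Lemma mn_fop_other T b i j : i != j -> 0 < T -> lipp T b -> mn T b j <= mn T (fop T i b) j.
Proof.
move=> ij T0 lb; have [C lC] := lipp_fop a i T0 lb (inl j).
have h0 : 0 <= (0 : R) <= T by rewrite lexx ltW.
apply: (le_finf lC h0) => s hs; rewrite /Ht /fop !vecE.
have h1 := mn_le j lb hs; have h2 := X_ge0 i lb hs.
have h3 : al i (inl j) <= 0 by rewrite /= -[0]/(0%:~R) ler_int (aneg ga) // eq_sym.
by have := mulr_ge0_le0 h2 h3; lra.
Qed.

Definition ph T b j := b T (inl j) - mn T b j.

(** For [j != i] the end rises by [- a j i] and the minimum by at most as much, because the progress
    never exceeds 1. *)
Lemma ph_fop T b i j : nice T b -> vf T i b -> ph T b j - (i == j)%:R <= ph T (fop T i b) j.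
Proof.
move=> nb vi; have [T0 _] := nb; have [lb b0 _ _ qb] := nice_ok nb.
rewrite /ph (fop_end a T0 lb vi) !vecE; have [<-|ij] := eqVneq i j.
  by rewrite (mn_fop ga T0 lb (qb i) vi) -/(mn T b i) /= a2 //; lra.
have [C lC] := lb (inl j).
have h0 : 0 <= (0 : R) <= T by rewrite lexx ltW.
have h3 : al i (inl j) <= 0 by rewrite /= -[0]/(0%:~R) ler_int (aneg ga) // eq_sym.
suff : mn T (fop T i b) j + al i (inl j) <= mn T b j by rewrite /=; lra.
apply: (le_finf lC h0) => s hs; rewrite /Ht.
have h1 := mn_le j (lipp_fop a i T0 lb) hs; rewrite /fop !vecE in h1.
have h2 := X_le1 T b i s.
have : al i (inl j) <= Xt T (Ht b i) s * al i (inl j).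
  by move: h3 h2; move: (al i _) (Xt _ _ _) => x y; nra.
by lra.
Qed.

Lemma ph_Fop T b F j : nice T b -> vld T F b -> ph T b j - (count_mem j F)%:R <= ph T (Fop T F b) j.
Proof.
move=> nb; elim: F => [|i F IH] /=; first by rewrite subr0.
move=> [vF vi]; apply: le_trans (ph_fop j (nice_Fop nb vF) vi).
by rewrite natrD; have := IH vF; lra.
Qed.

Definition full d A T b := forall F, all A F -> (size F <= d)%N -> vld T F b.

(** In contrast to [sim] the ends need not agree: words too short to exhaust either path cannot
    detect them. *)
Definition usim d A T b S c := [/\ full d A T b, full d A S c,
  forall F j, all A F -> (size F <= d)%N -> A j -> mn T (Fop T F b) j = mn S (Fop S F c) j &
  forall F G, all A F -> all A G -> (size F <= d)%N -> (size G <= d)%N ->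
    (eqon T (Fop T F b) (Fop T G b) <-> eqon S (Fop S F c) (Fop S G c))].

Lemma usim_sym d A T b S c : usim d A T b S c -> usim d A S c T b.
Proof.
by move=> [h1 h2 h3 h4]; split => // [F j hF sF hj|F G hF hG sF sG]; rewrite ?h3 ?h4.
Qed.

Lemma usim_trans d A T b S c U e : usim d A T b S c -> usim d A S c U e -> usim d A T b U e.
Proof.
move=> [h1 h2 h3 h4] [g1 g2 g3 g4]; split => // [F j hF sF hj|F G hF hG sF sG].
  by rewrite h3 ?g3.
by rewrite h4 ?g4.
Qed.

Lemma sim_usim d A T b S c U e : 0 < T -> 0 < S -> lipp T b -> lipp S c ->
  sim A T b S c -> usim d A S c U e -> usim d A T b U e.
Proof.
move=> T0 S0 lb lc s us; apply: usim_trans (us); case: us => fc _ _ _.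
have fb : full d A T b by move=> F hF sF; apply: (sim_vld (sim_sym s)) => //; exact: fc.
split => // [F j hF sF hj|F G hF hG sF sG]; case: s => _ h1 h2.
  by apply: h1 => //; [exact: fb|exact: fc].
by apply: h2 => //; [exact: fb|exact: fb|exact: fc|exact: fc].
Qed.

Lemma absorb_usim d A T p v : 0 < T -> lipp T p -> p 0 = 0 -> dom v -> full d A T p ->
  usim d A T p (T + 1) (cat T p (st v)).
Proof.
move=> T0 lp p0 dv fp; split => // [F hF sF|F j hF sF hj|F G hF hG sF sG].
- by have [] := absorb T0 lp dv (fp F hF sF).
- by rewrite absorb_mn //; exact: fp.
by rewrite absorb_eq //; exact: fp.
Qed.

Definition big n v := forall k, n%:R <= v (inl k).

Lemma big_dom n v : big n v -> dom v.
Proof. by move=> h k; apply: le_trans (h k). Qed.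

Lemma big_le m n v : (m <= n)%N -> big n v -> big m v.
Proof. by move=> mn h k; apply: le_trans (h k); rewrite ler_nat. Qed.

Lemma big_reg n v : (0 < n)%N -> big n v -> reg v.
Proof. by move=> mn h k; apply: lt_le_trans (h k); rewrite ltr0n. Qed.

Lemma full_st d A v : big d v -> isint v -> full d A 1 (st v).
Proof.
move=> bv iv; have dv := big_dom bv; have nv := nice_st ga dv iv.
elim=> //= i F IH /andP[_ hF] sF; split; first by apply: IH => //; exact: ltnW.
have vF : vld 1 F (st v) by apply: IH => //; exact: ltnW.
have := ph_Fop i nv vF; rewrite /ph mn_st // st1 subr0 /vf.
have h1 : (count_mem i F)%:R + 1 <= (d%:R : R).
  by rewrite natr1 ler_nat; apply: leq_trans sF; rewrite ltnS count_size.
by have := bv i; lra.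
Qed.

(** Each of the two is compared with its product with the other, where short words are absorbed, and
    the two products have the same sum. *)
Lemma usim_st d A v v' : big d.+1 v -> isint v -> big d.+1 v' -> isint v' ->
  usim d A 1 (st v) 1 (st v').
Proof.
move=> bv iv bv' iv'; have dv := big_dom bv; have dv' := big_dom bv'.
have h w w' : big d.+1 w -> isint w -> dom w' -> usim d A 1 (st w) (1 + 1) (cat 1 (st w) (st w')).
  move=> bw iw dw'; apply: absorb_usim => //; [exact: st_lipp|exact: st0|].
  by apply: full_st => //; exact: big_le bw.
apply: usim_trans (h v v' bv iv dv') _; apply: usim_sym.
apply: usim_trans (h v' v bv' iv' dv) _.
have r : reg (v' + v) by move=> k; rewrite vecDE; have := big_reg (ltn0Sn d) bv' k; have := dv k; lra.
have l (w w' : vec) : lipp (1 + 1) (cat 1 (st w) (st w')) by rewrite -line2E; exact: line2_lip.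
have s : sim A (1 + 1) (cat 1 (st v') (st v)) (1 + 1) (cat 1 (st v) (st v')).
  rewrite -!line2E; apply: (@sim_sub _ _ _ A predT) => //.
  by apply: (sim_line2 ga) => //; [rewrite addrC|exact: isintD].
have two : (0 : R) < 1 + 1 := addr_gt0 ltr01 ltr01.
have us := h v v' bv iv dv'.
exact: (sim_usim two two (l _ _) (l _ _) s (usim_trans (usim_sym us) us)).
Qed.

(* Followed by a sufficiently dominant straight path, [p] becomes
   indistinguishable from a straight path by words of bounded length. *)
Definition classG A T p := forall d, exists n, forall mu ka, big n mu -> isint mu ->
  big d.+1 ka -> isint ka -> usim d A (T + 1) (cat T p (st mu)) 1 (st ka).

Lemma classG_st A v : dom v -> isint v -> classG A 1 (st v).
Proof.
move=> dv iv d; exists d.+1 => mu ka bm im bk ik.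
have dm := big_dom bm.
have r : reg (v + mu) by move=> k; rewrite vecDE; have := big_reg (ltn0Sn d) bm k; have := dv k; lra.
have l (w w' : vec) : lipp (1 + 1) (cat 1 (st w) (st w')) by rewrite -line2E; exact: line2_lip.
have s : sim A (1 + 1) (cat 1 (st v) (st mu)) (1 + 1) (cat 1 (st mu) (st v)).
  rewrite -!line2E; apply: (@sim_sub _ _ _ A predT) => //.
  by apply: (sim_line2 ga) => //; [rewrite addrC|exact: isintD].
have two : (0 : R) < 1 + 1 := addr_gt0 ltr01 ltr01.
apply: (sim_usim two two (l _ _) (l _ _) s); apply: usim_trans (usim_st A bm im bk ik).
apply: usim_sym; apply: absorb_usim => //; [exact: st_lipp|exact: st0|].
by apply: full_st => //; exact: big_le bm.
Qed.

Lemma isint_rho n : isint (sc n%:R rho : vec).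
Proof. by move=> k; rewrite /sc /= mulr1 natr_int. Qed.

Lemma big_rho n : big n (sc n%:R rho : vec).
Proof. by move=> k; rewrite /sc /= mulr1. Qed.

(** For given words a sufficiently dominant path is appended to both sides. It does not interfere,
    and both products are then indistinguishable from the same straight path. *)
Lemma classG_sim A T p v : nice T p -> classG A T p -> dom v -> isint v ->
  (forall j, A j -> p T (inl j) = v (inl j)) -> sim A T p 1 (st v).
Proof.
move=> np gp dv iv h; have [T0 _] := np; have [lp p0 _ _ _] := nice_ok np.
have L0 : (0 : R) < 1 := ltr01.
have lv := @st_lipp R K 1 v.
have [us1 us2] : (forall d, exists mu, dom mu /\ usim d A (T + 1) (cat T p (st mu)) 1 (st (sc d.+1%:R rho))) /\
   (forall d, exists mu, dom mu /\ usim d A (1 + 1) (cat 1 (st v) (st mu)) 1 (st (sc d.+1%:R rho))).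
  split=> d; [have [n hn] := gp d|have [n hn] := classG_st A dv iv d]; exists (sc n%:R rho);
   (split; first exact: big_dom (big_rho n)); apply: hn; try exact: isint_rho; exact: big_rho.
split => [j hj|F j hF hj vF vF'|F G hF hG vF vG vF' vG'].
- by rewrite st1 h.
- have [mu [dm [_ _ m1 _]]] := us1 (size F); have [mu' [dm' [_ _ m2 _]]] := us2 (size F).
  by rewrite -(absorb_mn T0 lp dm j vF) -(absorb_mn L0 lv dm' j vF') m1 ?m2.
have [mu [dm [_ _ _ m1]]] := us1 (maxn (size F) (size G)).
have [mu' [dm' [_ _ _ m2]]] := us2 (maxn (size F) (size G)).
rewrite -(absorb_eq T0 lp dm vF vG) -(absorb_eq L0 lv dm' vF' vG').
by rewrite m1 ?leq_maxl ?leq_maxr // m2 ?leq_maxl ?leq_maxr.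
Qed.

(** The factor [v] merges with the appended dominant path into a single straight path. *)
Lemma classG_tensor0 A T p v : nice T p -> classG A T p -> dom v -> isint v ->
  classG A (T + 1) (cat T p (st v)).
Proof.
move=> np gp dv iv d; have [n hn] := gp d; exists n.+1 => mu ka bm im bk ik.
have [T0 _] := np; have [lp p0 _ _ _] := nice_ok np; have dm := big_dom bm.
have r : reg (v + mu) by move=> k; rewrite vecDE; have := big_reg (ltn0Sn n) bm k; have := dv k; lra.
have bvm : big n (v + mu).
  by move=> k; rewrite vecDE; have := big_le (leqnSn n) bm k; have := dv k; lra.
have ivm : isint (v + mu) by exact: isintD.
rewrite cat_assoc ?ltr01 ?st0 // -addrA.
have nv : nice 1 (st v) by exact: (nice_st ga).
have nm : nice 1 (st mu) by exact: (nice_st ga).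
have nvm : nice 1 (st (v + mu)) by apply: (nice_st ga) => //; exact: reg_dom.
have nvm2 := nice_cat nv nm.
have s : sim A (T + (1 + 1)) (cat T p (cat 1 (st v) (st mu))) (T + 1) (cat T p (st (v + mu))).
  apply: sim_cat => //.
  by apply: (@sim_sub _ _ _ A predT) => //; exact: (sim_st2 ga).
have n1 := nice_cat np nvm2; have n2 := nice_cat np nvm.
apply: (sim_usim n1.1 n2.1 (nice_lipp n1) (nice_lipp n2) s).
exact: hn.
Qed.

(** * Strings of one letter on multiples of a fundamental weight *)

Section Fundamental.
Variables (i : K) (M : R).
Hypotheses (M0 : 0 <= M) (Mint : M \is a Num.int).
Local Notation c := (st (sc M (om i))).
Local Notation cm := (fun m => Fop 1 (nseq m i) c).

Lemma nice_om : nice 1 c.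
Proof.
apply: (nice_st ga); first by move=> k; rewrite /sc; apply: mulr_ge0 => //=.
by apply: isint_sc => //; exact: isint_om.
Qed.

Lemma cm_spec m : m%:R <= M -> [/\ vld 1 (nseq m i) c, mn 1 (cm m) i = - m%:R,
  forall j, i != j -> mn 1 (cm m) j = 0 & cm m 1 (inl i) = M - 2 * m%:R].
Proof.
have dc : dom (sc M (om i)) by move=> k; rewrite /sc; apply: mulr_ge0 => //=.
have L0 : (0 : R) < 1 := ltr01.
elim: m => [|m IH] hm.
  split => //=; [by rewrite mn_st // oppr0|by move=> j _; rewrite mn_st|].
  by rewrite st1 /sc /= eqxx mulr1 mulr0 subr0.
have [|v1 m1 m2 e1] := IH; first by apply: le_trans hm; rewrite ler_nat.
have n1 := nice_Fop nice_om v1; have [l1 z1 _ _ q1] := nice_ok n1.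
rewrite -natr1 in hm *.
have vi : vf 1 i (cm m) by rewrite /vf m1 e1; lra.
split => //=.
- by rewrite (mn_fop ga L0 l1 (q1 i) vi) -/(mn 1 (cm m) i) m1; lra.
- move=> j ij; apply/eqP; rewrite eq_le mn_le0 ?fop0 //; last exact: lipp_fop.
  by rewrite -(m2 _ ij) mn_fop_other.
by rewrite (fop_end a L0 l1 vi) !vecE e1 /= a2 //; lra.
Qed.

Section Compare.
Variables (A : pred K) (T T' : R) (q q' : R -> vec) (m l : nat).
Hypotheses (nq : nice T q) (nq' : nice T' q').
Hypothesis HS : forall F, all A F -> vld T' F q' -> vld T F q /\
  forall j, A j -> mn T (Fop T F q) j = mn T' (Fop T' F q') j.
Hypothesis HE : forall j, A j -> q T (inl j) = q' T' (inl j) + (if j == i then m%:R else 0).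

(** At [i], phi_i on the left and epsilon_i on the right are both larger by [m] in the first
    product, which leaves the tensor product rule unchanged. At [j != i] the right factor has
    epsilon_j equal to 0 and the left one has enough phi_j left, so the letter acts on the left.
    Hence the splitting into [F1] and [k] is common. *)
Lemma om_compare F : all A F -> (m + l + size F)%N%:R <= M ->
  (forall j, j != i -> A j -> (size F)%:R <= ph T' q' j) -> exists F1 (k : nat),
  [/\ perm_eq F (F1 ++ nseq k i), vld T' F1 q',
     vld (T + 1) F (cat T q (cm (m + l)%N)) /\ vld (T' + 1) F (cat T' q' (cm l)),
     eqon (T + 1) (Fop (T + 1) F (cat T q (cm (m + l)%N))) (cat T (Fop T F1 q) (cm (m + l + k)%N)) &
     eqon (T' + 1) (Fop (T' + 1) F (cat T' q' (cm l))) (cat T' (Fop T' F1 q') (cm (l + k)%N))].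
Proof.
have [T0 T0'] : 0 < T /\ 0 < T' by split; [case: nq|case: nq'].
have L0 : (0 : R) < 1 := ltr01.
have [lq lq'] := (nice_lipp nq, nice_lipp nq').
have TU0 : 0 < T + 1 by rewrite addr_gt0.
have TU0' : 0 < T' + 1 by rewrite addr_gt0.
elim: F => [|j F IH] /=.
  by move=> _ _ _; exists [::], 0%N; rewrite !addn0.
move=> /andP[Aj hF] hM hph.
have [||F1 [k [pF v1' [vF vF'] e e']]] := IH hF.
- by apply: le_trans hM; rewrite ler_nat leq_add2l leqnSn.
- by move=> j' h1 h2; apply: le_trans (hph _ h1 h2); rewrite ler_nat leqnSn.
have hF1 : all A F1 by move: hF; rewrite (perm_all A pF) all_cat => /andP[].
have [v1 mE] := HS hF1 v1'.
have kF : (k <= size F)%N by rewrite (perm_size pF) size_cat size_nseq leq_addl.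
have cF : (count_mem j F1 <= size F)%N.
  by rewrite (perm_size pF) size_cat; apply: leq_trans (count_size _ _) (leq_addr _ _).
have hk1 : (m + l + k).+1%:R <= M.
  by apply: le_trans hM; rewrite ler_nat addnS ltnS leq_add2l.
have hk1' : (l + k).+1%:R <= M.
  by apply: le_trans hk1; rewrite ler_nat ltnS -addnA leq_addl.
have [|w1 mi mj ei] := @cm_spec (m + l + k)%N.
  by apply: le_trans hk1; rewrite ler_nat.
have [|w1' mi' mj' ei'] := @cm_spec (l + k)%N.
  by apply: le_trans hk1'; rewrite ler_nat.
have o1 := nice_ok (nice_Fop nq v1); have o1' := nice_ok (nice_Fop nq' v1').
have o2 := nice_ok (nice_Fop nice_om w1); have o2' := nice_ok (nice_Fop nice_om w1').
have [l1 z1 _ _ _] := o1; have [l2 z2 _ _ _] := o2.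
have [l1' z1' _ _ _] := o1'; have [l2' z2' _ _ _] := o2'.
have eE : Fop T F1 q T (inl j) = Fop T' F1 q' T' (inl j) + (if j == i then m%:R else 0).
  by rewrite !Fop_end // HE // addrAC.
have mm := mE _ Aj.
have [ji|ji] := eqVneq j i.
  rewrite ji eqxx in eE mm Aj *.
  have condE : mn T (Fop T F1 q) i + 1 <= Fop T F1 q T (inl i) + mn 1 (cm (m + l + k)%N) i <->
     mn T' (Fop T' F1 q') i + 1 <= Fop T' F1 q' T' (inl i) + mn 1 (cm (l + k)%N) i.
    by rewrite mm eE mi mi' -addnA natrD; split; lra.
  have [h|h] := tensor_or i o1' o2'.
    have h' := condE.2 h.
    exists (i :: F1), k; split => //.
    - by rewrite /= perm_cons.
    - by split => //; rewrite /vf; apply: le_trans h _; have := mn_le0 i L0 l2' z2'; lra.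
    - split; (split => //); [apply: (vf_eqon TU0 (eqon_sym e))|apply: (vf_eqon TU0' (eqon_sym e'))];
       rewrite /vf mn_cat // cat_end // vecDE min_l; lra || (rewrite ?ei ?ei' ?mi ?mi' -?natr1 in h h' hk1 hk1' *; lra).
    - apply: eqon_trans (fop_eqon a i e) _; exact: fop_cat_l.
    by apply: eqon_trans (fop_eqon a i e') _; exact: fop_cat_l.
  have h' : Fop T F1 q T (inl i) + mn 1 (cm (m + l + k)%N) i <= mn T (Fop T F1 q) i.
    have [h'|//] := tensor_or i o1 o2; have := condE.1 h'; lra.
  exists F1, k.+1; split => //.
  - by rewrite /= perm_sym -cat1s perm_catCA /= perm_cons perm_sym.
  - split; (split => //); [apply: (vf_eqon TU0 (eqon_sym e))|apply: (vf_eqon TU0' (eqon_sym e'))];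
     rewrite /vf mn_cat // cat_end // vecDE min_r //;
     rewrite ?ei ?ei' ?mi ?mi' -?natr1 in h h' hk1 hk1' *; lra.
  - rewrite addnS /=; apply: eqon_trans (fop_eqon a i e) _; exact: fop_cat_r.
  by rewrite addnS /=; apply: eqon_trans (fop_eqon a i e') _; exact: fop_cat_r.
rewrite (negbTE ji) addr0 in eE.
have h : mn T' (Fop T' F1 q') j + 1 <= Fop T' F1 q' T' (inl j).
  have := ph_Fop j nq' v1'; have := hph _ ji Aj; rewrite /ph -natr1.
  have : (count_mem j F1)%:R <= (size F)%:R :> R by rewrite ler_nat.
  by lra.
have ij : i != j by rewrite eq_sym.
have hj0 := mj _ ij; have hj0' := mj' _ ij.
have e2 : 0 <= cm (m + l + k)%N 1 (inl j) by rewrite -hj0 mn_le // lexx ltW.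
have e2' : 0 <= cm (l + k)%N 1 (inl j) by rewrite -hj0' mn_le // lexx ltW.
exists (j :: F1), k; split => //.
- by rewrite /= perm_cons.
- split; (split => //); [apply: (vf_eqon TU0 (eqon_sym e))|apply: (vf_eqon TU0' (eqon_sym e'))];
   rewrite /vf mn_cat // cat_end // vecDE min_l ?hj0 ?hj0' ?mm ?eE; lra.
- by apply: eqon_trans (fop_eqon a j e) _; apply: fop_cat_l; rewrite // hj0 addr0 mm eE.
by apply: eqon_trans (fop_eqon a j e') _; apply: fop_cat_l; rewrite // hj0' addr0.
Qed.

End Compare.
End Fundamental.
End Stable.

(** * Dominant products of extremal straight paths *)

Section Products.
Variables (R : realType) (K : choiceType) (a : K -> K -> int).
Hypothesis ga : gcm a.
Local Notation vec := ((K + K)%type -> R).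
Local Notation al := (al R a).
Local Notation om := (@om R K).
Local Notation fop := (fop a).
Local Notation Fop := (Fop a).
Local Notation vld := (vld a).
Local Notation sim := (sim a).
Local Notation usim := (usim a).
Local Notation nice := (nice a).
Local Notation classG := (classG a).
Implicit Types (b c p q : R -> vec) (F G W : seq K) (T U S t s : R) (A : pred K) (i j k : K).
Implicit Types (u v mu nu ka : vec) (d m n : nat).

Lemma al_le2 i j : al i (inl j) <= 2.
Proof.
rewrite /= -[2]/(2%:~R) ler_int; have [->|ij] := eqVneq j i; first by rewrite (a2 ga).
by apply: le_trans (aneg ga ij) _.
Qed.

Lemma Fop_end_ge T F b j : 0 < T -> lipp T b -> vld T F b ->
  b T (inl j) - 2 * (size F)%:R <= Fop T F b T (inl j).
Proof.
move=> T0 lb vF; rewrite Fop_end // lerD2l lerN2.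
elim: F {vF} => [|i F IH]; first by rewrite big_nil mulr0.
by rewrite big_cons /= -natr1; have := al_le2 i j; lra.
Qed.

(* If [i] is the first letter applied in [G], then [G pi_nu (x) pi_mu] is replaced
   by [G (pi_nu' (x) pi_(M om_i))] with the same total and [nu'_i = 0]; this is
   [G' pi_nu' (x) f_i^m pi_(M om_i)] with [G'] shorter than [G]. *)
Lemma classG_tensor A n G p T nu : (size G <= n)%N -> nice T p -> classG A T p ->
  dom nu -> isint nu -> vld 1 G (st nu) ->
  (forall j, A j -> 0 <= mn (T + 1) (cat T p (Fop 1 G (st nu))) j) ->
  classG A (T + 1) (cat T p (Fop 1 G (st nu))).
Proof.
have L0 : (0 : R) < 1 := ltr01.
elim: n G p T nu => [|n IH] G p T nu.
  by rewrite leqn0 => /nilP -> np gp dn inu _ _; apply: (classG_tensor0 ga).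
elim/last_ind: G => [_ np gp dn inu _ _|G0 i _]; first by apply: (classG_tensor0 ga).
rewrite size_rcons ltnS => sG np gp dn inu; rewrite -cats1; set G := G0 ++ [:: i] => vG Adom.
have [T0 _] := np; have [lp p0 _ pend _] := nice_ok np.
(* The string in [i] has to hold [m <= s] letters and [d] more. At other letters a height of at
   least [d + 1] must remain after fewer than [s] letters, each costing at most 2. *)
move=> d; set s := (size G0).+1; pose N := (d + 2 * s + 2)%N; exists N => mu ka0 bm im bk ik.
have dm := big_dom bm; pose tau : vec := nu + mu; pose M := tau (inl i).
have btau : big N tau by move=> k; rewrite /tau vecDE; have := dn k; have := bm k; lra.
have itau : isint tau by exact: isintD.
have M0 : 0 <= M := big_dom btau i; have MN : N%:R <= M := btau i.
have Mint : M \is a Num.int := itau i.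
pose nu' : vec := tau - sc M (om i).
have nu'E j : nu' (inl j) = if j == i then 0 else tau (inl j).
  rewrite /nu' vecDE vecNE scE /=; case: eqP => [->|_]; first by rewrite mulr1 subrr.
  by rewrite mulr0 subr0.
have dn' : dom nu'.
  by move=> j; rewrite nu'E; case: ifP => // _; exact: big_dom btau j.
have iom (x : R) : x \is a Num.int -> isint (sc x (om i)).
  by move=> hx; apply: isint_sc => //; exact: isint_om.
have dom_om x : 0 <= x -> dom (sc x (om i)) by move=> x0 k; rewrite /sc; apply: mulr_ge0 => //=.
have in' : isint nu' by apply: isintB => //; exact: iom.
set c := st (sc M (om i)).
have nc : nice 1 c by apply: (nice_st ga); [exact: dom_om|exact: iom].
have nn : nice 1 (st nu) by exact: (nice_st ga).
have nn' : nice 1 (st nu') by exact: (nice_st ga).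
have nm : nice 1 (st mu) by exact: (nice_st ga).
have N0 : (0 < N)%N by rewrite /N addnS.
have etau : nu' + sc M (om i) = tau by rewrite /nu' subrK.
have two : (0 : R) < 1 + 1 := addr_gt0 ltr01 ltr01.
have n1 := nice_cat nn nm; have n2 := nice_cat nn' nc.
have S : sim predT (1 + 1) (cat 1 (st nu) (st mu)) (1 + 1) (cat 1 (st nu') c).
  have s1 := sim_st2 ga dn dm (big_reg N0 btau) itau.
  have s2 : sim predT (1 + 1) (cat 1 (st nu') c) 1 (st tau).
    by rewrite -etau; apply: (sim_st2 ga) => //; rewrite ?etau //; [exact: dom_om|exact: big_reg btau].
  exact: (sim_trans two L0 (nice_lipp n1) (@st_lipp R K 1 _) s1 (sim_sym s2)).
have [vGa eGa] := absorb L0 (@st_lipp R K 1 nu) dm vG.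
have vG2 : vld (1 + 1) G (cat 1 (st nu') c).
  by apply: (sim_vld S two two (nice_lipp n1) (nice_lipp n2)) vGa; exact: all_predT.
have S1 := sim_Fop two two (nice_lipp n1) (nice_lipp n2) S (all_predT G) vGa.
have sM : (s%:R : R) <= M by apply: le_trans MN; rewrite ler_nat /N; (clear; lia).
have HS0 F : all predT F -> vld 1 F (st nu') -> vld 1 F (st nu') /\
  forall j, predT j -> mn 1 (Fop 1 F (st nu')) j = mn 1 (Fop 1 F (st nu')) j by [].
have HE0 j : predT j -> st nu' 1 (inl j) = st nu' 1 (inl j) + (if j == i then 0%N%:R else 0).
  by move=> _; case: ifP => _; rewrite addr0.
(* Used with equal left factors and shift 0, only to split [G0]; [l = 1] because the letter [i] has
   already acted, on the right factor since [nu'] vanishes at [i]. *)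
have [||G' [k [pG vG' _ _ eG']]] := om_compare ga M0 Mint (l := 1%N) nn' nn' HS0 HE0 (all_predT G0).
- by rewrite add0n add1n.
- move=> j ji _; rewrite /ph mn_st // st1 subr0 nu'E (negbTE ji).
  by apply: le_trans (btau j); rewrite ler_nat /N /s; (clear; lia).
set m := (1 + k)%N in eG'; set cm := Fop 1 (nseq m i) c.
have lc : lipp 1 c by exact: nice_lipp nc.
have c0 : c 0 = 0 by exact: st0.
have eG : eqon (1 + 1) (Fop (1 + 1) G (cat 1 (st nu') c)) (cat 1 (Fop 1 G' (st nu')) cm).
  rewrite /G Fop_cat; apply: eqon_trans eG'; apply: Fop_eqon.
  apply: fop_cat_r => //; try exact: st_lipp; rewrite ?st0 //.
  rewrite st1 nu'E eqxx add0r !mn_st //; exact: dom_om.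
have szG' : (size G' + k)%N = size G0 by rewrite (perm_size pG) size_cat size_nseq.
have mM : m%:R <= M by apply: le_trans sM; rewrite ler_nat /m /s; (clear -szG'; lia).
have [vm mi mj mend] := cm_spec ga i M0 Mint mM.
have ncm : nice 1 cm by exact: nice_Fop.
have nG' := nice_Fop nn' vG'; have nG := nice_Fop nn vG.
have S2 : sim predT (1 + 1) (cat 1 (Fop 1 G (st nu)) (st mu)) (1 + 1) (cat 1 (Fop 1 G' (st nu')) cm).
  have h := sim_eqon two eGa S1.
  exact: (sim_sym (sim_eqon two eG (sim_sym h))).
have S3 : sim A (T + (1 + 1)) (cat T p (cat 1 (Fop 1 G (st nu)) (st mu)))
    (T + (1 + 1)) (cat T p (cat 1 (Fop 1 G' (st nu')) cm)).
  apply: sim_cat => //; [|exact: nice_cat|exact: nice_cat].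
  by apply: (@sim_sub _ _ _ A predT).
pose p' := cat T p (Fop 1 G' (st nu')).
have np' : nice (T + 1) p' by exact: nice_cat.
have npb : nice (T + 1) (cat T p (Fop 1 G (st nu))) by exact: nice_cat.
have zG : Fop 1 G (st nu) 0 = 0 by rewrite Fop0 st0.
have zG' : Fop 1 G' (st nu') 0 = 0 by rewrite Fop0 st0.
rewrite addrA -!cat_assoc // in S3; rewrite -/p' in S3.
have TU0 : 0 < T + 1 := npb.1.
have dom2 j : A j -> 0 <= mn (T + 1 + 1) (cat (T + 1) p' cm) j.
  move=> hj; have [_ h _] := S3; rewrite -(h [::] j) //=.
  by rewrite (absorb_mn (a := a) (F := [::]) TU0 (nice_lipp npb) dm) //; exact: Adom.
have mnp' j : mn (T + 1 + 1) (cat (T + 1) p' cm) j =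
    Num.min (mn (T + 1) p' j) (p' (T + 1) (inl j) + mn 1 cm j).
  by apply: mn_cat => //; [exact: nice_lipp np'|exact: nice_lipp ncm|exact: nice_0 ncm].
have dom3 j : A j -> 0 <= mn (T + 1) p' j.
  by move=> /dom2; rewrite mnp' le_min => /andP[].
have gp' : classG A (T + 1) p'.
  by apply: IH => //; (clear -szG' sG; lia).
have [lp' p'0 _ iend' _] := nice_ok np'.
have end_ge j : A j -> 0 <= p' (T + 1) (inl j).
  move=> /dom3 h; apply: le_trans h _; apply: mn_le => //; by rewrite lexx ltW.
(* The similarity to [p'] prescribes heights on [A] only; elsewhere a value is chosen that is large
   enough for the bounds below. *)
pose nt : vec := fun x => if x is inl j then if A j then p' (T + 1) (inl j) else (d + s + 1)%N%:R else 0.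
have dnt : dom nt by move=> j; rewrite /nt; case: ifP => [/end_ge|].
have int : isint nt by move=> j; rewrite /nt; case: ifP => // _; rewrite natr_int.
have nnt : nice 1 (st nt) by exact: (nice_st ga).
have S4 : sim A (T + 1) p' 1 (st nt).
  by apply: (classG_sim ga) => // j hj; rewrite /nt hj.
have S5 : sim A (T + 1 + 1) (cat (T + 1) p' cm) (1 + 1) (cat 1 (st nt) cm) by apply: sim_cat.
(* For [i] in [A] this is dominance of the product, the string having minimum [-m] at [i]. *)
have mnt : m%:R <= nt (inl i).
  rewrite /nt; case: ifP => hi; last by rewrite ler_nat /m /s; (clear -szG'; lia).
  by have := dom2 i hi; rewrite mnp' le_min mi => /andP[_]; lra.
(* Taking [m om_i] off the left factor compensates for undoing [f_i^m] on the right: short words do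
   not distinguish the product for [nt] and [cm] from that for [ka] and [c], in which both paths are
   dominant and straight. *)
pose ka : vec := nt - sc m%:R (om i).
have m0 : (0 : R) <= m%:R by [].
have mI : (m%:R : R) \is a Num.int by rewrite natr_int.
have kaE j : ka (inl j) = nt (inl j) - if j == i then m%:R else 0.
  by rewrite /ka vecDE vecNE scE /=; case: eqP => _; rewrite ?mulr1 ?mulr0.
have dka : dom ka.
  by move=> j; rewrite kaE; case: eqP => [->|_]; rewrite ?subr_ge0 // subr0.
have ika : isint ka by apply: isintB => //; exact: iom.
have nka : nice 1 (st ka) by exact: (nice_st ga).
have nmo : nice 1 (st (sc m%:R (om i))) by apply: (nice_st ga); [exact: dom_om|exact: iom].
have S6 : sim A (1 + 1) (cat 1 (st ka) (st (sc m%:R (om i)))) 1 (st nt).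
  apply: (classG_sim ga) => //; first exact: nice_cat.
    by apply: (classG_tensor0 ga) => //; [exact: classG_st|exact: dom_om|exact: iom].
  by move=> j hj; rewrite cat_end ?st0 // !st1 /ka subrK.
have lmo := nice_lipp (nice_cat nka nmo).
have HS F : all A F -> vld 1 F (st ka) -> vld 1 F (st nt) /\
    forall j, A j -> mn 1 (Fop 1 F (st nt)) j = mn 1 (Fop 1 F (st ka)) j.
  move=> hF vF; have dmo := dom_om _ m0.
  have [v1 _] := absorb L0 (@st_lipp R K 1 ka) dmo vF.
  have v2 := sim_vld S6 two L0 lmo (@st_lipp R K 1 _) hF v1.
  split => // j hj; have [_ h _] := S6; rewrite -(h F j hF hj v1 v2).
  exact: (absorb_mn L0 (@st_lipp R K 1 ka) dmo j vF).
have HE j : A j -> st nt 1 (inl j) = st ka 1 (inl j) + (if j == i then m%:R else 0).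
  by move=> _; rewrite !st1 kaE subrK.
have bka j : j != i -> ((d + 1)%N%:R : R) <= ka (inl j).
  move=> ji; rewrite kaE (negbTE ji) subr0 /nt; case: ifP => hj; last by rewrite ler_nat; (clear -szG'; lia).
  have h1 : 0 <= p T (inl j).
    have := Adom j hj; rewrite mn_cat //; try exact: nice_lipp nG.
    rewrite le_min => /andP[h1 _]; apply: le_trans h1 _; apply: mn_le => //; by rewrite lexx ltW.
  have h2 := Fop_end_ge j L0 (@st_lipp R K 1 nu') vG'.
  rewrite /p' cat_end // vecDE; rewrite st1 nu'E (negbTE ji) in h2.
  have h3 := btau j.
  have h4 : ((d + 1)%N%:R : R) + 2 * (size G')%:R <= N%:R.
    by rewrite -natrM -natrD ler_nat /N /s; (clear -szG'; lia).
  by lra.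
have cmp F : all A F -> (size F <= d)%N -> exists F1 (k : nat),
  [/\ perm_eq F (F1 ++ nseq k i), vld 1 F1 (st ka),
     vld (1 + 1) F (cat 1 (st nt) cm) /\ vld (1 + 1) F (cat 1 (st ka) c),
     eqon (1 + 1) (Fop (1 + 1) F (cat 1 (st nt) cm)) (cat 1 (Fop 1 F1 (st nt)) (Fop 1 (nseq (m + k)%N i) c)) &
     eqon (1 + 1) (Fop (1 + 1) F (cat 1 (st ka) c)) (cat 1 (Fop 1 F1 (st ka)) (Fop 1 (nseq k i) c))].
  move=> hF sF; have := om_compare ga M0 Mint (l := 0%N) nnt nka HS HE hF; rewrite addn0; apply.
    by apply: le_trans MN; rewrite ler_nat /N /m /s; (clear -szG' sF; lia).
  move=> j ji _; rewrite /ph mn_st // st1 subr0; apply: le_trans (bka _ ji).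
  by rewrite ler_nat; (clear -sF; lia).
have kM F F1 (k' : nat) : (size F <= d)%N -> perm_eq F (F1 ++ nseq k' i) -> (m + k')%N%:R <= M.
  move=> sF pF; have e : size F = (size F1 + k')%N by rewrite (perm_size pF) size_cat size_nseq.
  by apply: le_trans MN; rewrite ler_nat /N /m /s; (clear -szG' e sF; lia).
have kM' F F1 (k' : nat) : (size F <= d)%N -> perm_eq F (F1 ++ nseq k' i) -> k'%:R <= M.
  by move=> sF e; apply: le_trans (kM _ _ _ sF e); rewrite ler_nat leq_addl.
have nnt2 := nice_cat nnt ncm; have nka2 := nice_cat nka nc.
have U : usim d A (1 + 1) (cat 1 (st nt) cm) (1 + 1) (cat 1 (st ka) c).
  split.
  - by move=> F hF sF; have [F1 [k' [_ _ [] ]]] := cmp F hF sF.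
  - by move=> F hF sF; have [F1 [k' [_ _ [] ]]] := cmp F hF sF.
  - move=> F j hF sF hj; have [F1 [k' [pF v1 _ e e']]] := cmp F hF sF.
    have hF1 : all A F1 by move: hF; rewrite (perm_all A pF) all_cat => /andP[].
    have [w1 wi wj wend] := cm_spec ga i M0 Mint (kM _ _ _ sF pF).
    have [w1' wi' wj' wend'] := cm_spec ga i M0 Mint (kM' _ _ _ sF pF).
    have [v1' mE] := HS _ hF1 v1.
    have o1 := nice_Fop nnt v1'; have o2 := nice_Fop nc w1.
    have o1' := nice_Fop nka v1; have o2' := nice_Fop nc w1'.
    rewrite (mn_eqon j e) (mn_eqon j e') !mn_cat ?(nice_0 o2) ?(nice_0 o2') //;
      try by [exact: nice_lipp o1|exact: nice_lipp o2|exact: nice_lipp o1'|exact: nice_lipp o2'].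
    have eE : Fop 1 F1 (st nt) 1 (inl j) = Fop 1 F1 (st ka) 1 (inl j) + (if j == i then m%:R else 0).
      by rewrite !Fop_end ?HE //; [rewrite addrAC|exact: st_lipp|exact: st_lipp].
    rewrite (mE j hj) eE; congr (Num.min _ _).
    have [->|ji] := eqVneq j i; first by rewrite wi wi' natrD; lra.
    by rewrite wj 1?eq_sym // wj' 1?eq_sym // addr0.
  move=> F H hF hH sF sH; have [F1 [k1 [pF v1 _ e e']]] := cmp F hF sF.
  have [H1 [k2 [pH v2 _ f f']]] := cmp H hH sH.
  have hF1 : all A F1 by move: hF; rewrite (perm_all A pF) all_cat => /andP[].
  have hH1 : all A H1 by move: hH; rewrite (perm_all A pH) all_cat => /andP[].
  have [v1' _] := HS _ hF1 v1; have [v2' _] := HS _ hH1 v2.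
  have eqF : eqon 1 (Fop 1 F1 (st nt)) (Fop 1 H1 (st nt)) <-> eqon 1 (Fop 1 F1 (st ka)) (Fop 1 H1 (st ka)).
    have dmo := dom_om _ m0.
    have [x1 _] := absorb L0 (@st_lipp R K 1 ka) dmo v1.
    have [x2 _] := absorb L0 (@st_lipp R K 1 ka) dmo v2.
    by have [_ _ h] := S6; rewrite -(h F1 H1) // (absorb_eq L0 (@st_lipp R K 1 ka) dmo v1 v2).
  have keq (k3 k4 : nat) : k3%:R <= M -> k4%:R <= M ->
      eqon 1 (Fop 1 (nseq k3 i) c) (Fop 1 (nseq k4 i) c) -> k3 = k4.
    move=> h3 h4 h; have [_ _ _ e3] := cm_spec ga i M0 Mint h3; have [_ _ _ e4] := cm_spec ga i M0 Mint h4.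
    have := h 1; rewrite lexx ler01 => /(_ isT) h5; rewrite h5 e4 in e3.
    have e5 : k3%:R = k4%:R :> R by lra.
    by apply/eqP; rewrite -(eqr_nat R) e5.
  have z (k3 : nat) : Fop 1 (nseq k3 i) c 0 = 0 by rewrite Fop0.
  split => h.
    have h' := eqon_trans (eqon_trans (eqon_sym e) h) f.
    have [||||/eqF q1 q2] := cat_inj _ _ _ _ h'; rewrite ?z ?ler01 //.
    have /addnI k12 := keq _ _ (kM _ _ _ sF pF) (kM _ _ _ sH pH) q2.
    apply: (eqon_trans e'); apply: eqon_trans (eqon_sym f'); rewrite k12.
    by apply: cat_eqon; rewrite ?ler01.
  have h' := eqon_trans (eqon_trans (eqon_sym e') h) f'.
  have [||||/eqF q1 q2] := cat_inj _ _ _ _ h'; rewrite ?z ?ler01 //.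
  have k12 := keq _ _ (kM' _ _ _ sF pF) (kM' _ _ _ sH pH) q2.
  apply: (eqon_trans e); apply: eqon_trans (eqon_sym f); rewrite k12.
  by apply: cat_eqon; rewrite ?ler01.
have kaM j : (ka + sc M (om i)) (inl j) = ka (inl j) + if j == i then M else 0.
  by rewrite vecDE scE /=; case: eqP => _; rewrite ?mulr1 ?mulr0.
have bkM : big d.+1 (ka + sc M (om i)).
  move=> j; rewrite kaM; have [->|ji] := eqVneq j i; last by rewrite addr0 -addn1; exact: bka.
  have h1 : (d.+1%:R : R) <= M by apply: le_trans MN; rewrite ler_nat /N; (clear -szG'; lia).
  by have := dka i; lra.
have ikM : isint (ka + sc M (om i)) by apply: isintD => //; exact: iom.
have S7 : sim A (1 + 1) (cat 1 (st ka) c) 1 (st (ka + sc M (om i))).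
  apply: (@sim_sub _ _ _ A predT) => //; apply: (sim_st2 ga) => //; first exact: dom_om.
  exact: big_reg bkM.
have npm := nice_cat npb nm.
have np2 := nice_cat np' ncm.
rewrite -/G; apply: (sim_usim npm.1 np2.1 (nice_lipp npm) (nice_lipp np2) S3).
apply: (sim_usim np2.1 nnt2.1 (nice_lipp np2) (nice_lipp nnt2) S5).
apply: usim_trans U _.
apply: (sim_usim nka2.1 L0 (nice_lipp nka2) (@st_lipp R K 1 _) S7).
exact: (usim_st ga).
Qed.

(** The constant path has phi_i equal to 0, so every letter acts on the second factor. It plays the
    empty product, as [classG_tensor] needs a first factor of positive length. *)
Lemma cat_zero_l T b F : 0 < T -> lipp T b -> b 0 = 0 ->
  (vld (1 + T) F (cat 1 (st 0) b) <-> vld T F b) /\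
  eqon (1 + T) (Fop (1 + T) F (cat 1 (st 0) b)) (cat 1 (st 0) (Fop T F b)).
Proof.
move=> T0 lb b0; have L0 : (0 : R) < 1 := ltr01; have T1 : 0 < 1 + T by rewrite addr_gt0.
elim: F => [//|i F [IH1 IH2]] /=.
have lF := lipp_Fop a F T0 lb.
have zF : Fop T F b 0 = 0 by rewrite Fop0.
have d0 : dom (0 : vec) by [].
have m := mn_le0 i T0 lF zF.
split; last first.
  apply: eqon_trans (fop_eqon a i IH2) _; apply: fop_cat_r => //; rewrite ?st0 //; first exact: st_lipp.
  by rewrite mn_st // st1 vec0E; lra.
have e : vf (1 + T) i (cat 1 (st 0) (Fop T F b)) <-> vf T i (Fop T F b).
  rewrite /vf mn_cat ?cat_end //; last exact: st_lipp.
  by rewrite mn_st // st1 !add0r min_r //; rewrite vec0E; lra.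
rewrite IH1 -e; split=> -[h1 h2]; split => //; apply: (vf_eqon T1) h2 => //.
exact: eqon_sym.
Qed.

Lemma sim_zero_l T b : 0 < T -> lipp T b -> b 0 = 0 -> sim predT (1 + T) (cat 1 (st 0) b) T b.
Proof.
move=> T0 lb b0; have L0 : (0 : R) < 1 := ltr01.
split => [j _|F j _ _ _ vF|F G _ _ _ _ vF vG].
- by rewrite cat_end // st1 add0r.
- have [_ e] := cat_zero_l F T0 lb b0; rewrite (mn_eqon j e).
  have lF := lipp_Fop a F T0 lb; have zF : Fop T F b 0 = 0 by rewrite Fop0.
  have m := mn_le0 j T0 lF zF.
  rewrite mn_cat // ?mn_st ?st1 ?vec0E ?add0r ?min_r //; exact: st_lipp.
have [_ e] := cat_zero_l F T0 lb b0; have [_ f] := cat_zero_l G T0 lb b0; split => h.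
  have h' := eqon_trans (eqon_trans (eqon_sym e) h) f.
  by have [||||] := cat_inj _ _ _ _ h'; rewrite ?Fop0 ?ler01 ?ltW.
apply: (eqon_trans e); apply: eqon_trans (eqon_sym f).
by apply: cat_eqon; rewrite ?ler01.
Qed.

Lemma classG_eqon A T b c : 0 < T -> eqon T b c -> classG A T b -> classG A T c.
Proof.
move=> T0 h gb d; have [n hn] := gb d; exists n => mu ka bm im bk ik.
have e : eqon (T + 1) (cat T b (st mu)) (cat T c (st mu)) by apply: cat_eqon; rewrite ?ltW.
have T1 : 0 < T + 1 by rewrite addr_gt0.
have [h1 h2 h3 h4] := hn _ _ bm im bk ik; split => //.
- by move=> F hF sF; apply: vld_eqon (h1 F hF sF).
- by move=> F j hF sF hj; rewrite -h3 //; apply/esym/mn_eqon/Fop_eqon.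
move=> F G hF hG sF sG; rewrite -h4 //; have eF := Fop_eqon a F e; have eG := Fop_eqon a G e.
split => q.
  by apply: (eqon_trans eF); apply: eqon_trans (eqon_sym eG).
by apply: (eqon_trans (eqon_sym eF)); apply: eqon_trans eG.
Qed.

Fixpoint pc (bs : nat -> R -> vec) n : R -> vec :=
  if n is n'.+1 then cat n'%:R (pc bs n') (bs n') else fun _ => 0.

Section DominantProduct.
Variables (A : pred K) (bs : nat -> R -> vec) (N : nat) (Gs : nat -> seq K) (nus : nat -> vec).
Hypothesis hd : forall (q : nat), (q < N)%N -> dom (nus q) /\ isint (nus q).
Hypothesis hb : forall (q : nat), (q < N)%N ->
  vld 1 (Gs q) (st (nus q)) /\ eqon 1 (Fop 1 (Gs q) (st (nus q))) (bs q).

Lemma nice_factor (q : nat) : (q < N)%N -> nice 1 (bs q).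
Proof.
move=> qN; have [d i] := hd qN; have [v e] := hb qN.
by apply: (nice_eqon e); apply: nice_Fop => //; exact: (nice_st ga).
Qed.

Lemma pc1_eqon : (0 < N)%N -> eqon 1 (bs 0) (pc bs 1).
Proof.
move=> N0 t ht; rewrite /= cat_r ?(nice_0 (nice_factor N0)) //; last by case/andP: ht.
by rewrite subr0 add0r.
Qed.

Lemma nice_pc m : (m < N)%N -> nice m.+1%:R (pc bs m.+1).
Proof.
elim: m => [|m IH] hm.
  by apply: (nice_eqon (pc1_eqon hm)); exact: nice_factor.
rewrite -[m.+2%:R]natr1 [pc _ _]/=; apply: nice_cat; last exact: nice_factor.
by apply: IH; exact: ltnW.
Qed.

Lemma sim_product v : (0 < N)%N -> (forall j, A j -> 0 <= mn N%:R (pc bs N) j) ->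
  dom v -> isint v -> (forall j, A j -> pc bs N N%:R (inl j) = v (inl j)) ->
  sim A N%:R (pc bs N) 1 (st v).
Proof.
move=> N0 hA dv iv hv; have L0 : (0 : R) < 1 := ltr01.
have nz : nice 1 (st (0 : vec)) by apply: (nice_st ga) => // k; rewrite rpred0.
(* Initial products of a dominant product are dominant; the induction descends from the full
   product. *)
have hmn m j : (m < N)%N -> A j -> 0 <= mn m.+1%:R (pc bs m.+1) j.
  move=> hm hj; have hm' := hm; move: hm'; rewrite -subn_gt0.
  move e : (N - m)%N => k; case: k e => // k e _.
  elim: k m hm e => [|k IH] m hm e.
    have -> : m.+1 = N by (clear -hm e; lia).
    exact: hA.
  have hm2 : (m.+1 < N)%N by (clear -e; lia).
  have := IH _ hm2; rewrite subnS e => /(_ erefl).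
  have nm := nice_pc hm; have nf := nice_factor hm2.
  rewrite -[m.+2%:R]natr1 [pc _ _]/= (mn_cat nm.1 nf.1 (nice_lipp nm) (nice_lipp nf) (nice_0 nf)).
  by rewrite le_min => /andP[].
have G m : (m < N)%N -> classG A (1 + m.+1%:R) (cat 1 (st 0) (pc bs m.+1)).
  move=> hm; have [dn i] := hd hm; have [vq e] := hb hm.
  have nf := nice_factor hm; have nm := nice_pc hm.
  have d0 : dom (0 : vec) by [].
  have full j : A j -> 0 <= mn (1 + m.+1%:R) (cat 1 (st 0) (pc bs m.+1)) j.
    move=> hj; rewrite (mn_cat nz.1 nm.1 (nice_lipp nz) (nice_lipp nm) (nice_0 nm)).
    by rewrite mn_st // st1 vec0E add0r le_min lexx hmn.
  elim: m hm dn i vq e nf nm full => [|m IH] hm dn i vq e nf nm full.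
    have e0 : eqon (1 + 1) (cat 1 (st 0) (Fop 1 (Gs 0) (st (nus 0)))) (cat 1 (st 0) (pc bs 1)).
      by apply: cat_eqon; rewrite ?ler01 //; apply: eqon_trans e (pc1_eqon hm).
    apply: (classG_eqon (addr_gt0 ltr01 ltr01) e0).
    have i0 : isint (0 : vec) by move=> k; rewrite rpred0.
    apply: (classG_tensor (leqnn _)) => //; first exact: (classG_st ga).
    by move=> j hj; rewrite (mn_eqon j e0); exact: full.
  have hm' := ltnW hm; have nm' := nice_pc hm'.
  have np := nice_cat nz nm'.
  have gp : classG A (1 + m.+1%:R) (cat 1 (st 0) (pc bs m.+1)).
    have [dn' i'] := hd hm'; have [vq' e'] := hb hm'.
    apply: IH => //; first exact: nice_factor.
    move=> j hj; rewrite (mn_cat nz.1 nm'.1 (nice_lipp nz) (nice_lipp nm') (nice_0 nm')).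
    by rewrite mn_st // st1 vec0E add0r le_min lexx hmn.
  have a1 : 1 + m.+2%:R = 1 + m.+1%:R + 1 :> R by rewrite -[m.+2%:R]natr1 addrA.
  have a2 : cat 1 (st 0) (pc bs m.+2) = cat (1 + m.+1%:R) (cat 1 (st 0) (pc bs m.+1)) (bs m.+1).
    by rewrite [RHS](cat_assoc _ _ _ nm'.1 (nice_0 nm')).
  rewrite a1 a2 in full *.
  have e0 : eqon (1 + m.+1%:R + 1) (cat (1 + m.+1%:R) (cat 1 (st 0) (pc bs m.+1)) (Fop 1 (Gs m.+1) (st (nus m.+1))))
     (cat (1 + m.+1%:R) (cat 1 (st 0) (pc bs m.+1)) (bs m.+1)).
    by apply: cat_eqon; rewrite ?(ltW np.1).
  have T2 : 0 < 1 + m.+1%:R + 1 :> R by rewrite addr_gt0 ?np.1.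
  apply: (classG_eqon T2 e0).
  apply: (classG_tensor (leqnn _)) => // j hj; rewrite (mn_eqon j e0); exact: full.
have hN : (N.-1 < N)%N by rewrite prednK.
have nm := nice_pc hN; have gm := G _ hN; rewrite prednK // in nm gm.
have np := nice_cat nz nm.
have s1 := sim_zero_l nm.1 (nice_lipp nm) (nice_0 nm).
apply: (sim_trans nm.1 np.1 (nice_lipp nm) (nice_lipp np)).
  by apply: sim_sym; apply: (@sim_sub _ _ _ A predT) => //; exact: s1.
apply: (classG_sim ga) => //.
move=> j hj; rewrite (cat_end _ _ nm.1 (nice_0 nm)).
by rewrite st1 vecDE add0r hv.
Qed.

End DominantProduct.
End Products.

(** * Root operators of the original paths *)

Section Extrema.
Local Open Scope classical_set_scope.
Variable R : realType.
Implicit Types (E : set R) (x : R).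

Lemma inf_min E x : E x -> (forall y, E y -> x <= y) -> inf E = x.
Proof.
move=> Ex h; apply/eqP; rewrite eq_le; apply/andP; split.
  by apply: ge_inf => //; exists x.
by apply: lb_le_inf; [exists x|].
Qed.

Lemma sup_max E x : E x -> (forall y, E y -> y <= x) -> sup E = x.
Proof.
move=> Ex h; apply/eqP; rewrite eq_le; apply/andP; split.
  by apply: ge_sup; [exists x|].
by apply: ub_le_sup => //; exists x.
Qed.

End Extrema.

Section RootOperators.
Local Open Scope classical_set_scope.
Variables (R : realType) (I : countType) (J : choiceType).
Variables (coroot : I -> J -> int) (supp : I -> seq J) (root : I -> J -> int).
Local Notation pairR := (pairR (R := R) coroot supp).
Local Notation cartan := (cartan coroot supp root).
Local Notation Hf := (Hf (R := R) coroot supp).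
Local Notation alphaR := (alphaR R root).
Local Notation mmin := (mmin (R := R) coroot supp).
Local Notation fplus := (fplus (R := R) coroot supp).
Local Notation f_root := (f_root (R := R) coroot supp root).
Local Notation e_root := (e_root (R := R) coroot supp root).
Local Notation Path := (Path R J).
Implicit Types (p q b : Path) (i j : I) (t s : R).

Lemma pairR_vadd i (u v : V R J) : pairR i (vadd u v) = pairR i u + pairR i v.
Proof. by rewrite /Defs.pairR -big_split /=; apply: eq_bigr => k _; rewrite /vadd mulrDr. Qed.

Lemma pairR_vscale i c (u : V R J) : pairR i (vscale c u) = c * pairR i u.
Proof. by rewrite /Defs.pairR mulr_sumr; apply: eq_bigr => k _; rewrite /vscale mulrCA. Qed.

Lemma pairR_emb i mu : pairR i (emb R mu) = (pairZ coroot supp i mu)%:~R.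
Proof. by rewrite /Defs.pairR /pairZ rmorph_sum /=; apply: eq_bigr => k _; rewrite intrM. Qed.

Lemma pairR_alpha i j : pairR i (alphaR j) = (cartan i j)%:~R.
Proof. exact: pairR_emb. Qed.

Lemma clamp_bound t : 0 <= clamp t <= 1.
Proof. by rewrite /clamp le_max lexx ge_max ler01 ge_min lexx orbT. Qed.

Lemma clamp_id t : 0 <= t <= 1 -> clamp t = t.
Proof. by move=> ht; rewrite /clamp min_l ?max_r //; lra. Qed.

Definition clamped p := forall t, p (clamp t) = p t.

(** Enough to identify the extremal times in the definition of the root operators with those of the
    future infimum. *)
Definition okH (H : R -> R) := [/\ exists C, lipschitz 1 C H, qprop 1 H,
  finf 1 H 0 \is a Num.int & H 1 \is a Num.int].

Section Min.
Variables (i : I) (p : Path) (m : R).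
Hypothesis (hm : forall s, 0 <= s <= 1 -> m <= Hf i p s) (im : m \is a Num.int).

Lemma mmin_at t : 0 <= t <= 1 -> Hf i p t = m -> mmin i p = m.
Proof.
move=> ht e; apply: inf_min.
  by exists t; split => //; apply/intrP.
by move=> y [s [hs <- _]]; exact: hm.
Qed.

Lemma fplus_at t : 0 <= t <= 1 -> Hf i p t = m -> (forall s, t < s <= 1 -> m < Hf i p s) ->
  fplus i p = t.
Proof.
move=> ht e h; rewrite /Defs.fplus (mmin_at ht e); apply: sup_max; first by split.
move=> y [hy ey]; rewrite leNgt; apply/negP => ty; have := h y; rewrite ey ltxx.
by move=> F; suff : false by []; apply: F; lra.
Qed.

End Min.

Lemma f_rootS i p m t1 t2 : m \is a Num.int -> (forall s, 0 <= s <= 1 -> m <= Hf i p s) ->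
  0 <= t1 -> t1 < t2 -> t2 <= 1 -> Hf i p t1 = m -> (forall s, t1 < s <= 1 -> m < Hf i p s) ->
  Hf i p t2 = m + 1 -> (forall s, t1 <= s -> s < t2 -> Hf i p s < m + 1) ->
  f_root i p = Some (fun t0 => let t := clamp t0 in
    if t <= t1 then p t
    else if t <= t2 then vadd (p t) (vscale (- (Hf i p t - m)) (alphaR i))
    else vadd (p t) (vscale (-1) (alphaR i))).
Proof.
move=> im hm h0 h12 h2 e1 g1 e2 l2; have h01 : 0 <= t1 <= 1 by lra.
rewrite /Defs.f_root (mmin_at hm im h01 e1) (fplus_at hm im h01 e1 g1).
have -> : t1 == 1 = false by apply/eqP; lra.
congr Some; apply/funext => t0; rewrite /=.
suff -> : inf [set t | t1 <= t <= 1 /\ Hf i p t = m + 1] = t2 by [].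
apply: inf_min; first by split => //; lra.
move=> y [hy ey]; rewrite leNgt; apply/negP => yt; have := l2 y; rewrite ey ltxx.
by move=> F; suff : false by []; apply: F; lra.
Qed.

Section Good.
Variables (i : I) (p : Path).
Local Notation H := (Hf i p).
Local Notation m := (finf 1 H 0).
Hypothesis oH : okH H.

Lemma good_min : [/\ forall s, 0 <= s <= 1 -> m <= H s, m \is a Num.int &
  exists t1, [/\ 0 <= t1 <= 1, H t1 = m, forall s, t1 < s <= 1 -> m < finf 1 H s &
    fplus i p = t1 /\ mmin i p = m]].
Proof.
have [[C lC] q im i1] := oH.
have h01 : 0 <= (0 : R) <= 1 by rewrite lexx ler01.
have hm s : 0 <= s <= 1 -> m <= H s by move=> hs; apply: (finf_le lC); lra.
split => //; have [t1 ht1 [_ e h]] := last_min lC ltr01 h01; exists t1; split => //.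
split; last exact: mmin_at e.
apply: (fplus_at hm im ht1 e) => s hs; apply: lt_le_trans (h _ hs) _.
by apply: (finf_le lC); lra.
Qed.

Lemma mminE : mmin i p = m.
Proof. by have [_ _ [t1 [_ _ _ []]]] := good_min. Qed.

(** The time [t2] is found as the end of the last stay below [m + 1]. It is also the first passage
    after [t1]: an earlier one would have a future infimum strictly between [m] and [m + 1] and
    below the height, against [qprop]. *)
Lemma f_root_spec : m + 1 <= H 1 -> exists t1 t2,
  [/\ [/\ 0 <= t1, t1 < t2, t2 <= 1, H t1 = m & H t2 = m + 1],
     forall s, 0 <= s <= 1 -> m <= H s, forall s, t1 < s <= 1 -> m < H s,
     forall s, t1 <= s -> s < t2 -> H s < m + 1 & forall s, t2 <= s <= 1 -> m + 1 <= H s].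
Proof.
move=> v; have [[C lC] q im i1] := oH; have [hm _ [t1 [ht1 e1 g1 _]]] := good_min.
have [t2 [h2 n2 a2]] : exists t2, [/\ t1 <= t2 <= 1, forall s, t2 < s <= 1 -> ~ (H s < m + 1) &
   forall e, 0 < e -> exists2 s, t2 - e < s & [/\ t1 <= s, s <= t2 & H s < m + 1]].
  by apply: last_time; lra.
have F1 s : t1 < s <= 1 -> m < H s.
  by move=> hs; apply: lt_le_trans (g1 _ hs) _; apply: (finf_le lC); lra.
have ht2 : 0 <= t2 <= 1 by lra.
have le2 : H t2 <= m + 1.
  apply: (lip_lim_le lC ht2) => e /a2[s s1 [s2 s3 s4]]; exists s; split; [lra| |exact: ltW].
  by rewrite ltr_norml; lra.
have after s : t2 < s <= 1 -> m + 1 <= H s by move=> /n2 /negP; rewrite -leNgt.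
have ge2 : m + 1 <= H t2.
  have [t21|t21] := ltP t2 1; last by have -> : t2 = 1 by lra.
  apply: (lip_lim_ge lC ht2) => e e0; exists (t2 + Num.min (e / 2) (1 - t2)).
  have d0 : 0 < Num.min (e / 2) (1 - t2) by rewrite lt_min; apply/andP; split; lra.
  have [d1 d2] : Num.min (e / 2) (1 - t2) <= e / 2 /\ Num.min (e / 2) (1 - t2) <= 1 - t2.
    by rewrite !ge_min !lexx orbT.
  split; [lra| |apply: after; lra].
  by rewrite addrAC subrr add0r gtr0_norm //; lra.
have e2 : H t2 = m + 1 by lra.
have h12 : t1 < t2.
  rewrite lt_neqAle (proj1 (andP h2)) andbT; apply/eqP => e; move: e2; rewrite -e e1; lra.
exists t1, t2; split => //.
- by split => //; lra.
- move=> s s1 s2; rewrite ltNge; apply/negP => h.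
  have [|r r1 [r2 r3 r4]] := a2 (t2 - s); first by lra.
  have sr : finf 1 H s <= H r by apply: (finf_le lC); lra.
  have hs : 0 <= s <= 1 by lra.
  have [h3|h3] := q s hs (lt_le_trans (le_lt_trans sr r4) h); last by lra.
  have [e|st] := eqVneq s t1; first by rewrite e e1 in h; lra.
  have : m < finf 1 H s by apply: g1; rewrite lt_neqAle eq_sym st s1 /=; lra.
  by lra.
move=> s hs; have [->|st] := eqVneq s t2; first by rewrite e2.
by apply: after; rewrite lt_neqAle eq_sym st; lra.
Qed.

Lemma f_root_none : ~ (m + 1 <= H 1) -> f_root i p = None.
Proof.
move=> /negP; rewrite -ltNge => h; have [_ _ im i1] := oH.
have [hm _ [t1 [ht1 e1 g1 [fp mp]]]] := good_min.
have h11 : 0 <= (1 : R) <= 1 by rewrite ler01 lexx.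
have e : H 1 = m.
  apply/eqP; rewrite eq_le hm // andbT leNgt; apply/negP => h'.
  by have := int_lt_le im i1 h'; lra.
rewrite /Defs.f_root fp; suff -> : t1 == 1 by [].
apply/eqP/le_anti; rewrite (proj2 (andP ht1)) leNgt; apply/negP => t11.
have [[C lC] _ _ _] := oH; have hh : t1 < 1 <= (1 : R) by rewrite t11 lexx.
by have := g1 1 hh; rewrite (finf_end lC) // e ltxx.
Qed.

Lemma f_root_closed : m + 1 <= H 1 ->
  f_root i p = Some (fun t0 => vadd (p (clamp t0)) (vscale (- Xt 1 H (clamp t0)) (alphaR i))).
Proof.
move=> v; have [t1 [t2 [[h0 h12 h2 e1 e2] hm g1 l2 a2]]] := f_root_spec v.
have [[C lC] q im i1] := oH.
rewrite (f_rootS im hm h0 h12 h2 e1 g1 e2 l2); congr Some; apply/funext => t0 /=.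
have := clamp_bound t0; move: (clamp t0) => t ht.
have Fm s : 0 <= s <= t1 -> finf 1 H s = m.
  move=> hs; apply/eqP; rewrite eq_le; apply/andP; split; last by apply: (finf_mono lC); lra.
  by rewrite -e1; apply: (finf_le lC); lra.
have [tt1|tt1] := leP t t1.
  rewrite /Xt Fm; last by lra.
  by rewrite subrr min_r ?ler01 // oppr0; apply/funext => x; rewrite /vadd /vscale mul0r addr0.
have Ft1 s : t1 < s <= 1 -> m < finf 1 H s.
  have [_ _ [t1' [ht1' e1' g1' _]]] := good_min => hs; apply: g1'.
  suff : t1' <= t1 by lra.
  by rewrite leNgt; apply/negP => h; have := g1 t1'; rewrite e1' ltxx => F; suff : false by []; apply: F; lra.
have a2F : m + 1 <= finf 1 H t2 by apply: (le_finf lC) => //; lra.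
have [tt2|tt2] := leP t t2.
  suff -> : Xt 1 H t = H t - m by [].
  have Fle : finf 1 H t <= H t by apply: (finf_le lC); lra.
  have Ht1 : H t <= m + 1 by have [->|n2] := eqVneq t t2; [lra|apply/ltW/l2; rewrite ?lt_neqAle ?n2 //; lra].
  have mF : m < finf 1 H t by apply: Ft1; lra.
  rewrite /Xt min_r; last by lra.
  congr (_ - _); apply/eqP; rewrite eq_le Fle leNgt; apply/negP => h.
  by have [|] := q t ht h; lra.
suff -> : Xt 1 H t = 1 by [].
by rewrite /Xt min_l //; have : finf 1 H t2 <= finf 1 H t; [apply: (finf_mono lC); lra|lra].
Qed.

End Good.

Section Inverse.
Variables (i : I) (p b : Path).
Local Notation H := (Hf i p).
Local Notation m := (finf 1 H 0).
Hypotheses (cp : clamped p) (oH : okH H) (v : m + 1 <= H 1) (fb : f_root i p = Some b).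

Lemma f_root_shape : exists t1 t2,
  [/\ [/\ 0 <= t1, t1 < t2, t2 <= 1, H t1 = m & H t2 = m + 1],
     [/\ forall s, 0 <= s <= 1 -> m <= H s, forall s, t1 < s <= 1 -> m < H s,
     forall s, t1 <= s -> s < t2 -> H s < m + 1 & forall s, t2 <= s <= 1 -> m + 1 <= H s],
     b = fun t0 => let t := clamp t0 in
    if t <= t1 then p t
    else if t <= t2 then vadd (p t) (vscale (- (H t - m)) (alphaR i))
    else vadd (p t) (vscale (-1) (alphaR i)) &
    forall t, 0 <= t <= 1 -> Hf i b t = if t <= t1 then H t else
      if t <= t2 then H t - (H t - m) * (cartan i i)%:~R else H t - (cartan i i)%:~R].
Proof.
have [t1 [t2 [[h0 h12 h2 e1 e2] hm g1 l2 a2]]] := f_root_spec oH v.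
have [_ _ im _] := oH; move: fb; rewrite (f_rootS im hm h0 h12 h2 e1 g1 e2 l2) => -[<-].
exists t1, t2; split => // t ht; rewrite /Defs.Hf /= (clamp_id ht).
case: ifP => // _; case: ifP => _; rewrite pairR_vadd pairR_vscale pairR_alpha; last by rewrite mulN1r.
by rewrite mulNr.
Qed.

(** On the image the minimum is [m - 1], first attained at [t2], and [m] is taken for the last time
    before [t2] at [t1]: the two times exchange roles. *)
Lemma e_f_real : cartan i i = 2 -> e_root i b = Some p.
Proof.
move=> a2; have [t1 [t2 [[h0 h12 h2 e1 e2] [hm g1 l2 g2] bE HE]]] := f_root_shape.
have [_ _ im _] := oH; rewrite a2 in HE.
have ht1 : 0 <= t1 <= 1 by lra.
have ht2 : 0 <= t2 <= 1 by lra.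
have t21 : t2 <= t1 = false by apply/negbTE; rewrite -ltNge.
have Hb2 : Hf i b t2 = m - 1 by rewrite HE // t21 lexx e2; ring.
have Hb1 : Hf i b t1 = m by rewrite HE // lexx.
have Hm s : 0 <= s <= 1 -> m - 1 <= Hf i b s.
  move=> hs; rewrite HE //; have [h|h] := leP s t1; first by have := hm s hs; lra.
  have [h'|h'] := leP s t2; last by have := g2 s; rewrite ltW //= => F; have := F (proj2 (andP hs)); lra.
  by have [->|n] := eqVneq s t2; [rewrite e2; lra|have := l2 s (ltW h); rewrite lt_neqAle n h' => /(_ isT); lra].
have im1 : m - 1 \is a Num.int by rewrite rpredB // rpred1.
rewrite /Defs.e_root (mmin_at Hm im1 ht2 Hb2) /is_real_index a2 eqxx.
have -> : inf [set t | 0 <= t <= 1 /\ Hf i b t = m - 1] = t2.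
  apply: inf_min => // y [hy]; rewrite HE //; have := hm y hy; have [h|h] := leP y t1; first by lra.
  have [h'|h'] := leP y t2; last by move=> *; exact: ltW.
  have [->|n] := eqVneq y t2; first by [].
  by have := l2 y (ltW h); rewrite lt_neqAle n h' => /(_ isT); lra.
have -> : t2 == 0 = false by apply/eqP; lra.
have -> : sup [set t | 0 <= t <= t2 /\ Hf i b t = m - 1 + 1] = t1.
  apply: sup_max; first by rewrite subrK; split => //; lra.
  move=> y [hy]; rewrite subrK HE; last by lra.
  have [//|h] := leP y t1; have -> : y <= t2 by lra.
  by have := g1 y; rewrite h => F; have := F (_ : y <= 1); lra.
congr Some; apply/funext => t0 /=; have hc := clamp_bound t0; rewrite (HE _ hc) bE /= (clamp_id hc).
rewrite -[in RHS]cp; move: (clamp t0) hc => t hc; have [//|h1] := leP t t1.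
have [h3|h3] := leP t t2; apply/funext => x; rewrite /vadd /vscale; ring.
Qed.

(** The minimum [m] and its last time [t1] are unchanged, while the heights above [m] on the middle
    piece are stretched by [1 - a]; hence [m + 1 - a] is first reached at [t2] and the excluded
    values do not occur later. *)
Lemma e_f_imag : cartan i i <= 0 -> e_root i b = Some p.
Proof.
move=> a0; have [t1 [t2 [[h0 h12 h2 e1 e2] [hm g1 l2 g2] bE HE]]] := f_root_shape.
have [_ _ im _] := oH; set a : R := (cartan i i)%:~R in HE.
have {}a0 : a <= 0 by rewrite /a -[0]/(0%:~R) ler_int.
have ht1 : 0 <= t1 <= 1 by lra.
have ht2 : 0 <= t2 <= 1 by lra.
have t21 : t2 <= t1 = false by apply/negbTE; rewrite -ltNge.
have Hb1 : Hf i b t1 = m by rewrite HE // lexx.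
have Hge s : t1 < s <= 1 -> m < Hf i b s.
  move=> hs; have h := g1 _ hs; rewrite HE; last by lra.
  have -> : s <= t1 = false by apply/negbTE; rewrite -ltNge; lra.
  by case: ifP => _; nra.
have Hm s : 0 <= s <= 1 -> m <= Hf i b s.
  move=> hs; have [h|h] := leP s t1; first by rewrite HE // h hm.
  by apply/ltW/Hge; lra.
have Hb2 : Hf i b t2 = m + 1 - a by rewrite HE // t21 lexx e2; ring.
have nr : is_real_index coroot supp root i = false.
  apply/negP => /eqP e; move: a0; rewrite /a e; lra.
rewrite /Defs.e_root nr (mmin_at Hm im ht1 Hb1) (fplus_at Hm im ht1 Hb1 Hge) -/a.
have -> : t1 == 1 = false by apply/eqP; lra.
case: asboolP => [h|_].
  by have := h t2; rewrite Hb2 ltxx => F; suff : false by []; apply: F; lra.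
have -> : inf [set t | t1 <= t <= 1 /\ Hf i b t = m + 1 - a] = t2.
  apply: inf_min; first by split => //; lra.
  move=> y [hy]; rewrite HE; last by lra.
  move=> e; rewrite leNgt; apply/negP => yt; move: e; have h := l2 y (proj1 (andP hy)) yt.
  have h' := hm y; rewrite (ltW yt).
  have h3 : m <= H y by apply: h'; lra.
  by case: ifP => _ e; nra.
case: asboolP => [[s [hs hle]]|_].
  exfalso; move: hle; have h := g2 s hs; rewrite HE; last by lra.
  have -> : s <= t1 = false by apply/negbTE; rewrite -ltNge; lra.
  have [h'|h'] := leP s t2; last by lra.
  have -> : s = t2 by lra.
  by rewrite e2; lra.
congr Some; apply/funext => t0 /=; have hc := clamp_bound t0; rewrite (HE _ hc) bE /= (clamp_id hc).
rewrite -[in RHS]cp; move: (clamp t0) hc => t hc; have [//|h1] := leP t t1.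
have d : 1 - a != 0 by lra.
have [h3|h3] := leP t t2; apply/funext => x; rewrite /vadd /vscale; last by ring.
by field.
Qed.

End Inverse.

(** The clause of the definition that forbids later heights at most [m - a] keeps the shifted tail
    above [m], so that [t1] remains the last minimum of [q] and [f_i] reverses the middle piece. *)
Lemma f_e_imag i b q : clamped b -> okH (Hf i b) -> cartan i i <= 0 ->
  e_root i b = Some q -> f_root i q = Some b.
Proof.
move=> cb oH a0; have [hm im [t1 [ht1 e1 g1 [fp mp]]]] := good_min oH.
set H := Hf i b in hm im e1 g1 fp mp oH *; set m := finf 1 H 0 in hm im e1 g1 fp mp.
have [[C lC] _ _ _] := oH.
set a : R := (cartan i i)%:~R.
have {}a0 : a <= 0 by rewrite /a -[0]/(0%:~R) ler_int.
have nr : is_real_index coroot supp root i = false.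
  by apply/negP => /eqP e; move: a0; rewrite /a e; lra.
have g1' s : t1 < s <= 1 -> m < H s.
  by move=> hs; apply: lt_le_trans (g1 _ hs) _; apply: (finf_le lC); lra.
rewrite /Defs.e_root nr fp mp -/a; case: eqP => // t11; case: asboolP => // h.
have [w hw Hw] : exists2 w, t1 <= w <= 1 & m + 1 - a <= H w.
  apply: contrapT => hn; apply: h => t ht; rewrite ltNge; apply/negP => h'; apply: hn.
  by exists t.
pose E := [set t | t1 <= t <= 1 /\ H t = m + 1 - a].
have [t2 [h2 e2 l2]] : exists t2, [/\ t1 <= t2 <= 1, H t2 = m + 1 - a &
    forall s, t1 <= s -> s < t2 -> H s < m + 1 - a].
  (* The first passage is obtained as the last passage of the negated height in reversed time. *)
  have lN : lipschitz 1 C (fun s => - H (1 - s)).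
    move=> s t hs ht; rewrite opprK addrC; have := lC (1 - t) (1 - s).
    have -> : 1 - t - (1 - s) = s - t by ring.
    by apply; lra.
  have [|||||s [hs es gs]] := @lip_ivt _ 1 C (fun s => - H (1 - s)) (1 - w) (1 - t1) (- (m + 1 - a)) lN.
  - by lra.
  - by lra.
  - by lra.
  - by rewrite subKr; lra.
  - by rewrite subKr e1; lra.
  exists (1 - s); split; [lra| |].
    by apply/eqP; rewrite -eqr_opp es.
  move=> r h1 h3; have := gs (1 - r); rewrite subKr ltrN2; apply.
  by apply/andP; split; lra.
have iE : inf E = t2.
  apply: inf_min; first by split.
  move=> y [hy ey]; rewrite leNgt; apply/negP => yt; have := l2 y (proj1 (andP hy)) yt.
  by rewrite ey ltxx.
rewrite -/E iE; case: asboolP => // hs [<-].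
have {}hs s : t2 <= s <= 1 -> m - a < H s.
  by move=> h'; rewrite ltNge; apply/negP => h3; apply: hs; exists s.
have t12 : t1 < t2.
  by rewrite lt_neqAle (proj1 (andP h2)) andbT; apply/eqP => e; move: e2; rewrite -e e1; lra.
set q' := fun t0 => _.
have d : 1 - a != 0 by lra.
have d0 : 0 < (1 - a)^-1 by rewrite invr_gt0; lra.
have HE t : 0 <= t <= 1 -> Hf i q' t = if t <= t1 then H t else
    if t <= t2 then m + (1 - a)^-1 * (H t - m) else H t + a.
  move=> ht; rewrite /Defs.Hf /q' (clamp_id ht); case: ifP => // _.
  case: ifP => _; rewrite pairR_vadd ?pairR_vscale pairR_alpha -/(Hf i b t) -/H -/a //.
  by field.
have Hlt (x : R) : x < m + 1 - a -> m + (1 - a)^-1 * (x - m) < m + 1.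
  move=> hx; rewrite ltrD2l mulrC ltr_pdivrMr; lra.
have Hgt (x : R) : m < x -> m < m + (1 - a)^-1 * (x - m).
  by move=> hx; rewrite ltrDl; apply: mulr_gt0 => //; lra.
have q1 : Hf i q' t1 = m by rewrite HE // lexx.
have q2 : Hf i q' t2 = m + 1.
  rewrite HE; last by lra.
  have -> : t2 <= t1 = false by apply/negbTE; rewrite -ltNge.
  by rewrite lexx e2; field.
have qg s : t1 < s <= 1 -> m < Hf i q' s.
  move=> h'; rewrite HE; last by lra.
  have -> : s <= t1 = false by apply/negbTE; rewrite -ltNge; lra.
  have [h3|h3] := leP s t2; first by apply: Hgt; exact: g1'.
  by have := hs s; rewrite (ltW h3) => F; have := F (proj2 (andP h')); lra.
have qm s : 0 <= s <= 1 -> m <= Hf i q' s.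
  move=> h'; have [h3|h3] := leP s t1; first by rewrite HE // h3 hm.
  by apply/ltW/qg; lra.
have ql s : t1 <= s -> s < t2 -> Hf i q' s < m + 1.
  move=> h' h3; rewrite HE; last by lra.
  have -> : s <= t2 by lra.
  case: ifP => h4; last by apply: Hlt; exact: l2.
  have -> : s = t1 by lra.
  by rewrite e1; lra.
rewrite (f_rootS im qm (proj1 (andP ht1)) t12 (proj2 (andP h2)) q1 qg q2 ql).
congr Some; apply/funext => t0 /=; have hc := clamp_bound t0; rewrite (HE _ hc) /q' (clamp_id hc).
rewrite -[in RHS]cb; move: (clamp t0) hc => t hc; have [//|h1] := leP t t1.
have [h3|h3] := leP t t2; apply/funext => x; rewrite /vadd /vscale -/(Hf i b t) -/H -/m; last by ring.
by field.
Qed.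

Lemma e_real_none i b : cartan i i = 2 -> okH (Hf i b) -> Hf i b 0 = 0 -> finf 1 (Hf i b) 0 = 0 ->
  e_root i b = None.
Proof.
move=> a2 oH H0 m0; rewrite /Defs.e_root /is_real_index a2 eqxx (mminE oH) m0.
suff -> : inf [set t | 0 <= t <= 1 /\ Hf i b t = 0] = 0 by rewrite eqxx.
apply: inf_min; first by rewrite /= lexx ler01.
by move=> y [/andP[]].
Qed.

End RootOperators.

(** * The enlarged Cartan matrix and the comparison with original paths *)

Lemma finf_scale (R : realType) (T : R) (g h : R -> R) t : 0 < T -> 0 <= t <= 1 ->
  (forall s, 0 <= s <= 1 -> h s = g (T * s)) -> finf 1 h t = finf T g (T * t).
Proof.
move=> T0 ht e; rewrite /finf; congr inf; apply/seteqP; split => x /= [s hs <-].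
  exists (T * s); last by rewrite e //; lra.
  by apply/andP; split; [apply: ler_wpM2l; lra|rewrite -[leRHS]mulr1; apply: ler_wpM2l; lra].
have es : T * (s / T) = s by rewrite mulrCA divff ?mulr1 // gt_eqF.
have h1 : t <= s / T by rewrite ler_pdivlMr // mulrC; lra.
have h2 : s / T <= 1 by rewrite ler_pdivrMr // mul1r; lra.
by exists (s / T); [rewrite h1|rewrite e ?es //; lra].
Qed.

(** Elimination of one vector at a coordinate where it is nonzero, done without division: the
    remaining family is integral again and still independent. *)
Lemma int_indep_real (R : realType) (I : eqType) (J : Type) (f : I -> J -> int) (s : seq I) : uniq s ->
  (forall c : I -> int, (forall k, \sum_(i <- s) c i * f i k = 0) -> forall i, i \in s -> c i = 0) ->
  forall c : I -> R, (forall k, \sum_(i <- s) c i * (f i k)%:~R = 0) -> forall i, i \in s -> c i = 0.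
Proof.
elim: s f => [//|i0 s IH] f /andP[i0s us] hf c hc.
have [k0 fk0] : exists k0, f i0 k0 != 0.
  apply: contrapT => h; have f0 k : f i0 k = 0.
    by apply/eqP; apply/negPn/negP => h'; apply: h; exists k.
  suff : (1 : int) = 0 by [].
  have := hf (fun i => (i == i0)%:R) _ i0 (mem_head _ _); rewrite eqxx; apply=> k.
  rewrite big_cons f0 mulr0 add0r big_seq big1 // => i hi.
  by case: eqP => [e|_]; [rewrite e (negbTE i0s) in hi|rewrite mul0r].
pose g i k := f i0 k0 * f i k - f i k0 * f i0 k.
have ci i : i \in s -> c i = 0.
  move=> hi; apply: (IH g us _ c _ i hi) => [d hd j hj|k].
    have := hf (fun i => if i == i0 then - \sum_(j <- s) d j * f j k0 else d i * f i0 k0) _ j _.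
    have jn : j == i0 = false by apply/eqP => e; rewrite -e hj in i0s.
    rewrite jn inE hj orbT => h; have /eqP : d j * f i0 k0 = 0.
      apply: h => // k; rewrite big_cons eqxx.
      rewrite -[RHS](hd k) mulNr mulr_suml.
      have -> : \sum_(j0 <- s) (if j0 == i0 then - (\sum_(j1 <- s) d j1 * f j1 k0) else d j0 * f i0 k0) * f j0 k
         = \sum_(j0 <- s) d j0 * f i0 k0 * f j0 k.
        apply: eq_big_seq => l hl; suff -> : l == i0 = false by [].
        by apply/eqP => e; rewrite -e hl in i0s.
      rewrite addrC -sumrB; apply: eq_bigr => l _; rewrite /g; ring.
    by rewrite mulf_eq0 (negbTE fk0) orbF => /eqP.
  have e1 := hc k0; have e2 := hc k; rewrite !big_cons in e1 e2.
  have -> : \sum_(j <- s) c j * (g j k)%:~R = (f i0 k0)%:~R * (\sum_(j <- s) c j * (f j k)%:~R)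
      - (\sum_(j <- s) c j * (f j k0)%:~R) * (f i0 k)%:~R :> R.
    rewrite mulr_sumr mulr_suml -sumrB; apply: eq_bigr => j _; rewrite /g rmorphB !rmorphM /=; ring.
  have -> : \sum_(j <- s) c j * (f j k)%:~R = - (c i0 * (f i0 k)%:~R) by lra.
  have -> : \sum_(j <- s) c j * (f j k0)%:~R = - (c i0 * (f i0 k0)%:~R) by lra.
  by ring.
move=> i; rewrite inE => /orP[/eqP ->|]; last exact: ci.
have := hc k0; rewrite big_cons big_seq big1 ?addr0 => [/eqP|j hj]; last by rewrite ci ?mul0r.
by rewrite mulf_eq0 intr_eq0 (negbTE fk0) orbF => /eqP.
Qed.

Section Hats.
Variables (R : realType) (I : countType) (J : choiceType).
Variables (coroot : I -> J -> int) (supp : I -> seq J) (root : I -> J -> int).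
Hypothesis HBC : BC_datum coroot supp root.
Local Notation pairR := (pairR (R := R) coroot supp).
Local Notation cartan := (cartan coroot supp root).
Local Notation isr := (is_real_index coroot supp root).
Local Notation Hf := (Hf (R := R) coroot supp).
Local Notation alphaR := (alphaR R root).
Local Notation f_root := (f_root (R := R) coroot supp root).
Local Notation Fapply := (Fapply (R := R) coroot supp root).
Local Notation Path := (Path R J).
Local Notation K := (I * nat)%type.
Implicit Types (i j : I) (k l : K) (t s : R) (U W : seq K) (F G : seq I).

(* An imaginary simple root behaves, for each single application of its root
   operator, like a fresh real one; so every imaginary index [i] is replaced by
   infinitely many real letters [(i, q)], pairing with one another by [a_ii]. *)
Definition ah k l : int := if k == l then 2 else
  if k.1 == l.1 then (if isr k.1 then 0 else cartan k.1 k.1) else cartan k.1 l.1.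

Lemma cartan_real i : isr i -> cartan i i = 2.
Proof. by move/eqP. Qed.

Lemma cartan_imag i : ~~ isr i -> cartan i i <= 0.
Proof. by case: HBC => -[_ /(_ i)[e|//] _ _] _; rewrite /is_real_index e eqxx. Qed.

Lemma gcm_ah : gcm ah.
Proof.
case: HBC => -[_ _ h1 h2] _; split => [k|k l kl|k l kl]; rewrite /ah ?eqxx //.
  rewrite (negbTE kl); have [e|ne] := eqVneq k.1 l.1; last exact: h1.
  by case: ifP => // /negbT; exact: cartan_imag.
rewrite [l == k]eq_sym (negbTE kl) [l.1 == k.1]eq_sym; have [->|ne] := eqVneq k.1 l.1 => //.
exact: h2.
Qed.

(* The labels of imaginary letters that occur in root operators are even; the
   odd ones are kept for the words producing the extremal weights. *)
Definition act_letter k := if isr k.1 then k.2 == 0%N else ~~ odd k.2.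
Local Notation A := act_letter.

Definition proper_letter k := isr k.1 ==> (k.2 == 0%N).

Lemma act_letter_proper k : A k -> proper_letter k.
Proof. by rewrite /act_letter /proper_letter; case: ifP. Qed.

Lemma ahE k l : proper_letter k -> proper_letter l -> isr k.1 || (k != l) ->
  ah k l = cartan k.1 l.1.
Proof.
rewrite /ah /proper_letter => hk hl; have [->|kl] := eqVneq k l; first by rewrite orbF => /cartan_real.
move=> _; have [e|//] := eqVneq k.1 l.1; rewrite -e in hl *; case: ifP hk hl => //= _ /eqP k0 /eqP l0.
by case/eqP: kl; case: (k) (l) e k0 l0 => ? ? [? ?] /= -> -> ->.
Qed.

(** An imaginary letter models a single application and occurs at most once; real letters may
    repeat. *)
Fixpoint good U := if U is k :: U' then [&& A k, isr k.1 || (k \notin U') & good U'] else true.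

Lemma good_all U : good U -> all A U.
Proof. by elim: U => //= k U IH /and3P[-> _ /IH]. Qed.

(** Twice the number of letters to the right is an even label that no other imaginary letter of the
    word carries. *)
Fixpoint lift F : seq K := if F is i :: F' then (i, if isr i then 0%N else (size F').*2) :: lift F' else [::].

Lemma lift_fst F : map fst (lift F) = F.
Proof. by elim: F => //= i F ->. Qed.

Lemma lift_lt F k : k \in lift F -> (k.2 <= (size F).*2)%N /\ (~~ isr k.1 -> (k.2 < (size F).*2)%N).
Proof.
elim: F => //= i F IH; rewrite inE => /orP[/eqP -> /=|/IH[h1 h2]].
  by case: ifP => _; split; lia.
by split => [|/h2]; lia.
Qed.

Lemma good_lift F : good (lift F).
Proof.
elim: F => //= i F ->; rewrite andbT /act_letter /=; have [hi|hi] := boolP (isr i) => //=.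
rewrite odd_double /=; apply/negP => /lift_lt[_] /=.
by rewrite hi ltnn => /(_ isT).
Qed.

Section System.
Variables (T : R) (b0 : R -> (K + K)%type -> R) (p0 : Path).
Hypotheses (nb : nice ah T b0) (cp : clamped p0).
Hypothesis h0 : forall k t, A k -> 0 <= t <= 1 -> Hf k.1 p0 t = b0 (T * t) (inl k).
Local Notation Fop := (Fop ah T).
Local Notation vld := (vld ah T).
Local Notation al := (al R ah).

Let T0 : 0 < T. Proof. by case: nb. Qed.

(** The progress is computed in the larger coordinates, with time rescaled by [T], and the original
    root is subtracted with it. *)
Fixpoint po U : Path := if U is k :: U' then
  fun t0 => vadd (po U' (clamp t0)) (vscale (- Xt T (Ht (Fop U' b0) k) (T * clamp t0)) (alphaR k.1))
  else p0.

Lemma po_clamped U : clamped (po U).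
Proof. by case: U => //= k U t; rewrite clamp_id // clamp_bound. Qed.

Lemma scale_bound t : 0 <= t <= 1 -> 0 <= T * t <= T.
Proof.
have h := T0; move=> ht; apply/andP; split; first by apply: mulr_ge0; lra.
by rewrite -[leRHS]mulr1; apply: ler_wpM2l; lra.
Qed.

Lemma po_H U k t : good U -> A k -> isr k.1 || (k \notin U) -> 0 <= t <= 1 ->
  Hf k.1 (po U) t = Fop U b0 (T * t) (inl k).
Proof.
move=> gU Ak; elim: U gU => [_ _|l U IH] /=; first exact: h0.
move=> /and3P[Al _ gU] hk ht; rewrite /Defs.Hf (clamp_id ht) pairR_vadd pairR_vscale pairR_alpha.
rewrite -/(Hf k.1 (po U) t) IH //; last first.
  by case/orP: hk => [->//|]; rewrite inE negb_or => /andP[_ ->]; rewrite orbT.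
rewrite /fop vecDE vecNE scE /= ahE ?act_letter_proper //; last first.
  by case/orP: hk => [->//|]; rewrite inE negb_or => /andP[-> _]; rewrite orbT.
by rewrite mulNr.
Qed.

Lemma po_okH U k : good U -> A k -> isr k.1 || (k \notin U) -> vld U b0 ->
  [/\ okH (Hf k.1 (po U)), finf 1 (Hf k.1 (po U)) 0 = mn T (Fop U b0) k,
    Hf k.1 (po U) 1 = Fop U b0 T (inl k), Hf k.1 (po U) 0 = 0 &
    forall t, 0 <= t <= 1 -> Xt 1 (Hf k.1 (po U)) t = Xt T (Ht (Fop U b0) k) (T * t)].
Proof.
move=> gU Ak hk vU; have e t := @po_H U k t gU Ak hk.
have [lb z hm he hq] := nb.2 _ vU; have h := T0.
have h01 : 0 <= (0 : R) <= 1 by rewrite lexx ler01.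
have h11 : 0 <= (1 : R) <= 1 by rewrite lexx ler01.
have eF t : 0 <= t <= 1 -> finf 1 (Hf k.1 (po U)) t = finf T (Ht (Fop U b0) k) (T * t).
  by move=> ht; apply: finf_scale.
have m0 : finf 1 (Hf k.1 (po U)) 0 = mn T (Fop U b0) k by rewrite eF // mulr0.
have e1 : Hf k.1 (po U) 1 = Fop U b0 T (inl k) by rewrite e // mulr1.
split => //; last first.
- by move=> t ht; rewrite /Xt !eF // mulr0.
- by rewrite e // mulr0 z.
split; rewrite ?m0 ?e1 //; last first.
  move=> t ht; rewrite !eF // e // mulr0; apply: hq.
  exact: scale_bound.
have [C lC] := lb (inl k); exists (C * T) => s t hs ht; rewrite !e //.
apply: le_trans (lC _ _ (scale_bound hs) (scale_bound ht)) _.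
by rewrite -mulrBr normrM (ger0_norm (ltW T0)) mulrA.
Qed.

Lemma po_f_root U k : good (k :: U) -> vld U b0 ->
  (vf T k (Fop U b0) -> f_root k.1 (po U) = Some (po (k :: U))) /\
  (~ vf T k (Fop U b0) -> f_root k.1 (po U) = None).
Proof.
move=> /= /and3P[Ak hk gU] vU; have [oH m0 e1 _ eX] := po_okH gU Ak hk vU.
split=> hv; last by apply: f_root_none => //; rewrite m0 e1.
rewrite f_root_closed ?m0 ?e1 //; congr Some; apply/funext => t0.
by rewrite eX ?clamp_bound.
Qed.

Lemma Fapply_good U : good U -> vld U b0 -> Fapply (map fst U) p0 = Some (po U).
Proof.
elim: U => [//|k U IH] gkU /= [vU vk]; have gU : good U by case/and3P: gkU.
by rewrite /Defs.Fapply /= -/(Fapply _ _) IH //=; case: (po_f_root gkU vU) => ->.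
Qed.

Lemma Fapply_Some U b : good U -> Fapply (map fst U) p0 = Some b -> vld U b0 /\ b = po U.
Proof.
move=> gU h; suff v : vld U b0 by split => //; move: h; rewrite Fapply_good // => -[].
elim: U gU b h => [//|k U IH] gkU b /=; have gU : good U by case/and3P: gkU.
rewrite /Defs.Fapply /= -/(Fapply _ _); case e : (Fapply _ _) => [c|//] /= hc.
have vU := IH gU _ e; split => //; apply: contrapT => nv.
move: e; rewrite Fapply_good // => -[ec]; move: hc; rewrite -ec.
by case: (po_f_root gkU vU) => _ ->.
Qed.

(** The accumulated progress of [k], which the formal root coordinate stores. *)
Definition trk U t k : R := b0 t (inr k) - Fop U b0 t (inr k).

Lemma trk_cons l U t k : trk (l :: U) t k = trk U t k + (k == l)%:R * Xt T (Ht (Fop U b0) l) t.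
Proof. by rewrite /trk /= /fop vecDE vecNE scE /=; ring. Qed.

Lemma sum_delta (S : seq K) l (x : R) (g : K -> R) : uniq S -> l \in S ->
  \sum_(k <- S) ((k == l)%:R * x) * g k = x * g l.
Proof.
move=> uS lS; rewrite (bigD1_seq l) //= eqxx mul1r big1 ?addr0 // => k /negbTE ->.
by rewrite !mul0r.
Qed.

Lemma Fop_trk S U t x : uniq S -> {subset U <= S} ->
  Fop U b0 t x = b0 t x - \sum_(k <- S) trk U t k * al k x.
Proof.
move=> uS; elim: U => [_|l U IH hS] /=.
  by rewrite big1 ?subr0 // => k _; rewrite /trk /= subrr mul0r.
rewrite /fop vecDE vecNE scE IH => [|k hk]; last by apply: hS; rewrite inE hk orbT.
under [in RHS]eq_bigr do rewrite trk_cons mulrDl.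
by rewrite big_split /= sum_delta ?hS ?mem_head // opprD addrA.
Qed.

Lemma po_trk S U t x : uniq S -> {subset U <= S} -> 0 <= t <= 1 ->
  po U t x = p0 t x - \sum_(k <- S) trk U (T * t) k * (root k.1 x)%:~R.
Proof.
move=> uS hS ht; elim: U hS => [_|l U IH hS] /=.
  by rewrite big1 ?subr0 // => k _; rewrite /trk /= subrr mul0r.
rewrite (clamp_id ht) /vadd /vscale IH => [|k hk]; last by apply: hS; rewrite inE hk orbT.
under [in RHS]eq_bigr do rewrite trk_cons mulrDl.
rewrite big_split /= sum_delta ?hS ?mem_head // opprD addrA.
by rewrite /Defs.alphaR /emb mulNr.
Qed.

Lemma po_eqon U W : eqon T (Fop U b0) (Fop W b0) -> po U = po W.
Proof.
move=> e; apply/funext => t0; rewrite -[LHS]po_clamped -[RHS]po_clamped.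
have := clamp_bound t0; move: (clamp t0) => t ht; apply/funext => x.
have uS := undup_uniq (U ++ W).
rewrite !(po_trk (S := undup (U ++ W))) //; try by move=> k hk; rewrite mem_undup mem_cat hk ?orbT.
congr (_ - _); apply: eq_bigr => k _; congr (_ * _).
by rewrite /trk e // scale_bound.
Qed.

(** Both words carry out the same sequence of original root operators. *)
Lemma po_relabel U W : good U -> good W -> map fst U = map fst W -> vld U b0 ->
  vld W b0 /\ po W = po U.
Proof.
move=> gU gW e vU; have := Fapply_good gU vU; rewrite e => /(Fapply_Some gW)[h1 h2].
by split.
Qed.

Lemma po_end U : vld U b0 -> po U 1 = fun x => p0 1 x - \sum_(i <- map fst U) (root i x)%:~R.
Proof.
move=> vU; apply/funext => x; have lb := nice_lipp nb; have h := T0.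
have h11 : 0 <= (1 : R) <= 1 by rewrite lexx ler01.
elim: U vU => [_|k U IH] /=; first by rewrite big_nil subr0.
move=> [vU vk]; rewrite (clamp_id h11) /vadd /vscale IH // big_cons mulr1.
by rewrite Xt_end ?min_l //; [rewrite /Defs.alphaR /emb; ring|rewrite lerBrDl|exact: lipp_Fop].
Qed.

(** Original simple roots are independent but do not separate the copies of an index, so equal paths
    determine only the total progress per index. *)
Lemma po_eq_sum U W t i : po U = po W -> 0 <= t <= 1 ->
  \sum_(k <- undup (U ++ W) | k.1 == i) trk U (T * t) k =
  \sum_(k <- undup (U ++ W) | k.1 == i) trk W (T * t) k.
Proof.
move=> e ht; set S := undup _; pose d k := trk U (T * t) k - trk W (T * t) k.
have uS : uniq S := undup_uniq _.
apply/eqP; rewrite -subr_eq0 -sumrB -/(d _); apply/eqP.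
set s := undup (map fst S); have us : uniq s := undup_uniq _.
have [iS|iS] := boolP (i \in s); last first.
  rewrite big_seq_cond big1 // => k /andP[kS /eqP ki].
  by case/negP: iS; rewrite mem_undup -ki map_f.
case: HBC => _ [_ ind].
apply: (int_indep_real us (fun c h => ind s c us h) (c := fun i => \sum_(k <- S | k.1 == i) d k)) => // x.
have h : \sum_(k <- S) d k * (root k.1 x)%:~R = 0.
  have := congr1 (fun q : Path => q t x) e.
  rewrite !(po_trk (S := S)) //; try by move=> k hk; rewrite mem_undup mem_cat hk ?orbT.
  move=> h; have {}h : \sum_(k <- S) trk U (T * t) k * (root k.1 x)%:~R =
     \sum_(k <- S) trk W (T * t) k * (root k.1 x)%:~R by lra.
  by rewrite /d; under eq_bigr do rewrite mulrBl; rewrite sumrB h subrr.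
rewrite -[RHS]h; under eq_bigr do rewrite mulr_suml big_mkcond.
rewrite exchange_big /=; apply: eq_big_seq => k kS.
rewrite (bigD1_seq k.1) //=; last by rewrite mem_undup map_f.
by rewrite eqxx big1 ?addr0 // => j; rewrite eq_sym => /negbTE ->.
Qed.

End System.
End Hats.

(** * Sums of ramps *)

Section Ramps.
Variable R : realType.
Implicit Types (c t : R) (cs ds : seq R).

(* The progress of one application of the root operator of an imaginary index,
   completed at time [c]. *)
Definition ramp c t : R := let q := (Num.ceil c - 1)%:~R in
  if t <= q then 0 else if t < c then (t - q) / (c - q) else 1.

Lemma ramp_ge c t : c <= t -> ramp c t = 1.
Proof.
move=> h; have /andP[h1 h2] := ceil_itv c; rewrite /ramp.
have -> : t <= (Num.ceil c - 1)%:~R = false by apply/negbTE; rewrite -ltNge (lt_le_trans h1).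
by rewrite ltNge h.
Qed.

Lemma ramp_lt c t : t < c -> ramp c t < 1.
Proof.
move=> h; have /andP[h1 h2] := ceil_itv c; rewrite /ramp; case: ifP => // _.
by rewrite h ltr_pdivrMr ?mul1r ?ltrD2r // subr_gt0.
Qed.

Lemma ramp_le1 c t : ramp c t <= 1.
Proof. by have [/ramp_ge ->|/ramp_lt/ltW] := leP c t. Qed.

Lemma rampE (q : int) c t : q%:~R < c -> c <= q%:~R + 1 ->
  ramp c t = if t <= q%:~R then 0 else if t < c then (t - q%:~R) / (c - q%:~R) else 1.
Proof.
move=> h1 h2; have -> // : ramp c t = let q' := q%:~R in
  if t <= q' then 0 else if t < c then (t - q') / (c - q') else 1.
have e : Num.ceil c = q + 1 by apply: ceil_def; rewrite addrK h1 rmorphD.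
by rewrite /ramp e addrK.
Qed.

Lemma seq_max cs : cs != [::] -> exists2 c, c \in cs & forall d, d \in cs -> d <= c.
Proof.
elim: cs => [//|x cs IH] _; have [->|/IH[c hc hm]] := eqVneq cs [::].
  by exists x => [|d]; rewrite ?mem_head // inE => /eqP ->.
have [xc|cx] := leP x c; [exists c => [|d]|exists x => [|d]]; rewrite ?inE ?hc ?eqxx ?orbT //.
  by move=> /orP[/eqP ->//|]; exact: hm.
by move=> /orP[/eqP -> //|/hm h]; apply: le_trans h (ltW cx).
Qed.

Lemma sum_ramp_full cs t : \sum_(c <- cs) ramp c t = (size cs)%:R -> forall c, c \in cs -> c <= t.
Proof.
elim: cs => [//|x cs IH]; rewrite big_cons /= -natr1 => e.
have h : \sum_(c <- cs) ramp c t <= (size cs)%:R.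
  elim: cs {IH e} => [|y cs IH]; first by rewrite big_nil.
  by rewrite big_cons /= -natr1; have := ramp_le1 y t; lra.
have h1 := ramp_le1 x t; move=> c; rewrite inE => /orP[/eqP ->|]; last by apply: IH; lra.
rewrite leNgt; apply/negP => /ramp_lt; lra.
Qed.

Lemma sum_ramp_ge cs t : (forall c, c \in cs -> c <= t) -> \sum_(c <- cs) ramp c t = (size cs)%:R.
Proof.
move=> h; rewrite -sum1_size natr_sum; apply: eq_big_seq => c /h; exact: ramp_ge.
Qed.

(** The sum first equals the number of ramps at the largest completion time, which is therefore
    common to both sides; that ramp is removed. *)
Lemma ramps_determined T cs ds : (forall c, c \in cs -> 0 <= c <= T) -> (forall c, c \in ds -> 0 <= c <= T) ->
  (forall t, 0 <= t <= T -> \sum_(c <- cs) ramp c t = \sum_(d <- ds) ramp d t) ->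
  0 <= T -> perm_eq cs ds.
Proof.
move=> + + + T0; move e : (size cs) => n; elim: n cs ds e => [|n IH] cs ds e hc hd h.
  have hT := h T; rewrite T0 lexx in hT; have {}hT := hT isT.
  rewrite !sum_ramp_ge in hT; last first.
  - by move=> c /hc /andP[].
  - by move=> c /hd /andP[].
  move/eqP: hT; rewrite eqr_nat e eq_sym => /nilP ->; by case: cs e {hc h}.
have hT := h T; rewrite T0 lexx in hT; have {}hT := hT isT.
rewrite !sum_ramp_ge in hT; last first.
- by move=> c /hc /andP[].
- by move=> c /hd /andP[].
move/eqP: hT; rewrite eqr_nat => /eqP sz.
have [|c cc mc] := @seq_max cs; first by rewrite -size_eq0 e.
have [|d dd md] := @seq_max ds; first by rewrite -size_eq0 -sz e.
have cd : c = d.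
  apply/eqP; rewrite eq_le; apply/andP; split.
    apply: (sum_ramp_full (cs := cs)) => //.
    by rewrite h ?hd // sz sum_ramp_ge.
  apply: (sum_ramp_full (cs := ds)) => //.
  by rewrite -h ?hc // -sz sum_ramp_ge.
have p1 := perm_to_rem cc; have p2 := perm_to_rem dd; rewrite -cd in p2 dd.
rewrite (permPl p1) (permPr p2) perm_cons; apply: IH => [|x hx|x hx|t ht].
- by rewrite size_rem // e.
- by apply: hc; exact: mem_rem hx.
- by apply: hd; exact: mem_rem hx.
by have := h t ht; rewrite (perm_big _ p1) [in RHS](perm_big _ p2) /= !big_cons => /addrI.
Qed.

End Ramps.

(** * Lifting equalities of original paths by renaming imaginary letters *)

Lemma perm_map_matching (X Y : eqType) (f g : X -> Y) (s t : seq X) : uniq s -> uniq t ->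
  perm_eq (map f s) (map g t) -> exists th : X -> X,
  [/\ forall k, k \in t -> th k \in s, forall k, k \in t -> f (th k) = g k,
      {in t &, injective th} & forall k, k \in s -> exists2 k', k' \in t & th k' = k].
Proof.
elim: t s => [|y t IH] s us /= ut h.
  exists id; split => // k; by case: s h {us} => // x s /perm_size.
case/andP: ut => yt ut; have : g y \in map f s by rewrite (perm_mem h) mem_head.
case/mapP => x xs ex; have ps := perm_to_rem xs.
have {}h : perm_eq (map f (rem x s)) (map g t).
  by rewrite -(perm_cons (g y)) -(permPr h) [in X in perm_eq X _]ex -map_cons perm_map // perm_sym.
have [th [h1 h2 h3 h4]] := IH _ (rem_uniq x us) ut h.
have th_neq k : k \in t -> th k != x.
  by move=> /h1; rewrite mem_rem_uniq // inE => /andP[].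
exists (fun k => if k == y then x else th k); split => [k|k|k l|k ks].
- rewrite inE; case: eqP => [//|_] /= /h1; exact: mem_rem.
- by rewrite inE; case: eqP => [->|_ /= /h2].
- rewrite !inE; case: eqP => [->|_] /=; case: eqP => [-> //|_] /=.
  + by move=> _ /th_neq /eqP h5 /esym.
  + by move=> /th_neq /eqP h5 _.
  exact: h3.
have [->|kx] := eqVneq k x; first by exists y; rewrite ?mem_head ?eqxx.
have [|k' k't e] := h4 k; first by rewrite mem_rem_uniq // inE kx.
exists k'; first by rewrite inE k't orbT.
by case: eqP => // e'; rewrite -e' k't in yt.
Qed.

Section Matching.
Variables (R : realType) (I : countType) (J : choiceType).
Variables (coroot : I -> J -> int) (supp : I -> seq J) (root : I -> J -> int).
Hypothesis HBC : BC_datum coroot supp root.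
Local Notation isr := (is_real_index coroot supp root).
Local Notation Hf := (Hf (R := R) coroot supp).
Local Notation Path := (Path R J).
Local Notation K := (I * nat)%type.
Local Notation ah := (ah coroot supp root).
Local Notation A := (act_letter coroot supp root).
Local Notation good := (good coroot supp root).
Implicit Types (i j : I) (k l : K) (t s : R) (U W : seq K).

Lemma good_relabel th W : good W -> (forall k, k \in W -> A (th k) /\ (th k).1 = k.1) ->
  {in W &, injective th} -> good (map th W).
Proof.
elim: W => //= k W IH /and3P[Ak fk gW] h inj; have [a1 e1] := h k (mem_head _ _).
rewrite a1 e1 IH //; first last.
- by move=> x y hx hy; apply: inj; rewrite inE ?hx ?hy orbT.
- by move=> x hx; apply: h; rewrite inE hx orbT.
rewrite andbT /=; case/orP: fk => [->//|kW]; apply/orP; right.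
apply/mapP => -[l lW e]; have := inj k l; rewrite !inE eqxx lW orbT => /(_ isT isT e) kl.
by rewrite kl lW in kW.
Qed.

Variables (T : R) (b0 : R -> (K + K)%type -> R) (p0 : Path).
Hypotheses (nb : nice ah T b0) (cp : clamped p0).
Hypothesis h0 : forall k t, A k -> 0 <= t <= 1 -> Hf k.1 p0 t = b0 (T * t) (inl k).
Hypothesis hramp : forall k U, good (k :: U) -> ~~ isr k.1 -> vld ah T (k :: U) b0 ->
  exists c, 0 <= c <= T /\ forall t, 0 <= t <= T -> Xt T (Ht (Fop ah T U b0) k) t = ramp c t.
Local Notation Fop := (Fop ah T).
Local Notation vld := (vld ah T).
Local Notation po := (po coroot supp root T b0 p0).
Local Notation trk := (trk coroot supp root T b0).

Lemma trk_notin U t k : k \notin U -> trk U t k = 0.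
Proof.
elim: U => [_|l U IH]; first by rewrite /trk /= subrr.
rewrite inE negb_or => /andP[/negbTE kl kU].
by rewrite trk_cons kl mul0r addr0 IH.
Qed.

Lemma trk_ramp U k : good U -> vld U b0 -> k \in U -> ~~ isr k.1 ->
  exists c, 0 <= c <= T /\ forall t, 0 <= t <= T -> trk U t k = ramp c t.
Proof.
elim: U => [//|l U IH] gU vU; rewrite inE => hk ik.
have [gU' vU'] : good U /\ vld U b0 by split; [case/and3P: gU|case: vU].
have [kl|kl] := eqVneq k l; last first.
  rewrite (negbTE kl) /= in hk; have [c [h1 h2]] := IH gU' vU' hk ik.
  by exists c; split => // t ht; rewrite trk_cons (negbTE kl) mul0r addr0 h2.
rewrite -kl in gU vU *; have [c [h1 h2]] := hramp gU ik vU; exists c; split => // t ht.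
case/and3P: gU => _ fk _; rewrite (negbTE ik) /= in fk.
by rewrite trk_cons eqxx mul1r trk_notin // add0r h2.
Qed.

Definition same i U := [seq k <- U | k.1 == i].

Lemma same_uniq i U : ~~ isr i -> good U -> uniq (same i U).
Proof.
move=> ii; elim: U => //= k U IH /and3P[_ fk gU]; case: eqP => [e|_] /=; last exact: IH.
rewrite IH // andbT; rewrite e (negbTE ii) /= in fk.
by rewrite mem_filter negb_and fk orbT.
Qed.

Lemma sum_same U S i t : ~~ isr i -> good U -> uniq S -> {subset U <= S} ->
  \sum_(k <- S | k.1 == i) trk U t k = \sum_(k <- same i U) trk U t k.
Proof.
move=> ii gU uS hS; rewrite (bigID (fun k => k \in U)) /= [X in _ + X]big1 ?addr0; last first.
  by move=> k /andP[_ kU]; exact: trk_notin.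
rewrite -big_filter; apply: perm_big; apply: uniq_perm; [exact: filter_uniq|exact: same_uniq|].
move=> k; rewrite !mem_filter; case: (k.1 == i) => //=; case kU : (k \in U) => //=.
exact: hS.
Qed.

(** The progress of a next admissible letter can be read off from the original path. *)
Lemma step_relabel U W k l t : good (k :: U) -> good (l :: W) -> k.1 = l.1 -> vld U b0 -> vld W b0 ->
  po U = po W -> 0 <= t <= T -> Xt T (Ht (Fop U b0) k) t = Xt T (Ht (Fop W b0) l) t.
Proof.
move=> /and3P[Ak fk gU] /and3P[Al fl gW] kl vU vW e ht; have T0 := nb.1.
have [_ _ _ _ eX] := po_okH nb h0 gU Ak fk vU; have [_ _ _ _ eX'] := po_okH nb h0 gW Al fl vW.
have ht' : 0 <= t / T <= 1.
  by apply/andP; split; [apply: divr_ge0; lra|rewrite ler_pdivrMr // mul1r; lra].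
have et : T * (t / T) = t by rewrite mulrCA divff ?mulr1 // gt_eqF.
by rewrite -{1}et -eX // -[in RHS]et -eX' // kl e.
Qed.

Lemma trk_relabel th W t k : good W -> good (map th W) -> vld W b0 ->
  (forall l, l \in W -> (th l).1 = l.1) -> {in W &, injective th} -> k \in W ->
  0 <= t <= T -> trk (map th W) t (th k) = trk W t k.
Proof.
move=> gW gW' vW h inj kW ht.
suff gen W1 W2 : W = W1 ++ W2 -> trk (map th W2) t (th k) = trk W2 t k by exact: (gen [::] W).
elim: W2 W1 => [|l W2 IH] W1 e; first by rewrite /trk /= !subrr.
have lW : l \in W by rewrite e mem_cat mem_head orbT.
rewrite /= !trk_cons (IH (rcons W1 l)) ?cat_rcons //.
have suff_good : forall X Y, good (X ++ Y) -> good Y.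
  by elim=> //= x X IHX Y /and3P[_ _ /IHX].
have g1 : good (l :: W2) by apply: (suff_good W1); rewrite -e.
have g2 : good (map th (l :: W2)) by apply: (suff_good (map th W1)); rewrite -map_cat -e.
have v1 : vld (l :: W2) b0 by move: vW; rewrite e => /vld_cat[].
have g1' : good W2 by case/and3P: g1.
have g2' : good (map th W2) by case/and3P: g2.
have ef : map fst W2 = map fst (map th W2).
  rewrite -map_comp; apply/eq_in_map => x hx /=; rewrite h //.
  by rewrite e mem_cat inE hx !orbT.
have [v2' ep] := po_relabel nb h0 g1' g2' ef v1.1.
congr (_ + _ * _); last first.
  by apply: (step_relabel g2 g1) => //; [rewrite h|exact: v1.1].
by congr (_%:R); congr nat_of_bool; apply/eqP/eqP => [/inj|->//]; apply.
Qed.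

(* Equal paths arise from equal hat paths after renaming imaginary letters: the
   sum of the ramps of index [i] determines their completion times. *)
Lemma matching U W : good U -> good W -> vld U b0 -> vld W b0 -> po U = po W ->
  exists W', [/\ good W', map fst W' = map fst W & eqon T (Fop U b0) (Fop W' b0)].
Proof.
move=> gU gW vU vW e; have T0 := nb.1.
have chooseC Z : good Z -> vld Z b0 -> exists c : K -> R, forall k, k \in Z -> ~~ isr k.1 ->
    0 <= c k <= T /\ forall t, 0 <= t <= T -> trk Z t k = ramp (c k) t.
  move=> gZ vZ; suff h k : exists c : R, k \in Z -> ~~ isr k.1 ->
      0 <= c <= T /\ forall t, 0 <= t <= T -> trk Z t k = ramp c t.
    by have [c hc] := choice h; exists c.
  have [kZ|kZ] := boolP (k \in Z); last by exists 0.
  have [ik|ik] := boolP (isr k.1); first by exists 0.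
  by have [c hc] := trk_ramp gZ vZ kZ ik; exists c.
have [cU hU] := chooseC U gU vU; have [cW hW] := chooseC W gW vW.
have scale t : 0 <= t <= T -> exists2 s, 0 <= s <= 1 & t = T * s.
  move=> ht; exists (t / T); last by rewrite mulrCA divff ?mulr1 // gt_eqF.
  by apply/andP; split; [apply: divr_ge0; lra|rewrite ler_pdivrMr // mul1r; lra].
have sameS i Z k : k \in same i Z -> k \in Z /\ k.1 = i.
  by rewrite mem_filter => /andP[/eqP].
have ramps Z c : (forall k, k \in Z -> ~~ isr k.1 ->
    0 <= c k <= T /\ forall t, 0 <= t <= T -> trk Z t k = ramp (c k) t) ->
    forall i t, ~~ isr i -> 0 <= t <= T ->
    \sum_(k <- same i Z) trk Z t k = \sum_(x <- map c (same i Z)) ramp x t.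
  move=> hc i t ii ht; rewrite big_map; apply: eq_big_seq => k /sameS[kZ ki].
  by have [|_ ->] := hc k kZ; rewrite ?ki.
have pm i : ~~ isr i -> perm_eq (map cU (same i U)) (map cW (same i W)).
  move=> ii; apply: (@ramps_determined R T) => [c|c|t ht|]; last exact: ltW.
  - by move=> /mapP[k /sameS[kU ki] ->]; have [] := hU k kU; rewrite ?ki.
  - by move=> /mapP[k /sameS[kU ki] ->]; have [] := hW k kU; rewrite ?ki.
  have uS : uniq (undup (U ++ W)) := undup_uniq _.
  rewrite -(ramps U cU) // -(ramps W cW) //.
  rewrite -(sum_same (S := undup (U ++ W))) //; last by move=> k hk; rewrite mem_undup mem_cat hk.
  rewrite -(sum_same (S := undup (U ++ W)) (U := W)) //; last by move=> k hk; rewrite mem_undup mem_cat hk orbT.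
  have [s hs ->] := scale t ht; exact: (po_eq_sum HBC i e hs).
have [th0 hth0] : exists th : I -> K -> K, forall i, ~~ isr i ->
    [/\ forall k, k \in same i W -> th i k \in same i U, forall k, k \in same i W -> cU (th i k) = cW k,
     {in same i W &, injective (th i)} & forall k, k \in same i U -> exists2 k', k' \in same i W & th i k' = k].
  suff h i : exists th : K -> K, ~~ isr i -> [/\ forall k, k \in same i W -> th k \in same i U,
     forall k, k \in same i W -> cU (th k) = cW k,
     {in same i W &, injective th} & forall k, k \in same i U -> exists2 k', k' \in same i W & th k' = k].
    by have [th hth] := choice h; exists th.
  have [ii|ii] := boolP (isr i); first by exists id.
  by have [th h] := perm_map_matching (same_uniq ii gU) (same_uniq ii gW) (pm i ii); exists th.
pose th k := if isr k.1 then k else th0 k.1 k.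
have kS k Z : k \in Z -> k \in same k.1 Z by rewrite mem_filter eqxx.
have thE k : k \in W -> ~~ isr k.1 -> [/\ th k \in U, (th k).1 = k.1 & cU (th k) = cW k].
  move=> kW ik; have [h1 h2 _ _] := hth0 _ ik; have kw := kS _ _ kW.
  by have [h3 h4] := sameS _ _ _ (h1 _ kw); rewrite /th (negbTE ik) h2.
have th1 k : k \in W -> (th k).1 = k.1.
  by move=> kW; have [ik|ik] := boolP (isr k.1); [rewrite /th ik|case: (thE k)].
have thA k : k \in W -> A (th k) /\ (th k).1 = k.1.
  move=> kW; split; last exact: th1.
  have [ik|ik] := boolP (isr k.1); first by rewrite /th ik; exact: (allP (good_all gW)).
  by have [h _ _] := thE k kW ik; exact: (allP (good_all gU)).
have inj : {in W &, injective th}.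
  move=> k l kW lW ekl; have e1 : k.1 = l.1 by rewrite -(th1 k) // -(th1 l) // ekl.
  move: ekl; rewrite /th -e1; case: ifP => // /negbT ik; have [_ _ h _] := hth0 _ ik.
  by apply: h; [exact: kS|rewrite e1; exact: kS].
have gW' := good_relabel gW thA inj.
have ef : map fst (map th W) = map fst W.
  by rewrite -map_comp; apply/eq_in_map => k kW /=; rewrite th1.
exists (map th W); split => //.
have [vW' eW'] := po_relabel nb h0 gW gW' (esym ef) vW.
have eUW' : po U = po (map th W) by rewrite eW'.
have tE k t : 0 <= t <= T -> trk U t k = trk (map th W) t k.
  move=> ht; have [ik|ik] := boolP (isr k.1); last first.
    have [kU|kU] := boolP (k \in U).
      have [_ h2 _ h4] := hth0 _ ik; have [k' k's ek] := h4 _ (kS _ _ kU).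
      have [k'W k'1] := sameS _ _ _ k's.
      have ek' : th k' = k by rewrite /th k'1 (negbTE ik).
      have ik' : ~~ isr k'.1 by rewrite k'1.
      rewrite -[in RHS]ek' (trk_relabel gW gW' vW th1 inj k'W ht).
      have [_ ->] := hU k kU ik => //; have [_ ->] := hW k' k'W ik' => //.
      by have [_ _ <-] := thE k' k'W ik'; rewrite ek'.
    rewrite !trk_notin //; apply/mapP => -[l lW el].
    have il : ~~ isr l.1 by rewrite -(th1 l lW) -el.
    by have [h _ _] := thE l lW il; rewrite el h in kU.
  have [kS'|] := boolP (k \in undup (U ++ map th W)); last first.
    by rewrite mem_undup mem_cat negb_or => /andP[h1 h2]; rewrite !trk_notin.
  (* A real index has a single active letter, so the total progress of the index is that of the
     letter. *)
  have onlyk l : l \in undup (U ++ map th W) -> l.1 = k.1 -> l = k.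
    move=> lS' lk; have al x : x \in undup (U ++ map th W) -> A x.
      by rewrite mem_undup mem_cat => /orP[|]; apply/allP; apply: good_all.
    have := al _ lS'; have := al _ kS'; rewrite /act_letter lk ik.
    by case: (k) (l) lk => ? ? [? ?] /= -> /eqP -> /eqP ->.
  have [s hs ->] := scale t ht; have := po_eq_sum HBC k.1 eUW' hs.
  have one Z : \sum_(l <- undup (U ++ map th W) | l.1 == k.1) trk Z (T * s) l = trk Z (T * s) k.
    rewrite big_mkcond (bigD1_seq k) ?undup_uniq //= eqxx big_seq_cond big1 ?addr0 //.
    by move=> l /andP[lS' lk]; case: eqP => // /(onlyk l lS') lk'; rewrite lk' eqxx in lk.
  by rewrite !one.
move=> t ht; apply/funext => x; have uS : uniq (undup (U ++ map th W)) := undup_uniq _.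
have sU : {subset U <= undup (U ++ map th W)} by move=> k hk; rewrite mem_undup mem_cat hk.
have sW : {subset map th W <= undup (U ++ map th W)} by move=> k hk; rewrite mem_undup mem_cat hk orbT.
rewrite (Fop_trk coroot supp root T b0 t x uS sU) (Fop_trk coroot supp root T b0 t x uS sW).
congr (_ - _); apply: eq_bigr => k _; by rewrite tE.
Qed.

End Matching.

(** * Straight paths: ramps, strings and lowering *)

Section Straight.
Variables (R : realType) (K : choiceType) (a : K -> K -> int).
Hypothesis ga : gcm a.
Local Notation vec := ((K + K)%type -> R).
Local Notation al := (al R a).
Local Notation rho := (@rho R K).
Local Notation fop := (fop a).
Local Notation eop := (eop a).
Local Notation Fop := (Fop a).
Local Notation vld := (vld a).
Local Notation nice := (nice a).
Implicit Types (b p : R -> vec) (F G U : seq K) (T t s : R) (i j k : K).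
Implicit Types (u v mu nu : vec) (m n : nat).

Lemma Xt_inr L b i t : Xt L (Ht b i) t = b t (inr i) - fop L i b t (inr i).
Proof. by rewrite /fop vecDE vecNE scE /= eqxx mulr1; ring. Qed.

Lemma dom_rho : dom rho. Proof. by move=> k; exact: ler01. Qed.

Lemma isint_rho1 : isint rho. Proof. by move=> k; exact: rpred1. Qed.

Lemma st_absorb_X nu F k t : dom nu -> vld 1 F (st nu) -> 0 <= t <= 1 ->
  Xt 2 (Ht (Fop 2 F (line2 nu rho)) k) t = Xt 1 (Ht (Fop 1 F (st nu)) k) t.
Proof.
move=> dn vF ht; have L0 : (0 : R) < 1 := ltr01.
have [_ e] := absorb L0 (@st_lipp R K 1 nu) dom_rho vF.
have e2 : (1 : R) + 1 = 2 by [].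
have lF : lipp 1 (Fop 1 F (st nu)) by apply: lipp_Fop => //; exact: st_lipp.
have ht2 : 0 <= t <= 1 + 1 by lra.
have lr := @st_lipp R K 1 rho; have sr := @st0 R K rho.
have E s : 0 <= s -> s <= 1 -> finf (1 + 1) (Ht (cat 1 (Fop 1 F (st nu)) (st rho)) k) s = finf 1 (Ht (Fop 1 F (st nu)) k) s.
  move=> s0 s1; rewrite cat_finf_l // mn_st ?addr0; last exact: dom_rho.
  rewrite min_l //; have [C lC] := lF (inl k).
  by apply: (finf_le lC); rewrite ?s1 ?lexx.
rewrite line2E -e2 (Xt_eqon _ e ht2) /Xt !E ?ler01 //; lra.
Qed.

(** With [rho] appended, the progress below 1 is proportional to time by [line2_fresh_X]; hence [c]
    is twice the time at which it equals 1/2. *)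
Lemma fresh_ramp nu F k : dom nu -> isint nu -> k \notin F -> vld 1 (k :: F) (st nu) ->
  exists c : R, 0 < c <= 1 /\ forall t, 0 <= t <= 1 ->
    Xt 1 (Ht (Fop 1 F (st nu)) k) t = if t < c then t / c else 1.
Proof.
move=> dn inu kF [vF vk]; set X := Xt 1 _; have L0 : (0 : R) < 1 := ltr01.
have lF : lipp 1 (Fop 1 F (st nu)) by apply: lipp_Fop => //; exact: st_lipp.
have rr : reg (nu + rho) by move=> j; rewrite vecDE ltr_wpDl.
have ir : isint (nu + rho) by apply: isintD => //; exact: isint_rho1.
have lin t t' : 0 <= t' -> t' <= t -> t <= 1 -> X t < 1 -> t * X t' = t' * X t.
  move=> h1 h2 h3; have e s : 0 <= s <= 1 -> X s = Xt 2 (Ht (Fop 2 F (line2 nu rho)) k) s.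
    by move=> hs; rewrite st_absorb_X.
  rewrite !e; try lra; exact: (line2_fresh_X ga dn dom_rho rr ir kF h1 h2 h3).
have [C lC] := Xt_lip L0 (lF (inl k)); rewrite -/X in lC.
have X0 : X 0 = 0 by exact: XtE0.
have X1 : X 1 = 1 by rewrite /X Xt_end // min_l //; move: vk; rewrite /vf; lra.
have h01 : (0 : R) <= 1 := ler01.
have [t0 [ht0 Xt0 _]] : exists s, [/\ 0 <= s <= 1, X s = 1 / 2 & forall r, s < r <= 1 -> 1 / 2 < X r].
  by apply: (lip_ivt lC); lra.
have t00 : 0 < t0.
  by rewrite lt_neqAle (proj1 (andP ht0)) andbT; apply/eqP => e; move: Xt0; rewrite -e X0; lra.
pose c := 2 * t0; have c0 : 0 < c by rewrite /c; lra.
have low t : 0 <= t <= 1 -> X t < 1 -> X t = t / c.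
  move=> ht Xl; have cn : c != 0 by lra.
  have tn : t0 != 0 by lra.
  have [h|h] := leP t t0.
    have := lin t0 t (proj1 (andP ht)) h (proj2 (andP ht0)); rewrite Xt0 => /(_ _).
    have h2 : 1 / 2 < 1 :> R by lra.
    by move=> /(_ h2) e; apply: (mulfI tn); rewrite e /c; field.
  have := lin t t0 (ltW t00) (ltW h) (proj2 (andP ht)) Xl; rewrite Xt0 => e.
  by apply: (mulfI tn); rewrite -e /c; field.
have Xle t : X t <= 1 by exact: X_le1.
have big t : 0 <= t <= 1 -> t < c -> X t < 1.
  move=> ht tc; rewrite lt_neqAle Xle andbT; apply/eqP => Xe.
  have tc1 : t / c < 1 by rewrite ltr_pdivrMr // mul1r.
  have tc0 : 0 <= t / c by apply: divr_ge0; lra.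
  have [r [hr Xr _]] : exists s, [/\ 0 <= s <= t, X s = (1 + t / c) / 2 &
      forall r, s < r <= t -> (1 + t / c) / 2 < X r].
    by apply: (lip_ivt lC); lra.
  have hr1 : 0 <= r <= 1 by lra.
  have Xr1 : X r < 1 by lra.
  have e := low r hr1 Xr1.
  have : r / c <= t / c by apply: ler_wpM2r; [rewrite invr_ge0 ltW|lra].
  by lra.
have c1 : c <= 1.
  by rewrite leNgt; apply/negP => h; have := big 1; rewrite X1 ltxx h01 lexx => /(_ isT h).
exists c; split; first by rewrite c0.
move=> t ht; have [tc|tc] := ltP t c; first by apply: low => //; exact: big.
apply/eqP; rewrite eq_le Xle leNgt; apply/negP => h; have e := low t ht h.
by move: h; rewrite e ltr_pdivrMr // mul1r; lra.
Qed.

Lemma Xt_cat_l T S b c i t : 0 < T -> 0 < S -> lipp T b -> lipp S c -> c 0 = 0 ->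
  mn T b i + 1 <= b T (inl i) + mn S c i -> 0 <= t <= T + S ->
  Xt (T + S) (Ht (cat T b c) i) t = if t <= T then Xt T (Ht b i) t else 1.
Proof.
move=> T0 S0 lb lc c0 h ht; rewrite Xt_inr (fop_cat_l a T0 S0 lb lc c0 h ht).
have [tT|tT] := leP t T; first by rewrite !cat_l // -Xt_inr.
have m0 := mn_le0 i S0 lc c0; have v : vf T i b by rewrite /vf; lra.
rewrite !(cat_r _ c0 (ltW tT)) (fop_end a T0 lb v) !vecDE vecNE /= eqxx -[true%:R]/(1 : R); ring.
Qed.

Lemma Xt_cat_r T S b c i t : 0 < T -> 0 < S -> lipp T b -> lipp S c -> b 0 = 0 -> c 0 = 0 ->
  b T (inl i) + mn S c i <= mn T b i -> 0 <= t <= T + S ->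
  Xt (T + S) (Ht (cat T b c) i) t = if t <= T then 0 else Xt S (Ht c i) (t - T).
Proof.
move=> T0 S0 lb lc b0 c0 h ht; rewrite Xt_inr (fop_cat_r a T0 S0 lb lc c0 b0 h ht).
have [tT|tT] := leP t T; first by rewrite !cat_l // subrr.
have f0 : fop S i c 0 = 0 by rewrite fop0.
rewrite (cat_r _ c0 (ltW tT)) (cat_r _ f0 (ltW tT)) !vecDE Xt_inr; ring.
Qed.

Section Product.
Variables (bs : nat -> R -> vec) (N : nat) (Gs : nat -> seq K) (nus : nat -> vec) (k : K).
Hypothesis hd : forall q : nat, (q < N)%N -> dom (nus q) /\ isint (nus q).
Hypothesis hb : forall q : nat, (q < N)%N ->
  vld 1 (Gs q) (st (nus q)) /\ eqon 1 (Fop 1 (Gs q) (st (nus q))) (bs q).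
Hypothesis kG : forall q : nat, (q < N)%N -> k \notin Gs q.

Lemma factor_ramp (q : nat) F : (q < N)%N -> k \notin F -> vld 1 (k :: F) (bs q) ->
  exists c : R, 0 < c <= 1 /\ forall t, 0 <= t <= 1 ->
    Xt 1 (Ht (Fop 1 F (bs q)) k) t = if t < c then t / c else 1.
Proof.
move=> qN kF v; have [d i] := hd qN; have [vG e] := hb qN; have L0 : (0 : R) < 1 := ltr01.
have v' := vld_eqon L0 (eqon_sym e) v.
have v2 : vld 1 (k :: (F ++ Gs q)) (st (nus q)) by rewrite -cat_cons; apply/vld_cat.
have [|c [c1 cX]] := fresh_ramp d i _ v2; first by rewrite mem_cat negb_or kF kG.
exists c; split => // t ht; rewrite -cX //; apply: Xt_eqon => //.
by rewrite Fop_cat; apply: Fop_eqon; exact: eqon_sym.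
Qed.

(** The letter acts inside one tensor factor, and its progress starts with that factor, at an
    integral time; this is the integer built into [ramp]. *)
Lemma ramp_product (m : nat) F : (m < N)%N -> k \notin F -> vld m.+1%:R (k :: F) (pc bs m.+1) ->
  exists c : R, 0 <= c <= m.+1%:R /\ forall t, 0 <= t <= m.+1%:R ->
    Xt m.+1%:R (Ht (Fop m.+1%:R F (pc bs m.+1)) k) t = ramp c t.
Proof.
have L0 : (0 : R) < 1 := ltr01.
elim: m F => [|m IH] F hm kF v.
  have e := pc1_eqon ga hd hb hm; have v' := vld_eqon L0 (eqon_sym e) v.
  have [c [c1 cX]] := factor_ramp hm kF v'; exists c; split => [|t ht]; first by lra.
  have -> : Xt 1 (Ht (Fop 1 F (pc bs 1)) k) t = Xt 1 (Ht (Fop 1 F (bs 0)) k) t.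
    by apply: Xt_eqon => //; apply: Fop_eqon; exact: eqon_sym.
  rewrite cX // (@rampE _ 0) ?add0r ?subr0; try by lra.
  have [t0|//] := leP t 0; have -> : t = 0 by lra.
  have -> : 0 < c by lra.
  by rewrite mul0r.
have hm' := ltnW hm; have np := nice_pc ga hd hb hm'; have nf := nice_factor ga hd hb hm.
rewrite -[m.+2%:R]natr1 [pc _ m.+2]/= -/(pc bs m.+1) in v *.
set T : R := m.+1%:R in v np IH *; have T0 : 0 < T := np.1.
have [vF vk] := v; have [F1 [F2 [pF v1 v2 e]]] := Fop_tensor np nf vF.
have [k1 k2] : k \notin F1 /\ k \notin F2.
  by move: kF; rewrite (perm_mem pF) mem_cat negb_or => /andP.
have T1 : 0 < T + 1 by rewrite addr_gt0.
have o1 := np.2 _ v1; have o2 := nf.2 _ v2.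
have [l1 z1 _ _ _] := o1; have [l2 z2 _ _ _] := o2.
have vk' := vf_eqon T1 e vk.
have [h|h] := tensor_or k o1 o2.
  have m0 := mn_le0 k L0 l2 z2.
  have [|c [c1 cX]] := IH F1 hm' k1; first by split => //; rewrite /vf; lra.
  exists c; split => [|t ht]; first by lra.
  rewrite (Xt_eqon k e ht) (Xt_cat_l T0 L0 l1 l2 z2 h ht); have [tT|tT] := leP t T.
    by apply: cX; lra.
  by rewrite ramp_ge //; lra.
have [|c [c1 cX]] := factor_ramp hm k2 _.
  split => //; move: vk'; rewrite /vf mn_cat // cat_end // vecDE min_r //; lra.
exists (T + c); split => [|t ht]; first by lra.
rewrite (Xt_eqon k e ht) (Xt_cat_r T0 L0 l1 l2 z1 z2 h ht).
have eT : T = (m.+1 : int)%:~R by [].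
rewrite (@rampE _ m.+1) -?eT; try by lra.
have [//|tT] := leP t T; rewrite cX; last by lra.
have -> : T + c - T = c by ring.
by have -> : (t - T < c) = (t < T + c) by rewrite ltrBlDl.
Qed.

End Product.

(** A letter acting on the straight factor would be visible in the formal root coordinates at its
    end, which count the letters applied to it; so all letters act on [p]. *)
Lemma absorb_conv T p v F c : nice T p -> dom v -> isint v -> vld (T + 1) F (cat T p (st v)) ->
  eqon (T + 1) (Fop (T + 1) F (cat T p (st v))) (cat T c (st v)) -> vld T F p.
Proof.
move=> np dv iv; have nv := nice_st ga dv iv; have T0 := np.1; have L0 : (0 : R) < 1 := ltr01.
have T1 : 0 < T + 1 by rewrite addr_gt0.
have lv := @st_lipp R K 1 v; have sv := @st0 R K v; have h11 : 0 <= (1 : R) <= 1 by rewrite ler01 lexx.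
have nilF F2 : vld 1 F2 (st v) -> eqon 1 (Fop 1 F2 (st v)) (st v) -> F2 = [::].
  move=> v2 e2; have h k : count_mem k F2 = 0%N.
    have := congr1 (fun f => f (inr k)) (e2 1 h11); rewrite Fop_end // sum_al_inr => h.
    by apply/eqP; rewrite -(eqr_nat R); apply/eqP; lra.
  by case: F2 {v2 e2} h => // x F2 /(_ x) /=; rewrite eqxx.
elim: F c => [//|i F IH] c [vF vi] e.
have [F1 [F2 [pF v1 v2 eF]]] := Fop_tensor np nv vF.
have o1 := np.2 _ v1; have o2 := nv.2 _ v2.
have [l1 z1 _ _ _] := o1; have [l2 z2 _ _ _] := o2.
have ei := fop_eqon a i eF.
have [h|h] := tensor_or i o1 o2.
  have e3 := eqon_trans (eqon_sym (eqon_trans ei (fop_cat_l a T0 L0 l1 l2 z2 h))) e.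
  have [||||_ q2] := cat_inj _ _ _ _ e3; rewrite ?(ltW T0) ?ler01 ?z2 //.
  have F20 := nilF _ v2 q2; rewrite F20 /= in eF h.
  have vFp : vld T F p by exact: IH eF.
  split => //; have [_ e4] := absorb T0 (nice_lipp np) dv vFp.
  have [||||q1 _] := cat_inj _ _ _ _ (eqon_trans (eqon_sym eF) e4); rewrite ?(ltW T0) ?ler01 //.
  by apply: (vf_eqon T0 q1); rewrite /vf; move: h; rewrite mn_st // addr0.
have e3 := eqon_trans (eqon_sym (eqon_trans ei (fop_cat_r a T0 L0 l1 l2 z2 z1 h))) e.
have [||||_ q2] := cat_inj _ _ _ _ e3; rewrite ?(ltW T0) ?ler01 ?fop0 //.
have vi2 : vf 1 i (Fop 1 F2 (st v)).
  by move: (vf_eqon T1 eF vi); rewrite /vf mn_cat // cat_end // vecDE min_r //; lra.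
have v3 : vld 1 (i :: F2) (st v) by split.
by have := nilF (i :: F2) v3 q2.
Qed.

(** With [rho] appended this is [fam_lower] at parameter 0; [absorb_conv] makes the word so obtained
    act on [nu] alone. *)
Lemma st_lower nu G i : dom nu -> isint nu -> vld 1 G (st nu) -> ve 1 i (Fop 1 G (st nu)) ->
  exists G', [/\ perm_eq (i :: G') G, vld 1 (i :: G') (st nu) &
    eqon 1 (Fop 1 G (st nu)) (Fop 1 (i :: G') (st nu))].
Proof.
move=> dn inu vG vi; have L0 : (0 : R) < 1 := ltr01.
have rr : reg (nu + rho) by move=> j; rewrite vecDE ltr_wpDl.
have ir : isint (nu + rho) by apply: isintD => //; exact: isint_rho1.
have lnu := @st_lipp R K 1 nu.
have [v1 e1] := absorb L0 lnu dom_rho vG.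
have h01 : 0 <= (0 : R) <= 1 by rewrite lexx ler01.
have e2 : (1 : R) + 1 = 2 by [].
have [||G' [pG vG' eG]] := @fam_lower _ _ _ ga nu rho dn dom_rho rr ir G i 0 h01; rewrite ?fam0 ?line2E //.
  by rewrite /ve -e2 absorb_mn //; exact: dom_rho.
rewrite fam0 line2E -e2 in vG' eG.
have ec := eqon_trans (eqon_sym eG) e1.
have v2 := absorb_conv (nice_st ga dn inu) dom_rho isint_rho1 vG' ec.
exists G'; split => //; have [_ e3] := absorb L0 lnu dom_rho v2.
have e4 := eqon_trans (eqon_trans (eqon_sym e1) eG) e3.
by have [||||q _] := cat_inj _ _ _ _ e4; rewrite ?ler01 ?st0.
Qed.

(** The image follows the reflected direction until time [m / c] and then resumes [mu]. Other
    coordinates of [mu] may be negative, as for extremal weights. *)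
Lemma straight_f mu k m (c : nat) : mu (inl k) = c%:R -> (m <= c)%N -> (0 < c)%N ->
  vld 1 (nseq m k) (st mu) /\
  eqon 1 (Fop 1 (nseq m k) (st mu)) (fun t => sc t mu - sc (Num.min (t * c%:R) m%:R) (al k)).
Proof.
move=> muk + c0; have L0 : (0 : R) < 1 := ltr01; elim: m => [_|m IH mc].
  split => // t ht; have -> : Num.min (t * c%:R) 0%:R = 0 :> R.
    by rewrite min_r // mulr_ge0 //; case/andP: ht.
  by apply/funext => x; rewrite /st !vecE mul0r subr0.
have [vm e] := IH (ltnW mc).
have lm : lipp 1 (Fop 1 (nseq m k) (st mu)) by apply: lipp_Fop => //; exact: st_lipp.
have [C lC] := lm (inl k); set b := Fop 1 (nseq m k) (st mu) in vm e lm lC *.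
have cR : (0 : R) < c%:R by rewrite ltr0n.
have mcR : (m%:R : R) + 1 <= c%:R by rewrite natr1 ler_nat.
have Hb t : 0 <= t <= 1 -> Ht b k t = t * c%:R - 2 * Num.min (t * c%:R) m%:R.
  by move=> ht; rewrite /Ht e // !vecE muk /= a2 //; ring.
have tm0 : 0 <= m%:R / c%:R :> R by rewrite divr_ge0.
have tm1 : m%:R / c%:R <= 1 :> R by rewrite ler_pdivrMr // mul1r; lra.
have tmc : m%:R / c%:R * c%:R = m%:R :> R by rewrite divfK // gt_eqF.
have F t : 0 <= t <= 1 -> finf 1 (Ht b k) t = Num.max (t * c%:R) m%:R - 2 * m%:R.
  move=> ht; apply/eqP; rewrite eq_le; apply/andP; split.
    have [h|h] := leP (t * c%:R) m%:R.
      have -> : m%:R - 2 * m%:R = Ht b k (m%:R / c%:R).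
        by rewrite Hb ?tm0 // tmc minxx; ring.
      apply: (finf_le lC); first by case/andP: ht.
      by rewrite tm1 andbT ler_pdivlMr.
    have -> : t * c%:R - 2 * m%:R = Ht b k t by rewrite Hb // min_r // ltW.
    by apply: (finf_le lC); lra.
  apply: (le_finf lC) => // s hs; rewrite -[leRHS]/(Ht b k s) Hb; last by lra.
  have h1 : t * c%:R <= s * c%:R by apply: ler_wpM2r; lra.
  have [h|h] := leP (t * c%:R) m%:R; have [h'|h'] := leP (s * c%:R) m%:R; lra.
have h01 : 0 <= (0 : R) <= 1 by rewrite lexx ler01.
have m0 : mn 1 b k = - m%:R.
  by rewrite /mn F // mul0r max_r //; ring.
have h11 : 0 <= (1 : R) <= 1 by rewrite ler01 lexx.
split; first by split => //; rewrite /vf -/b m0 -/(Ht b k 1) Hb // mul1r min_r; lra.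
move=> t ht; rewrite /= -/b /fop e //; apply/funext => x; rewrite !vecE.
have -> : Xt 1 (Ht b k) t = Num.min (t * c%:R) m.+1%:R - Num.min (t * c%:R) m%:R.
  have eS : m.+1%:R = m%:R + 1 :> R by rewrite natr1.
  rewrite /Xt F // -/(mn 1 b k) m0 eS; move: (t * _) (m%:R) => y z.
  have [h1|h1] := leP y z.
    by rewrite (min_l (x := y)); [rewrite min_r; lra|lra].
  have [h2|h2] := leP y (z + 1); [rewrite min_r|rewrite min_l]; lra.
by ring.
Qed.

Lemma straight_refl mu k (c : nat) : mu (inl k) = c%:R ->
  vld 1 (nseq c k) (st mu) /\ eqon 1 (Fop 1 (nseq c k) (st mu)) (st (rs a k mu)).
Proof.
case: c => [|c] muk.
  split => // t ht; apply/funext => x; rewrite /st !vecE rsE muk mul0r subr0 //.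
have [v e] := straight_f muk (leqnn _) (ltn0Sn _); split => // t ht; rewrite e //.
rewrite min_l; last by rewrite ler_piMl //; case/andP: ht.
by apply/funext => x; rewrite /st !vecE rsE muk; ring.
Qed.

Lemma iter_eop k n b : b 0 = 0 -> iter n (eop 1 k) b = revp 1 (Fop 1 (nseq n k) (revp 1 b)).
Proof.
move=> b0; elim: n => [|n IH] /=; first by rewrite revpK.
by rewrite IH {1}/eop revpK // Fop0 revp0.
Qed.

Lemma straight_raise mu k (c : nat) : mu (inl k) = - c%:R ->
  eqon 1 (iter c (eop 1 k) (st mu)) (st (rs a k mu)).
Proof.
move=> muk; rewrite iter_eop ?st0 //.
have e : eqon 1 (revp 1 (st mu)) (st (- mu)).
  by move=> t _; apply/funext => x; rewrite /revp /st !vecE; ring.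
have [|_ e2] := @straight_refl (- mu) k c; first by rewrite vecNE muk opprK.
apply: eqon_trans (revp_eqon (eqon_trans (Fop_eqon a _ e) e2)) _.
by move=> t _; apply/funext => x; rewrite /revp /st !vecE !rsE !vecE; ring.
Qed.

Lemma st_lower_iter nu G k n : dom nu -> isint nu -> vld 1 G (st nu) ->
  mn 1 (Fop 1 G (st nu)) k <= - n%:R -> exists G',
  [/\ perm_eq (nseq n k ++ G') G, vld 1 G' (st nu) &
    eqon 1 (iter n (eop 1 k) (Fop 1 G (st nu))) (Fop 1 G' (st nu))].
Proof.
move=> dn inu; have L0 : (0 : R) < 1 := ltr01; have nn := nice_st ga dn inu.
elim: n G => [|n IH] G vG hm; first by exists G.
have [|G1 [pG [v1 vk] e]] := st_lower dn inu vG (i := k).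
  by rewrite /ve; move: hm; rewrite -natr1; have : (0 : R) <= n%:R by []; lra.
have [l1 z1 _ _ q1] := nn.2 _ v1.
have m1 : mn 1 (Fop 1 G1 (st nu)) k <= - n%:R.
  move: hm; rewrite (mn_eqon k e) /= (mn_fop ga L0 l1 (q1 k) vk) -/(mn _ _ _) -natr1; lra.
have [G' [p' v' e']] := IH G1 v1 m1; exists G'; split => //.
  by rewrite /=; apply: perm_trans pG; rewrite perm_cons.
rewrite iterSr; apply: eqon_trans e'; have eG1 := eop_fop ga L0 l1 z1 (q1 k) vk.
have h : eqon 1 (eop 1 k (Fop 1 G (st nu))) (Fop 1 G1 (st nu)).
  by apply: eqon_trans eG1; exact: eop_eqon.
elim: (n) => [//|n' IHn]; exact: eop_eqon.
Qed.

End Straight.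

(** * Weights in W P^+ as ends of extremal straight paths *)

Section Extremal.
Variables (R : realType) (I : countType) (J : choiceType).
Variables (coroot : I -> J -> int) (supp : I -> seq J) (root : I -> J -> int).
Hypothesis HBC : BC_datum coroot supp root.
Local Notation pairZ := (pairZ coroot supp).
Local Notation pairR := (pairR (R := R) coroot supp).
Local Notation cartan := (cartan coroot supp root).
Local Notation isr := (is_real_index coroot supp root).
Local Notation Hf := (Hf (R := R) coroot supp).
Local Notation Path := (Path R J).
Local Notation K := (I * nat)%type.
Local Notation ah := (ah coroot supp root).
Local Notation A := (act_letter coroot supp root).
Local Notation proper := (proper_letter coroot supp root).
Local Notation vec := ((K + K)%type -> R).
Local Notation ga := (gcm_ah HBC).
Implicit Types (i j : I) (k l : K) (t s : R) (G : seq K) (mu : J -> int).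

Lemma pairZ_refl i j mu : pairZ i (refl coroot supp root j mu) = pairZ i mu - pairZ j mu * cartan i j.
Proof.
rewrite /Defs.pairZ /refl /Defs.cartan /Defs.pairZ mulr_sumr -sumrB; apply: eq_bigr => k _.
by rewrite mulrBr mulrCA.
Qed.

Definition hat mu : vec := fun x => if x is inl k then (pairZ k.1 mu)%:~R else 0.

Lemma isint_hat mu : isint (hat mu).
Proof. by move=> k; exact: intr_int. Qed.

Lemma fresh_odd G i : exists q, odd q /\ (i, q) \notin G.
Proof.
exists (\sum_(l <- G) l.2).*2.+1; rewrite /= odd_double; split => //; apply/negP => h.
have : ((\sum_(l <- G) l.2).*2.+1 <= \sum_(l <- G) l.2)%N.
  by rewrite {2}(perm_big _ (perm_to_rem h)) big_cons /= leq_addr.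
lia.
Qed.

Definition ext_letter k := if isr k.1 then k.2 == 0%N else odd k.2.

(** Induction on the word of reflections. With [c] the pairing at [i], the reflection is [f_k^c] if
    [c >= 0], and for real [i] and negative [c] a power of [e_k], which shortens [G]. For imaginary
    [i] the letter [k] is a new one with odd label, whose own pairing is the only one to come out
    differently. There [c] is nonnegative, because the letters of [G] pair nonpositively with
    [k]. *)
Lemma extremal_hat mu : in_WPplus coroot supp root mu -> exists G (nu muh : vec),
  [/\ dom nu /\ isint nu, vld ah 1 G (st nu), all ext_letter G,
      eqon 1 (Fop ah 1 G (st nu)) (st muh) &
      forall k, proper k -> isr k.1 || (k \notin G) -> muh (inl k) = (pairZ k.1 mu)%:~R].
Proof.
move=> [w [nu0 [dn ->]]] {mu}; have L0 : (0 : R) < 1 := ltr01.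
have h11 : 0 <= (1 : R) <= 1 by rewrite ler01 lexx.
elim: w => [|i w [G [nu [muh [[dnu inu] vG allG eG mE]]]]].
  exists [::], (hat nu0), (hat nu0); split => //; split; last exact: isint_hat.
  by move=> k; rewrite /hat -[0]/(0%:~R) ler_int.
cbn [foldr]; set mu := foldr _ _ _ in mE *; set c := pairZ i mu.
have [k [k1 pk ek fk]] : exists k, [/\ k.1 = i, proper k, ext_letter k & isr k.1 || (k \notin G)].
  rewrite /proper_letter /ext_letter; have [ii|ii] := boolP (isr i).
    by exists (i, 0%N); rewrite /= ii.
  have [q [oq fq]] := fresh_odd G i; exists (i, q).
  by rewrite /= (negbTE ii); split.
have mk : muh (inl k) = c%:~R by rewrite mE // k1.
have lnu := @st_lipp R K 1 nu.
have new l : proper l -> isr l.1 || (l != k) -> isr l.1 || (l \notin G) ->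
    rs ah k muh (inl l) = (pairZ l.1 (refl coroot supp root i mu))%:~R.
  move=> pl lk lG; rewrite rsE mE // mk pairZ_refl /= ahE // k1.
  by rewrite rmorphB rmorphM.
case ec : c => [m|m].
  have mk' : muh (inl k) = m%:R by rewrite mk ec.
  have [v e] := straight_refl ga mk'.
  exists (nseq m k ++ G), nu, (rs ah k muh); split => //.
  - by apply/vld_cat; split => //; apply: (vld_eqon L0 (eqon_sym eG)).
  - by rewrite all_cat allG andbT all_nseq ek orbT.
  - by rewrite Fop_cat; apply: eqon_trans (Fop_eqon ah _ eG) e.
  move=> l pl; rewrite mem_cat negb_or => h.
  have lG : isr l.1 || (l \notin G) by case/orP: h => [->//|/andP[_ ->]]; rewrite orbT.
  have [m0|m0] := posnP m; last first.
    apply: new => //; case/orP: h => [->//|/andP[h _]]; apply/orP; right.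
    by apply: contraNneq h => ->; rewrite mem_nseq m0 eqxx.
  rewrite rsE mk' m0 mul0r subr0 mE // pairZ_refl -/c ec m0.
  by rewrite mul0r subr0.
have mk' : muh (inl k) = - m.+1%:R by rewrite mk ec NegzE rmorphN.
have [ii|ii] := boolP (isr i); last first.
  exfalso; have e1 := congr1 (fun f => f (inl k)) (eG 1 h11); rewrite Fop_end // !st1 mk' in e1.
  have kG : k \notin G by move: fk; rewrite k1 (negbTE ii).
  have s0 : \sum_(l <- G) al R ah l (inl k) <= 0.
    rewrite big_seq; apply: sumr_le0 => l lG; rewrite /= -[0]/(0%:~R) ler_int.
    by apply: (aneg ga); apply: contraNneq kG => ->.
  have := dnu k; have : (0 : R) < m.+1%:R by rewrite ltr0n.
  by lra.
have hm : mn 1 (Fop ah 1 G (st nu)) k <= - m.+1%:R.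
  rewrite (mn_eqon k eG); have := mn_le k (@st_lipp R K 1 muh) h11.
  by rewrite st1 mk'.
have [G' [pG vG' eG']] := st_lower_iter ga dnu inu vG hm.
have it n (b b' : R -> vec) : eqon 1 b b' -> eqon 1 (iter n (eop ah 1 k) b) (iter n (eop ah 1 k) b').
  by move=> h; elim: n => [//|n IHn]; exact: eop_eqon.
exists G', nu, (rs ah k muh); split => //.
- by move: allG; rewrite -(perm_all ext_letter pG) all_cat => /andP[].
- exact: (eqon_trans (eqon_sym eG') (eqon_trans (it m.+1 _ _ eG) (straight_raise ga mk'))).
move=> l pl h; have lk : isr l.1 || (l != k).
  by case: eqP => [->|]; rewrite ?orbT // k1 ii.
apply: new => //; have [il|il] := boolP (isr l.1) => //=; rewrite (negbTE il) /= in h lk.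
by rewrite -(perm_mem pG) mem_cat negb_or h andbT mem_nseq negb_and lk orbT.
Qed.

End Extremal.

(** * Concatenations of straight paths in unit time *)

Section Concat.
Variables (R : realType) (I : countType) (J : choiceType).
Variables (coroot : I -> J -> int) (supp : I -> seq J).
Local Notation pairR := (pairR (R := R) coroot supp).
Local Notation Path := (Path R J).
Implicit Types (t : R) (lams : seq (J -> int)).

Definition lamn lams (q : nat) : J -> int := nth (fun _ => 0) lams q.

Lemma concat_clamped (ps : seq Path) : clamped (concat ps).
Proof. by move=> t; rewrite /concat (clamp_id (clamp_bound t)). Qed.

(** Asking only for a closed unit interval around the rescaled time hides the truncation and its
    cut-off at [t = 1]; at break points both neighbours give the same value. *)
Lemma concat_val lams t : lams != [::] -> 0 <= t <= 1 -> exists2 l : nat, (l < size lams)%N &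
  l%:R <= (size lams)%:R * t <= l%:R + 1 /\ concat [seq pi_mu (emb R mu) | mu <- lams] t = fun k =>
   \sum_(q < l) (lamn lams q k)%:~R + ((size lams)%:R * t - l%:R) * (lamn lams l k)%:~R.
Proof.
move=> l0 ht; have n0 : (0 < size lams)%N by rewrite lt0n size_eq0.
set n := size lams in n0 *; set y := n%:R * t.
have y0 : 0 <= y by apply: mulr_ge0 => //; lra.
have yn : y <= n%:R by rewrite -[leRHS]mulr1; apply: ler_wpM2l => //; lra.
have /andP[t1 t2] := truncn_itv y0.
set l := minn n.-1 (Num.truncn y).
have ln : (l < n)%N by rewrite /l; apply: leq_ltn_trans (geq_minl _ _) _; rewrite prednK.
have ly : l%:R <= y <= l%:R + 1.
  apply/andP; split; first by apply: le_trans t1; rewrite ler_nat geq_minr.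
  rewrite /l; have [h|h] := leqP n.-1 (Num.truncn y); last by rewrite natr1 ltW.
  by rewrite natr1 prednK.
exists l => //; split => //; apply/funext => k.
rewrite /concat size_map -/n (clamp_id ht) -/y -/l.
have nE q : (q < n)%N -> nth (fun _ _ => 0) [seq pi_mu (emb R mu) | mu <- lams] q = pi_mu (emb R (lamn lams q)).
  by move=> h; rewrite (nth_map (fun _ => 0)).
rewrite nE // /pi_mu /vscale /emb clamp_id; last by lra.
congr (_ + _); apply: eq_bigr => q _; rewrite nE ?(ltn_trans (ltn_ord q)) //.
have h11 : 0 <= (1 : R) <= 1 by rewrite ler01 lexx.
by rewrite /pi_mu /vscale /emb (clamp_id h11) mul1r.
Qed.

Lemma concat_end lams : lams != [::] ->
  concat [seq pi_mu (emb R mu) | mu <- lams] 1 = emb R (fun k => \sum_(mu <- lams) mu k).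
Proof.
move=> l0; have h11 : 0 <= (1 : R) <= 1 by rewrite ler01 lexx.
have [l ln [ly ->]] := concat_val l0 h11; apply/funext => k.
have el : l.+1 = size lams.
  apply/eqP; rewrite eqn_leq ln -(ler_nat R) -natr1; move: ly; rewrite mulr1 => /andP[].
  by [].
rewrite mulr1 -el -natr1 addrAC subrr add0r mul1r -(big_ord_recr l (fun q => (lamn lams q k)%:~R)) /=.
by rewrite /emb rmorph_sum /= (big_nth (fun _ => 0)) big_mkord el.
Qed.

Lemma pairR_sum i l (g : nat -> V R J) (c : R) (h : V R J) :
  pairR i (fun k => \sum_(q < l) g q k + c * h k) = \sum_(q < l) pairR i (g q) + c * pairR i h.
Proof.
rewrite /Defs.pairR mulr_sumr exchange_big /= -big_split /=; apply: eq_bigr => k _.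
by rewrite mulrDr mulr_sumr mulrCA.
Qed.

End Concat.

Lemma pc_val (R : realType) (K : choiceType) (bs : nat -> R -> (K + K)%type -> R) (n l : nat) t x :
  (forall q, bs q 0 = 0) -> (l < n)%N -> l%:R <= t <= l%:R + 1 ->
  pc bs n t x = \sum_(q < l) bs q 1 x + bs l (t - l%:R) x.
Proof.
move=> b0; elim: n l t => [//|n IH] l t; rewrite ltnS leq_eqVlt => /orP[/eqP ->|ln] ht /=; last first.
  have tn : t <= n%:R.
    by case/andP: ht => _ h; apply: le_trans h _; rewrite natr1 ler_nat.
  by rewrite cat_l //; exact: IH.
rewrite cat_r //; last by case/andP: ht.
rewrite vecDE; congr (_ + _); case: n IH {ht} => [|n] IH; first by rewrite big_ord0.
rewrite (IH n) // ?big_ord_recr /=.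
  have -> : n.+1%:R - n%:R = 1 :> R by rewrite -natr1; ring.
  by [].
by rewrite -natr1 lexx lerDl ler01.
Qed.

(** * Transfer between similar systems and the crystal isomorphism *)

Section Transfer.
Variables (R : realType) (I : countType) (J : choiceType).
Variables (coroot : I -> J -> int) (supp : I -> seq J) (root : I -> J -> int).
Hypothesis HBC : BC_datum coroot supp root.
Local Notation cartan := (cartan coroot supp root).
Local Notation isr := (is_real_index coroot supp root).
Local Notation Hf := (Hf (R := R) coroot supp).
Local Notation f_root := (f_root (R := R) coroot supp root).
Local Notation e_root := (e_root (R := R) coroot supp root).
Local Notation Fapply := (Fapply (R := R) coroot supp root).
Local Notation Forbit := (Forbit (R := R) coroot supp root).
Local Notation Path := (Path R J).
Local Notation K := (I * nat)%type.
Local Notation ah := (ah coroot supp root).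
Local Notation A := (act_letter coroot supp root).
Local Notation good := (good coroot supp root).
Local Notation lift := (lift coroot supp root).
Local Notation po := (po coroot supp root).
Local Notation vec := ((K + K)%type -> R).
Implicit Types (i j : I) (k l : K) (t s T : R) (U W : seq K) (F G : seq I).

Lemma good_perm U W : perm_eq U W -> good U = good W.
Proof.
have E Z : good Z = all A Z && uniq [seq k <- Z | ~~ isr k.1].
  elim: Z => //= k Z ->; case: (A k) => //=; case ik : (isr k.1) => //=.
  by rewrite mem_filter ik /= andbCA.
move=> p; rewrite !E (perm_all _ p); congr (_ && _); apply: perm_uniq; exact: perm_filter.
Qed.

(** The path [b0] is a model of [p0] in the larger coordinates; [sys_ramp] is what makes equalities
    of original paths liftable. *)
Record system T (b0 : R -> vec) (p0 : Path) : Prop := System {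
  sys_nice : nice ah T b0;
  sys_clamped : clamped p0;
  sys_height : forall k t, A k -> 0 <= t <= 1 -> Hf k.1 p0 t = b0 (T * t) (inl k);
  sys_ramp : forall k U, good (k :: U) -> ~~ isr k.1 -> vld ah T (k :: U) b0 ->
    exists c, 0 <= c <= T /\ forall t, 0 <= t <= T -> Xt T (Ht (Fop ah T U b0) k) t = ramp c t }.

Lemma Fapply_lift T (b0 : R -> vec) (p0 : Path) F b : system T b0 p0 -> Fapply F p0 = Some b ->
  vld ah T (lift F) b0 /\ b = po T b0 p0 (lift F).
Proof.
move=> S h; apply: (Fapply_Some (sys_nice S) (sys_height S) (good_lift _ _ _ F)).
by rewrite lift_fst.
Qed.

Lemma Fapply_vld T (b0 : R -> vec) (p0 : Path) U : system T b0 p0 -> good U -> vld ah T U b0 ->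
  Fapply (map fst U) p0 = Some (po T b0 p0 U).
Proof. move=> S gU vU; exact: (Fapply_good (sys_nice S) (sys_height S) gU vU). Qed.

Section Two.
Variables (T T' : R) (b0 b0' : R -> vec) (p0 p0' : Path).
Hypotheses (S : system T b0 p0) (S' : system T' b0' p0') (sm : sim ah A T b0 T' b0').

Lemma transfer_vld U : good U -> vld ah T U b0 -> vld ah T' U b0'.
Proof.
move=> gU; have [n n'] := (sys_nice S, sys_nice S').
exact: (sim_vld sm n.1 n'.1 (nice_lipp n) (nice_lipp n') (good_all gU)).
Qed.

Lemma transfer_def F b : Fapply F p0 = Some b -> exists b', Fapply F p0' = Some b'.
Proof.
move=> /(Fapply_lift S)[v _]; exists (po T' b0' p0' (lift F)).
have g := good_lift coroot supp root F.
by rewrite -{1}(lift_fst coroot supp root F); apply: Fapply_vld => //; exact: transfer_vld.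
Qed.

(** The equality is lifted by [matching], carried over by similarity and projected again; renaming
    letters does not change the original word. *)
Lemma transfer_eq F G b b' b'' : Fapply F p0 = Some b -> Fapply G p0 = Some b ->
  Fapply F p0' = Some b' -> Fapply G p0' = Some b'' -> b' = b''.
Proof.
move=> /(Fapply_lift S)[vF ->] /(Fapply_lift S)[vG e] /(Fapply_lift S')[vF' ->] /(Fapply_lift S')[vG' ->].
have [gF gG] := (good_lift coroot supp root F, good_lift coroot supp root G).
have [W [gW eW eq]] := matching HBC (sys_nice S) (sys_height S) (sys_ramp S) gF gG vF vG e.
have [vW _] := po_relabel (sys_nice S) (sys_height S) gG gW (esym eW) vG.
have vW' := transfer_vld gW vW.
have [_ _ h] := sm; have eq' := (h _ _ (good_all gF) (good_all gW) vF vW vF' vW').1 eq.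
rewrite (po_eqon (sys_nice S') (sys_clamped S') eq').
by have [_ ->] := po_relabel (sys_nice S') (sys_height S') gG gW (esym eW) vG'.
Qed.

End Two.

Section Isomorphism.
Variables (T T' : R) (b0 b0' : R -> vec) (p0 p0' : Path).
Hypotheses (S : system T b0 p0) (S' : system T' b0' p0') (sm : sim ah A T b0 T' b0').
Hypothesis ends : p0 1 = p0' 1.
Hypothesis lower : forall k U, isr k.1 -> good U -> vld ah T U b0 -> ve T k (Fop ah T U b0) ->
  exists U', [/\ perm_eq (k :: U') U, vld ah T (k :: U') b0 & eqon T (Fop ah T U b0) (Fop ah T (k :: U') b0)].

Lemma iso_map : exists Phi : Path -> Path, forall F b, Fapply F p0 = Some b -> Fapply F p0' = Some (Phi b).
Proof.
(* The condition on [b] is placed under the existential so that choice yields a total function,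
   arbitrary off the orbit. *)
have h b : exists c, (exists F, Fapply F p0 = Some b) -> exists2 F, Fapply F p0 = Some b & Fapply F p0' = Some c.
  have [[F e]|n] := pselect (exists F, Fapply F p0 = Some b); last by exists b => /n.
  by have [c ec] := transfer_def S S' sm e; exists c => _; exists F.
have [Phi hPhi] := choice h; exists Phi => F b e.
have [G eG eG'] := hPhi b (ex_intro _ F e).
have [c ec] := transfer_def S S' sm e; rewrite ec; congr Some.
exact: (transfer_eq S S' sm e eG ec eG').
Qed.

(** A negative minimum is at most -1, so [lower] rewrites the word with [i] in front, and
    [e_i f_i = 1] identifies the raised path. A zero minimum is shared by the other system. *)
Lemma e_real_orbit i F b : cartan i i = 2 -> Fapply F p0 = Some b ->
  (e_root i b = None /\ forall b', Fapply F p0' = Some b' -> e_root i b' = None) \/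
  exists G c, [/\ Fapply (i :: G) p0 = Some b, Fapply G p0 = Some c & e_root i b = Some c].
Proof.
move=> a2 e; have [vU eb] := Fapply_lift S e; set U := lift F in vU eb.
have gU : good U := good_lift _ _ _ F.
have ri : isr i by apply/eqP.
pose k : K := (i, 0%N); have Ak : A k by rewrite /act_letter /= ri eqxx.
have rk : isr k.1 || (k \notin U) by rewrite /= ri.
have [oH m0 e1 z _] := po_okH (sys_nice S) (sys_height S) gU Ak rk vU.
have [_ _ hm _ _] := (sys_nice S).2 _ vU.
have [lb b00 _ _ _] := (sys_nice S).2 _ vU.
have T0 := (sys_nice S).1.
have mle := mn_le0 k T0 lb b00.
have [me|me] := eqVneq (mn T (Fop ah T U b0) k) 0.
  left; split; first by rewrite eb; apply: e_real_none => //; rewrite m0.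
  move=> b' /(Fapply_lift S')[vU' ->]; have [oH' m0' _ z' _] := po_okH (sys_nice S') (sys_height S') gU Ak rk vU'.
  apply: e_real_none => //; rewrite m0' -me; have [_ h _] := sm.
  by rewrite (h U k (good_all gU)).
have vk : ve T k (Fop ah T U b0).
  have h0 : (0 : R) \is a Num.int by rewrite rpred0.
  by apply: (int_lt_le (hm k) h0); rewrite lt_neqAle me.
have [U' [pU vkU eU]] := lower (ri : isr k.1) gU vU vk; right.
have gkU : good (k :: U') by rewrite (good_perm pU).
have gU' : good U' by case/and3P: gkU.
exists (map fst U'), (po T b0 p0 U').
have ek : Fapply (map fst (k :: U')) p0 = Some b.
  by rewrite (Fapply_vld S gkU vkU) eb (po_eqon (sys_nice S) (sys_clamped S) eU).
have eU' := Fapply_vld S gU' vkU.1; split => //.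
have fb : f_root i (po T b0 p0 U') = Some b by move: ek; rewrite /= /Defs.Fapply /= -/(Fapply _ _) eU'.
have rk' : isr k.1 || (k \notin U') by rewrite /= ri.
have [oH1 m1 e11 _ _] := po_okH (sys_nice S) (sys_height S) gU' Ak rk' vkU.1.
apply: (e_f_real (po_clamped coroot supp root T b0 (sys_clamped S) U') oH1 _ fb a2).
by rewrite m1 e11; case: vkU.
Qed.

End Isomorphism.

Lemma e_f_orbit T b0 p0 i F b c : system T b0 p0 -> Fapply F p0 = Some b -> f_root i b = Some c ->
  e_root i c = Some b.
Proof.
move=> S e fc; have [vU eb] := Fapply_lift S e.
have ec : Fapply (i :: F) p0 = Some c by rewrite /Defs.Fapply /= -/(Fapply _ _) e.
have [vkU _] := Fapply_lift S ec.
have /and3P[Ak fk gU] : good (lift (i :: F)) := good_lift _ _ _ (i :: F).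
have [oH1 m1 e11 _ _] := po_okH (sys_nice S) (sys_height S) gU Ak fk vkU.1.
have cb := po_clamped coroot supp root T b0 (sys_clamped S) (lift F).
rewrite eb in fc *; have v : finf 1 (Hf i (po T b0 p0 (lift F))) 0 + 1 <= Hf i (po T b0 p0 (lift F)) 1.
  by rewrite m1 e11; case: vkU.
have [ii|ii] := boolP (isr i); first exact: (e_f_real cb oH1 v fc (cartan_real ii)).
exact: (e_f_imag cb oH1 v fc (cartan_imag HBC ii)).
Qed.

Lemma f_e_orbit T b0 p0 i F b c : system T b0 p0 -> Fapply F p0 = Some b -> ~~ isr i ->
  e_root i b = Some c -> f_root i c = Some b.
Proof.
move=> S e ii; have [vU eb] := Fapply_lift S e.
have /and3P[Ak fk gU] : good (lift (i :: F)) := good_lift _ _ _ (i :: F).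
have [oH1 _ _ _ _] := po_okH (sys_nice S) (sys_height S) gU Ak fk vU.
have cb := po_clamped coroot supp root T b0 (sys_clamped S) (lift F).
rewrite eb; exact: (f_e_imag cb oH1 (cartan_imag HBC ii)).
Qed.

Section Crystal.
Variables (T T' : R) (b0 b0' : R -> vec) (p0 p0' : Path).
Hypotheses (S : system T b0 p0) (S' : system T' b0' p0') (sm : sim ah A T b0 T' b0').
Hypothesis ends : p0 1 = p0' 1.
Hypothesis lower : forall k U, isr k.1 -> good U -> vld ah T U b0 -> ve T k (Fop ah T U b0) ->
  exists U', [/\ perm_eq (k :: U') U, vld ah T (k :: U') b0 & eqon T (Fop ah T U b0) (Fop ah T (k :: U') b0)].

Lemma iso_crystal : exists Phi : Path -> Path,
  crystal_iso coroot supp root (Forbit p0) (Forbit p0') Phi /\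
  forall F b, Fapply F p0 = Some b -> Fapply F p0' = Some (Phi b).
Proof.
have [Phi hP] := iso_map S S' sm; exists Phi; split => //.
have sm' := sim_sym sm.
have inj b c : Forbit p0 b -> Forbit p0 c -> Phi b = Phi c -> b = c.
  move=> [F eF] [G eG] e; have eF' := hP _ _ eF; have eG' := hP _ _ eG.
  by rewrite -e in eG'; exact: (transfer_eq S' S sm' eF' eG' eF eG).
have surj c : Forbit p0' c -> exists2 b, Forbit p0 b & Phi b = c.
  move=> [F eF]; have [b eb] := transfer_def S' S sm' eF; exists b; first by exists F.
  by have := hP _ _ eb; rewrite eF => -[].
have FE i F p : Fapply (i :: F) p = obind (f_root i) (Fapply F p) by [].
have kf b i : Forbit p0 b -> f_root i (Phi b) = omap Phi (f_root i b).
  move=> [F eF]; have e1 : Fapply (i :: F) p0 = f_root i b by rewrite FE eF.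
  have e2 : Fapply (i :: F) p0' = f_root i (Phi b) by rewrite FE (hP _ _ eF).
  rewrite -e1 -e2.
  case ec : (Fapply (i :: F) p0) => [c|]; first by rewrite (hP _ _ ec).
  case ec' : (Fapply (i :: F) p0') => [c'|//].
  by have [c] := transfer_def S' S sm' ec'; rewrite ec.
split => //; first by move=> b [F eF]; exists F; exact: hP.
move=> b Bb; have [F eF] := Bb; have eF' := hP _ _ eF.
have [vU eb] := Fapply_lift S eF; have [vU' eb'] := Fapply_lift S' eF'.
have ewt : wt (Phi b) = wt b.
  rewrite /wt eb' eb (po_end p0' (sys_nice S') vU') (po_end p0 (sys_nice S) vU).
  by apply/funext => x; rewrite ends.
split => // i.
have emm : isr i -> mmin coroot supp i (Phi b) = mmin coroot supp i b.
  move=> ri; have gU : good (lift F) := good_lift _ _ _ F.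
  pose k : K := (i, 0%N); have Ak : A k by rewrite /act_letter /= ri eqxx.
  have rk : isr k.1 || (k \notin lift F) by rewrite /= ri.
  have [oH m0 _ _ _] := po_okH (sys_nice S) (sys_height S) gU Ak rk vU.
  have [oH' m0' _ _ _] := po_okH (sys_nice S') (sys_height S') gU Ak rk vU'.
  rewrite eb' eb (mminE oH) (mminE oH') m0 m0'; have [_ h _] := sm.
  by rewrite (h (lift F) k (good_all gU)).
split.
- by rewrite /eps; case: ifP => // /emm ->.
- rewrite /phi /Defs.Hf; move: ewt; rewrite /wt => ->.
  by case: ifP => // /emm ->.
- have FB G c : Fapply G p0 = Some c -> Forbit p0 c by move=> e; exists G.
  have [ri|ii] := boolP (isr i); rewrite /kas_e.
    rewrite ri; have [[e1 e2]|[G [c [e1 e2 e3]]]] := e_real_orbit S S' sm lower (cartan_real ri) eF.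
      by rewrite e1 (e2 _ eF').
    rewrite e3 /=; apply: (e_f_orbit S' (hP _ _ e2)).
    rewrite (kf _ _ (FB _ _ e2)).
    by move: e1; rewrite FE e2 /= => ->.
  (* For imaginary [i] the crystal operator discards images outside the orbit. The two membership
     tests agree because [e_i b = c] amounts to [f_i c = b] on the orbits, and [f_i] commutes with
     [Phi]; [into] and [back] are the two directions. *)
  rewrite (negbTE ii); have into c : e_root i b = Some c -> Forbit p0 c ->
      e_root i (Phi b) = Some (Phi c) /\ Forbit p0' (Phi c).
    move=> ec [G eG]; split; last by exists G; exact: hP.
    apply: (e_f_orbit S' (hP _ _ eG)); rewrite (kf _ _ (FB _ _ eG)).
    by rewrite (f_e_orbit S eF ii ec).
  have back c' : e_root i (Phi b) = Some c' -> Forbit p0' c' ->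
      exists2 c, e_root i b = Some c & Forbit p0 c.
    move=> ec' /[dup] Bc' /surj[c Bc ecc]; exists c => //.
    have fc' := f_e_orbit S' eF' ii ec'.
    rewrite -ecc (kf _ _ Bc) in fc'; case efc : (f_root i c) fc' => [d|//] [ed].
    have [G eG] := Bc; have Bd : Forbit p0 d.
      by exists (i :: G); rewrite FE eG.
    by rewrite -(inj _ _ Bd Bb ed); exact: (e_f_orbit S eG efc).
  case ec : (e_root i b) => [c|] /=; case ec' : (e_root i (Phi b)) => [c'|] //=.
  + case: asboolP => [Bc'|nBc']; case: asboolP => [Bc|nBc] //=.
    * by have [] := into _ ec Bc; rewrite ec' => -[->].
    * by have [d] := back _ ec' Bc'; rewrite ec => -[<-].
    * by have [] := into _ ec Bc; rewrite ec' => -[ecc] Bcc; case: nBc'; rewrite ecc.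
  + by case: asboolP => // Bc; have [] := into _ ec Bc; rewrite ec'.
  + by case: asboolP => // Bc'; have [d] := back _ ec' Bc'; rewrite ec.
exact: kf.
Qed.

End Crystal.
End Transfer.

(** * The systems of a dominant product and of the straight path with the same end *)

Lemma In_nth (T : Type) (x0 : T) (s : seq T) q : (q < size s)%N -> List.In (nth x0 s q) s.
Proof.
elim: s q => // x s IH [|q] /=; first by left.
by rewrite ltnS => /IH; right.
Qed.

Theorem theorem4p2p1 (R : realType) (I : countType) (J : choiceType)
    (coroot : I -> J -> int) (supp : I -> seq J) (root : I -> J -> int)
    (HBC : BC_datum coroot supp root)
    (lams : seq (J -> int)) :
  lams != [::] ->
  (forall mu, List.In mu lams -> in_WPplus coroot supp root mu) ->
  let piL : Path R J := concat [seq pi_mu (emb R mu) | mu <- lams] in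
  dominant_path coroot supp piL ->
  let lam : J -> int := fun k => \sum_(mu <- lams) mu k in
  let pil : Path R J := pi_mu (emb R lam) in
  exists Phi : Path R J -> Path R J,
    crystal_iso coroot supp root (Forbit coroot supp root pil)
                (Forbit coroot supp root piL) Phi /\
    (forall (F : seq I) (b : Path R J),
        Fapply coroot supp root F pil = Some b ->
        Fapply coroot supp root F piL = Some (Phi b)).
Proof.
move=> l0 hW piL domL lam pil.
pose K := (I * nat)%type; pose vec := ((K + K)%type -> R).
have ga := gcm_ah HBC; set n := size lams.
have n0 : (0 < n)%N by rewrite lt0n size_eq0.
have h11 : 0 <= (1 : R) <= 1 by rewrite ler01 lexx.
have L0 : (0 : R) < 1 := ltr01.
have ext q : exists x : seq K * (vec * vec), (q < n)%N -> [/\ dom x.2.1 /\ isint x.2.1,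
    vld (ah coroot supp root) 1 x.1 (st x.2.1), all (ext_letter coroot supp root) x.1,
    eqon 1 (Fop (ah coroot supp root) 1 x.1 (st x.2.1)) (st x.2.2) &
    forall k, proper_letter coroot supp root k -> is_real_index coroot supp root k.1 || (k \notin x.1) ->
      x.2.2 (inl k) = (pairZ coroot supp k.1 (lamn lams q))%:~R].
  have [qn|qn] := boolP (q < n)%N; last by exists ([::], (0, 0)).
  have [G [nu [muh h]]] := extremal_hat R HBC (hW _ (In_nth (fun _ => 0) qn)).
  by exists (G, (nu, muh)).
have [x hx] := choice ext.
pose bs q : R -> vec := st (x q).2.2.
have hd (q : nat) : (q < n)%N -> dom (x q).2.1 /\ isint (x q).2.1 by move=> /hx[].
have hb (q : nat) : (q < n)%N -> vld (ah coroot supp root) 1 (x q).1 (st (x q).2.1) /\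
    eqon 1 (Fop (ah coroot supp root) 1 (x q).1 (st (x q).2.1)) (bs q) by move=> /hx[].
(* Active imaginary labels are even and those of the extremal words odd, so active imaginary letters
   are foreign to these words: their heights are the original ones and their progress is a ramp. *)
have kG k q : (q < n)%N -> act_letter coroot supp root k -> ~~ is_real_index coroot supp root k.1 -> k \notin (x q).1.
  move=> /hx[_ _ al _ _] Ak ik; apply/negP => /(allP al).
  by move: Ak; rewrite /act_letter /ext_letter (negbTE ik) => /negbTE ->.
have muE k q : (q < n)%N -> act_letter coroot supp root k ->
    (x q).2.2 (inl k) = (pairZ coroot supp k.1 (lamn lams q))%:~R.
  move=> qn Ak; have [_ _ _ _ h] := hx q qn; apply: h; first exact: act_letter_proper.
  by have [//|ik] := boolP (is_real_index _ _ _ _); exact: kG.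
have hL k t : act_letter coroot supp root k -> 0 <= t <= 1 ->
    Hf coroot supp k.1 piL t = pc bs n (n%:R * t) (inl k).
  move=> Ak ht; have [l ln [hl e]] := concat_val l0 ht.
  rewrite /Hf /piL e (pairR_sum _ _ _ _ (fun q => emb R (lamn lams q)) _ (emb R (lamn lams l))).
  rewrite (pc_val _ _ ln hl); last by move=> q; exact: st0.
  rewrite pairR_emb -muE // /bs [st _ _ _]scE; congr (_ + _).
  by apply: eq_bigr => q _; rewrite pairR_emb -muE ?st1 // (ltn_trans (ltn_ord q)).
have nL : nice (ah coroot supp root) n%:R (pc bs n).
  have hn : (n.-1 < n)%N by rewrite prednK.
  by have := nice_pc ga hd hb hn; rewrite prednK.
have dH i t : 0 <= t <= 1 -> 0 <= Hf coroot supp i piL t.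
  move=> /domL[s [hs e]]; rewrite /Hf e /pairR.
  under eq_bigr do rewrite mulr_sumr; rewrite exchange_big /=.
  elim: s hs {e} => [|y s IH] hs; first by rewrite big_nil.
  rewrite big_cons addr_ge0 //; last by apply: IH => z hz; apply: hs; right.
  have [y0 dy] := hs y (or_introl erefl).
  under eq_bigr do rewrite mulrCA; rewrite -mulr_sumr; apply: mulr_ge0 => //.
  by have := dy i; rewrite -(ler_int R) -(pairR_emb R).
have endL : piL 1 = emb R lam := concat_end R l0.
have dlam : dom (hat R coroot supp lam : vec).
  by move=> k; have := dH k.1 1 h11; rewrite /Hf endL pairR_emb.
have nlam := nice_st ga dlam (isint_hat R coroot supp lam).
have smL : sim (ah coroot supp root) (act_letter coroot supp root) n%:R (pc bs n) 1 (st (hat R coroot supp lam)).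
  apply: (sim_product ga hd hb) => //.
  - move=> j hj; have [C lC] := nice_lipp nL (inl j); have nR := nL.1.
    apply: (le_finf lC) => [|s hs]; first by rewrite lexx ltW.
    have ht : 0 <= s / n%:R <= 1 by rewrite divr_ge0 ?ler_pdivrMr ?mul1r; lra.
    have := dH j.1 _ ht; rewrite hL // mulrCA divff ?mulr1 // gt_eqF //.
  - exact: isint_hat.
  by move=> j hj; have := hL j 1 hj h11; rewrite mulr1 => <-; rewrite /Hf endL pairR_emb.
have Sl : system coroot supp root 1 (st (hat R coroot supp lam)) pil.
  split => //.
  - by move=> t; rewrite /pil /pi_mu clamp_id // clamp_bound.
  - move=> k t Ak ht; rewrite /Hf /pil /pi_mu (clamp_id ht) pairR_vscale pairR_emb mul1r.
    by rewrite [RHS]scE.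
  move=> k U /and3P[_ fk _] ik v; rewrite (negbTE ik) /= in fk.
  have [c [c1 cX]] := fresh_ramp ga dlam (isint_hat R coroot supp lam) fk v.
  exists c; split => [|t ht]; first by lra.
  rewrite cX // (@rampE _ 0) ?add0r ?subr0; try by lra.
  have [t0|//] := leP t 0; have -> : t = 0 by lra.
  have -> : 0 < c by lra.
  by rewrite mul0r.
have SL : system coroot supp root n%:R (pc bs n) piL.
  split => //; first exact: concat_clamped.
  move=> k U /and3P[Ak fk _] ik v; rewrite (negbTE ik) /= in fk.
  have hn : (n.-1 < n)%N by rewrite prednK.
  have kG' (q : nat) : (q < n)%N -> k \notin (x q).1 by move=> qn; exact: kG.
  by have := ramp_product ga hd hb kG' hn fk; rewrite prednK //; apply.
apply: (iso_crystal HBC Sl SL (sim_sym smL)).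
- by rewrite endL /pil /pi_mu (clamp_id h11); apply/funext => y; rewrite /vscale mul1r.
move=> k U _ _ vU vk; exact: (st_lower ga dlam (isint_hat R coroot supp lam) vU vk).
Qed.
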